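(* Let $n\geq 2$ and $\gamma>1$, let $1\leq\beta<\frac{n+1}{2}$, let $\beta+\frac{n-1}{2}<\alpha<n$, and set $$s=1-\frac12\Big(\frac{\alpha}{\beta}+2-\gamma\Big).$$ Then there is a constant $C>0$, independent of $f$ and $w$, such that for every weight $w\ge 0$ on $\mathbb{R}^n$ with $w^\beta\in\mathcal{KS}_\alpha$ and every $f\in L^2(\mathbb{R}^n)$, $$\big\||\nabla|^s e^{-it(-\Delta)^{\gamma/2}}f\big\|_{L^2_{x,t}(w(x))}\leq C\,\|w^\beta\|_{\mathcal{KS}_\alpha}^{\frac{1}{2\beta}}\,\|f\|_{L^2}.$$
   Context: Fourier transform: $\widehat f(\xi)=\int_{\mathbb{R}^n}e^{-ix\cdot\xi}f(x)\,dx$. The fractional Schrödinger propagator is $e^{-it(-\Delta)^{\gamma/2}}f(x)=(2\pi)^{-n}\int_{\mathbb{R}^n}e^{ix\cdot\xi}e^{-it|\xi|^\gamma}\widehat f(\xi)\,d\xi$, and $|\nabla|^s$ is the Fourier multiplier operator with symbol $|\xi|^s$, so that $|\nabla|^s e^{-it(-\Delta)^{\gamma/2}}f(x)=(2\pi)^{-n}\int_{\mathbb{R}^n}e^{ix\cdot\xi}|\xi|^s e^{-it|\xi|^\gamma}\widehat f(\xi)\,d\xi$. As usual, this is given by the integral for $f$ in the Schwartz class and is understood for general $f\in L^2$ by density. The weighted norm is $\|F\|_{L^2_{x,t}(w(x))}=\big(\int_{\mathbb{R}}\int_{\mathbb{R}^n}|F(x,t)|^2 w(x)\,dx\,dt\big)^{1/2}$.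 Kerman–Sawyer class: for $0<\alpha<n$, a weight (nonnegative locally integrable function) $v$ on $\mathbb{R}^n$ belongs to $\mathcal{KS}_\alpha$ if $$\|v\|_{\mathcal{KS}_\alpha}:=\sup_Q\Big(\int_Q v(x)\,dx\Big)^{-1}\int_Q\int_Q\frac{v(x)v(y)}{|x-y|^{n-\alpha}}\,dx\,dy<\infty,$$ where the supremum is over all dyadic cubes $Q\subset\mathbb{R}^n$ (cubes with $\int_Q v=0$ contribute $0$). *)

(* Defs.v *)
From HB Require Import structures.
From mathcomp Require Import all_boot all_order all_algebra.
From mathcomp Require Import complex.
From mathcomp Require Import all_classical all_reals all_analysis.

Set Implicit Arguments.
Unset Strict Implicit.
Unset Printing Implicit Defensive.

Import Order.TTheory GRing.Theory Num.Theory.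
Import numFieldNormedType.Exports.

Local Open Scope classical_set_scope.
Local Open Scope ring_scope.

(* R^n as n-tuples: this carries the library's product sigma-algebra, which
   the row-vector type does not. *)
Notation Rn R n := (n.-tuple (measurableTypeR R)).

Section LebesgueRn.
Context {R : realType}.
Local Notation T := (measurableTypeR R).

Definition cons_point n (p : T * n.-tuple T) : n.+1.-tuple T :=
  [tuple of p.1 :: p.2].

Lemma measurable_cons_point n : measurable_fun setT (@cons_point n).
Proof. exact: measurable_cons. Qed.

Section step.
Variables (n : nat) (mu : {sigma_finite_measure set (n.-tuple T) -> \bar R}).

Definition lebesgue_step : set (n.+1.-tuple T) -> \bar R :=
  pushforward (lebesgue_measure \x mu)%E (@cons_point n).

Let lebesgue_step0 : lebesgue_step set0 = 0%E.
Proof. by rewrite /lebesgue_step /pushforward preimage_set0 measure0. Qed.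

Let lebesgue_step_ge0 A : (0 <= lebesgue_step A)%E.
Proof. by rewrite /lebesgue_step /pushforward measure_ge0. Qed.

Let lebesgue_step_sigma_additive : semi_sigma_additive lebesgue_step.
Proof.
move=> F mF tF mUF; rewrite /lebesgue_step /pushforward preimage_bigcup.
apply: measure_semi_sigma_additive.
- by move=> i; rewrite -[X in measurable X]setTI; exact: measurable_cons_point.
- apply/trivIsetP => i j _ _ ij; rewrite -preimage_setI.
  by move/trivIsetP : tF => /(_ i j Logic.I Logic.I ij) ->; rewrite preimage_set0.
- rewrite -preimage_bigcup -[X in measurable X]setTI.
  exact: measurable_cons_point.
Qed.

HB.instance Definition _ := isMeasure.Build _ _ _ lebesgue_step
  lebesgue_step0 lebesgue_step_ge0 lebesgue_step_sigma_additive.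

Let measurable_uncons : measurable_fun setT
  (fun x : n.+1.-tuple T => (thead x, [tuple of behead x])).
Proof.
apply/measurable_fun_pairP; split => /=.
- exact: measurable_tnth.
- exact: measurable_behead.
Qed.

Let lebesgue_step_sigma_finite : sigma_finite setT lebesgue_step.
Proof.
have /sigma_finiteP[F [FT ndF Foo]] := sigma_finiteT (@lebesgue_measure R).
have /sigma_finiteP[G [GT ndG Goo]] := sigma_finiteT mu.
pose u (x : n.+1.-tuple T) : T * n.-tuple T := (thead x, [tuple of behead x]).
have uK : cancel (@cons_point n) u.
  by case=> a b; rewrite /u /= theadE; congr pair; apply: val_inj.
exists (fun i => u @^-1` (F i `*` G i)).
  apply/esym/seteqP; split=> // x _.
  have [i _ Fi] : (\bigcup_i F i) (u x).1 by rewrite -FT.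
  have [j _ Gj] : (\bigcup_i G i) (u x).2 by rewrite -GT.
  exists (maxn i j) => //; split.
    by move: Fi; apply/subsetPset/ndF/leq_maxl.
  by move: Gj; apply/subsetPset/ndG/leq_maxr.
move=> i; have [mF Fi] := Foo i; have [mG Gi] := Goo i; split.
  rewrite -[X in measurable X]setTI; apply: measurable_uncons => //.
  exact: measurableX.
rewrite /lebesgue_step /pushforward -comp_preimage.
rewrite (_ : u \o @cons_point n = id); last by apply/funext => p /=; rewrite uK.
by rewrite preimage_id product_measure1E// lte_mul_pinfty// ge0_fin_numE.
Qed.

HB.instance Definition _ := Measure_isSigmaFinite.Build _ _ _ lebesgue_step
  lebesgue_step_sigma_finite.

End step.

Fixpoint lebesgueRn (n : nat) :
    {sigma_finite_measure set (n.-tuple T) -> \bar R} :=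
  match n with
  | 0 => dirac ([tuple] : 0.-tuple T)
  | m.+1 => lebesgue_step (lebesgueRn m)
  end.

Lemma lebesgueRn_prod n (A : 'I_n -> set T) :
  (forall i, measurable (A i)) ->
  lebesgueRn n [set x | forall i, A i (tnth x i)] =
  (\prod_(i < n) lebesgue_measure (A i))%E.
Proof.
elim: n A => [|n IH] A mA.
  rewrite big_ord0 /= diracE mem_set//=; by case.
rewrite big_ord_recl -(IH (fun i => A (lift ord0 i))) //.
rewrite /= /lebesgue_step /pushforward -product_measure1E //; last first.
  rewrite (_ : [set x | _] =
    \bigcap_(i in [set: 'I_n]) ((@tnth n T)^~ i @^-1` A (lift ord0 i))).
    apply: fin_bigcap_measurable => // i _.
    rewrite -[X in measurable X]setTI; exact: measurable_tnth.
  by apply/seteqP; split=> x /= h; [move=> i _|move=> i]; exact: h.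
congr (_ \x _)%E; apply/seteqP; split=> -[a x] /=.
  by move=> h; split; [exact: (h ord0)|move=> i; have := h (lift ord0 i); rewrite tnthS].
by move=> [ha hx] i; have [j ->|->] := unliftP ord0 i; rewrite ?tnthS; [exact: hx|exact: ha].
Qed.

End LebesgueRn.

Section Analysis.
Context {R : realType} {n : nat}.
Implicit Types (x y xi : Rn R n) (u v w : Rn R n -> R) (f : Rn R n -> R[i]).

Definition dot x y : R := \sum_(i < n) tnth x i * tnth y i.

Definition enorm x : R := Num.sqrt (dot x x).

Definition edist x y : R :=
  Num.sqrt (\sum_(i < n) ((tnth x i : R) - tnth y i) ^+ 2).

Definition cball0 (r : R) : set (Rn R n) := [set x | enorm x <= r].

Definition cmeasurable d (X : measurableType d) (g : X -> R[i]) : Prop :=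
  measurable_fun setT (fun z => complex.Re (g z)) /\
  measurable_fun setT (fun z => complex.Im (g z)).

Definition cintegral f : R[i] :=
  Complex (\int[lebesgueRn n]_x complex.Re (f x))
          (\int[lebesgueRn n]_x complex.Im (f x)).

Definition L2norm f : \bar R :=
  Lnorm (lebesgueRn n) 2%:E (fun x => (ComplexField.Normc.normc (f x))%:E).

Definition L2fun f : Prop := cmeasurable f /\ (L2norm f < +oo)%E.

Definition set_coord x (i : 'I_n) (a : R) : Rn R n :=
  [tuple if j == i then a else tnth x j | j < n].

Definition partial (i : 'I_n) u : Rn R n -> R :=
  fun x => derive1 (fun a : R => u (set_coord x i a)) (tnth x i).

Definition partials (I : seq 'I_n) u : Rn R n -> R := foldr partial u I.

(* Continuity of the partial derivatives is not listed: bounded first-order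
   partial derivatives make a function Lipschitz, so the bounds with [k = 0]
   give it. *)
Definition schwartz_real u : Prop := forall I : seq 'I_n,
  (forall (i : 'I_n) x,
     derivable (fun a : R => partials I u (set_coord x i a)) (tnth x i) 1) /\
  (forall k : nat, exists M : R,
     forall x, enorm x ^+ k * `|partials I u x| <= M).

Definition schwartz f : Prop :=
  schwartz_real (fun x => complex.Re (f x)) /\
  schwartz_real (fun x => complex.Im (f x)).

Definition expi (a : R) : R[i] := Complex (cos a) (sin a).

Definition fourier f : Rn R n -> R[i] :=
  fun xi => cintegral (fun x => expi (- dot x xi) * f x).

(* |nabla|^s e^{-it(-Delta)^{gamma/2}} f on Schwartz functions. The library's
   [powR] has junk values at [xi = 0] only, a null set. *)
Definition propagator (s gamma : R) f (x : Rn R n) (t : R) : R[i] :=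
  real_complex R ((2 * pi) ^- n) *
  cintegral (fun xi => expi (dot x xi) * real_complex R (enorm xi `^ s) *
                       expi (- (t * enorm xi `^ gamma)) * fourier f xi).

Definition schwartz_approx f (f_ : nat -> Rn R n -> R[i]) : Prop :=
  (forall k, schwartz (f_ k)) /\
  L2norm (fun x => f_ k x - f x) @[k --> \oo] --> 0%E.

(* [F] is |nabla|^s e^{-it(-Delta)^{gamma/2}} f for [f] in L^2: the extension
   by density of [propagator], with values in L^2_loc(R^n x R). *)
Definition propagator_L2 (s gamma : R) f (F : Rn R n -> R -> R[i]) : Prop :=
  cmeasurable (fun z : Rn R n * measurableTypeR R => F z.1 z.2) /\
  (exists f_ : nat -> Rn R n -> R[i], schwartz_approx f f_) /\
  forall f_ : nat -> Rn R n -> R[i], schwartz_approx f f_ -> forall r : R,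
    (\int[lebesgue_measure]_(t in `[(- r)%R, r])
      \int[lebesgueRn n]_(x in cball0 r)
        (ComplexField.Normc.normc (propagator s gamma (f_ k) x t - F x t)
          ^+ 2)%:E)%E
    @[k --> \oo] --> 0%E.

Definition weighted_L2norm w (F : Rn R n -> R -> R[i]) : \bar R :=
  ((\int[lebesgue_measure]_t \int[lebesgueRn n]_x
     (ComplexField.Normc.normc (F x t) ^+ 2 * w x)%:E) `^ 2^-1)%E.

Definition weight v : Prop :=
  [/\ measurable_fun setT v, (forall x, 0 <= v x) &
      forall r : R, (\int[lebesgueRn n]_(x in cball0 r) (v x)%:E < +oo)%E].

Definition dyadic_cube (k : int) (m : 'I_n -> int) : set (Rn R n) :=
  [set x | forall i, (m i)%:~R * 2 ^ k <= (tnth x i : R) < (m i + 1)%:~R * 2 ^ k].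

(* On the diagonal, a null set, the kernel takes the value [0^-1 = 0]. *)
Definition KS_ratio (alpha : R) v (Q : set (Rn R n)) : \bar R :=
  if (\int[lebesgueRn n]_(x in Q) (v x)%:E == 0)%E then 0%E
  else ((\int[lebesgueRn n]_(x in Q) (v x)%:E)^-1 *
        \int[lebesgueRn n]_(y in Q) \int[lebesgueRn n]_(x in Q)
          (v x * v y / edist x y `^ (n%:R - alpha))%:E)%E.

Definition KS_norm (alpha : R) v : \bar R :=
  ereal_sup [set KS_ratio alpha v (dyadic_cube km.1 km.2)
            | km in [set: int * ('I_n -> int)]].

Definition KS (alpha : R) v : Prop := weight v /\ (KS_norm alpha v < +oo)%E.

End Analysis.

(* Main.v *)
(* Of the Kerman-Sawyer condition only the Morrey bound
   [int_Q v <= C |v|_KS l(Q)^(n - alpha)] for [v = w^beta] is used; it holds because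
   the kernel is bounded below on a cube.  The heart of the matter is the
   estimate [int w |T g|^2 <= C 2^-J r^(alpha/beta) D^(1/beta) int |g|^2], where
   [D] is the Morrey constant, for the Fourier integral [T g] of a function
   supported in the shell where [r |xi|] differs from 1 by [2^-J].  By the T T^* method it
   reduces to a majorant of the indicator function of the shell, taken to be a
   Fejer average in [tau] of [exp(-p|xi|^2) cos(tau (p|xi|^2 - 1))] with [p = r^-2]:
   the Fourier transform of each Gaussian is explicit, and van der Corput's
   lemma yields its decay after integration over dyadic ranges of [tau].  Each
   range is bounded both trivially, by the maximum of the weight, and by Schur's
   test, by the Morrey constant; playing these bounds against each other on the
   level sets of [w] and summing is possible because [alpha > beta + (n - 1)/2].
   Bessel's inequality in time expresses the space-time norm through thin shells
   [| |xi|^gamma - lambda | <= delta], and [delta -> 0] gives the theorem for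
   Schwartz functions; density and Fatou's lemma extend it to L^2. *)

From HB Require Import structures.
Require Import Defs.
From mathcomp Require Import all_boot all_order all_algebra.
From mathcomp Require Import complex.
From mathcomp Require Import all_classical all_reals all_analysis.
From mathcomp Require Import measurable_realfun ring lra.

Set Implicit Arguments.
Unset Strict Implicit.
Unset Printing Implicit Defensive.

Import Order.TTheory GRing.Theory Num.Theory.
Import numFieldNormedType.Exports.

Local Open Scope classical_set_scope.
Local Open Scope ring_scope.


(** The exponents fit together as follows. For [tau] near [2^j] the Gaussian average has a kernel of
    size [r^n 2^(-j(n-1)/2)] on the ball of radius [2^j / r]: this is the decay of the Fourier
    transform of the sphere, but cut into pieces that are localised in space, which is what a Morrey
    bound can integrate. Schur's test gives the piece the norm [r^alpha 2^(-j eta)] times the Morrey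
    constant, [eta = alpha - (n+1)/2]. Where [w] is about [t], the trivial norm is [2^j t], while
    [w <= t^(1-beta) w^beta] gives the Schur norm [r^alpha 2^(-j eta) t^(1-beta) D]. For [beta > 1],
    summing the smaller of the two over dyadic [t] costs a constant times the value at the balance
    point, [(2^j)^(1-1/beta) (r^alpha 2^(-j eta) D)^(1/beta)], whose exponent in [2^j] is
    [-(eta + 1 - beta)/beta]; this is negative exactly when [alpha > beta + (n-1)/2]. The factor
    [2^-J] is the normalisation of the Fejer average over [[0, 2^J]]. In time, a shell of thickness
    [delta] around [lambda = r^gamma] has relative thickness [delta / lambda], so that the frequency
    weight becomes [|xi|^(alpha/beta - gamma)], and [s] is the exponent that cancels it. *)

Lemma measurable_norm d (X : measurableType d) (R : realType) (f : X -> R) :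
  measurable_fun setT f -> measurable_fun setT (fun x => `|f x|).
Proof. by move=> mf; exact: measurableT_comp. Qed.

(** * Measurability and integration of real-valued functions *)

Section MeasurablePair.
Context d1 d2 d3 (X : measurableType d1) (Y : measurableType d2)
  (Z : measurableType d3).

Lemma measurable_fst_comp (f : X -> Z) : measurable_fun setT f ->
  measurable_fun setT (fun z : X * Y => f z.1).
Proof. by move=> mf; exact: (measurableT_comp mf measurable_fst). Qed.

Lemma measurable_snd_comp (f : Y -> Z) : measurable_fun setT f ->
  measurable_fun setT (fun z : X * Y => f z.2).
Proof. by move=> mf; exact: (measurableT_comp mf measurable_snd). Qed.

Lemma measurable_section1 (f : X * Y -> Z) x : measurable_fun setT f ->
  measurable_fun setT (fun y => f (x, y)).
Proof. by move=> mf; exact: (measurableT_comp mf (pair1_measurable x)). Qed.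

Lemma measurable_section2 (f : X * Y -> Z) y : measurable_fun setT f ->
  measurable_fun setT (fun x => f (x, y)).
Proof. by move=> mf; exact: (measurableT_comp mf (pair2_measurable y)). Qed.

End MeasurablePair.

Section RealIntegrable.
Context d (X : measurableType d) (R : realType).
Variable mu : {measure set X -> \bar R}.
Implicit Types f g h : X -> R.

Definition rint f : Prop := mu.-integrable setT (EFin \o f).

Lemma rint_measurable f : rint f -> measurable_fun setT f.
Proof. by move=> /measurable_int/measurable_EFinP. Qed.

Lemma rint_le f g : measurable_fun setT f -> (forall x, `|f x| <= g x) ->
  rint g -> rint f.
Proof.
move=> mf fg; apply: le_integrable => //; first exact/measurable_EFinP.
by move=> x _ /=; rewrite lee_fin (le_trans (fg x))// ler_norm.
Qed.

Lemma eq_rint f g : f =1 g -> rint f -> rint g.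
Proof. by move=> fg; rewrite (_ : g = f)//; apply/funext => x; rewrite fg. Qed.

Lemma rintD f g : rint f -> rint g -> rint (fun x => f x + g x).
Proof. by move=> rf rg; exact: (integrableD measurableT rf rg). Qed.

Lemma rintZl (k : R) f : rint f -> rint (fun x => k * f x).
Proof. by move=> rf; exact: (integrableZl measurableT k rf). Qed.

Lemma rintN f : rint f -> rint (fun x => - f x).
Proof. by move=> rf; move: (rintZl (-1) rf); apply: eq_rint => x; rewrite mulN1r. Qed.

Lemma rintB f g : rint f -> rint g -> rint (fun x => f x - g x).
Proof. by move=> rf rg; apply: rintD => //; exact: rintN. Qed.

Lemma rint_norm f : rint f -> rint (fun x => `|f x|).
Proof. by move=> rf; exact: integrable_norm rf. Qed.

Lemma rint0 : rint (fun=> 0).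
Proof. exact: integrable0. Qed.

Lemma rint_sum (I : Type) (s : seq I) (F : I -> X -> R) :
  (forall i, rint (F i)) -> rint (fun x => \sum_(i <- s) F i x).
Proof.
move=> rF; elim: s => [|i s ih].
  by under eq_fun do rewrite big_nil; exact: rint0.
by under eq_fun do rewrite big_cons; exact: rintD.
Qed.

Lemma rint_mulb M h f : measurable_fun setT h -> (forall x, `|h x| <= M) ->
  rint f -> rint (fun x => h x * f x).
Proof.
move=> mh hM rf; apply: (@rint_le _ (fun x => M * `|f x|)).
- by apply: measurable_funM => //; exact: rint_measurable.
- by move=> x; rewrite normrM ler_wpM2r.
- exact/rintZl/rint_norm.
Qed.

Lemma RintE f : rint f -> ((\int[mu]_x f x)%:E = \int[mu]_x (f x)%:E)%E.
Proof. by move=> rf; rewrite /Rintegral fineK//; exact: integrable_fin_num. Qed.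

Lemma ge0_rint f : measurable_fun setT f -> (forall x, 0 <= f x) ->
  (\int[mu]_x (f x)%:E < +oo)%E -> rint f.
Proof.
move=> mf f0 foo; apply/integrableP; split; first exact/measurable_EFinP.
by under eq_integral do rewrite /= ger0_norm//.
Qed.

Lemma rint_lty f : rint f -> (\int[mu]_x (f x)%:E < +oo)%E.
Proof. by move=> rf; rewrite -RintE// ltry. Qed.

Lemma rint_indic_mul (A : set X) f : measurable A -> rint f ->
  rint (fun x => \1_A x * f x).
Proof.
move=> mA; apply: (@rint_mulb 1) => // x; rewrite indicE.
by case: (x \in A); rewrite ?normr1 ?normr0.
Qed.

Lemma rint_bounded (A : set X) M f : measurable A -> (mu A < +oo)%E ->
  measurable_fun setT f -> (forall x, `|f x| <= M) -> (forall x, ~ A x -> f x = 0) ->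
  rint f.
Proof.
move=> mA Aoo mf fM f0; apply: (@rint_le _ (fun x => M * \1_A x)) => //.
  move=> x; rewrite indicE; have [|/negP] := boolP (x \in A).
    by rewrite mulr1.
  by rewrite inE mulr0 => /f0 ->; rewrite normr0.
by apply: rintZl; apply: ge0_rint => //; rewrite integral_indic// setIT.
Qed.

Lemma RintZl (k : R) f : rint f -> \int[mu]_x (k * f x) = k * \int[mu]_x f x.
Proof. by move=> rf; rewrite RintegralZl. Qed.

Lemma RintD f g : rint f -> rint g ->
  \int[mu]_x (f x + g x) = \int[mu]_x f x + \int[mu]_x g x.
Proof. by move=> rf rg; rewrite RintegralD. Qed.

Lemma RintB f g : rint f -> rint g ->
  \int[mu]_x (f x - g x) = \int[mu]_x f x - \int[mu]_x g x.
Proof. by move=> rf rg; rewrite RintegralB. Qed.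

Lemma Rint_sum (I : Type) (s : seq I) (F : I -> X -> R) :
  (forall i, rint (F i)) ->
  \int[mu]_x (\sum_(i <- s) F i x) = \sum_(i <- s) \int[mu]_x F i x.
Proof.
move=> rF; elim: s => [|i s ih].
  under eq_Rintegral do rewrite big_nil.
  by rewrite big_nil /Rintegral integral0.
under eq_Rintegral do rewrite big_cons.
by rewrite RintD ?ih ?big_cons//; exact: rint_sum.
Qed.

Lemma le_Rint f g : rint f -> rint g -> (forall x, f x <= g x) ->
  \int[mu]_x f x <= \int[mu]_x g x.
Proof. by move=> rf rg fg; apply: le_Rintegral => // x _; exact: fg. Qed.

Lemma norm_Rint_le f g : measurable_fun setT f -> rint g ->
  (forall x, `|f x| <= g x) -> `|\int[mu]_x f x| <= \int[mu]_x g x.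
Proof.
move=> mf rg fg; have rf : rint f by exact: rint_le rg.
by rewrite (le_trans (le_normr_Rintegral _ rf))// le_Rint//; exact: rint_norm.
Qed.

Lemma ge0_intZl (k : R) f : 0 <= k -> measurable_fun setT f ->
  (forall x, 0 <= f x) ->
  (\int[mu]_x (k * f x)%:E = k%:E * \int[mu]_x (f x)%:E)%E.
Proof.
move=> k0 mf f0; rewrite -ge0_integralZl//; first exact/measurable_EFinP.
by move=> x _; rewrite lee_fin.
Qed.

Lemma le_ge0_int f g : measurable_fun setT f -> measurable_fun setT g ->
  (forall x, 0 <= f x <= g x) ->
  (\int[mu]_x (f x)%:E <= \int[mu]_x (g x)%:E)%E.
Proof.
move=> mf mg fg; apply: ge0_le_integral => //.
- by move=> x _; rewrite lee_fin; case/andP: (fg x).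
- exact/measurable_EFinP.
- exact/measurable_EFinP.
- by move=> x _; rewrite lee_fin; case/andP: (fg x).
Qed.

Lemma Rint_le_norm f : rint f -> ((\int[mu]_x f x)%:E <= \int[mu]_x `|f x|%:E)%E.
Proof.
move=> rf; rewrite -RintE ?lee_fin; last exact: rint_norm.
by rewrite (le_trans (ler_norm _))// le_normr_Rintegral.
Qed.

(** Regularisations and truncations are removed through this form throughout: pointwise convergence
    and a bound uniform in the index suffice, without a dominating function. *)
Lemma fatou_bound (f_ : nat -> X -> R) f (B : \bar R) :
  (forall k, measurable_fun setT (f_ k)) -> (forall k x, 0 <= f_ k x) ->
  (forall x, f_ k x @[k --> \oo] --> f x) ->
  (forall k, \int[mu]_x (f_ k x)%:E <= B)%E -> (\int[mu]_x (f x)%:E <= B)%E.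
Proof.
move=> mf f0 ff fB.
have E x : limn_einf (fun k => (f_ k x)%:E) = (f x)%:E.
  apply: (cvg_limn_einf_sup _).1; apply/fine_cvgP; split; last exact: ff.
  exact: nearW.
under eq_integral do rewrite -E.
apply: (le_trans (fatou mu measurableT _ _)) => [k|k x _|].
- exact/measurable_EFinP.
- by rewrite lee_fin.
rewrite limn_einf_lim; apply: lime_le.
  exact/ereal_nondecreasing_is_cvgn/nondecreasing_einfs.
apply: nearW => k; apply: le_trans (fB k).
by apply: ereal_inf_lbound; exists k => /=.
Qed.

End RealIntegrable.

(* The library registers sigma-finiteness of a product measure only for
   subprobabilities. *)
Section SigmaFiniteProduct.
Context d1 d2 {R : realType} (T1 : measurableType d1) (T2 : measurableType d2).
Variables (m1 : {sigma_finite_measure set T1 -> \bar R})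
          (m2 : {sigma_finite_measure set T2 -> \bar R}).

Definition prodm : set (T1 * T2)%type -> \bar R := (m1 \x m2)%E.
HB.instance Definition _ := Measure.on prodm.

Let prodm_sigma_finite : sigma_finite setT prodm.
Proof.
have /sigma_finiteP[F [TF ndF Foo]] := sigma_finiteT m1.
have /sigma_finiteP[G [TG ndG Goo]] := sigma_finiteT m2.
exists (fun n => F n `*` G n).
  rewrite -setXTT TF TG; apply/seteqP; split=> -[x y] /=.
    move=> [[n _ Fnx] [k _ Gky]]; exists (maxn n k) => //; split.
    - by move: x Fnx; exact/subsetPset/ndF/leq_maxl.
    - by move: y Gky; exact/subsetPset/ndG/leq_maxr.
  by move=> [n _ []/= ? ?]; split; exists n.
move=> k; have [? ?] := Foo k; have [? ?] := Goo k.
split; first exact: measurableX.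
by rewrite /prodm product_measure1E// lte_mul_pinfty// ge0_fin_numE.
Qed.
HB.instance Definition _ := Measure_isSigmaFinite.Build _ _ _ prodm prodm_sigma_finite.

End SigmaFiniteProduct.


(** Domination by a tensor product of integrable functions is enough here, because the oscillating
    factors of the double integrals are bounded by 1. *)
Section FubiniDominated.
Context d1 d2 (X : measurableType d1) (Y : measurableType d2) (R : realType).
Variables (m1 : {sigma_finite_measure set X -> \bar R})
          (m2 : {sigma_finite_measure set Y -> \bar R}).
Variables (f : X * Y -> R) (a : X -> R) (b : Y -> R).
Hypothesis mf : measurable_fun setT f.
Hypothesis fab : forall x y, `|f (x, y)| <= a x * b y.
Hypotheses (ra : rint m1 a) (rb : rint m2 b).

Lemma rint_sectionl x : rint m2 (fun y => f (x, y)).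
Proof.
apply: (@rint_le _ _ _ _ _ (fun y => a x * b y)) => //; last exact: rintZl.
exact: (measurableT_comp mf (pair1_measurable x)).
Qed.

Lemma rint_sectionr y : rint m1 (fun x => f (x, y)).
Proof.
apply: (@rint_le _ _ _ _ _ (fun x => b y * a x)).
- exact: (measurableT_comp mf (pair2_measurable y)).
- by move=> x; rewrite mulrC.
- exact: rintZl.
Qed.

Lemma rint_prod : rint (m1 \x m2)%E f.
Proof.
have mf' : measurable_fun setT (EFin \o f) by exact/measurable_EFinP.
apply/(integrable12ltyP _ _ mf') => /=.
have mF : measurable_fun setT (fun x => \int[m2]_y `|(f (x, y))%:E|)%E.
  apply: (measurable_fun_fubini_tonelli_F (fun z => `|(f z)%:E|)%E) => //.
  exact: measurableT_comp.
apply: (@le_lt_trans _ _ (\int[m1]_x (`|a x| * \int[m2]_y `|b y|)%:E)%E).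
  apply: ge0_le_integral => //.
    by move=> x _; apply: integral_ge0.
    apply/measurable_EFinP/measurable_funM => //.
    by apply: measurableT_comp => //; exact: rint_measurable ra.
  move=> x _; rewrite -RintZl; last exact: rint_norm.
  rewrite RintE; last exact/rintZl/rint_norm.
  apply: ge0_le_integral => //.
  - apply/measurable_EFinP; apply: measurableT_comp => //.
    exact: (measurableT_comp mf (pair1_measurable x)).
  - apply/measurable_EFinP/measurable_funM => //.
    by apply: measurableT_comp => //; exact: rint_measurable rb.
  - by move=> y _; rewrite lee_fin (le_trans (fab _ _))// -normrM ler_norm.
rewrite (_ : (fun x => _) = (fun x => ((\int[m2]_y `|b y|) * `|a x|)%:E)); last first.
  by apply/funext => x; rewrite mulrC.
exact/rint_lty/rintZl/rint_norm.
Qed.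

Let FE x : fubini_F m2 (EFin \o f) x = (\int[m2]_y f (x, y))%:E.
Proof. by rewrite RintE//; exact: rint_sectionl. Qed.

Let GE y : fubini_G m1 (EFin \o f) y = (\int[m1]_x f (x, y))%:E.
Proof. by rewrite RintE//; exact: rint_sectionr. Qed.

Lemma rint_fubinil : rint m1 (fun x => \int[m2]_y f (x, y)).
Proof.
rewrite /rint (_ : EFin \o _ = fubini_F m2 (EFin \o f)).
  exact/integrable_fubini_F/rint_prod.
by apply/funext => x; rewrite FE.
Qed.

Lemma Rint_prodl : \int[m1]_x \int[m2]_y f (x, y) = \int[(m1 \x m2)%E]_z f z.
Proof.
rewrite {1}/Rintegral; under eq_integral do rewrite -FE.
by rewrite integral12_prod_meas1//; exact: rint_prod.
Qed.

Lemma Rint_prodr : \int[m2]_y \int[m1]_x f (x, y) = \int[(m1 \x m2)%E]_z f z.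
Proof.
rewrite {1}/Rintegral; under eq_integral do rewrite -GE.
by rewrite integral21_prod_meas1//; exact: rint_prod.
Qed.

Lemma Rint_swap :
  \int[m1]_x \int[m2]_y f (x, y) = \int[m2]_y \int[m1]_x f (x, y).
Proof. by rewrite Rint_prodl Rint_prodr. Qed.

End FubiniDominated.

Lemma rint_fubinir d1 d2 (X : measurableType d1) (Y : measurableType d2)
  (R : realType) (m1 : {sigma_finite_measure set X -> \bar R})
  (m2 : {sigma_finite_measure set Y -> \bar R})
  (f : X * Y -> R) (a : X -> R) (b : Y -> R) :
  measurable_fun setT f -> (forall x y, `|f (x, y)| <= a x * b y) ->
  rint m1 a -> rint m2 b -> rint m2 (fun y => \int[m1]_x f (x, y)).
Proof.
move=> mf fab ra rb.
apply: (@rint_fubinil _ _ _ _ _ m2 m1 (fun z => f (z.2, z.1)) b a) => //.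
  apply: (measurableT_comp mf); apply/measurable_fun_pairP.
  by split; [exact: measurable_snd|exact: measurable_fst].
by move=> x y; rewrite mulrC /=; exact: fab.
Qed.

Section TonelliReal.
Context d1 d2 (X : measurableType d1) (Y : measurableType d2) (R : realType).
Variables (m1 : {sigma_finite_measure set X -> \bar R})
          (m2 : {sigma_finite_measure set Y -> \bar R}) (f : X * Y -> R).
Hypotheses (mf : measurable_fun setT f) (f0 : forall z, 0 <= f z).

Lemma tonelli_prod1 :
  (\int[(m1 \x m2)%E]_z (f z)%:E = \int[m1]_x \int[m2]_y (f (x, y))%:E)%E.
Proof.
by rewrite (fubini_tonelli1 (fun z => (f z)%:E))//; exact/measurable_EFinP.
Qed.

Lemma tonelli_prod2 :
  (\int[(m1 \x m2)%E]_z (f z)%:E = \int[m2]_y \int[m1]_x (f (x, y))%:E)%E.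
Proof.
by rewrite (fubini_tonelli2 (fun z => (f z)%:E))//; exact/measurable_EFinP.
Qed.

Lemma tonelli_swap :
  (\int[m1]_x \int[m2]_y (f (x, y))%:E = \int[m2]_y \int[m1]_x (f (x, y))%:E)%E.
Proof. by rewrite -tonelli_prod1 tonelli_prod2. Qed.

Lemma measurable_tonelli1 :
  measurable_fun setT (fun x => \int[m2]_y (f (x, y))%:E)%E.
Proof.
apply: (measurable_fun_fubini_tonelli_F (fun z => (f z)%:E)).
  exact/measurable_EFinP.
by move=> z; rewrite lee_fin.
Qed.

Lemma measurable_tonelli2 :
  measurable_fun setT (fun y => \int[m1]_x (f (x, y))%:E)%E.
Proof.
apply: (measurable_fun_fubini_tonelli_G (fun z => (f z)%:E)).
  exact/measurable_EFinP.
by move=> z; rewrite lee_fin.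
Qed.

End TonelliReal.

Section IntegralSucc.
Context {R : realType}.
Local Notation T := (measurableTypeR R).
Local Notation mu := (@lebesgue_measure R).
Variable n : nat.

Lemma cons_point_inj (x : Rn R n.+1) : exists p, x = cons_point p.
Proof.
exists (thead x, [tuple of behead x]); rewrite /cons_point /=.
by rewrite [LHS]tuple_eta.
Qed.

Lemma ge0_integral_lebesgueRnS (f : Rn R n.+1 -> \bar R) :
  measurable_fun setT f -> (forall x, 0 <= f x)%E ->
  (\int[lebesgueRn n.+1]_x f x =
   \int[mu]_a \int[lebesgueRn n]_x f (cons_point (a, x)))%E.
Proof.
move=> mf f0.
transitivity (\int[pushforward (mu \x lebesgueRn n) (@cons_point R n)]_x f x)%E.
  by apply: eq_measure_integral; [exact: measurable_cons_point|move=> mc A].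
rewrite ge0_integral_pushforward//; last exact: measurable_cons_point.
rewrite preimage_setT fubini_tonelli1//; last by move=> p; exact: f0.
by apply: (measurableT_comp mf); exact: measurable_cons_point.
Qed.

Lemma rint_lebesgueRnS (f : Rn R n.+1 -> R) (a : T -> R) (b : Rn R n -> R) :
  measurable_fun setT f -> rint mu a -> rint (lebesgueRn n) b ->
  (forall x y, `|f (cons_point (x, y))| <= a x * b y) ->
  rint (lebesgueRn n.+1) f /\
  \int[lebesgueRn n.+1]_x f x =
   \int[mu]_a \int[lebesgueRn n]_x f (cons_point (a, x)).
Proof.
move=> mf ra rb fab.
have mfc : measurable_fun setT (f \o @cons_point R n).
  by apply: measurableT_comp => //; exact: measurable_cons_point.
have rfc := rint_prod mfc fab ra rb.
have mE : measurable_fun setT (EFin \o f) by exact/measurable_EFinP.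
have E (g : Rn R n.+1 -> \bar R) : (\int[lebesgueRn n.+1]_x g x =
   \int[pushforward (mu \x lebesgueRn n) (@cons_point R n)]_x g x)%E.
  by apply: eq_measure_integral; [exact: measurable_cons_point|move=> mc A].
split.
  apply/integrableP; split => //; rewrite E ge0_integral_pushforward//=.
  - rewrite preimage_setT; case/integrableP: rfc => _ /=; exact.
  - exact: measurable_cons_point.
  - by apply/measurable_EFinP; exact: measurableT_comp.
rewrite (Rint_prodl mfc fab ra rb).
rewrite /Rintegral E integral_pushforward ?preimage_setT//.
exact: measurable_cons_point.
Qed.

End IntegralSucc.

(** * Oscillatory integrals *)

(** The rules are stated for eta-expanded functions, so that a derivative is obtained by composing
    proof terms; what remains is an identity between values, settled through [is_derive_eq], mostly
    by [ring] or [field]. *)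
Section DerivativeRules.
Context {R : realType}.
Implicit Types (f g : R -> R) (x a b : R).

Lemma drv_id x : is_derive x 1 (fun t : R => t) 1.
Proof. exact: is_derive_id. Qed.

Lemma drv_cst x (k : R) : is_derive x 1 (fun _ : R => k) 0.
Proof. exact: is_derive_cst. Qed.

Lemma drvD x f g a b : is_derive x 1 f a -> is_derive x 1 g b ->
  is_derive x 1 (fun t => f t + g t) (a + b).
Proof. by move=> df dg; exact: is_deriveD. Qed.

Lemma drvN x f a : is_derive x 1 f a -> is_derive x 1 (fun t => - f t) (- a).
Proof. by move=> df; exact: is_deriveN. Qed.

Lemma drvB x f g a b : is_derive x 1 f a -> is_derive x 1 g b ->
  is_derive x 1 (fun t => f t - g t) (a - b).
Proof. by move=> df dg; exact: is_deriveB. Qed.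

Lemma drvM x f g a b : is_derive x 1 f a -> is_derive x 1 g b ->
  is_derive x 1 (fun t => f t * g t) (a * g x + f x * b).
Proof.
move=> df dg; apply: (is_derive_eq (is_deriveM df dg)).
by rewrite addrC; congr (_ + _); exact: mulrC.
Qed.

Lemma drvZ x k f a : is_derive x 1 f a -> is_derive x 1 (fun t => k * f t) (k * a).
Proof.
by move=> df; apply: (is_derive_eq (drvM (drv_cst x k) df)); rewrite mul0r add0r.
Qed.

Lemma drvX x n f a : is_derive x 1 f a ->
  is_derive x 1 (fun t => f t ^+ n) (n%:R * f x ^+ n.-1 * a).
Proof.
move=> df; elim: n => [|n ih].
  by apply: (is_derive_eq (drv_cst x 1)); rewrite mulr0n !mul0r.
under eq_fun do rewrite exprS.
apply: (is_derive_eq (drvM df ih)); case: n {ih} => [|n] /=.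
  by ring.
by rewrite !exprS; ring.
Qed.

Lemma drvV x f a : is_derive x 1 f a -> f x != 0 ->
  is_derive x 1 (fun t => (f t)^-1) (- (a / f x ^+ 2)).
Proof.
move=> df fx; have dvf : derivable f x 1 by exact: ex_derive.
apply: DeriveDef; first exact: derivableV.
by rewrite deriveV// derive_val scaleNr; congr (- _); rewrite mulrC.
Qed.

Lemma drv_comp x h f a b : is_derive (f x) 1 h b -> is_derive x 1 f a ->
  is_derive x 1 (fun t => h (f t)) (b * a).
Proof. by move=> dh df; exact: (is_derive1_comp dh df). Qed.

Lemma drv_cos x f a : is_derive x 1 f a ->
  is_derive x 1 (fun t => cos (f t)) (- sin (f x) * a).
Proof. by move=> df; apply: drv_comp df; exact: is_derive_cos. Qed.

Lemma drv_sin x f a : is_derive x 1 f a ->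
  is_derive x 1 (fun t => sin (f t)) (cos (f x) * a).
Proof. by move=> df; apply: drv_comp df; exact: is_derive_sin. Qed.

Lemma drv_exp x f a : is_derive x 1 f a ->
  is_derive x 1 (fun t => expR (f t)) (expR (f x) * a).
Proof. by move=> df; apply: drv_comp df; exact: is_derive_expR. Qed.

Lemma drv_powR x p f a : is_derive x 1 f a -> 0 < f x ->
  is_derive x 1 (fun t => f t `^ p) (p * f x `^ (p - 1) * a).
Proof.
by move=> df f0; apply: (drv_comp (h := (@powR R)^~ p)) df; exact: is_derive1_powR.
Qed.

Lemma drv_atan x f a : is_derive x 1 f a ->
  is_derive x 1 (fun t => atan (f t)) ((1 + f x ^+ 2)^-1 * a).
Proof. by move=> df; apply: drv_comp df; exact: is_derive1_atan. Qed.

Lemma drv_continuous x f a : is_derive x 1 f a -> {for x, continuous f}.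
Proof.
by move=> df; apply: differentiable_continuous; apply/derivable1_diffP; exact: ex_derive.
Qed.

Lemma drv_within f f' a b : (forall x, a <= x <= b -> is_derive x 1 f (f' x)) ->
  {within `[a, b], continuous f}.
Proof.
move=> df; apply: continuous_in_subspaceT => x /set_mem /=; rewrite in_itv/= => xab.
exact: drv_continuous (df x xab).
Qed.

Lemma drv_mvt f f' a b : a <= b -> (forall x, a <= x <= b -> is_derive x 1 f (f' x)) ->
  exists2 c, a <= c <= b & f b - f a = f' c * (b - a).
Proof.
move=> ab df; have [|c] := @MVT_segment _ f f' a b ab _ (drv_within df).
  by move=> x; rewrite in_itv/= => /andP[ax xb]; apply: df; rewrite !ltW.
by rewrite in_itv/= => cab E; exists c.
Qed.

(** The mean value theorem is applied to [g - f] and to [g + f], whose derivatives are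
    nonnegative. *)
Lemma drv_dom f f' g g' a b : a <= b ->
  (forall x, a <= x <= b -> is_derive x 1 f (f' x)) ->
  (forall x, a <= x <= b -> is_derive x 1 g (g' x)) ->
  (forall x, a <= x <= b -> `|f' x| <= g' x) ->
  `|f b - f a| <= g b - g a.
Proof.
move=> ab df dg fg; rewrite ler_norml.
have [c cab Ec] : exists2 c, a <= c <= b &
    (g b - f b) - (g a - f a) = (g' c - f' c) * (b - a).
  by apply: (@drv_mvt (fun x => g x - f x) (fun x => g' x - f' x)) => // x xab;
    exact: drvB (dg _ xab) (df _ xab).
have [d dab Ed] : exists2 c, a <= c <= b &
    (g b + f b) - (g a + f a) = (g' c + f' c) * (b - a).
  by apply: (@drv_mvt (fun x => g x + f x) (fun x => g' x + f' x)) => // x xab;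
    exact: drvD (dg _ xab) (df _ xab).
have ba : 0 <= b - a by rewrite subr_ge0.
have : 0 <= (g' c - f' c) * (b - a).
  by rewrite mulr_ge0// subr_ge0 (le_trans (ler_norm _))// fg.
have : 0 <= (g' d + f' d) * (b - a).
  rewrite mulr_ge0// addrC -lerBlDr sub0r.
  by have := fg _ dab; rewrite ler_norml => /andP[].
by rewrite -Ec -Ed; lra.
Qed.

Lemma drv_lip f f' M a b : a <= b ->
  (forall x, a <= x <= b -> is_derive x 1 f (f' x)) ->
  (forall x, a <= x <= b -> `|f' x| <= M) -> `|f b - f a| <= M * (b - a).
Proof.
move=> ab df fM.
have := @drv_dom f f' (fun x => M * x) (fun=> M) a b ab df _ fM.
rewrite mulrBr; apply=> x _.
by apply: (is_derive_eq (drvZ M (drv_id x))); rewrite mulr1.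
Qed.

Lemma drv_ge0 f f' a b : a <= b ->
  (forall x, a <= x <= b -> is_derive x 1 f (f' x)) ->
  (forall x, a <= x <= b -> 0 <= f' x) -> f a <= f b.
Proof.
move=> ab df f0; have [c cab E] := drv_mvt ab df.
by rewrite -subr_ge0 E mulr_ge0 ?f0// subr_ge0.
Qed.

Lemma FTC f F a b : a <= b -> (forall x, a <= x <= b -> {for x, continuous f}) ->
  (forall x, a <= x <= b -> is_derive x 1 F (f x)) ->
  \int[lebesgue_measure]_(x in `[a, b]) f x = F b - F a.
Proof.
rewrite le_eqVlt => /predU1P[->|ab] cf dF.
  by rewrite set_itv1 Rintegral_set1 subrr.
have cF x : a <= x <= b -> F z @[z --> x] --> F x.
  by move=> xab; exact: drv_continuous (dF _ xab).
rewrite /Rintegral (@continuous_FTC2 _ f F)//.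
- apply: continuous_in_subspaceT => x /set_mem /=; rewrite in_itv/=; exact: cf.
- split.
  + by move=> x; rewrite in_itv/= => /andP[ax xb];
      have := dF x; rewrite !ltW// => /(_ isT) ?; exact: ex_derive.
  + by apply: cvg_at_right_filter; apply: cF; rewrite lexx ltW.
  + by apply: cvg_at_left_filter; apply: cF; rewrite lexx ltW.
- move=> x; rewrite in_itv/= => /andP[ax xb].
  have := dF x; rewrite !ltW// => /(_ isT) dFx.
  by rewrite derive1E derive_val.
Qed.

(** The point [c] is only an origin for the integral. Applications take [c = -1], to the left of the
    range of integration, so that its end points are interior points. *)
Lemma continuous_antiderivative f c : (forall x, {for x, continuous f}) ->
  exists F, forall x, c < x -> is_derive x 1 F (f x).
Proof.
move=> cf; exists (fun x => \int[lebesgue_measure]_(t in `[c, x]) f t) => x cx.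
have xx1 : x < x + 1 by rewrite ltrDl.
have [||dF FE] := @continuous_FTC1 R f (BLeft c) x (x + 1) xx1 _ _ (cf x).
- apply: continuous_compact_integrable; first exact: segment_compact.
  exact: continuous_subspaceT.
- by rewrite lte_fin.
by apply: DeriveDef; [exact: dF|rewrite -FE derive1E].
Qed.

End DerivativeRules.

Section VanDerCorput.
Context {R : realType}.
Implicit Types a b x y mu A M : R.

(* [F - sin phi / phi1] has derivative [sin phi * phi2 / phi1 ^ 2], which is
   dominated by [(1 / phi1)'] because [phi1] is decreasing. *)
Lemma van_der_corput1 phi phi1 phi2 F a b mu : a <= b -> 0 < mu ->
  (forall x, a <= x <= b -> is_derive x 1 phi (phi1 x)) ->
  (forall x, a <= x <= b -> is_derive x 1 phi1 (phi2 x)) ->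
  (forall x, a <= x <= b -> is_derive x 1 F (cos (phi x))) ->
  (forall x, a <= x <= b -> phi2 x <= 0) ->
  (forall x, a <= x <= b -> mu <= phi1 x) \/
  (forall x, a <= x <= b -> phi1 x <= - mu) ->
  `|F b - F a| <= 3 / mu.
Proof.
move=> ab mu0 d1 d2 dF p2 pmu.
have p0 x : a <= x <= b -> phi1 x != 0.
  by move=> xab; case: pmu => /(_ x xab) h; apply/eqP => z; move: h; rewrite z; lra.
have ivle x : a <= x <= b -> `|(phi1 x)^-1| <= mu^-1.
  move=> xab; rewrite normfV lef_pV2 ?posrE ?normr_gt0 ?p0//.
  by case: pmu => /(_ x xab) h; [rewrite (le_trans h)// ler_norm|
    rewrite ler0_norm; lra].
have dI x : a <= x <= b -> is_derive x 1 (fun t => (phi1 t)^-1) (- (phi2 x / phi1 x ^+ 2)).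
  by move=> xab; exact: drvV (d2 _ xab) (p0 _ xab).
have dG x : a <= x <= b -> is_derive x 1 (fun t => F t - sin (phi t) * (phi1 t)^-1)
    (sin (phi x) * (phi2 x / phi1 x ^+ 2)).
  move=> xab.
  apply: (is_derive_eq (drvB (dF _ xab) (drvM (drv_sin (d1 _ xab)) (dI _ xab)))).
  by rewrite mulfK ?p0//; ring.
have := drv_dom ab dG dI.
have le1 x : a <= x <= b ->
    `|sin (phi x) * (phi2 x / phi1 x ^+ 2)| <= - (phi2 x / phi1 x ^+ 2).
  move=> xab; rewrite normrM -[leRHS]mul1r ler_pM//.
    by rewrite ler_norml sin_geN1 sin_le1.
  by rewrite ler0_norm// mulr_le0_ge0 ?p2// invr_ge0 sqr_ge0.
move=> /(_ le1).
have Sb : `|sin (phi b) * (phi1 b)^-1| <= mu^-1.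
  rewrite normrM -[leRHS]mul1r ler_pM ?ivle ?ab ?lexx//.
  by rewrite ler_norml sin_geN1 sin_le1.
have Sa : `|sin (phi a) * (phi1 a)^-1| <= mu^-1.
  rewrite normrM -[leRHS]mul1r ler_pM ?ivle ?ab ?lexx//.
  by rewrite ler_norml sin_geN1 sin_le1.
(* The two reciprocals have the same sign, so their difference costs a single [mu^-1]; with the two
   boundary terms this makes 3. *)
have ivd : (phi1 b)^-1 - (phi1 a)^-1 <= mu^-1.
  have := ivle a; have := ivle b; rewrite !lexx ab => /(_ isT) hb /(_ isT) ha.
  move: hb ha; rewrite !ler_norml => /andP[b1 b2] /andP[a1 a2].
  case: pmu => h.
    have : 0 <= (phi1 a)^-1 by rewrite invr_ge0 (le_trans (ltW mu0))// h// lexx.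
    lra.
  have : (phi1 b)^-1 <= 0.
    by rewrite invr_le0; have := h b; rewrite lexx ab => /(_ isT); lra.
  lra.
move: Sb Sa; rewrite !ler_norml => /andP[? ?] /andP[? ?] /andP[? ?].
by apply/andP; split; lra.
Qed.

Section second.
Variables (phi phi1 phi2 F : R -> R) (s : R).
Hypothesis s0 : 0 < s.

Let cosle (phi' : R -> R) a b : (forall x, a <= x <= b -> is_derive x 1 F (cos (phi' x))) ->
  a <= b -> `|F b - F a| <= b - a.
Proof.
move=> dF ab; rewrite -[leRHS]mul1r; apply: (drv_lip ab dF) => x _.
by rewrite ler_norml cos_geN1 cos_le1.
Qed.

Let decr a b : a <= b ->
  (forall x, a <= x <= b -> is_derive x 1 phi1 (phi2 x)) ->
  (forall x, a <= x <= b -> phi2 x <= - s ^+ 2) ->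
  phi1 b - phi1 a <= - s ^+ 2 * (b - a).
Proof.
move=> ab d2 p2; have [c cab ->] := drv_mvt ab d2.
by rewrite ler_wpM2r ?subr_ge0// p2.
Qed.

(** Up to [a + s^-1] the trivial bound on the cosine is used. Beyond, [phi1] has dropped below
    [- s], and the first derivative test with [mu = s] gives [3 / s]. *)
Let left_half a b : a <= b ->
  (forall x, a <= x <= b -> is_derive x 1 phi (phi1 x)) ->
  (forall x, a <= x <= b -> is_derive x 1 phi1 (phi2 x)) ->
  (forall x, a <= x <= b -> is_derive x 1 F (cos (phi x))) ->
  (forall x, a <= x <= b -> phi2 x <= - s ^+ 2) ->
  phi1 a <= 0 -> `|F b - F a| <= 4 / s.
Proof.
move=> ab d1 d2 dF p2 pa.
have si : 0 < s^-1 by rewrite invr_gt0.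
have [h|h] := leP (b - a) s^-1.
  by rewrite (le_trans (cosle dF ab))// (le_trans h)//; lra.
pose c := a + s^-1.
have ac : a <= c by rewrite lerDl ltW.
have cb : c <= b by rewrite /c; lra.
have sub1 x : a <= x <= c -> a <= x <= b.
  by move=> /andP[-> h1]; rewrite (le_trans h1 cb).
have sub2 x : c <= x <= b -> a <= x <= b.
  by move=> /andP[h1 ->]; rewrite (le_trans ac h1).
have A1 : `|F c - F a| <= c - a by apply: (@cosle phi) => // x /sub1; exact: dF.
have A2 : `|F b - F c| <= 3 / s.
  apply: (@van_der_corput1 phi phi1 phi2) => // [x /sub2 /d1//|x /sub2 /d2//|x /sub2 /dF//|x /sub2 /p2|].
    by move/le_trans; apply; rewrite oppr_le0 sqr_ge0.
  right => x /andP[cx xb].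
  have ax : a <= x by rewrite (le_trans ac).
  have D : phi1 x - phi1 a <= - s ^+ 2 * (x - a).
    apply: decr => // y /andP[h1 h2]; [apply: d2|apply: p2];
    by rewrite h1 (le_trans h2 xb).
  have : s ^+ 2 * s^-1 <= s ^+ 2 * (x - a).
    by rewrite ler_wpM2l ?sqr_ge0//; move: cx; rewrite /c; lra.
  by rewrite expr2 mulfK ?gt_eqF//; move: D; rewrite expr2; lra.
rewrite (_ : F b - F a = (F b - F c) + (F c - F a)); last by lra.
by rewrite (le_trans (ler_normD _ _))//; move: A1; rewrite /c; lra.
Qed.

Let right_half a b : a <= b ->
  (forall x, a <= x <= b -> is_derive x 1 phi (phi1 x)) ->
  (forall x, a <= x <= b -> is_derive x 1 phi1 (phi2 x)) ->
  (forall x, a <= x <= b -> is_derive x 1 F (cos (phi x))) ->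
  (forall x, a <= x <= b -> phi2 x <= - s ^+ 2) ->
  0 <= phi1 b -> `|F b - F a| <= 4 / s.
Proof.
move=> ab d1 d2 dF p2 pb.
have si : 0 < s^-1 by rewrite invr_gt0.
have [h|h] := leP (b - a) s^-1.
  by rewrite (le_trans (cosle dF ab))// (le_trans h)//; lra.
pose c := b - s^-1.
have cb : c <= b by rewrite gerBl ltW.
have ac : a <= c by rewrite /c; lra.
have sub1 x : a <= x <= c -> a <= x <= b.
  by move=> /andP[-> h1]; rewrite (le_trans h1 cb).
have sub2 x : c <= x <= b -> a <= x <= b.
  by move=> /andP[h1 ->]; rewrite (le_trans ac h1).
have A1 : `|F b - F c| <= b - c by apply: (@cosle phi) => // x /sub2; exact: dF.
have A2 : `|F c - F a| <= 3 / s.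
  apply: (@van_der_corput1 phi phi1 phi2) => // [x /sub1 /d1//|x /sub1 /d2//|x /sub1 /dF//|x /sub1 /p2|].
    by move/le_trans; apply; rewrite oppr_le0 sqr_ge0.
  left => x /andP[ax xc].
  have xb : x <= b by rewrite (le_trans xc).
  have D : phi1 b - phi1 x <= - s ^+ 2 * (b - x).
    apply: decr => // y /andP[h1 h2]; [apply: d2|apply: p2];
    by rewrite h2 (le_trans ax h1).
  have : s ^+ 2 * s^-1 <= s ^+ 2 * (b - x).
    by rewrite ler_wpM2l ?sqr_ge0//; move: xc; rewrite /c; lra.
  by rewrite expr2 mulfK ?gt_eqF//; move: D; rewrite expr2; lra.
rewrite (_ : F b - F a = (F b - F c) + (F c - F a)); last by lra.
by rewrite (le_trans (ler_normD _ _))//; move: A1; rewrite /c; lra.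
Qed.

(** [phi1] is decreasing: either one half lemma applies to the whole interval, or [phi1] has a zero
    at which the interval is cut, and each side costs [4 / s]. *)
Lemma van_der_corput2 a b : a <= b ->
  (forall x, a <= x <= b -> is_derive x 1 phi (phi1 x)) ->
  (forall x, a <= x <= b -> is_derive x 1 phi1 (phi2 x)) ->
  (forall x, a <= x <= b -> is_derive x 1 F (cos (phi x))) ->
  (forall x, a <= x <= b -> phi2 x <= - s ^+ 2) ->
  `|F b - F a| <= 8 / s.
Proof.
move=> ab d1 d2 dF p2.
have si : 0 < s^-1 by rewrite invr_gt0.
have [pa|pa] := leP (phi1 a) 0.
  by rewrite (le_trans (left_half ab d1 d2 dF p2 pa))//; lra.
have [pb|pb] := leP 0 (phi1 b).
  by rewrite (le_trans (right_half ab d1 d2 dF p2 pb))//; lra.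
have [||c] := @IVT R phi1 a b 0 ab; first exact: drv_within d2.
  by rewrite ge_min le_max (ltW pa) (ltW pb) orbT.
rewrite in_itv/= => /andP[ac cb] c0.
have A1 : `|F c - F a| <= 4 / s.
  apply: right_half => //; last by rewrite c0.
  - by move=> x /andP[h1 h2]; apply: d1; rewrite h1 (le_trans h2).
  - by move=> x /andP[h1 h2]; apply: d2; rewrite h1 (le_trans h2).
  - by move=> x /andP[h1 h2]; apply: dF; rewrite h1 (le_trans h2).
  - by move=> x /andP[h1 h2]; apply: p2; rewrite h1 (le_trans h2).
have A2 : `|F b - F c| <= 4 / s.
  apply: left_half => //; last by rewrite c0.
  - by move=> x /andP[h1 h2]; apply: d1; rewrite h2 (le_trans ac).
  - by move=> x /andP[h1 h2]; apply: d2; rewrite h2 (le_trans ac).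
  - by move=> x /andP[h1 h2]; apply: dF; rewrite h2 (le_trans ac).
  - by move=> x /andP[h1 h2]; apply: p2; rewrite h2 (le_trans ac).
rewrite (_ : F b - F a = (F b - F c) + (F c - F a)); last by lra.
by rewrite (le_trans (ler_normD _ _))//; lra.
Qed.

End second.

(* Second mean value theorem, up to the constant. *)
Lemma monotone_amplitude (G g H m m' : R -> R) a b A M : a <= b -> 0 <= A ->
  (forall x, a <= x <= b -> is_derive x 1 G (g x)) ->
  (forall x, a <= x <= b -> is_derive x 1 m (m' x)) ->
  (forall x, a <= x <= b -> is_derive x 1 H (m x * g x)) ->
  (forall x, a <= x <= b -> `|G x - G a| <= A) ->
  (forall x, a <= x <= b -> 0 <= m x <= M) ->
  (forall x, a <= x <= b -> m' x <= 0) \/ (forall x, a <= x <= b -> 0 <= m' x) ->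
  forall x, a <= x <= b -> `|H x - H a| <= 2 * (M * A).
Proof.
move=> ab A0 dG dm dH GA mM mm x /andP[ax xb].
have sub y : a <= y <= x -> a <= y <= b.
  by move=> /andP[-> h]; rewrite (le_trans h xb).
have aa : a <= a <= b by rewrite lexx.
have xx : a <= x <= b by rewrite ax.
(* Integration by parts in differential form: the derivative of this difference contains [m'] times
   a quantity bounded by [A], and [m'] has a constant sign, so that [A * m] or its opposite
   dominates. *)
have dK y : a <= y <= x ->
    is_derive y 1 (fun t => H t - m t * (G t - G a)) (- (m' y * (G y - G a))).
  move=> /sub yab; apply: (is_derive_eq (drvB (dH _ yab)
    (drvM (dm _ yab) (drvB (dG _ yab) (drv_cst y (G a)))))).
  by ring.
have K : `|(H x - m x * (G x - G a)) - (H a - m a * (G a - G a))| <= M * A.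
  case: mm => mm.
    have := @drv_dom R _ _ (fun t => - (A * m t)) (fun t => - (A * m' t)) _ _ ax dK.
    move=> /(_ (fun y h => drvN (drvZ A (dm _ (sub _ h))))).
    have h y : a <= y <= x -> `|- (m' y * (G y - G a))| <= - (A * m' y).
      move=> /sub yab; rewrite normrN normrM ler0_norm ?mm// mulNr lerN2 mulrC.
      by rewrite ler_wnM2l ?mm//; exact: GA.
    move=> /(_ h) /le_trans; apply.
    have /andP[? ?] := mM a aa; have /andP[? ?] := mM x xx; nra.
  have := @drv_dom R _ _ (fun t => A * m t) (fun t => A * m' t) _ _ ax dK.
  move=> /(_ (fun y h => drvZ A (dm _ (sub _ h)))).
  have h y : a <= y <= x -> `|- (m' y * (G y - G a))| <= A * m' y.
    move=> /sub yab; rewrite normrN normrM ger0_norm ?mm// mulrC.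
    by rewrite ler_wpM2r ?mm//; exact: GA.
  move=> /(_ h) /le_trans; apply.
  have /andP[? ?] := mM a aa; have /andP[? ?] := mM x xx; nra.
have E : H x - H a = ((H x - m x * (G x - G a)) - (H a - m a * (G a - G a)))
   + m x * (G x - G a) by ring.
rewrite E (le_trans (ler_normD _ _))// mulr_natl mulr2n lerD//.
have /andP[m0 mx] := mM x xx.
rewrite normrM ler_pM//; [by rewrite ger0_norm|exact: GA].
Qed.

End VanDerCorput.

Section GaussianPhase.
Context {R : realType}.
Variable k : R.
Hypothesis k0 : 0 <= k.
Implicit Types X a b t tau T : R.

(** With [k = n / 2] and [X = |x|^2 / p], these are the argument and, in [gamp], the modulus of [(1
    - i tau)^(-k) exp(- X / (4 (1 - i tau)))], that is, of the Fourier transform of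
    [exp(- p (1 - i tau) |xi|^2)] up to the factor [(pi / p)^(n/2)]. *)
Definition gphase X tau : R := k * atan tau - X * tau / (4 * (1 + tau ^+ 2)).

Definition gamp X tau : R :=
  (1 + tau ^+ 2) `^ (- (k / 2)) * expR (- (X / (4 * (1 + tau ^+ 2)))).

Let Phi X t := gphase X t - t.
Let Phi1 X t := k / (1 + t ^+ 2) - X * (1 - t ^+ 2) / (4 * (1 + t ^+ 2) ^+ 2) - 1.
Let Phi2 X t := - (2 * k * t) / (1 + t ^+ 2) ^+ 2 +
  X * t * (3 - t ^+ 2) / (2 * (1 + t ^+ 2) ^+ 3).

Let p1 t : 1 + t ^+ 2 != 0. Proof. by rewrite gt_eqF// ltr_pwDl// sqr_ge0. Qed.
Let pp1 t : 0 < 1 + t ^+ 2. Proof. by rewrite ltr_pwDl// sqr_ge0. Qed.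

Let dsq t : is_derive t 1 (fun x : R => 1 + x ^+ 2) (2 * t).
Proof.
apply: (is_derive_eq (drvD (drv_cst t 1) (drvX 2 (drv_id t)))).
by rewrite /= expr1 add0r mulr1.
Qed.

Let dPhi X t : is_derive t 1 (Phi X) (Phi1 X t).
Proof.
have d4 : is_derive t 1 (fun x : R => 4 * (1 + x ^+ 2)) (4 * (2 * t)).
  exact: drvZ (dsq t).
have n4 : 4 * (1 + t ^+ 2) != 0 by rewrite mulf_neq0// p1.
rewrite /Phi /gphase.
apply: (is_derive_eq (drvB (drvB (drvZ k (drv_atan (drv_id t)))
  (drvM (drvZ X (drv_id t)) (drvV d4 n4))) (drv_id t))).
have := p1 t; rewrite /Phi1 => h.
by field.
Qed.

Let dPhi1 X t : is_derive t 1 (Phi1 X) (Phi2 X t).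
Proof.
have d4 : is_derive t 1 (fun x : R => 4 * (1 + x ^+ 2) ^+ 2)
    (4 * (2 * (1 + t ^+ 2) * (2 * t))).
  by apply: drvZ; apply: (is_derive_eq (drvX 2 (dsq t))); rewrite expr1.
have n4 : 4 * (1 + t ^+ 2) ^+ 2 != 0 by rewrite mulf_neq0// expf_neq0// p1.
have dn : is_derive t 1 (fun x : R => X * (1 - x ^+ 2)) (X * (- (2 * t))).
  apply: drvZ; apply: (is_derive_eq (drvB (drv_cst t 1) (drvX 2 (drv_id t)))).
  by rewrite /= expr1 sub0r mulr1.
rewrite /Phi1.
apply: (is_derive_eq (drvB (drvB (drvZ k (drvV (dsq t) (p1 t)))
  (drvM dn (drvV d4 n4))) (drv_cst t 1))).
have := p1 t; rewrite /Phi2 => h.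
by field.
Qed.

(** There are three regimes. For [a <= 4 k + 2] the interval is short. For [X <= a^2] the term [- t]
    of the phase wins and its derivative is at most [- 1/2]. For [X > a^2] the phase may be
    stationary, but its second derivative is at most [- (12 s)^-2], of order [- 1 / a], which gives
    [8 * 12 * s]. *)
Let phase_bound : exists2 C : R, 0 <= C & forall X a b F, 0 <= X -> 1 <= a ->
  a <= b <= 2 * a ->
  (forall t, a <= t <= b -> is_derive t 1 F (cos (Phi X t))) ->
  `|F b - F a| <= C * Num.sqrt a.
Proof.
have kk := k0; exists (4 * k + 100) => [|X a b F X0 a1 /andP[ab b2] dF]; first by lra.
set s := Num.sqrt a.
have s2 : s ^+ 2 = a by rewrite sqr_sqrtr//; lra.
have s1 : 1 <= s by rewrite -(sqrtr1 R) ler_wsqrtr.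
have [ak|ak] := leP a (4 * k + 2).
  have : `|F b - F a| <= 1 * (b - a).
    apply: (drv_lip ab dF) => t _.
    by rewrite ler_norml cos_geN1 cos_le1.
  have : 0 <= k * s by rewrite mulr_ge0//; lra.
  nra.
have a2 : 2 <= a by lra.
have tge t : a <= t <= b -> 2 <= t /\ 4 <= t ^+ 2.
  by move=> /andP[h _]; split; [lra|nra].
have P2le t : a <= t <= b ->
    Phi2 X t <= X * t * (3 - t ^+ 2) / (2 * (1 + t ^+ 2) ^+ 3).
  move=> /tge[t2 _]; rewrite /Phi2 gerDr mulNr oppr_le0 divr_ge0//.
    by rewrite !mulr_ge0//; lra.
  by rewrite exprn_ge0// ltW// pp1.
have D3 t : 0 < 2 * (1 + t ^+ 2) ^+ 3 by rewrite mulr_gt0// exprn_gt0// pp1.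
have P20 t : a <= t <= b -> Phi2 X t <= 0.
  move=> tab; apply: (le_trans (P2le _ tab)); have [t2 t4] := tge _ tab.
  rewrite pmulr_lle0 ?invr_gt0 ?D3//.
  by rewrite mulr_ge0_le0//; [rewrite mulr_ge0//; lra|lra].
have [Xa|Xa] := leP X (a ^+ 2).
  have : `|F b - F a| <= 3 / (1 / 2).
    have half0 : 0 < 1 / 2 :> R by lra.
    apply: (van_der_corput1 ab half0 (fun t _ => dPhi X t) (fun t _ => dPhi1 X t) dF P20).
    right => t tab; have [t2 t4] := tge _ tab.
    have ta : a ^+ 2 <= t ^+ 2 by move: tab => /andP[? _]; nra.
    have h1 : k / (1 + t ^+ 2) <= 1 / 8.
      by rewrite ler_pdivrMr ?pp1//; nra.
    have h2 : - (X * (1 - t ^+ 2) / (4 * (1 + t ^+ 2) ^+ 2)) <= 1 / 4.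
      rewrite -mulNr ler_pdivrMr ?mulr_gt0 ?exprn_gt0 ?pp1//.
      have e1 : X * (t ^+ 2 - 1) <= (1 + t ^+ 2) * (1 + t ^+ 2).
        by rewrite ler_pM//; lra.
      by move: e1; rewrite expr2; lra.
    by rewrite /Phi1; lra.
  have : 0 <= k * s by rewrite mulr_ge0//; lra.
  lra.
have s0 : 0 < (12 * s)^-1 by rewrite invr_gt0; lra.
have : `|F b - F a| <= 8 / (12 * s)^-1.
  apply: (van_der_corput2 s0 ab (fun t _ => dPhi X t) (fun t _ => dPhi1 X t) dF) => t tab.
  apply: (le_trans (P2le _ tab)); have [t2 t4] := tge _ tab.
  rewrite exprVn exprMn s2 -lerN2 opprK -mulNr -mulrN opprB.
  rewrite ler_pdivlMr// mulrC ler_pdivrMr; last by lra.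
  move: tab => /andP[at' tb].
  (* The constant 12 is chosen for this comparison: as [t <= 2 a] and [1 + t^2 <= 5/4 t^2], the left
     side is at most [31.25 a^3 t^3], while [X > a^2] and [t^2 - 3 >= t^2 / 4] make the right side
     at least [36 a^3 t^3]. *)
  have e1 : 1 + t ^+ 2 <= 5 / 4 * t ^+ 2 by lra.
  have e2 : (1 + t ^+ 2) ^+ 3 <= (5 / 4 * t ^+ 2) ^+ 3.
    by rewrite lerXn2r// nnegrE; [rewrite ltW// pp1|lra].
  have e3 : t ^+ 3 <= (2 * a) ^+ 3 by rewrite lerXn2r// ?nnegrE; lra.
  have t30 : 0 <= t ^+ 3 by rewrite exprn_ge0//; lra.
  have e4 : t ^+ 3 * t ^+ 3 <= (2 * a) ^+ 3 * t ^+ 3 by rewrite ler_wpM2r.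
  have e5 : t * (t ^+ 2 / 4) <= t * (t ^+ 2 - 3) by rewrite ler_wpM2l; lra.
  have e6 : X * (t * (t ^+ 2 / 4)) <= X * (t * (t ^+ 2 - 3)) by rewrite ler_wpM2l.
  have e7 : a ^+ 2 * (t ^+ 3 / 4) <= X * (t ^+ 3 / 4) by rewrite ler_wpM2r; lra.
  have e8 : a * (a ^+ 2 * (t ^+ 3 / 4)) <= a * (X * (t * (t ^+ 2 - 3))).
    rewrite ler_wpM2l//; first by lra.
    apply: (le_trans e7); apply: le_trans e6; rewrite le_eqVlt; apply/orP; left.
    by apply/eqP; ring.
  have e9 : 0 <= a * (a ^+ 2 * (t ^+ 3 / 4)).
    have a0 : 0 <= a by lra.
    by apply: mulr_ge0 => //; apply: mulr_ge0; [exact: sqr_ge0|exact: divr_ge0].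
  have E1 : (2 * a) ^+ 3 * t ^+ 3 = 32 * (a * (a ^+ 2 * (t ^+ 3 / 4))) by field.
  have E2 : (5 / 4 * t ^+ 2) ^+ 3 = 125 / 64 * (t ^+ 3 * t ^+ 3) by field.
  have E3 : X * t * (t ^+ 2 - 3) * (12 ^+ 2 * a) =
     144 * (a * (X * (t * (t ^+ 2 - 3)))) by ring.
  by rewrite E3; move: e2; rewrite E2; move: e4; rewrite E1; lra.
rewrite invrK; have : 0 <= k * s by rewrite mulr_ge0//; lra.
by lra.
Qed.

Definition kint X T tau : R := (1 - tau / T) * gamp X tau * cos (gphase X tau - tau).

Lemma continuous_kint X T t : {for t, continuous (kint X T)}.
Proof.
have d4 : is_derive t 1 (fun x : R => 4 * (1 + x ^+ 2)) (4 * (2 * t)).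
  exact: drvZ (dsq t).
have n4 : 4 * (1 + t ^+ 2) != 0 by rewrite mulf_neq0// p1.
rewrite /kint /gamp.
exact: drv_continuous (drvM (drvM (drvB (drv_cst t 1) (drvM (drv_id t) (drv_cst t T^-1)))
  (drvM (drv_powR (- (k / 2)) (dsq t) (pp1 t))
  (drv_exp (drvN (drvM (drv_cst t X) (drvV d4 n4)))))) (drv_cos (dPhi X t))).
Qed.

(** The amplitude need not be monotone, but it is a product of three monotone factors: the Fejer
    weight and the power decrease, the exponential increases. Inserting them one at a time by
    [monotone_amplitude] costs a factor 2 each. *)
Let amplitude_bound X T a b A M2 M3 : 0 <= X -> 0 < T -> 0 <= a -> a <= b <= T ->
  0 <= A ->
  (forall F t, a <= t <= b ->
     (forall t, a <= t <= b -> is_derive t 1 F (cos (Phi X t))) ->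
     `|F t - F a| <= A) ->
  (forall t, a <= t <= b -> (1 + t ^+ 2) `^ (- (k / 2)) <= M2) ->
  (forall t, a <= t <= b -> expR (- (X / (4 * (1 + t ^+ 2)))) <= M3) ->
  `|\int[lebesgue_measure]_(t in `[a, b]) kint X T t| <= 8 * (M3 * (M2 * A)).
Proof.
move=> X0 T0 a0 /andP[ab bT] A0 hA hM2 hM3.
have lt1 t : a <= t <= b -> -1 < t by move=> /andP[? _]; lra.
pose m1 t : R := 1 - t / T.
pose m2 t : R := (1 + t ^+ 2) `^ (- (k / 2)).
pose m3 t : R := expR (- (X / (4 * (1 + t ^+ 2)))).
have dm1 t : is_derive t 1 m1 (- T^-1).
  apply: (is_derive_eq (drvB (drv_cst t 1) (drvM (drv_id t) (drv_cst t T^-1)))).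
  by rewrite mulr0 addr0 mul1r sub0r.
have dm2 t : is_derive t 1 m2 (- (k / 2) * (1 + t ^+ 2) `^ (- (k / 2) - 1) * (2 * t)).
  by rewrite /m2; exact: (drv_powR (- (k / 2)) (dsq t) (pp1 t)).
have n4 t : 4 * (1 + t ^+ 2) != 0 by rewrite mulf_neq0// p1.
have dm3 t : is_derive t 1 m3
    (m3 t * (X * (4 * (2 * t)) / (4 * (1 + t ^+ 2)) ^+ 2)).
  have d4 : is_derive t 1 (fun x : R => 4 * (1 + x ^+ 2)) (4 * (2 * t)).
    exact: drvZ (dsq t).
  apply: (is_derive_eq (drv_exp (drvN (drvM (drv_cst t X) (drvV d4 (n4 t)))))).
  by rewrite mul0r add0r (mulrN X) opprK; congr (_ * _); exact: mulrA.
pose g t := cos (Phi X t).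
have dg t : is_derive t 1 g (- sin (Phi X t) * Phi1 X t) by exact: drv_cos.
have [G0 dG0] := continuous_antiderivative (-1) (fun x => drv_continuous (dg x)).
have d1 t := drvM (dm1 t) (dg t).
have [G1 dG1] := continuous_antiderivative (-1) (fun x => drv_continuous (d1 x)).
have d2 t := drvM (dm2 t) (d1 t).
have [G2 dG2] := continuous_antiderivative (-1) (fun x => drv_continuous (d2 x)).
have d3 t := drvM (dm3 t) (d2 t).
have [G3 dG3] := continuous_antiderivative (-1) (fun x => drv_continuous (d3 x)).
have E t : m3 t * (m2 t * (m1 t * g t)) = kint X T t.
  by rewrite /kint /gamp /g /Phi /m1 /m2 /m3; ring.
have -> : \int[lebesgue_measure]_(t in `[a, b]) kint X T t = G3 b - G3 a.
  apply: FTC => // [t _|t /lt1 t1]; first exact: continuous_kint.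
  by apply: (is_derive_eq (dG3 _ t1)); rewrite E.
have hG0 t : a <= t <= b -> `|G0 t - G0 a| <= A.
  by move=> tab; apply: hA => // u /lt1; exact: dG0.
have hG1 t : a <= t <= b -> `|G1 t - G1 a| <= 2 * (1 * A).
  apply: (monotone_amplitude ab A0 (fun t h => dG0 t (lt1 _ h))
    (fun t _ => dm1 t) (fun t h => dG1 t (lt1 _ h)) hG0).
    move=> u /andP[au ub]; rewrite /m1 subr_ge0 ler_pdivrMr// mul1r (le_trans ub bT)/=.
    by rewrite gerBl divr_ge0 ?(le_trans a0 au)// ltW.
  by left => u _; rewrite oppr_le0 invr_ge0 ltW.
have A1 : 0 <= 2 * (1 * A) by rewrite mul1r mulr_ge0.
have hG2 t : a <= t <= b -> `|G2 t - G2 a| <= 2 * (M2 * (2 * (1 * A))).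
  apply: (monotone_amplitude ab A1 (fun t h => dG1 t (lt1 _ h))
    (fun t _ => dm2 t) (fun t h => dG2 t (lt1 _ h)) hG1).
    by move=> u uab; rewrite powR_ge0 hM2.
  left => u /andP[au ub]; rewrite !mulNr oppr_le0 !mulr_ge0 ?powR_ge0//.
  exact: le_trans au.
have M20 : 0 <= M2 by apply: le_trans (hM2 a _); rewrite ?powR_ge0 ?lexx.
have A2 : 0 <= 2 * (M2 * (2 * (1 * A))) by rewrite !mulr_ge0// mul1r.
have hG3 := monotone_amplitude ab A2 (fun t h => dG2 t (lt1 _ h))
    (fun t _ => dm3 t) (fun t h => dG3 t (lt1 _ h)) hG2.
apply: (le_trans (hG3 M3 _ _ b _)); last by rewrite le_eqVlt; apply/orP; left; apply/eqP; ring.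
- by move=> u uab; rewrite expR_ge0 hM3.
- right => u /andP[au ub]; rewrite mulr_ge0 ?expR_ge0// divr_ge0 ?sqr_ge0//.
  by rewrite !mulr_ge0// (le_trans a0).
- by rewrite ab lexx.
Qed.

Lemma kernel_bound0 X T : 0 <= X -> 1 <= T ->
  `|\int[lebesgue_measure]_(t in `[0, 1]) kint X T t| <= 8 * expR (- (X / 20)).
Proof.
move=> X0 T1.
have := @amplitude_bound X T 0 1 1 1 (expR (- (X / 20))) X0.
rewrite mul1r mulr1; apply=> //; first by lra.
- by rewrite ler01 T1.
- move=> F t /andP[t0 t1] dF.
  have : `|F t - F 0| <= 1 * (t - 0).
    apply: drv_lip => // [x /andP[h1 h2]|x _]; first by apply: dF; rewrite h1 (le_trans h2).
    by rewrite ler_norml cos_geN1 cos_le1.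
  by lra.
- move=> t /andP[t0 t1]; rewrite powRN invf_le1 ?powR_gt0 ?pp1//.
  have : (1 + t ^+ 2) `^ 0 <= (1 + t ^+ 2) `^ (k / 2).
    by rewrite ler_powR ?divr_ge0// lerDl sqr_ge0.
  by rewrite powRr0.
- move=> t /andP[t0 t1]; rewrite ler_expR lerN2 ler_wpM2l// lef_pV2 ?posrE//.
    by nra.
  by rewrite mulr_gt0// pp1.
Qed.

(** For [1 <= a <= t <= 2 a] one has [4 (1 + t^2) <= 20 a^2], the origin of 20. The oscillation
    replaces the length [a] of the interval by [a^(1/2)], hence the exponent [1/2 - k]. *)
Lemma kernel_bound : exists2 C : R, 0 <= C & forall X T a b, 0 <= X -> 1 <= a ->
  a <= b <= 2 * a -> b <= T ->
  `|\int[lebesgue_measure]_(t in `[a, b]) kint X T t| <=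
  C * (a `^ (2^-1 - k) * expR (- (X / (20 * a ^+ 2)))).
Proof.
have [C C0 hC] := phase_bound.
exists (8 * C) => [|X T a b X0 a1 /andP[ab b2] bT]; first by rewrite mulr_ge0.
have a0 : 0 < a by lra.
have := @amplitude_bound X T a b (C * Num.sqrt a) (a `^ (- k)) (expR (- (X / (20 * a ^+ 2)))) X0.
have E : a `^ (2^-1 - k) = Num.sqrt a * a `^ (- k).
  by rewrite -powR12_sqrt ?ltW// -powRD// (gt_eqF a0) implybT.
rewrite E (_ : 8 * C * _ = 8 * (expR (- (X / (20 * a ^+ 2))) * (a `^ (- k) * (C * Num.sqrt a)))).
  apply => //.
  - by lra.
  - by rewrite ltW.
  - by rewrite ab.
  - by rewrite mulr_ge0// sqrtr_ge0.
  - move=> F t /andP[at' tb] dF; apply: (hC X a t) => //; first by rewrite at' (le_trans tb).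
    by move=> u /andP[h1 h2]; apply: dF; rewrite h1 (le_trans h2).
  - move=> t /andP[at' tb].
    rewrite (_ : - k = 2%:R * - (k / 2)); last by field.
    rewrite powRrM (powR_mulrn 2 (ltW a0)).
    rewrite !powRN lef_pV2 ?posrE ?powR_gt0 ?exprn_gt0 ?pp1//.
    have aat : a ^+ 2 <= 1 + t ^+ 2 by nra.
    by apply: ge0_ler_powR; rewrite ?nnegrE ?divr_ge0 ?sqr_ge0 ?(ltW (pp1 _)).
  - move=> t /andP[at' tb]; rewrite ler_expR lerN2 ler_wpM2l// lef_pV2 ?posrE ?mulr_gt0 ?exprn_gt0 ?pp1//.
    have : t ^+ 2 <= (2 * a) ^+ 2 by rewrite lerXn2r// ?nnegrE; lra.
    by rewrite exprMn; nra.
by ring.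
Qed.

End GaussianPhase.

(** * Gaussian integrals *)

Section GaussianIntegral1.
Context {R : realType}.
Local Notation mu := (@lebesgue_measure R).
Implicit Types (f g h : R -> R) (x y p tau : R).

Lemma drv_measurable f (f' : R -> R) :
  (forall x, is_derive x 1 f (f' x)) -> measurable_fun setT f.
Proof.
by move=> df; apply: continuous_measurable_fun => x; exact: drv_continuous (df x).
Qed.

Lemma Rint_itv_cvg f : rint mu f ->
  (\int[mu]_(x in `[(- k%:R), k%:R]) f x) @[k --> \oo] --> \int[mu]_x f x.
Proof.
move=> rf; pose F k x := (\1_`[(- k%:R), k%:R] x * f x)%:E.
have FE k : (\int[mu]_(x in `[(- k%:R), k%:R]) f x)%:E = (\int[mu]_x F k x)%E.
  rewrite /Rintegral fineK; last first.
    by apply: integrable_fin_num => //; apply: integrableS rf.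
  rewrite integral_mkcond; apply: eq_integral => x _.
  by rewrite /F patchE indicE; case: ifPn; rewrite (mul1r, mul0r).
have mf := rint_measurable rf.
have : (\int[mu]_x F k x)%E @[k --> \oo] --> (\int[mu]_x (f x)%:E)%E.
  apply: (@dominated_cvg _ _ _ mu _ _ _ _ (fun x => `|f x|%:E)) => //.
  - by move=> k; apply/measurable_EFinP/measurable_funM.
  - move=> x _; apply: cvg_near_cst; near=> k.
    rewrite /F indicE mem_set ?mul1r//= in_itv/= -ler_norml.
    by apply/ltW; near: k; exact: nbhs_infty_gtr.
  - exact: rint_norm.
  - move=> k x _; rewrite /F abse_EFin lee_fin normrM indicE.
    by case: (_ \in _); rewrite ?normr1 ?normr0 ?mul1r ?mul0r.
under eq_fun do rewrite -FE.
by rewrite -RintE// => h; exact: (fine_cvg h).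
Unshelve. all: by end_near. Qed.

(** The second derivative makes [f'] continuous for the fundamental theorem of calculus; the bound
    on [f] makes the boundary terms at [k] and [- k] tend to 0. *)
Lemma Rint_deriv0 f (f' f'' : R -> R) c : (forall x, is_derive x 1 f (f' x)) ->
  (forall x, is_derive x 1 f' (f'' x)) ->
  rint mu f' -> (forall x, `|f x| <= c / (1 + `|x|)) -> \int[mu]_x f' x = 0.
Proof.
move=> df ddf rf' fc.
have E k : \int[mu]_(x in `[(- k%:R), k%:R]) f' x = f k%:R - f (- k%:R).
  apply: FTC; first by rewrite (@le_trans _ _ 0)// oppr_le0.
  by move=> y _; exact: drv_continuous (ddf y).
have c0 : 0 <= c.
  have := fc 0; rewrite normr0 addr0 divr1; exact: le_trans.
have l0 : (f k%:R - f (- k%:R)) @[k --> \oo] --> 0.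
  apply/cvgr0Pnorm_le => e e0; near=> k.
  apply: (le_trans (ler_normB _ _)); apply: (le_trans (lerD (fc _) (fc _))).
  rewrite normrN ger0_norm// -mulrDl -mulr2n ler_pdivrMr ?ltr_pwDl//.
  rewrite -ler_pdivrMl// (le_trans (y := k%:R)) ?lerDr//.
  by apply/ltW; near: k; exact: nbhs_infty_gtr.
have h := Rint_itv_cvg rf'.
rewrite (_ : (fun k : nat => _) = (fun k => f k%:R - f (- k%:R))) in h; last first.
  by apply/funext => k; rewrite E.
by rewrite -(cvg_lim _ h)// (cvg_lim _ l0).
Unshelve. all: by end_near. Qed.

Lemma integral_gauss p m : 0 < p ->
  (\int[mu]_x (expR (- (p * (x - m) ^+ 2)))%:E = (Num.sqrt (pi / p))%:E)%E.
Proof.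
(* [s] is the standard deviation with [2 s^2 = p^-1], so that the integrand is the normal density
   divided by its peak value. *)
move=> p0; pose s := Num.sqrt ((2 * p)^-1).
have s2 : s ^+ 2 *+ 2 = p^-1.
  rewrite sqr_sqrtr; last by rewrite invr_ge0 mulr_ge0// ltW.
  by rewrite -mulr_natr; field; rewrite gt_eqF.
have s0 : s != 0 by rewrite gt_eqF// sqrtr_gt0 invr_gt0 mulr_gt0.
have := integral_normal_pdf m s; rewrite normal_pdfE//.
have -> : (fun x => (normal_peak s * normal_fun m s x)%:E) =
   (fun x => ((normal_peak s)%:E * (expR (- (p * (x - m) ^+ 2)))%:E)%E).
  apply/funext => x; rewrite EFinM /normal_fun s2 invrK.
  by congr (_ * (expR _)%:E)%E; rewrite mulNr mulrC.
have mg : measurable_fun setT (fun x => expR (- (p * (x - m) ^+ 2))).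
  exact: drv_measurable (fun x =>
    drv_exp (drvN (drvZ p (drvX 2 (drvB (drv_id x) (drv_cst x m)))))).
rewrite ge0_integralZl//; last 2 first.
  exact/measurable_EFinP.
  by rewrite lee_fin ltW// normal_peak_gt0.
have pk := normal_peak_gt0 s0.
move=> h; have : ((normal_peak s)^-1%:E * ((normal_peak s)%:E *
   \int[mu]_x (expR (- (p * (x - m) ^+ 2)))%:E) = (normal_peak s)^-1%:E * 1)%E.
  by rewrite h.
rewrite [LHS]muleA -EFinM mulVf ?gt_eqF// mul1e mule1 => ->.
by rewrite /normal_peak invrK -mulrnAl s2 mulrC.
Qed.

Lemma rint_gauss p m : 0 < p -> rint mu (fun x => expR (- (p * (x - m) ^+ 2))).
Proof.
move=> p0; apply: ge0_rint; last 2 first.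
- by move=> x; exact: expR_ge0.
- by rewrite integral_gauss// ltry.
exact: drv_measurable (fun x =>
    drv_exp (drvN (drvZ p (drvX 2 (drvB (drv_id x) (drv_cst x m)))))).
Qed.

Lemma rint_gauss0 p : 0 < p -> rint mu (fun x => expR (- (p * x ^+ 2))).
Proof. by move=> p0; move: (rint_gauss 0 p0); apply: eq_rint => x; rewrite subr0. Qed.

(** Half of the exponent absorbs the quadratic growth of [h], the other half remains integrable. *)
Lemma rint_gauss_mul p M h : 0 < p -> measurable_fun setT h ->
  (forall x, `|h x| <= M * (1 + x ^+ 2)) ->
  rint mu (fun x => expR (- (p * x ^+ 2)) * h x).
Proof.
move=> p0 mh hM.
have p20 : 0 < p / 2 by rewrite divr_gt0.
apply: (@rint_le _ _ _ mu _ (fun x => M * (1 + 2 / p) * expR (- (p / 2 * x ^+ 2)))).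
- apply: measurable_funM => //; exact: rint_measurable (rint_gauss0 p0).
- move=> x; have M0 : 0 <= M.
    by have := hM 0; rewrite expr0n addr0 mulr1; exact: le_trans.
  rewrite normrM ger0_norm ?expR_ge0//.
  apply: (@le_trans _ _ (expR (- (p * x ^+ 2)) * (M * (1 + x ^+ 2)))).
    by rewrite ler_wpM2l ?expR_ge0.
  have -> : - (p * x ^+ 2) = - (p / 2 * x ^+ 2) + - (p / 2 * x ^+ 2) by field.
  rewrite expRD; set u := p / 2 * x ^+ 2.
  have u0 : 0 <= u by rewrite mulr_ge0 ?sqr_ge0// ltW.
  have x2 : x ^+ 2 = 2 / p * u by rewrite /u; field; rewrite gt_eqF.
  have e1 : expR (- u) * (1 + x ^+ 2) <= 1 + 2 / p.
    have eu : expR (- u) * (1 + u) <= 1.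
      by rewrite -[leRHS](expRxMexpNx_1 u) mulrC ler_wpM2r ?expR_ge0// expR_ge1Dx.
    have en : expR (- u) <= 1 by rewrite -expR0 ler_expR oppr_le0.
    have eu' : expR (- u) * u <= 1 by have := expR_gt0 (- u); lra.
    rewrite x2 mulrDr mulr1 lerD// mulrCA -[leRHS]mulr1.
    by rewrite ler_wpM2l// divr_ge0// ltW.
  rewrite [leRHS](_ : _ = M * (expR (- u) * (1 + 2 / p))); last by ring.
  rewrite [leLHS](_ : _ = M * (expR (- u) * (expR (- u) * (1 + x ^+ 2)))); last by ring.
  by rewrite ler_wpM2l// ler_wpM2l ?expR_ge0.
- exact/rintZl/rint_gauss0.
Qed.

(** The integrand is the derivative of [expR (- (p * x ^+ 2)) * h x]; the growth bounds on [h] and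
    [h'] provide the integrability and the vanishing at infinity. *)
Lemma gauss_ibp p M h (h' h'' : R -> R) : 0 < p ->
  (forall x, is_derive x 1 h (h' x)) -> (forall x, is_derive x 1 h' (h'' x)) ->
  (forall x, `|h x| <= M * (1 + `|x|)) -> (forall x, `|h' x| <= M * (1 + x ^+ 2)) ->
  \int[mu]_x (expR (- (p * x ^+ 2)) * (h' x - 2 * p * x * h x)) = 0.
Proof.
move=> p0 dh ddh hM h'M.
have M0 : 0 <= M by have := hM 0; rewrite normr0 addr0 mulr1; exact: le_trans.
have de (x : R) : is_derive x 1 (fun t : R => expR (- (p * t ^+ 2)))
    (expR (- (p * x ^+ 2)) * - (p * (2 * x))).
  apply: (is_derive_eq (drv_exp (drvN (drvZ p (drvX 2 (drv_id x)))))).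
  by rewrite /= expr1 mulr1.
have sqn (x : R) : (1 + `|x|) * (1 + `|x|) <= 2 * (1 + x ^+ 2).
  by rewrite -(real_normK (num_real x)); have := sqr_ge0 (`|x| - 1); lra.
have mh : measurable_fun setT h by exact: drv_measurable dh.
have mh' : measurable_fun setT h' by exact: drv_measurable ddh.
have xle (x : R) : `|2 * p * x * h x| <= 4 * p * M * (1 + x ^+ 2).
  rewrite !normrM (gtr0_norm p0) (@ger0_norm _ 2)//.
  have -> : 4 * p * M * (1 + x ^+ 2) = 2 * p * (M * (2 * (1 + x ^+ 2))) by ring.
  rewrite -!mulrA ler_wpM2l// ler_wpM2l ?(ltW p0)//.
  apply: le_trans (_ : `|x| * (M * (1 + `|x|)) <= _); first by rewrite ler_wpM2l.
  rewrite mulrCA ler_wpM2l//; apply: le_trans (sqn x).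
  by rewrite ler_wpM2r ?addr_ge0// lerDr.
have rF : rint mu (fun x => expR (- (p * x ^+ 2)) * (h' x - 2 * p * x * h x)).
  apply: (@rint_gauss_mul p (M + 4 * p * M)) => //.
    apply: measurable_funB => //; apply: measurable_funM => //.
  by move=> x; apply: (le_trans (ler_normB _ _)); rewrite [leRHS]mulrDl; exact: lerD.
have D1 (x : R) : is_derive x 1 (fun x : R => expR (- (p * x ^+ 2)) * h x)
    (expR (- (p * x ^+ 2)) * (h' x - 2 * p * x * h x)).
  by apply: (is_derive_eq (drvM (de x) (dh x))); ring.
have D2 (x : R) := drvM (de x) (drvB (ddh x) (drvM (drvZ (2 * p) (drv_id x)) (dh x))).
apply: (Rint_deriv0 (c := M * (2 * (1 + 2 / p))) D1 D2 rF) => x.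
rewrite normrM ger0_norm ?expR_ge0// ler_pdivlMr ?ltr_pwDl//.
  apply: (@le_trans _ _ (expR (- (p * x ^+ 2)) * (M * (1 + `|x|)) * (1 + `|x|))).
    by rewrite ler_wpM2r ?addr_ge0// ler_wpM2l ?expR_ge0.
  apply: (@le_trans _ _ (M * (2 * (expR (- (p * x ^+ 2)) * (1 + x ^+ 2))))).
    rewrite [leLHS](_ : _ = M * (expR (- (p * x ^+ 2)) * ((1 + `|x|) * (1 + `|x|)))); last by ring.
    rewrite ler_wpM2l// (mulrCA 2) ler_wpM2l ?expR_ge0//.
  rewrite ler_wpM2l// ler_wpM2l//.
  set u := p * x ^+ 2; have u0 : 0 <= u by rewrite mulr_ge0 ?sqr_ge0// ltW.
  have -> : x ^+ 2 = u / p by rewrite /u; field; rewrite gt_eqF.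
  have eu : expR (- u) * (1 + u) <= 1.
    by rewrite -[leRHS](expRxMexpNx_1 u) mulrC ler_wpM2r ?expR_ge0// expR_ge1Dx.
  have en : expR (- u) <= 1 by rewrite -expR0 ler_expR oppr_le0.
  have eu' : expR (- u) * u <= 1 by have := expR_gt0 (- u); lra.
  have pi0 : 0 < p^-1 by rewrite invr_gt0.
  rewrite mulrDr mulr1 lerD// mulrA; nra.
Qed.

Lemma Rint_lin3 d (X : measurableType d) (nu : {measure set X -> \bar R})
  (a b c : R) (u v w : X -> R) : rint nu u -> rint nu v -> rint nu w ->
  \int[nu]_x (a * u x + b * v x + c * w x) =
  a * \int[nu]_x u x + b * \int[nu]_x v x + c * \int[nu]_x w x.
Proof.
move=> ru rv rw; rewrite RintD ?RintD ?RintZl//; try exact: rintZl.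
by apply: rintD; exact: rintZl.
Qed.

(** The Gaussian Fourier integral is computed by an ordinary differential equation instead of a
    contour shift. The whole phase [q] is multiplied by a parameter [s]; then [Z = C 0 + i S 0]
    satisfies [Z' = (al + i be) Z], and it is followed from [s = 0], where it is the plain Gaussian
    integral, to [s = 1]. *)
Section phase.
Variables (p tau x : R).
Hypothesis p0 : 0 < p.

Let q (xi : R) := p * tau * xi ^+ 2 + x * xi.
Let e (xi : R) := expR (- (p * xi ^+ 2)).
Let C j s := \int[mu]_xi (e xi * (xi ^+ j * cos (s * q xi))).
Let S j s := \int[mu]_xi (e xi * (xi ^+ j * sin (s * q xi))).

Let dq (s xi : R) : is_derive xi 1 (fun t : R => s * q t) (s * (p * tau * (2 * xi) + x)).
Proof.
apply: drvZ; apply: (is_derive_eq (drvD (drvZ (p * tau) (drvX 2 (drv_id xi)))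
  (drvZ x (drv_id xi)))).
by rewrite /= expr1 !mulr1.
Qed.

Let mX j : measurable_fun setT (fun xi : R => xi ^+ j).
Proof. exact: (drv_measurable (fun xi : R => drvX j (drv_id xi))). Qed.

Let mcos s : measurable_fun setT (fun xi => cos (s * q xi)).
Proof. exact: (drv_measurable (fun xi : R => drv_cos (dq s xi))). Qed.

Let msin s : measurable_fun setT (fun xi => sin (s * q xi)).
Proof. exact: (drv_measurable (fun xi : R => drv_sin (dq s xi))). Qed.

Let Xle j (xi : R) : (j <= 2)%N -> `|xi ^+ j| <= 1 * (1 + xi ^+ 2).
Proof.
move=> j2; rewrite mul1r normrX -(real_normK (num_real xi)).
have := normr_ge0 xi; move: `|xi| => u u0.
case: j j2 => [|[|[|//]]] _; rewrite ?expr0 ?expr1; nra.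
Qed.

Let cos1 u : `|cos u| <= 1 :> R. Proof. by rewrite ler_norml cos_geN1 cos_le1. Qed.
Let sin1 u : `|sin u| <= 1 :> R. Proof. by rewrite ler_norml sin_geN1 sin_le1. Qed.

Let rC j s : (j <= 2)%N -> rint mu (fun xi => e xi * (xi ^+ j * cos (s * q xi))).
Proof.
move=> j2; apply: (@rint_gauss_mul p 1) => //; first exact: measurable_funM.
by move=> xi; rewrite normrM -[leRHS]mulr1; apply: ler_pM => //; exact: Xle.
Qed.

Let rS j s : (j <= 2)%N -> rint mu (fun xi => e xi * (xi ^+ j * sin (s * q xi))).
Proof.
move=> j2; apply: (@rint_gauss_mul p 1) => //; first exact: measurable_funM.
by move=> xi; rewrite normrM -[leRHS]mulr1; apply: ler_pM => //; exact: Xle.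
Qed.

Let K (s : R) := 2 * `|s| * p * `|tau| + `|s| * `|x| + 1.

Let K1 s : 1 <= K s.
Proof. by rewrite lerDr !addr_ge0// !mulr_ge0// ltW. Qed.

Let dqle (s xi : R) : `|s * (p * tau * (2 * xi) + x)| <= K s * (1 + `|xi|) - 1.
Proof.
rewrite normrM; have h : `|p * tau * (2 * xi) + x| <= 2 * p * `|tau| * `|xi| + `|x|.
  rewrite (le_trans (ler_normD _ _))// !normrM (gtr0_norm p0) (@ger0_norm _ 2)//.
  by rewrite lerD2r le_eqVlt; apply/orP; left; apply/eqP; ring.
apply: (le_trans (ler_wpM2l (normr_ge0 s) h)).
rewrite /K -subr_ge0; have := normr_ge0 s; have := normr_ge0 x; have := normr_ge0 xi.
have := normr_ge0 tau; move: `|s| `|x| `|xi| `|tau| => a b c d d0 c0 b0 a0.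
have -> : (2 * a * p * d + a * b + 1) * (1 + c) - 1 - a * (2 * p * d * c + b) =
  2 * (a * p * d) + a * b * c + c by ring.
by rewrite !addr_ge0 ?mulr_ge0// ltW.
Qed.

Let sq1 (xi : R) : `|xi| <= 1 + xi ^+ 2.
Proof. by have := @Xle 1 xi isT; rewrite expr1 mul1r. Qed.

Let dqle2 (s xi : R) : `|s * (p * tau * (2 * xi) + x)| <= (2 * K s) * (1 + xi ^+ 2).
Proof.
apply: (le_trans (dqle s xi)); have := K1 s; have := sq1 xi; have := sqr_ge0 xi.
nra.
Qed.

(** This identity and the three similar ones come from [gauss_ibp] applied to [cos (s q)],
    [sin (s q)], [xi cos (s q)] and [xi sin (s q)]. Together they express the first and second
    moments by [C 0] and [S 0]. *)
Let ibp0c s : - (2 * p * tau * s) * S 1 s + - (s * x) * S 0 s + - (2 * p) * C 1 s = 0.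
Proof.
rewrite -Rint_lin3; [|exact: rS|exact: rS|exact: rC].
rewrite -[RHS](@gauss_ibp p (2 * K s) (fun xi => cos (s * q xi)) _ _ p0
  (fun xi => drv_cos (dq s xi))
  (fun xi => drvM (drvN (drv_sin (dq s xi)))
    (drvZ s (drvD (drvZ (p * tau) (drvZ 2 (drv_id xi))) (drv_cst xi x))))).
- by apply: eq_Rintegral => xi _; rewrite /e; ring.
- move=> xi; rewrite (le_trans (cos1 _))//.
  by have := K1 s; have := normr_ge0 xi; nra.
- move=> xi; rewrite normrM normrN -[leRHS]mul1r.
  by apply: ler_pM => //; exact: dqle2.
Qed.

Let ibp0s s : 2 * p * tau * s * C 1 s + s * x * C 0 s + - (2 * p) * S 1 s = 0.
Proof.
rewrite -Rint_lin3; [|exact: rC|exact: rC|exact: rS].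
rewrite -[RHS](@gauss_ibp p (2 * K s) (fun xi => sin (s * q xi)) _ _ p0
  (fun xi => drv_sin (dq s xi))
  (fun xi => drvM (drv_cos (dq s xi))
    (drvZ s (drvD (drvZ (p * tau) (drvZ 2 (drv_id xi))) (drv_cst xi x))))).
- by apply: eq_Rintegral => xi _; rewrite /e; ring.
- move=> xi; rewrite (le_trans (sin1 _))//.
  by have := K1 s; have := normr_ge0 xi; nra.
- move=> xi; rewrite normrM -[leRHS]mul1r.
  by apply: ler_pM => //; exact: dqle2.
Qed.

Let h1le (s : R) (g g' : R -> R) (xi : R) : (forall u, `|g u| <= 1) ->
  (forall u, `|g' u| <= 1) ->
  `|1 * g (s * q xi) + xi * (g' (s * q xi) * (s * (p * tau * (2 * xi) + x)))| <=
   (2 * K s) * (1 + xi ^+ 2).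
Proof.
move=> g1 g'1; rewrite (le_trans (ler_normD _ _))// mul1r.
apply: (@le_trans _ _ (1 + `|xi| * (K s * (1 + `|xi|) - 1))).
  apply: lerD; first exact: g1.
  rewrite normrM ler_wpM2l// normrM -[leRHS]mul1r; apply: ler_pM => //; exact: dqle.
have := K1 s; rewrite -(real_normK (num_real xi)); have := normr_ge0 xi.
move: `|xi| (K s) => u k u0 k1.
have u2 := sqr_ge0 u; have : 0 <= (k - 1) * (u ^+ 2 - u + 2).
  by apply: mulr_ge0; [lra|have := sqr_ge0 (u - 1); nra].
lra.
Qed.

Let ibp1c s : - (2 * p * tau * s) * S 2 s + - (s * x) * S 1 s + - (2 * p) * C 2 s = - C 0 s.
Proof.
apply/eqP; rewrite -subr_eq0 opprK -Rint_lin3; [|exact: rS|exact: rS|exact: rC].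
rewrite -RintD; [|by apply: rintD; [apply: rintD|]; apply: rintZl; (exact: rS || exact: rC)|exact: rC].
apply/eqP; rewrite -[RHS](@gauss_ibp p (2 * K s) (fun xi => xi * cos (s * q xi)) _ _ p0
  (fun xi => drvM (drv_id xi) (drv_cos (dq s xi)))
  (fun xi => drvD (drvZ 1 (drv_cos (dq s xi)))
     (drvM (drv_id xi) (drvM (drvN (drv_sin (dq s xi)))
    (drvZ s (drvD (drvZ (p * tau) (drvZ 2 (drv_id xi))) (drv_cst xi x))))))).
- by apply: eq_Rintegral => xi _; rewrite /e; ring.
- move=> xi; rewrite normrM; have := cos1 (s * q xi); have := normr_ge0 (cos (s * q xi)).
  by have := K1 s; have := normr_ge0 xi; nra.
- by move=> xi; apply: (@h1le s cos (fun u => - sin u)) => // u; rewrite normrN.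
Qed.

Let ibp1s s : 2 * p * tau * s * C 2 s + s * x * C 1 s + - (2 * p) * S 2 s = - S 0 s.
Proof.
apply/eqP; rewrite -subr_eq0 opprK -Rint_lin3; [|exact: rC|exact: rC|exact: rS].
rewrite -RintD; [|by apply: rintD; [apply: rintD|]; apply: rintZl; (exact: rS || exact: rC)|exact: rS].
apply/eqP; rewrite -[RHS](@gauss_ibp p (2 * K s) (fun xi => xi * sin (s * q xi)) _ _ p0
  (fun xi => drvM (drv_id xi) (drv_sin (dq s xi)))
  (fun xi => drvD (drvZ 1 (drv_sin (dq s xi)))
     (drvM (drv_id xi) (drvM (drv_cos (dq s xi))
    (drvZ s (drvD (drvZ (p * tau) (drvZ 2 (drv_id xi))) (drv_cst xi x))))))).
- by apply: eq_Rintegral => xi _; rewrite /e; ring.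
- move=> xi; rewrite normrM; have := sin1 (s * q xi); have := normr_ge0 (sin (s * q xi)).
  by have := K1 s; have := normr_ge0 xi; nra.
- by move=> xi; apply: (@h1le s sin cos).
Qed.

(** Differentiation in the parameter brings down [q xi], which grows quadratically and is absorbed
    by the Gaussian uniformly in the parameter. The function [g] is generic in order to cover the
    cosine and the sine. *)
Let under_integral (g g' : R -> R) (s : R) : (forall u : R, is_derive u 1 g (g' u)) ->
  (forall u : R, `|g u| <= 1) -> (forall u : R, `|g' u| <= 1) ->
  is_derive s 1 (fun t : R => \int[mu]_xi (e xi * (xi ^+ 0 * g (t * q xi))))
    (\int[mu]_xi (e xi * (g' (s * q xi) * q xi))).
Proof.
move=> dg g1 g'1.
have mq : measurable_fun setT q.
  by have := @drv_measurable (fun t : R => 1 * q t) _ (fun xi => dq 1 xi); apply: eq_measurable_fun => xi _; rewrite mul1r.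
have me : measurable_fun setT e by exact: rint_measurable (rint_gauss0 p0).
have mg : measurable_fun setT g by exact: drv_measurable dg.
pose G xi := e xi * ((p * `|tau| + `|x|) * (1 + xi ^+ 2)).
have c0 : 0 <= p * `|tau| + `|x| by rewrite addr_ge0// mulr_ge0// ltW.
have qle xi : `|q xi| <= (p * `|tau| + `|x|) * (1 + xi ^+ 2).
  rewrite (le_trans (ler_normD _ _))// !normrM (gtr0_norm p0) mulrDl lerD//.
    by rewrite ler_wpM2l ?mulr_ge0 ?(ltW p0)// -normrM -expr2 ger0_norm ?sqr_ge0// lerDr.
  by rewrite ler_wpM2l.
have rG : rint mu G.
  apply: (@rint_gauss_mul p (p * `|tau| + `|x|)) => //.
    exact: (drv_measurable (fun xi : R => drvZ (p * `|tau| + `|x|) (drvD (drv_cst xi 1) (drvX 2 (drv_id xi))))).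
  by move=> xi; rewrite ger0_norm// mulr_ge0// addr_ge0 ?sqr_ge0.
have Is : `]s - 1, s + 1[%classic s by rewrite /= in_itv/=; apply/andP; split; lra.
have df (t xi : R) : is_derive t 1 (fun t => e xi * (xi ^+ 0 * g (t * q xi)))
   (e xi * (g' (t * q xi) * q xi)).
  apply: drvZ; apply: (is_derive_eq (drvZ _ (drv_comp (f := fun t => t * q xi) (dg _) (drvM (drv_id t) (drv_cst t (q xi)))))).
  by rewrite expr0 mulr0 addr0 !mul1r.
have H := @derivable_under_integral R _ _ mu (fun t xi => e xi * (xi ^+ 0 * g (t * q xi)))
  setT measurableT s _ _ Is.
have H' := @differentiation_under_integral R _ _ mu (fun t xi => e xi * (xi ^+ 0 * g (t * q xi)))
  setT measurableT s _ _ Is.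
have c1 (t : R) : `]s - 1, s + 1[%classic t -> mu.-integrable setT
    (EFin \o (fun xi => e xi * (xi ^+ 0 * g (t * q xi)))).
  move=> _; apply: (@rint_gauss_mul p 1) => //.
    by apply: measurable_funM => //; apply: measurableT_comp => //; exact: measurable_funM.
  by move=> xi; rewrite expr0 mul1r mul1r (le_trans (g1 _))// lerDl sqr_ge0.
have c2 (t xi : R) : `]s - 1, s + 1[%classic t -> setT xi ->
    derivable (fun t : R => e xi * (xi ^+ 0 * g (t * q xi))) t 1.
  by move=> _ _; have := df t xi => ?; exact: ex_derive.
have pE t xi : partial1of2 (fun t xi => e xi * (xi ^+ 0 * g (t * q xi))) t xi =
    e xi * (g' (t * q xi) * q xi).
  by rewrite partial1of2E; have := df t xi => ?; rewrite derive_val.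
have G0 xi : 0 <= G xi.
  by rewrite mulr_ge0 ?expR_ge0// mulr_ge0// addr_ge0// sqr_ge0.
have c3 (t xi : R) : `]s - 1, s + 1[%classic t -> setT xi ->
    `|partial1of2 (fun t xi => e xi * (xi ^+ 0 * g (t * q xi))) t xi| <= G xi.
  move=> _ _; rewrite pE normrM ger0_norm ?expR_ge0// ler_wpM2l ?expR_ge0//.
  rewrite normrM -[leRHS]mul1r; apply: ler_pM => //; exact: qle.
apply: DeriveDef; first exact: (H c1 c2 G G0 rG c3).
rewrite -derive1E (H' c1 c2 G G0 rG c3).
by apply: eq_Rintegral => xi _; rewrite -pE.
Qed.

Let dC (s : R) : is_derive s 1 (C 0) (- (p * tau * S 2 s + x * S 1 s)).
Proof.
apply: (is_derive_eq (under_integral s (@is_derive_cos R) cos1 _)).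
  by move=> u; rewrite normrN.
rewrite [RHS](_ : _ = - (p * tau) * S 2 s + - x * S 1 s + 0 * C 0 s); last by ring.
rewrite -Rint_lin3; [|exact: rS|exact: rS|exact: rC].
by apply: eq_Rintegral => xi _; rewrite /q; ring.
Qed.

Let dS (s : R) : is_derive s 1 (S 0) (p * tau * C 2 s + x * C 1 s).
Proof.
apply: (is_derive_eq (under_integral s (@is_derive_sin R) sin1 cos1)).
rewrite [RHS](_ : _ = p * tau * C 2 s + x * C 1 s + 0 * C 0 s); last by ring.
rewrite -Rint_lin3; [|exact: rC|exact: rC|exact: rC].
by apply: eq_Rintegral => xi _; rewrite /q; ring.
Qed.

Let d (s : R) := 1 + (s * tau) ^+ 2.
Let d0 s : 0 < d s. Proof. by rewrite ltr_pwDl// sqr_ge0. Qed.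

(** [al + i be] is the logarithmic derivative in [s] of [(1 - i s tau)^(-1/2) exp(- (s x)^2 / (4 p
    (1 - i s tau)))], split into its real and imaginary parts. *)
Let al (s : R) := - (tau * (s * tau)) / (2 * d s) +
  tau * (s * tau) * (s * x) ^+ 2 / (2 * p * d s ^+ 2) - x * (s * x) / (2 * p * d s).
Let be (s : R) := tau / (2 * d s) -
  tau * (s * x) ^+ 2 * (1 - (s * tau) ^+ 2) / (4 * p * d s ^+ 2) -
  x * (s * x) * (s * tau) / (2 * p * d s).

Let ode s : - (p * tau * S 2 s + x * S 1 s) = al s * C 0 s - be s * S 0 s /\
  p * tau * C 2 s + x * C 1 s = be s * C 0 s + al s * S 0 s.
Proof.
have := ibp0c s; have := ibp0s s; have := ibp1c s; have := ibp1s s.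
move: (S 0 s) (S 1 s) (S 2 s) (C 0 s) (C 1 s) (C 2 s) => s0 s1 s2 c0 c1 c2.
move=> H4 H3 H2 H1.
have dn := lt0r_neq0 (d0 s); have pn := lt0r_neq0 p0.
have k0 : 2 * p * d s != 0 by rewrite !mulf_neq0.
(* The identities of order 0 form a two by two system for the first moments, those of order 1 a
   system for the second moments. Both have determinant proportional to [d s] and are inverted by
   combinations with the coefficients 1 and [s * tau]. *)
have e1 : s1 = (s * x * c0 - s * tau * (s * x) * s0) / (2 * p * d s).
  apply: (mulfI k0); rewrite [RHS]mulrC divfK//; apply/eqP; rewrite -subr_eq0; apply/eqP.
  transitivity (- (2 * p * tau * s * c1 + s * x * c0 + - (2 * p) * s1) - s * tau *
    (- (2 * p * tau * s) * s1 + - (s * x) * s0 + - (2 * p) * c1)); first by rewrite /d; ring.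
  by rewrite H1 H2; ring.
have e2 : c1 = (- (s * x * s0) - s * tau * (s * x) * c0) / (2 * p * d s).
  apply: (mulfI k0); rewrite [RHS]mulrC divfK//; apply/eqP; rewrite -subr_eq0; apply/eqP.
  transitivity (s * tau * (2 * p * tau * s * c1 + s * x * c0 + - (2 * p) * s1) -
    (- (2 * p * tau * s) * s1 + - (s * x) * s0 + - (2 * p) * c1)); first by rewrite /d; ring.
  by rewrite H1 H2; ring.
have e3 : s2 = (s0 + s * x * c1 + s * tau * (c0 - s * x * s1)) / (2 * p * d s).
  apply: (mulfI k0); rewrite [RHS]mulrC divfK//; apply/eqP; rewrite -subr_eq0; apply/eqP.
  transitivity (- (2 * p * tau * s * c2 + s * x * c1 + - (2 * p) * s2 + s0) - s * tau *
    (- (2 * p * tau * s) * s2 + - (s * x) * s1 + - (2 * p) * c2 + c0)); first by rewrite /d; ring.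
  by rewrite H3 H4; ring.
have e4 : c2 = (c0 - s * x * s1 - s * tau * (s0 + s * x * c1)) / (2 * p * d s).
  apply: (mulfI k0); rewrite [RHS]mulrC divfK//; apply/eqP; rewrite -subr_eq0; apply/eqP.
  transitivity (s * tau * (2 * p * tau * s * c2 + s * x * c1 + - (2 * p) * s2 + s0) -
    (- (2 * p * tau * s) * s2 + - (s * x) * s1 + - (2 * p) * c2 + c0)); first by rewrite /d; ring.
  by rewrite H3 H4; ring.
rewrite e3 e4 e1 e2 /al /be; move: dn; rewrite /d => dn.
by split; field; rewrite dn pn.
Qed.

Let dd (s : R) : is_derive s 1 d (2 * (s * tau) * tau).
Proof.
apply: (is_derive_eq (drvD (drv_cst s 1) (drvX 2 (drvM (drv_id s) (drv_cst s tau))))).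
by rewrite /= expr1; ring.
Qed.

Let dyy (s : R) : is_derive s 1 (fun s : R => (s * x) ^+ 2) (2 * (s * x) * x).
Proof.
apply: (is_derive_eq (drvX 2 (drvM (drv_id s) (drv_cst s x)))).
by rewrite /= expr1; ring.
Qed.

Let p4d s : 4 * p * d s != 0.
Proof. by rewrite !mulf_neq0// ?(lt0r_neq0 p0) ?(lt0r_neq0 (d0 s)). Qed.

(** The reciprocal of the modulus and, in [th], the argument of the expected solution. The functions
    in [dU] and [dV] are the real and imaginary parts of [B exp(- i th) (C 0 + i S 0)], which is
    therefore constant. *)
Let B (s : R) := d s `^ 4^-1 * expR ((s * x) ^+ 2 / (4 * p * d s)).
Let th (s : R) := 2^-1 * atan (s * tau) - (s * x) ^+ 2 * (s * tau) / (4 * p * d s).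

Let dB (s : R) : is_derive s 1 B (- (al s * B s)).
Proof.
apply: (is_derive_eq (drvM (drv_powR 4^-1 (dd s) (d0 s))
  (drv_exp (drvM (dyy s) (drvV (drvZ (4 * p) (dd s)) (p4d s)))))).
rewrite /B powRB ?(lt0r_neq0 (d0 s)) ?implybT// powRr1 ?(ltW (d0 s))//.
move: (_ `^ _) (expR _) => u v; rewrite /al.
have dn := lt0r_neq0 (d0 s); have pn := lt0r_neq0 p0.
by field; rewrite dn pn.
Qed.

Let dth (s : R) : is_derive s 1 th (be s).
Proof.
apply: (is_derive_eq (drvB (drvZ 2^-1 (drv_atan (drvM (drv_id s) (drv_cst s tau))))
  (drvM (drvM (dyy s) (drvM (drv_id s) (drv_cst s tau)))
    (drvV (drvZ (4 * p) (dd s)) (p4d s))))).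
have := lt0r_neq0 (d0 s); have pn := lt0r_neq0 p0; rewrite /be /d => dn.
by field; rewrite dn pn.
Qed.

Let dU (s : R) : is_derive s 1 (fun s : R => B s * (C 0 s * cos (th s) + S 0 s * sin (th s))) 0.
Proof.
have [oc os] := ode s.
apply: (is_derive_eq (drvM (dB s) (drvD
  (drvM (is_derive_eq (dC s) oc) (drv_cos (dth s)))
  (drvM (is_derive_eq (dS s) os) (drv_sin (dth s)))))).
by ring.
Qed.

Let dV (s : R) : is_derive s 1 (fun s : R => B s * (S 0 s * cos (th s) - C 0 s * sin (th s))) 0.
Proof.
have [oc os] := ode s.
apply: (is_derive_eq (drvM (dB s) (drvB
  (drvM (is_derive_eq (dS s) os) (drv_cos (dth s)))
  (drvM (is_derive_eq (dC s) oc) (drv_sin (dth s)))))).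
by ring.
Qed.

Let cst01 (U : R -> R) : (forall s : R, is_derive s 1 U 0) -> U 1 = U 0.
Proof.
move=> h; have [c _ E] := drv_mvt ler01 (fun s _ => h s).
by apply/eqP; rewrite -subr_eq0 E mul0r.
Qed.

Let C00 : C 0 0 = Num.sqrt (pi / p).
Proof.
rewrite /C /Rintegral (_ : (fun _ => _) = (fun xi => (expR (- (p * (xi - 0) ^+ 2)))%:E)).
  by rewrite integral_gauss.
by apply/funext => xi; rewrite expr0 mul0r cos0 !mulr1 subr0.
Qed.

Let S00 : S 0 0 = 0.
Proof.
rewrite /S /Rintegral (_ : (fun _ => _) = (fun=> 0%E)) ?integral0//.
by apply/funext => xi; rewrite mul0r sin0 !mulr0.
Qed.

Let B0 : B 0 = 1.
Proof. by rewrite /B /d !mul0r !expr0n /= addr0 powR1 mul0r expR0 mulr1. Qed.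

Let th0 : th 0 = 0.
Proof. by rewrite /th !mul0r atan0 expr0n /= !mul0r mulr0 subrr. Qed.

(** The free phase [psi] receives the contribution of the other coordinates when the dimension is
    raised by one. *)
Lemma gauss_phase1 psi :
  rint mu (fun xi => expR (- (p * xi ^+ 2)) * cos (p * tau * xi ^+ 2 + x * xi + psi)) /\
  \int[mu]_xi (expR (- (p * xi ^+ 2)) * cos (p * tau * xi ^+ 2 + x * xi + psi)) =
  Num.sqrt (pi / p) *
    (gamp 2^-1 (x ^+ 2 / p) tau * cos (gphase 2^-1 (x ^+ 2 / p) tau + psi)).
Proof.
have U1 := cst01 dU; have V1 := cst01 dV.
rewrite /= B0 th0 C00 S00 cos0 sin0 !mul0r !mulr0 !mulr1 mul1r subr0 ?addr0 in U1 V1; rewrite mulr0 in V1.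
have dn : 1 + tau ^+ 2 != 0 by have := d0 1; rewrite /d mul1r => /lt0r_neq0.
have pn := lt0r_neq0 p0.
have Bg : 0 < B 1 by rewrite mulr_gt0 ?powR_gt0 ?expR_gt0.
have BE : (B 1)^-1 = gamp 2^-1 (x ^+ 2 / p) tau.
  rewrite /B /gamp /d !mul1r invfM -powRN -expRN.
  rewrite (_ : 4^-1 = 2^-1 / 2 :> R); last by field.
  by congr (_ * expR (- _)); field; rewrite dn pn.
have thE : th 1 = gphase 2^-1 (x ^+ 2 / p) tau.
  rewrite /th /gphase /d !mul1r; congr (_ - _).
  by field; rewrite dn pn.
rewrite -BE -thE.
have CE : C 0 1 = Num.sqrt (pi / p) * ((B 1)^-1 * cos (th 1)).
  rewrite -U1; have := cos2Dsin2 (th 1) => cs; have /eqP := V1; rewrite mulf_eq0 gt_eqF//= => /eqP h.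
  transitivity (C 0 1 * (cos (th 1) ^+ 2 + sin (th 1) ^+ 2) +
    sin (th 1) * (S 0 1 * cos (th 1) - C 0 1 * sin (th 1))).
    by rewrite cs h; ring.
  by field; rewrite gt_eqF.
have SE : S 0 1 = Num.sqrt (pi / p) * ((B 1)^-1 * sin (th 1)).
  rewrite -U1; have := cos2Dsin2 (th 1) => cs; have /eqP := V1; rewrite mulf_eq0 gt_eqF//= => /eqP h.
  transitivity (S 0 1 * (cos (th 1) ^+ 2 + sin (th 1) ^+ 2) -
    cos (th 1) * (S 0 1 * cos (th 1) - C 0 1 * sin (th 1))).
    by rewrite cs h; ring.
  by field; rewrite gt_eqF.
pose f xi := cos psi * (e xi * (xi ^+ 0 * cos (1 * q xi))) -
  sin psi * (e xi * (xi ^+ 0 * sin (1 * q xi))).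
have -> : (fun xi => expR (- (p * xi ^+ 2)) * cos (p * tau * xi ^+ 2 + x * xi + psi)) = f.
  by apply/funext => xi; rewrite cosD /f /e /q expr0 !mul1r; ring.
split; first by apply: rintB; apply: rintZl; [exact: rC|exact: rS].
transitivity (cos psi * C 0 1 + - sin psi * S 0 1 + 0 * C 0 1); last by rewrite CE SE cosD; ring.
rewrite -Rint_lin3; [|exact: rC|exact: rS|exact: rC].
by apply: eq_Rintegral => xi _; rewrite /f; ring.
Qed.

End phase.
End GaussianIntegral1.

(** * Gaussians in n dimensions *)

Section RnGeometry.
Context {R : realType}.
Local Notation mu := (@lebesgue_measure R).
Local Notation L := (@lebesgueRn R).

Definition vsub n (x y : Rn R n) : Rn R n := [tuple tnth x i - tnth y i | i < n].

Lemma dotC n (x y : Rn R n) : dot x y = dot y x.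
Proof. by apply: eq_bigr => i _; rewrite mulrC. Qed.

Lemma dot_vsub n (x y z : Rn R n) : dot (vsub x y) z = dot x z - dot y z.
Proof.
rewrite /dot -sumrB; apply: eq_bigr => i _; rewrite tnth_mktuple.
exact: mulrBl.
Qed.

Lemma dot_ge0 n (x : Rn R n) : 0 <= dot x x.
Proof. by apply: sumr_ge0 => i _; exact: sqr_ge0. Qed.

Lemma dot_cons n (a b : R) (x y : Rn R n) :
  dot (cons_point (a, x)) (cons_point (b, y)) = a * b + dot x y.
Proof.
rewrite /dot big_ord_recl /= !tnth0; congr (_ + _).
by apply: eq_bigr => i _; rewrite !tnthS.
Qed.

Lemma vsub_cons n (a b : R) (x y : Rn R n) :
  vsub (cons_point (a, x)) (cons_point (b, y)) = cons_point (a - b, vsub x y).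
Proof.
apply: eq_from_tnth => i; rewrite tnth_mktuple.
have [j ->|->] := unliftP ord0 i; first by rewrite !tnthS tnth_mktuple.
by rewrite !tnth0.
Qed.

Lemma vsub0 n (x : Rn R n) : vsub x [tuple 0 | i < n] = x.
Proof. by apply: eq_from_tnth => i; rewrite !tnth_mktuple; exact: subr0. Qed.

Lemma dot0n (x y : Rn R 0) : dot x y = 0.
Proof. by rewrite /dot big_ord0. Qed.

Section measurability.
Context d (X : measurableType d) (n : nat).
Implicit Types f g : X -> Rn R n.

Lemma measurable_coord f i : measurable_fun setT f ->
  measurable_fun setT (fun x => tnth (f x) i : measurableTypeR R).
Proof. by move=> mf; exact: (measurableT_comp (measurable_tnth i) mf). Qed.

Lemma measurable_dot f g : measurable_fun setT f -> measurable_fun setT g ->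
  measurable_fun setT (fun x => dot (f x) (g x)).
Proof.
move=> mf mg; apply: measurable_sum => i.
by apply: measurable_funM; exact: measurable_coord.
Qed.

Lemma measurable_vsub f g : measurable_fun setT f -> measurable_fun setT g ->
  measurable_fun setT (fun x => vsub (f x) (g x)).
Proof.
move=> mf mg; apply/measurable_fun_tnthP => i /=.
rewrite (_ : _ \o _ = fun x => tnth (f x) i - tnth (g x) i).
  by apply: measurable_funB; exact: measurable_coord.
by apply/funext => x /=; rewrite tnth_mktuple.
Qed.

End measurability.

Lemma integral_lebesgueRn0 (f : Rn R 0 -> \bar R) :
  (\int[L 0]_x f x = f [tuple])%E.
Proof.
have mf : measurable_fun setT f.
  move=> _ Y mY; rewrite setTI.
  have [h|h] := pselect (Y (f [tuple])).
    rewrite (_ : _ @^-1` _ = setT); first exact: measurableT.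
    by apply/seteqP; split => // x _ /=; rewrite (tuple0 x).
  rewrite (_ : _ @^-1` _ = set0); first exact: measurable0.
  by apply/seteqP; split => // x /=; rewrite (tuple0 x).
by rewrite [LHS]integral_dirac// diracT mul1e.
Qed.

Lemma integral_gaussRn n p (m : Rn R n) : 0 < p ->
  (\int[L n]_x (expR (- (p * dot (vsub x m) (vsub x m))))%:E =
   (Num.sqrt (pi / p) ^+ n)%:E)%E.
Proof.
move=> p0; elim: n m => [|n ih] m.
  by rewrite integral_lebesgueRn0 dot0n mulr0 oppr0 expR0.
have mg k (y : Rn R k) : measurable_fun setT
    (fun x : Rn R k => expR (- (p * dot (vsub x y) (vsub x y)))).
  apply: measurableT_comp => //; apply: measurableT_comp => //.
  apply: measurable_funM => //; apply: measurable_dot; exact: measurable_vsub.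
rewrite ge0_integral_lebesgueRnS; last 2 first.
- by apply/measurable_EFinP; exact: mg.
- by move=> x; rewrite lee_fin expR_ge0.
have [[b y] ->] := cons_point_inj m.
transitivity (\int[mu]_a (Num.sqrt (pi / p) ^+ n *
    expR (- (p * (a - b) ^+ 2)))%:E)%E.
  apply: eq_integral => a _; rewrite EFinM -(ih y) muleC -ge0_intZl ?expR_ge0//.
  apply: eq_integral => x _.
  by rewrite vsub_cons dot_cons mulrDr opprD expRD -expr2.
  exact: mg.
rewrite ge0_intZl ?exprn_ge0 ?sqrtr_ge0//; last exact: rint_measurable (rint_gauss b p0).
by rewrite integral_gauss// -EFinM exprSr.
Qed.

Lemma rint_gaussRn n p : 0 < p -> rint (L n) (fun x => expR (- (p * dot x x))).
Proof.
move=> p0; apply: ge0_rint; last 2 first.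
- by move=> x; exact: expR_ge0.
- rewrite (eq_integral (fun x => (expR (- (p * dot (vsub x [tuple 0 | i < n])
      (vsub x [tuple 0 | i < n]))))%:E)); first by rewrite integral_gaussRn// ltry.
  by move=> x _; rewrite vsub0.
apply: measurableT_comp => //; apply: measurableT_comp => //.
by apply: measurable_funM => //; exact: measurable_dot.
Qed.

(** The dimension enters through [k] and the squared length through [X], both additive over
    coordinates: this is the induction step from one coordinate to [n]. *)
Lemma gampD k l X Y tau : gamp (k + l) (X + Y) tau = gamp k X tau * gamp l Y tau :> R.
Proof.
have h : 0 < 1 + tau ^+ 2 by rewrite ltr_pwDl// sqr_ge0.
rewrite /gamp mulrACA -expRD -powRD ?(gt_eqF h) ?implybT//.
by congr (_ `^ _ * expR _); [field|rewrite mulrDl opprD].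
Qed.

Lemma gphaseD k l X Y tau : gphase (k + l) (X + Y) tau = gphase k X tau + gphase l Y tau :> R.
Proof. by rewrite /gphase; ring. Qed.

Lemma gauss_phase n p tau psi (z : Rn R n) : 0 < p ->
  \int[L n]_xi (expR (- (p * dot xi xi)) * cos (p * tau * dot xi xi + dot z xi + psi)) =
  Num.sqrt (pi / p) ^+ n * (gamp (n%:R / 2) (dot z z / p) tau *
     cos (gphase (n%:R / 2) (dot z z / p) tau + psi)).
Proof.
move=> p0; elim: n z psi => [|n ih] z psi.
  rewrite /Rintegral integral_lebesgueRn0 !dot0n /gamp /gphase /=.
  by rewrite !(mulr0, mul0r, oppr0, expR0, powRr0, subr0, mul1r, add0r, mulr1).
pose f k (z : Rn R k) psi (xi : Rn R k) :=
  expR (- (p * dot xi xi)) * cos (p * tau * dot xi xi + dot z xi + psi).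
have mf k (w : Rn R k) phi : measurable_fun setT (f k w phi).
  have md : measurable_fun setT (fun x : Rn R k => dot x x) by exact: measurable_dot.
  apply: measurable_funM.
    apply: measurableT_comp => //; apply: measurableT_comp => //.
    exact: measurable_funM.
  apply: (@measurableT_comp _ _ _ _ _ _ cos).
    exact: (drv_measurable (@is_derive_cos R)).
  apply: measurable_funD => //; apply: measurable_funD; first exact: measurable_funM.
  exact: measurable_dot.
have [[b y] zE] := cons_point_inj z.
have fE a x : f n.+1 z psi (cons_point (a, x)) =
    expR (- (p * a ^+ 2)) * f n y (p * tau * a ^+ 2 + b * a + psi) x.
  rewrite /f zE !dot_cons mulrA -expRD.
  by congr (expR _ * cos _); ring.
have fle k (w : Rn R k) phi xi : `|f k w phi xi| <= expR (- (p * dot xi xi)).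
  rewrite normrM ger0_norm ?expR_ge0// -[leRHS]mulr1 ler_wpM2l ?expR_ge0//.
  by rewrite ler_norml cos_geN1 cos_le1.
have rf k (w : Rn R k) phi : rint (L k) (f k w phi).
  exact: rint_le (mf _ _ _) (fle _ _ _) (rint_gaussRn k p0).
have [|_ ->] := @rint_lebesgueRnS R n (f n.+1 z psi) (fun a => expR (- (p * a ^+ 2)))
    _ (mf _ _ _) (rint_gauss0 p0) (rint_gaussRn n p0).
  by move=> a x; rewrite fE normrM ger0_norm ?expR_ge0// ler_wpM2l ?expR_ge0.
pose c := Num.sqrt (pi / p) ^+ n * gamp (n%:R / 2) (dot y y / p) tau.
pose psi' := gphase (n%:R / 2) (dot y y / p) tau + psi.
have [r1 E1] := gauss_phase1 tau b p0 psi'.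
transitivity (\int[mu]_a (c * (expR (- (p * a ^+ 2)) *
    cos (p * tau * a ^+ 2 + b * a + psi')))).
  apply: eq_Rintegral => a _.
  transitivity (\int[L n]_x (expR (- (p * a ^+ 2)) *
      f n y (p * tau * a ^+ 2 + b * a + psi) x)).
    by apply: eq_Rintegral => x _; exact: fE.
  rewrite RintZl// ih /c.
  rewrite (_ : gphase _ _ _ + _ = p * tau * a ^+ 2 + b * a + psi'); first by ring.
  by rewrite /psi'; ring.
rewrite RintZl// E1 zE dot_cons -expr2 (mulrDl (b ^+ 2)) (addrC (b ^+ 2 / p)).
rewrite (_ : n.+1%:R / 2 = n%:R / 2 + 2^-1 :> R); last by rewrite -natr1; field.
rewrite gampD gphaseD (exprSr (Num.sqrt _)) /c /psi' addrA (addrC (gphase 2^-1 _ _)).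
by move: (Num.sqrt _) (cos _) (gamp _ _ _) (gamp _ _ _) => q C u v; ring.
Qed.

Lemma measurable_cos_comp d (X : measurableType d) (f : X -> R) :
  measurable_fun setT f -> measurable_fun setT (fun x => cos (f x)).
Proof.
by apply: measurableT_comp; exact: (drv_measurable (@is_derive_cos R)).
Qed.

Lemma measurable_sin_comp d (X : measurableType d) (f : X -> R) :
  measurable_fun setT f -> measurable_fun setT (fun x => sin (f x)).
Proof.
by apply: measurableT_comp; exact: (drv_measurable (@is_derive_sin R)).
Qed.

Lemma normr_cos_le1 (x : R) : `|cos x| <= 1.
Proof. by rewrite ler_norml cos_geN1 cos_le1. Qed.

Lemma normr_sin_le1 (x : R) : `|sin x| <= 1.
Proof. by rewrite ler_norml sin_geN1 sin_le1. Qed.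

End RnGeometry.

(** * Schur's test and Bessel's inequality *)

Section ProductIntegral.
Context d1 d2 (X : measurableType d1) (Y : measurableType d2) (R : realType).
Variables (m1 : {sigma_finite_measure set X -> \bar R})
          (m2 : {sigma_finite_measure set Y -> \bar R}).

Lemma rint_tensor (f : X -> R) (g : Y -> R) : rint m1 f -> rint m2 g ->
  rint (m1 \x m2)%E (fun z => f z.1 * g z.2) /\
  \int[(m1 \x m2)%E]_z (f z.1 * g z.2) = \int[m1]_x f x * \int[m2]_y g y.
Proof.
move=> rf rg.
have mfg : measurable_fun setT (fun z : X * Y => f z.1 * g z.2).
  by apply: measurable_funM;
    [apply: (measurableT_comp (rint_measurable rf)); exact: measurable_fst
    |apply: (measurableT_comp (rint_measurable rg)); exact: measurable_snd].
have le x y : `|f (x, y).1 * g (x, y).2| <= `|f x| * `|g y| by rewrite normrM.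
have ra := rint_norm rf; have rb := rint_norm rg.
split; first exact: rint_prod mfg le ra rb.
rewrite -(Rint_prodl mfg le ra rb) /=.
under eq_Rintegral do rewrite RintZl//.
by rewrite -RintegralZr.
Qed.

End ProductIntegral.

(* Schur's test, written for the quadratic form of the kernel [G] on
   [L^2(om)]. *)
Lemma schur_test d (X : measurableType d) (R : realType)
    (mu : {sigma_finite_measure set X -> \bar R})
    (G : X * X -> R) (om e : X -> R) (Gam : R) :
  measurable_fun setT G -> measurable_fun setT om -> measurable_fun setT e ->
  (forall z, 0 <= G z) -> (forall x, 0 <= om x) -> 0 <= Gam ->
  (forall x, \int[mu]_y (G (x, y) * om y)%:E <= Gam%:E)%E ->
  (forall y, \int[mu]_x (G (x, y) * om x)%:E <= Gam%:E)%E ->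
  (\int[(mu \x mu)%E]_z (G z * (om z.1 * `|e z.1|) * (om z.2 * `|e z.2|))%:E <=
   Gam%:E * \int[mu]_x (om x * e x ^+ 2)%:E)%E.
Proof.
move=> mG mom me G0 om0 Gam0 hy hx.
have m1 (g : X -> R) : measurable_fun setT g -> measurable_fun setT (fun z : X * X => g z.1).
  by move=> mg; apply: (measurableT_comp mg); exact: measurable_fst.
have m2 (g : X -> R) : measurable_fun setT g -> measurable_fun setT (fun z : X * X => g z.2).
  by move=> mg; apply: (measurableT_comp mg); exact: measurable_snd.
have me2 : measurable_fun setT (fun x => om x * e x ^+ 2).
  by apply: measurable_funM => //; exact: measurable_funX.
pose F1 (z : X * X) := 2^-1 * (om z.1 * e z.1 ^+ 2 * (G z * om z.2)).
pose F2 (z : X * X) := 2^-1 * (om z.2 * e z.2 ^+ 2 * (G z * om z.1)).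
have mF1 : measurable_fun setT F1.
  apply: measurable_funM => //; apply: measurable_funM; first exact: (m1 (fun x => om x * e x ^+ 2)).
  by apply: measurable_funM => //; exact: m2.
have mF2 : measurable_fun setT F2.
  apply: measurable_funM => //; apply: measurable_funM; first exact: (m2 (fun x => om x * e x ^+ 2)).
  by apply: measurable_funM => //; exact: m1.
have e20 x : 0 <= om x * e x ^+ 2 by rewrite mulr_ge0// sqr_ge0.
have F10 z : 0 <= F1 z.
  by apply: mulr_ge0 => //; apply: mulr_ge0; [exact: e20|exact: mulr_ge0].
have F20 z : 0 <= F2 z.
  by apply: mulr_ge0 => //; apply: mulr_ge0; [exact: e20|exact: mulr_ge0].
apply: (@le_trans _ _ (\int[(mu \x mu)%E]_z ((F1 z)%:E + (F2 z)%:E))%E).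
  apply: ge0_le_integral => //.
  - by move=> z _; rewrite lee_fin !mulr_ge0.
  - apply/measurable_EFinP; apply: measurable_funM.
      apply: measurable_funM => //; apply: (m1 (fun x => om x * `|e x|)).
      by apply: measurable_funM => //; exact: measurableT_comp.
    apply: (m2 (fun x => om x * `|e x|)).
    by apply: measurable_funM => //; exact: measurableT_comp.
  - by apply: emeasurable_funD; apply/measurable_EFinP.
  - move=> z _; rewrite -EFinD lee_fin /F1 /F2.
    have c0 : 0 <= G z * om z.1 * om z.2 by rewrite !mulr_ge0.
    rewrite -(real_normK (num_real (e z.1))) -(real_normK (num_real (e z.2))).
    move: (`|e z.1|) (`|e z.2|) => u v.
    have := mulr_ge0 c0 (sqr_ge0 (u - v)).
    move: (G z) (om z.1) (om z.2) => g a b; lra.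
rewrite ge0_integralD//; last 4 first.
- by move=> z _; rewrite lee_fin.
- exact/measurable_EFinP.
- by move=> z _; rewrite lee_fin.
- exact/measurable_EFinP.
have half (H : X -> \bar R) : (forall x, 0 <= H x)%E -> measurable_fun setT H ->
    (forall x, H x <= (2^-1 * (om x * e x ^+ 2))%:E * Gam%:E)%E ->
    (\int[mu]_x H x <= (2^-1)%:E * (Gam%:E * \int[mu]_x (om x * e x ^+ 2)%:E))%E.
  move=> H0 mH HG; rewrite muleA -EFinM -ge0_intZl ?mulr_ge0//.
  apply: ge0_le_integral => //.
  - by apply/measurable_EFinP; exact: measurable_funM.
  - move=> x _; apply: le_trans (HG x) _; rewrite -!EFinM lee_fin.
    by rewrite le_eqVlt; apply/orP; left; apply/eqP; ring.
have E : (Gam%:E * \int[mu]_x (om x * e x ^+ 2)%:E =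
  (2^-1)%:E * (Gam%:E * \int[mu]_x (om x * e x ^+ 2)%:E) +
  (2^-1)%:E * (Gam%:E * \int[mu]_x (om x * e x ^+ 2)%:E))%E.
  rewrite -ge0_muleDl ?lee_fin ?invr_ge0// -EFinD (_ : 2^-1 + 2^-1 = 1 :> R) ?mul1e//.
  by field.
have mGr x : measurable_fun setT (fun y => G (x, y)).
  exact: (measurableT_comp mG (pair1_measurable x)).
have mGl y : measurable_fun setT (fun x => G (x, y)).
  exact: (measurableT_comp mG (pair2_measurable y)).
rewrite E; apply: leeD.
  rewrite tonelli_prod1//; apply: half.
  - by move=> x; apply: integral_ge0 => y _; rewrite lee_fin.
  - exact: measurable_tonelli1.
  - move=> x; have c0 : 0 <= 2^-1 * (om x * e x ^+ 2) by rewrite mulr_ge0.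
    apply: le_trans (_ : _ <= (2^-1 * (om x * e x ^+ 2))%:E *
      \int[mu]_y (G (x, y) * om y)%:E)%E _; last by rewrite lee_wpmul2l ?lee_fin.
    rewrite -ge0_intZl//; last 2 first.
    - exact: measurable_funM.
    - by move=> y; rewrite mulr_ge0.
    by rewrite /F1 /=; under [leRHS]eq_integral do rewrite -mulrA.
rewrite tonelli_prod2//; apply: half.
- by move=> x; apply: integral_ge0 => y _; rewrite lee_fin.
- exact: measurable_tonelli2.
- move=> y; have c0 : 0 <= 2^-1 * (om y * e y ^+ 2) by rewrite mulr_ge0.
  apply: le_trans (_ : _ <= (2^-1 * (om y * e y ^+ 2))%:E *
    \int[mu]_x (G (x, y) * om x)%:E)%E _; last by rewrite lee_wpmul2l ?lee_fin.
  rewrite -ge0_intZl//; last 2 first.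
  - exact: measurable_funM.
  - by move=> x; rewrite mulr_ge0.
  by rewrite /F2 /=; under [leRHS]eq_integral do rewrite -mulrA.
Qed.

Section Bessel.
Context {R : realType} (n : nat).
Local Notation L := (lebesgueRn n).
Implicit Types (h phi : Rn R n -> R).

Definition cosT h (xi : Rn R n) : R := \int[L]_x (h x * cos (dot x xi)).
Definition sinT h (xi : Rn R n) : R := \int[L]_x (h x * sin (dot x xi)).
(** The squared modulus of the Fourier transform of [h]. *)
Definition energyT h xi : R := cosT h xi ^+ 2 + sinT h xi ^+ 2.

Lemma energyT_ge0 h xi : 0 <= energyT h xi.
Proof. by rewrite addr_ge0// sqr_ge0. Qed.

Lemma rint_cosT h xi : rint L h -> rint L (fun x => h x * cos (dot x xi)).
Proof.
move=> rh; apply: eq_rint (rint_mulb (M := 1) _ _ rh) => [x||x].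
- exact: mulrC.
- by apply: measurable_cos_comp; exact: measurable_dot.
- exact: normr_cos_le1.
Qed.

Lemma rint_sinT h xi : rint L h -> rint L (fun x => h x * sin (dot x xi)).
Proof.
move=> rh; apply: eq_rint (rint_mulb (M := 1) _ _ rh) => [x||x].
- exact: mulrC.
- by apply: measurable_sin_comp; exact: measurable_dot.
- exact: normr_sin_le1.
Qed.

(** Expanding the square gives [h x * h y * cos (dot (x - y) xi)]. A multiplier [phi] on the
    frequency side thus becomes a convolution kernel, the cosine transform of [phi], to which
    Schur's test applies. *)
Lemma energyT_form h phi : rint L h -> rint L phi ->
  [/\ rint L (fun xi => phi xi * energyT h xi),
    rint (L \x L)%E (fun z => h z.1 * h z.2 * \int[L]_xi (phi xi * cos (dot (vsub z.1 z.2) xi))) &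
    \int[L]_xi (phi xi * energyT h xi) =
    \int[(L \x L)%E]_z (h z.1 * h z.2 * \int[L]_xi (phi xi * cos (dot (vsub z.1 z.2) xi)))].
Proof.
move=> rh rphi.
pose F (zx : (Rn R n * Rn R n) * Rn R n) : R :=
  h zx.1.1 * h zx.1.2 * (phi zx.2 * cos (dot (vsub zx.1.1 zx.1.2) zx.2)).
have [rhh hhE] := rint_tensor rh rh.
have mF : measurable_fun setT F.
  apply: measurable_funM.
    exact: (measurableT_comp (rint_measurable rhh) measurable_fst).
  apply: measurable_funM.
    exact: (measurableT_comp (rint_measurable rphi) measurable_snd).
  apply: measurable_cos_comp; apply: measurable_dot; last exact: measurable_snd.
  by apply: measurable_vsub; apply: (measurableT_comp _ measurable_fst).
have Fle z xi : `|F (z, xi)| <= `|h z.1 * h z.2| * `|phi xi|.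
  rewrite normrM ler_wpM2l// normrM -[leRHS]mulr1 ler_wpM2l//.
  exact: normr_cos_le1.
have r1 := rint_norm rhh; have r2 := rint_norm rphi.
have inner z : \int[L]_xi F (z, xi) =
    h z.1 * h z.2 * \int[L]_xi (phi xi * cos (dot (vsub z.1 z.2) xi)).
  rewrite -RintZl//; apply: eq_rint (rint_mulb (M := 1) _ _ rphi) => [x||x].
  - exact: mulrC.
  - by apply: measurable_cos_comp; exact: measurable_dot.
  - exact: normr_cos_le1.
have outer xi : \int[(L \x L)%E]_z F (z, xi) = phi xi * energyT h xi.
  have [rc cE] := rint_tensor (rint_cosT xi rh) (rint_cosT xi rh).
  have [rs sE] := rint_tensor (rint_sinT xi rh) (rint_sinT xi rh).
  rewrite /energyT !expr2 -cE -sE -RintD// -RintZl; last exact: rintD.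
  apply: eq_Rintegral => z _; rewrite /F /= dot_vsub cosB; ring.
split.
- by apply: (eq_rint outer);
    exact: (@rint_fubinir _ _ _ _ R (prodm L L) L F _ _ mF Fle r1 r2).
- by apply: (eq_rint inner);
    exact: (@rint_fubinil _ _ _ _ R (prodm L L) L F _ _ mF Fle r1 r2).
- transitivity (\int[L]_xi \int[prodm L L]_z F (z, xi)).
    by apply: eq_Rintegral => xi _; rewrite -outer.
  rewrite -(@Rint_swap _ _ _ _ R (prodm L L) L F _ _ mF Fle r1 r2).
  by apply: eq_Rintegral => z _; exact: inner.
Qed.

(** The product with a Gaussian is integrable by [energyT_form], hence measurable; the Gaussian is
    then divided out. *)
Lemma measurable_energyT h : rint L h -> measurable_fun setT (energyT h).
Proof.
move=> rh; have [r _ _] := energyT_form rh (rint_gaussRn n (@ltr01 R)).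
have := measurable_funM (_ : measurable_fun setT (fun xi : Rn R n => expR (1 * dot xi xi)))
   (rint_measurable r).
rewrite (_ : _ \* _ = energyT h)//; last first.
  by apply/funext => xi /=; rewrite mulrA -expRD subrr expR0 mul1r.
apply; apply: measurableT_comp => //; apply: measurable_funM => //.
exact: measurable_dot.
Qed.

Lemma gamp0 k X : gamp k X 0 = expR (- (X / 4)) :> R.
Proof. by rewrite /gamp expr0n /= addr0 powR1 mul1r mulr1. Qed.

Lemma gphase0 k X : gphase k X 0 = 0 :> R.
Proof. by rewrite /gphase atan0 !mulr0 mul0r subrr. Qed.

Lemma cvg_expR_harmonic (c : R) :
  expR (- (k.+1%:R^-1 * c)) @[k --> \oo] --> (1 : R).
Proof.
have H : - (k.+1%:R^-1 * c) @[k --> \oo] --> (0 : R).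
  rewrite -oppr0; apply: cvgN; rewrite -(mul0r c); apply: cvgM; last exact: cvg_cst.
  exact: cvg_harmonic.
by have := cvg_comp _ _ H (@continuous_expR R 0); rewrite expR0.
Qed.

(** With the factor [exp(- p |xi|^2)] the kernel is a Gaussian whose mass [(2 pi)^n] does not depend
    on [p]. Schur's test with the weight 1 gives the bound, and [p] tends to 0. *)
Lemma bessel h : rint L h -> rint L (fun x => h x ^+ 2) ->
  (\int[L]_xi (energyT h xi)%:E <= ((2 * pi) ^+ n * \int[L]_x (h x ^+ 2))%:E)%E.
Proof.
move=> rh rh2.
have mh := rint_measurable rh.
have bound p : 0 < p -> (\int[L]_xi (expR (- (p * dot xi xi)) * energyT h xi)%:E <=
    ((2 * pi) ^+ n * \int[L]_x (h x ^+ 2))%:E)%E.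
  move=> p0; have [r1 r2 E] := energyT_form rh (rint_gaussRn n p0).
  rewrite -RintE// E.
  pose G (z : Rn R n * Rn R n) : R := Num.sqrt (pi / p) ^+ n *
     expR (- ((4 * p)^-1 * dot (vsub z.1 z.2) (vsub z.1 z.2))).
  have KE z : \int[L]_xi (expR (- (p * dot xi xi)) * cos (dot (vsub z.1 z.2) xi)) = G z.
    have := gauss_phase 0 0 (vsub z.1 z.2) p0.
    under eq_Rintegral do rewrite mulr0 mul0r add0r addr0.
    move=> ->; rewrite gamp0 gphase0 addr0 cos0 mulr1 /G; congr (_ * expR (- _)).
    by field; rewrite gt_eqF.
  have mG : measurable_fun setT G.
    apply: measurable_funM => //; apply: measurableT_comp => //.
    apply: measurableT_comp => //; apply: measurable_funM => //.
    by apply: measurable_dot; exact: measurable_vsub.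
  have G0 z : 0 <= G z by rewrite mulr_ge0 ?expR_ge0// exprn_ge0 ?sqrtr_ge0.
  have q0 : 0 < (4 * p)^-1 by rewrite invr_gt0 mulr_gt0.
  have mass : Num.sqrt (pi / p) ^+ n * Num.sqrt (pi / (4 * p)^-1) ^+ n = (2 * pi) ^+ n :> R.
    rewrite -exprMn -sqrtrM ?divr_ge0 ?pi_ge0 ?(ltW p0)//; congr (_ ^+ n).
    have E4 (q : R) : q / p * (q / (4 * p)^-1) = (2 * q) ^+ 2.
      by field; rewrite gt_eqF.
    rewrite E4.
    by rewrite sqrtr_sqr ger0_norm// mulr_ge0// pi_ge0.
  have Gy x : (\int[L]_y (G (y, x) * 1)%:E = ((2 * pi) ^+ n)%:E)%E.
    rewrite -mass EFinM -(integral_gaussRn x q0) -ge0_intZl.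
    - by apply: eq_integral => y _; rewrite mulr1.
    - by rewrite exprn_ge0 ?sqrtr_ge0.
    - apply: measurableT_comp => //; apply: measurableT_comp => //.
      by apply: measurable_funM => //; apply: measurable_dot; exact: measurable_vsub.
    - by move=> y; exact: expR_ge0.
  have Gs x y : G (x, y) = G (y, x).
    rewrite /G /=; congr (_ * expR (- (_ * _))).
    rewrite /dot; apply: eq_bigr => i _; rewrite !tnth_mktuple -!expr2.
    by rewrite -sqrrN opprB.
  have Gx x : (\int[L]_y (G (x, y) * 1)%:E = ((2 * pi) ^+ n)%:E)%E.
    by rewrite -(Gy x); apply: eq_integral => y _; rewrite Gs.
  have := @schur_test _ _ R L G (fun=> 1) h ((2 * pi) ^+ n) mG (measurable_cst _) mh G0
    (fun=> ler01) _ _ _.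
  have -> : (\int[L]_x (1 * h x ^+ 2)%:E = (\int[L]_x (h x ^+ 2))%:E)%E.
    by rewrite RintE//; apply: eq_integral => x _; rewrite mul1r.
  rewrite -EFinM; move=> H; apply: le_trans (H _ _ _).
  - apply: le_trans (Rint_le_norm r2) _; apply: ge0_le_integral => //.
    + by apply/measurable_EFinP; apply: measurableT_comp => //; exact: rint_measurable r2.
    + apply/measurable_EFinP; apply: measurable_funM.
        apply: measurable_funM => //; apply: measurable_funM => //.
        exact: measurable_fst_comp (measurable_norm mh).
      apply: measurable_funM => //.
      exact: measurable_snd_comp (measurable_norm mh).
    + by move=> z _; rewrite KE lee_fin normrM (ger0_norm (G0 z)) normrM !mul1r mulrC mulrA.
  - by rewrite exprn_ge0// mulr_ge0// pi_ge0.
  - by move=> x; rewrite Gx.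
  - by move=> x; rewrite Gy.
apply: (@fatou_bound _ _ _ _ (fun k xi => expR (- (k.+1%:R^-1 * dot xi xi)) * energyT h xi)).
- move=> k; apply: measurable_funM; last exact: measurable_energyT.
  by apply: rint_measurable (rint_gaussRn n _); rewrite invr_gt0.
- by move=> k x; rewrite mulr_ge0 ?expR_ge0 ?energyT_ge0.
- move=> xi; rewrite -[X in _ --> X]mul1r; apply: cvgM; last exact: cvg_cst.
  exact: cvg_expR_harmonic.
- by move=> k; apply: bound; rewrite invr_gt0.
Qed.

End Bessel.

(** * Morrey weights *)

Section Morrey.
Context {R : realType} (n : nat).
Local Notation L := (@lebesgueRn R n).
Implicit Types (x y z : Rn R n) (v : Rn R n -> R).

Definition cube x (rho : R) : set (Rn R n) :=
  [set y | forall i, `|(tnth y i : R) - tnth x i| <= rho].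

Definition morrey v (kap D : R) : Prop := forall x rho, 0 < rho ->
  (\int[L]_y (\1_(cube x rho) y * v y)%:E <= (D * rho `^ kap)%:E)%E.

Lemma measurable_cube x rho : measurable (cube x rho).
Proof.
rewrite (_ : cube x rho = \bigcap_(i in [set: 'I_n])
  ((@tnth n (measurableTypeR R))^~ i @^-1` [set t : R | `|t - tnth x i| <= rho])).
  apply: fin_bigcap_measurable => // i _; rewrite -[X in measurable X]setTI.
  apply: measurable_tnth => //.
  rewrite (_ : [set t : R | _] = `[tnth x i - rho, tnth x i + rho]%classic) //.
  by apply/seteqP; split => t /=; rewrite in_itv/= ler_distl.
by apply/seteqP; split => y /= h; [move=> i _|move=> i]; exact: h.
Qed.

Lemma measurable_indic_cube x rho : measurable_fun setT (\1_(cube x rho) : Rn R n -> R).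
Proof. by apply: measurable_indic; exact: measurable_cube. Qed.

Lemma dot_vsub_ge x z rho : 0 <= rho -> ~ cube x rho z ->
  rho ^+ 2 <= dot (vsub x z) (vsub x z).
Proof.
move=> rho0 /existsNP[i /negP]; rewrite -ltNge => h.
rewrite /dot (bigD1 i)//= tnth_mktuple -expr2.
apply: (@le_trans _ _ ((tnth x i - tnth z i) ^+ 2)).
  rewrite -(real_normK (num_real (_ - _))) ler_pXn2r ?nnegrE// distrC.
  exact: ltW.
rewrite lerDl; apply: sumr_ge0 => j _; exact: sqr_ge0.
Qed.

(* Dyadic shells around [x]: the Gaussian decays faster than any power, the
   measure of the cubes grows like the power [kap] of the radius. *)
Lemma morrey_gauss v kap D x rho : (0 < n)%N -> kap <= n%:R ->
  measurable_fun setT v -> (forall x, 0 <= v x) -> morrey v kap D -> 0 < rho ->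
  (\int[L]_y (expR (- (dot (vsub x y) (vsub x y) / (20 * rho ^+ 2))) * v y)%:E <=
   ((1 + 2 * (40 * n%:R) ^+ n) * (D * rho `^ kap))%:E)%E.
Proof.
move=> n0 kapn mv v0 hv rho0.
have nR : (0 : R) < n%:R by rewrite ltr0n.
pose e y := expR (- (dot (vsub x y) (vsub x y) / (20 * rho ^+ 2))).
have me : measurable_fun setT e.
  apply: measurableT_comp => //; apply: measurableT_comp => //.
  by apply: measurable_funM => //; apply: measurable_dot; exact: measurable_vsub.
pose B := D * rho `^ kap; set C := (40 * n%:R) ^+ n.
have C0 : 0 <= C by rewrite exprn_ge0// mulr_ge0.
have B0 : 0 <= B.
  have := hv x rho rho0; rewrite -lee_fin; apply: le_trans.
  by apply: integral_ge0 => y _; rewrite lee_fin mulr_ge0.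
have mI K : measurable_fun setT (fun y => \1_(cube x (2 ^+ K * rho)) y * (e y * v y)).
  apply: measurable_funM; first exact: measurable_indic_cube.
  exact: measurable_funM.
(* The partial sums [1 + 2 C (1 - 2^-K)] allow the step from the cube of radius [2^K rho] to the
   next one to contribute [C 2^-K]. *)
have key K : (\int[L]_y (\1_(cube x (2 ^+ K * rho)) y * (e y * v y))%:E <=
    ((1 + 2 * C * (1 - 2^-1 ^+ K)) * B)%:E)%E.
  elim: K => [|K ih].
    rewrite expr0 mul1r subrr mulr0 addr0 mul1r.
    apply: le_trans (hv x rho rho0); apply: le_ge0_int.
    - by have := mI 0%N; rewrite expr0 mul1r.
    - by apply: measurable_funM => //; exact: measurable_indic_cube.
    - move=> y; rewrite !mulr_ge0 ?expR_ge0//=; apply: ler_wpM2l => //.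
      rewrite ler_piMl// -expR0 ler_expR oppr_le0.
      by rewrite divr_ge0 ?dot_ge0// mulr_ge0// sqr_ge0.
  have K0 : (0 : R) < 2 ^+ K by rewrite exprn_gt0.
  (* Off the cube the exponent [u] is at least [4^K / 20], and [exp(- u) <= (1 + u / n)^(-n) <= (n /
     u)^n]. The resulting [4^(-K n)] beats the growth [2^((K+1) kap)] of the Morrey bound because
     [kap <= n]. *)
  pose c := (20 * n%:R / 4 ^+ K) ^+ n : R.
  have c0 : 0 <= c by rewrite exprn_ge0// !mulr_ge0// invr_ge0 exprn_ge0.
  have ec y : ~ cube x (2 ^+ K * rho) y -> e y <= c.
    move=> /dot_vsub_ge; rewrite (_ : 0 <= _); last by rewrite mulr_ge0// ltW.
    move=> /(_ isT) h; rewrite /e /c.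
    set u := dot _ _ / _.
    have hu : 4 ^+ K / 20 <= u.
      rewrite ler_pdivlMr; last by rewrite mulr_gt0// exprn_gt0.
      apply: le_trans h; rewrite exprMn -exprM mulnC exprM (_ : 2 ^+ 2 = 4 :> R).
        by rewrite le_eqVlt; apply/orP; left; apply/eqP; field.
      by ring.
    have -> : - u = - (u / n%:R) * n%:R by field; rewrite gt_eqF.
    rewrite expRM_natr ler_pXn2r ?nnegrE ?expR_ge0 ?divr_ge0 ?mulr_ge0 ?exprn_ge0//.
    rewrite expRN -[leRHS]invf_div lef_pV2; first last.
    - by rewrite posrE divr_gt0 ?mulr_gt0 ?exprn_gt0.
    - by rewrite posrE expR_gt0.
    apply: (@le_trans _ _ (1 + u / n%:R)); last exact: expR_ge1Dx.
    apply: (@le_trans _ _ (u / n%:R)); last by rewrite lerDr.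
    by rewrite invfM mulrA ler_pM2r ?invr_gt0.
  apply: (@le_trans _ _ (\int[L]_y ((\1_(cube x (2 ^+ K * rho)) y * (e y * v y))%:E +
     (c * (\1_(cube x (2 ^+ K.+1 * rho)) y * v y))%:E))%E).
    apply: ge0_le_integral => //.
    - by move=> y _; rewrite lee_fin !mulr_ge0 ?expR_ge0.
    - exact/measurable_EFinP.
    - apply: emeasurable_funD; apply/measurable_EFinP => //.
      apply: measurable_funM => //; apply: measurable_funM => //.
      exact: measurable_indic_cube.
    - move=> y _; rewrite -EFinD lee_fin !indicE.
      have [/set_mem h|/negP h] := boolP (y \in cube x (2 ^+ K * rho)).
        rewrite mul1r (le_trans (y := e y * v y))//.
          by rewrite ler_piMl ?mulr_ge0 ?expR_ge0//; case: (_ \in _).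
        by rewrite lerDl !mulr_ge0//; case: (_ \in _).
      rewrite [false%:R * _]mul0r add0r mulrCA [leRHS]mulrCA mulrCA.
      apply: ler_wpM2l => //; apply: ler_wpM2r => //; apply: ec.
      by move=> H; apply: h; rewrite inE.
  rewrite ge0_integralD//; last 4 first.
  - by move=> y _; rewrite lee_fin !mulr_ge0 ?expR_ge0.
  - exact/measurable_EFinP.
  - by move=> y _; rewrite lee_fin !mulr_ge0.
  - apply/measurable_EFinP; apply: measurable_funM => //.
    by apply: measurable_funM => //; exact: measurable_indic_cube.
  rewrite ge0_intZl//; last 2 first.
  - by apply: measurable_funM => //; exact: measurable_indic_cube.
  - by move=> y; rewrite mulr_ge0.
  have rK : 0 < 2 ^+ K.+1 * rho by rewrite mulr_gt0// exprn_gt0.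
  apply: (@le_trans _ _ (((1 + 2 * C * (1 - 2^-1 ^+ K)) * B)%:E +
     c%:E * (D * (2 ^+ K.+1 * rho) `^ kap)%:E)%E).
    by rewrite leeD// lee_wpmul2l ?lee_fin//; exact: hv.
  rewrite -EFinM -EFinD lee_fin powRM ?exprn_ge0 ?(ltW rho0)//.
  have -> : (1 + 2 * C * (1 - 2^-1 ^+ K.+1)) * B =
    (1 + 2 * C * (1 - 2^-1 ^+ K)) * B + (C * 2^-1 ^+ K) * B.
    by rewrite exprS; field.
  rewrite lerD2l (mulrC (_ `^ kap)) (mulrA D) -/B mulrCA mulrC ler_wpM2r//.
  have p2 : (2 ^+ K.+1) `^ kap <= (2 ^+ K.+1) ^+ n :> R.
    rewrite -[leRHS]powR_mulrn ?exprn_ge0//; apply: ler_powR => //.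
    by rewrite exprn_ege1// ler1n.
  apply: (@le_trans _ _ (c * (2 ^+ K.+1) ^+ n)); first by rewrite ler_wpM2l.
  rewrite /c -exprMn /C.
  have -> : 20 * n%:R / 4 ^+ K * 2 ^+ K.+1 = 40 * n%:R * (2^-1 ^+ K) :> R.
    rewrite (_ : 4 = 2 * 2 :> R); last by ring.
    rewrite exprMn exprS exprVn; move/lt0r_neq0: K0 => K0.
    by field; rewrite ?K0.
  rewrite exprMn ler_wpM2l// -exprM.
  by rewrite ler_wiXn2l// ?invf_le1 ?ler1n// leq_pmulr.
apply: (@fatou_bound _ _ _ _ (fun K y => \1_(cube x (2 ^+ K * rho)) y * (e y * v y))).
- exact: mI.
- by move=> K y; rewrite !mulr_ge0 ?expR_ge0.
- move=> y; apply: cvg_near_cst.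
  exists (Num.truncn (\sum_(i < n) `|(tnth y i : R) - tnth x i| / rho)).+1 => // K /= hK.
  rewrite indicE mem_set ?mul1r// => i; rewrite -ler_pdivrMr//.
  apply: (@le_trans _ _ (\sum_(i < n) `|(tnth y i : R) - tnth x i| / rho)).
    rewrite (bigD1 i)//= lerDl; apply: sumr_ge0 => j _.
    by rewrite divr_ge0// ltW.
  apply: (@le_trans _ _ K%:R); last by rewrite -natrX ler_nat ltnW// ltn_expl.
  apply: (le_trans (ltW (truncnS_gt _))); by rewrite ler_nat.
- move=> K; apply: le_trans (key K) _; rewrite lee_fin ler_wpM2r//.
  by rewrite lerD2l -[leRHS]mulr1 ler_wpM2l ?mulr_ge0// gerBl exprn_ge0.
Qed.

End Morrey.

(** * Restriction to thin shells *)

Section Fejer.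
Context {R : realType}.
Local Notation mu := (@lebesgue_measure R).
Implicit Types T a b s : R.

Lemma Rint_indic d (X : measurableType d) (nu : {measure set X -> \bar R})
    (A : set X) (f : X -> R) : measurable A ->
  \int[nu]_(x in A) f x = \int[nu]_x (\1_A x * f x).
Proof.
move=> mA; rewrite Rintegral_mkcond; apply: eq_Rintegral => x _.
rewrite patchE indicE; case: ifPn => _; by rewrite ?mul1r ?mul0r.
Qed.

Lemma rint_itv a b : rint mu (\1_`[a, b] : R -> R).
Proof.
apply: ge0_rint => //; rewrite integral_indic// setIT.
suff : (lebesgue_measure (`[a, b]%classic : set R) < +oo)%E by [].
by rewrite lebesgue_measure_itv/=; case: ifP => _; rewrite ?ltry// -EFinB ltry.
Qed.

Lemma Rint_itv1 a b : a <= b -> \int[mu]_t \1_`[a, b] t = b - a.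
Proof.
move=> ab; transitivity (\int[mu]_(t in `[a, b]) (1 : R)).
  rewrite [RHS]Rint_indic//.
  by apply: eq_Rintegral => t _; rewrite mulr1.
apply: (@FTC R (fun=> 1) id) => // x _; exact: cvg_cst.
Qed.

(** Over [[0, T]] and for [s != 0] this is the Fejer kernel [(1 - cos (T s)) / (T s^2)]. The range
    is left free so that it can be cut dyadically. *)
Definition fejer T a b s : R :=
  \int[mu]_(t in `[a, b]) ((1 - t / T) * cos (t * s)).

Let dfejer T s t : is_derive t (1 : R) (fun t : R => (1 - t / T) * cos (t * s))
  ((- T^-1) * cos (t * s) + (1 - t / T) * (- sin (t * s) * s)).
Proof.
have d1 : is_derive t 1 (fun t : R => 1 - t / T) (- T^-1).
  by apply: (is_derive_eq (drvB (drv_cst t 1) (drvM (drv_id t) (drv_cst t T^-1)))); rewrite mulr0 mul1r; ring.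
have d2 : is_derive t 1 (fun t : R => t * s) s.
  by apply: (is_derive_eq (drvM (drv_id t) (drv_cst t s))); rewrite mulr0 mul1r; ring.
exact: drvM d1 (drv_cos d2).
Qed.

Let cfejer T s t : {for t, continuous (fun t : R => (1 - t / T) * cos (t * s))}.
Proof. exact: drv_continuous (dfejer T s t). Qed.

Lemma measurable_fejer_integrand T s :
  measurable_fun setT (fun t : R => (1 - t / T) * cos (t * s)).
Proof. exact: drv_measurable (dfejer T s). Qed.

Lemma fejer_integrand_le T a b s t : 0 <= a -> b <= T ->
  `|\1_`[a, b] t * ((1 - t / T) * cos (t * s))| <= \1_`[a, b] t.
Proof.
move=> a0 bT; rewrite indicE; have [/set_mem/=|_] := boolP (t \in _).
  rewrite in_itv/= => /andP[at' tb]; rewrite mul1r normrM.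
  have [T0|T0] := leP T 0.
    have -> : t = 0 by apply/eqP; rewrite eq_le !(le_trans _ at', le_trans tb)//; lra.
    by rewrite !mul0r subr0 normr1 mul1r normr_cos_le1.
  rewrite -[leRHS]mulr1 ler_pM//; last exact: normr_cos_le1.
  have tT0 : 0 <= t / T by rewrite divr_ge0 ?(ltW T0)// (le_trans a0).
  have tT1 : t / T <= 1 by rewrite ler_pdivrMr// mul1r (le_trans tb).
  by rewrite ger0_norm ?subr_ge0// gerBl.
by rewrite mul0r normr0.
Qed.

Lemma fejer_le T a b s : 0 <= a <= b -> b <= T -> `|fejer T a b s| <= b - a.
Proof.
move=> /andP[a0 ab] bT; rewrite /fejer Rint_indic// -(Rint_itv1 ab).
apply: norm_Rint_le; last by move=> t; exact: fejer_integrand_le.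
- apply: measurable_funM; last exact: measurable_fejer_integrand.
  exact: measurable_indic.
- exact: rint_itv.
Qed.

Lemma fejer_split T a b c s : -1 < a -> a <= b -> b <= c ->
  fejer T a c s = fejer T a b s + fejer T b c s.
Proof.
move=> a1 ab bc; have [F dF] := continuous_antiderivative (-1) (@cfejer T s).
have E x y : -1 < x -> x <= y -> fejer T x y s = F y - F x.
  move=> x1 xy; apply: FTC => // t /andP[xt _].
  by apply: dF; exact: lt_le_trans xt.
by rewrite !E ?(lt_le_trans a1)// ?(le_trans ab)//; ring.
Qed.

Lemma fejer_ge0 T s : 0 < T -> 0 <= fejer T 0 T s.
Proof.
move=> T0; have [->|s0] := eqVneq s 0.
  apply: Rintegral_ge0 => t /=; rewrite in_itv/= mulr0 cos0 mulr1 => /andP[t0 tT].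
  by rewrite subr_ge0 ler_pdivrMr// mul1r.
pose F t := (1 - t / T) * (sin (t * s) / s) - cos (t * s) / (T * s ^+ 2).
have -> : fejer T 0 T s = F T - F 0.
  apply: FTC (ltW T0) _ _ => t _; first exact: cfejer.
  have d1 : is_derive t 1 (fun t : R => 1 - t / T) (- T^-1).
    by apply: (is_derive_eq (drvB (drv_cst t 1) (drvM (drv_id t) (drv_cst t T^-1)))); rewrite mulr0 mul1r; ring.
  have d2 : is_derive t 1 (fun t : R => t * s) s.
    by apply: (is_derive_eq (drvM (drv_id t) (drv_cst t s))); rewrite mulr0 mul1r; ring.
  apply: (is_derive_eq (drvB (drvM d1 (drvM (drv_sin d2) (drv_cst t s^-1)))
               (drvM (drv_cos d2) (drv_cst t (T * s ^+ 2)^-1)))); move: (cos _) (sin _) => C S.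
  by field; rewrite s0 gt_eqF.
rewrite /F !(mul0r, sin0, cos0) divff ?gt_eqF// subrr mul0r mulr0.
rewrite (_ : _ - _ = (1 - cos (T * s)) / (T * s ^+ 2)); last first.
  by move: (cos _) => C; field; rewrite s0 gt_eqF.
by rewrite divr_ge0 ?subr_ge0 ?cos_le1// mulr_ge0 ?(ltW T0)// sqr_ge0.
Qed.

(** The condition on [s] keeps [|t s| <= 1/2], where the cosine is at least [1/2]; the integral of
    [(1 - t / T) / 2] is [T / 4]. *)
Lemma fejer_ge T s : 0 < T -> `|s| <= (2 * T)^-1 -> T / 4 <= fejer T 0 T s.
Proof.
move=> T0 hs.
have chalf t : 0 <= t <= T -> 2^-1 <= cos (t * s).
  move=> /andP[t0 tT].
  have ts : `|t * s| <= 2^-1.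
    rewrite normrM ger0_norm// (le_trans (y := T * (2 * T)^-1))//.
      by rewrite ler_pM.
    by rewrite le_eqVlt; apply/orP; left; apply/eqP; field; rewrite gt_eqF.
  have ac : cos `|t * s| = cos (t * s) by case: (ler0P (t * s)) => _; rewrite ?cosN.
  have := @drv_lip R cos (fun x => - sin x) 1 0 `|t * s| (normr_ge0 _)
    (fun x _ => is_derive_cos x) _.
  rewrite cos0 subr0 mul1r ac => h.
  have {h} /(fun h => le_trans h ts) : `|cos (t * s) - 1| <= `|t * s|.
    by apply: h => x _; rewrite normrN normr_sin_le1.
  rewrite ler_norml => /andP[]; lra.
have E : \int[mu]_(t in `[0, T]) (2^-1 * (1 - t / T)) = T / 4.
  pose F t := 2^-1 * (t - t ^+ 2 / (2 * T)).
  transitivity (F T - F 0); last by rewrite /F; field; rewrite gt_eqF.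
  apply: FTC (ltW T0) _ _ => t _.
    apply: (@drv_continuous _ _ _ (2^-1 * - T^-1)).
    by apply: (is_derive_eq (drvZ 2^-1 (drvB (drv_cst t 1) (drvM (drv_id t) (drv_cst t T^-1))))); rewrite mulr0 mul1r; ring.
  by apply: (is_derive_eq (drvZ 2^-1 (drvB (drv_id t) (drvM (drvX 2 (drv_id t)) (drv_cst t (2 * T)^-1))))); field; rewrite gt_eqF.
have mI := @measurable_itv R `[0, T].
rewrite -E /fejer Rint_indic// [leRHS]Rint_indic//.
apply: le_Rint.
- apply: (@rint_le _ _ _ mu _ (\1_`[0, T] : R -> R)); last exact: rint_itv.
    apply: measurable_funM; first exact: measurable_indic.
    by apply: measurable_funM => //; apply: measurable_funB => //; exact: measurable_funM.
  move=> t; have := @fejer_integrand_le T 0 T 0 t (lexx _) (lexx _).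
  rewrite mulr0 cos0 mulr1 mulrCA [leLHS]normrM; apply: le_trans.
  rewrite -normrM [leLHS]normrM ler_piMl//.
  by rewrite ger0_norm ?invr_ge0// invf_le1 ?ler1n.
- apply: (@rint_le _ _ _ mu _ (\1_`[0, T] : R -> R)); last exact: rint_itv.
    apply: measurable_funM; first exact: measurable_indic.
    exact: measurable_fejer_integrand.
  by move=> t; exact: fejer_integrand_le.
- move=> t; rewrite indicE; have [/set_mem/=|_] := boolP (t \in _); last by rewrite !mul0r.
  rewrite in_itv/= => tT; rewrite !mul1r mulrC ler_wpM2l ?chalf//.
  by case/andP: tT => t0 tT; rewrite subr_ge0 ler_pdivrMr// mul1r.
Qed.

End Fejer.

Lemma dot_vsubC (R : realType) n (x y : Rn R n) :
  dot (vsub x y) (vsub x y) = dot (vsub y x) (vsub y x).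
Proof.
by apply: eq_bigr => i _; rewrite !tnth_mktuple -!expr2 -sqrrN opprB.
Qed.

Section Multiplier.
Context {R : realType} (n : nat).
Local Notation L := (@lebesgueRn R n).
Local Notation mu := (@lebesgue_measure R).
Implicit Types (x y z xi : Rn R n) (T a b p : R).

Definition mult T p a b xi : R :=
  expR (- (p * dot xi xi)) * fejer T a b (p * dot xi xi - 1).

Section piece.
Variables (T p a b : R).
Hypotheses (p0 : 0 < p) (a0 : 0 <= a) (ab : a <= b) (bT : b <= T).

Let F (z : Rn R n) (q : Rn R n * measurableTypeR R) : R :=
  expR (- (p * dot q.1 q.1)) *
  (\1_`[a, b] q.2 * ((1 - q.2 / T) * cos (q.2 * (p * dot q.1 q.1 - 1)))) *
  cos (dot z q.1).

Let mdot d (X : measurableType d) (f : X -> Rn R n) : measurable_fun setT f ->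
  measurable_fun setT (fun u => dot (f u) (f u)).
Proof. by move=> mf; exact: measurable_dot. Qed.

Let mF z : measurable_fun setT (F z).
Proof.
have md : measurable_fun setT (fun q : Rn R n * measurableTypeR R => p * dot q.1 q.1).
  by apply: measurable_funM => //; apply: mdot; exact: measurable_fst.
have mt : measurable_fun setT (fun q : Rn R n * measurableTypeR R => q.2).
  exact: measurable_snd.
apply: measurable_funM.
  apply: measurable_funM.
    by apply: measurableT_comp => //; exact: measurableT_comp.
  apply: measurable_funM.
    by apply: (measurable_snd_comp (f := (\1_`[a, b] : R -> R))); exact: measurable_indic.
  apply: measurable_funM.
    by apply: measurable_funB => //; apply: measurable_funM.
  apply: measurable_cos_comp; apply: measurable_funM => //.
  exact: measurable_funB.
apply: measurable_cos_comp; apply: measurable_dot => //; exact: measurable_fst.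
Qed.

Let Fle z xi t : `|F z (xi, t)| <= expR (- (p * dot xi xi)) * \1_`[a, b] t.
Proof.
rewrite /F /= normrM -[leRHS]mulr1 ler_pM// ?normr_cos_le1//.
rewrite normrM ger0_norm ?expR_ge0// ler_wpM2l ?expR_ge0//.
exact: fejer_integrand_le.
Qed.

Let innerF z xi : \int[mu]_t F z (xi, t) = mult T p a b xi * cos (dot z xi).
Proof.
rewrite /mult /fejer [in RHS]Rint_indic// -mulrA mulrCA mulrC.
set c := expR _; set d := cos (dot z xi).
transitivity (\int[mu]_t ((c * d) * (\1_`[a, b] t *
    ((1 - t / T) * cos (t * (p * dot xi xi - 1)))))).
  by apply: eq_Rintegral => t _; rewrite /F /= -/c -/d; ring.
rewrite RintZl; first by ring.
apply: (@rint_le _ _ _ mu _ (\1_`[a, b] : R -> R)); last exact: rint_itv.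
  by apply: measurable_funM; [exact: measurable_indic|exact: measurable_fejer_integrand].
by move=> t; exact: fejer_integrand_le.
Qed.

Let outerF z t : \int[L]_xi F z (xi, t) =
  \1_`[a, b] t * (Num.sqrt (pi / p) ^+ n * kint (n%:R / 2) (dot z z / p) T t).
Proof.
pose G (s : R) (z : Rn R n) xi :=
  expR (- (p * dot xi xi)) * cos (p * t * dot xi xi + dot z xi + s).
have rG s y : rint L (G s y).
  apply: rint_le (rint_gaussRn n p0) => [|xi].
    apply: measurable_funM; first exact: rint_measurable (rint_gaussRn n p0).
    apply: measurable_cos_comp; apply: measurable_funD => //.
    apply: measurable_funD; last exact: measurable_dot.
    by apply: measurable_funM => //; exact: mdot.
  by rewrite normrM ger0_norm ?expR_ge0// ler_piMr ?expR_ge0// normr_cos_le1.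
(* [z'] is [- z]: the product of the two cosines is half the sum of the cosines with the phases
   [dot z xi] and [dot z' xi], and the Gaussian formula gives both the same integral. *)
pose z' : Rn R n := vsub [tuple 0 | i < n] z.
have dz' xi : dot z' xi = - dot z xi.
  rewrite dot_vsub [X in X - _](_ : _ = 0) ?sub0r// /dot big1// => i _.
  by rewrite tnth_mktuple mul0r.
have dzz : dot z' z' = dot z z by rewrite dz' dotC dz' opprK.
transitivity (\int[L]_xi ((\1_`[a, b] t * (1 - t / T) * 2^-1) *
   (G (- t) z xi + G (- t) z' xi))).
  apply: eq_Rintegral => xi _; rewrite /F /G /= dz'.
  have -> : t * (p * dot xi xi - 1) = p * t * dot xi xi - t by ring.
  have -> : p * t * dot xi xi + dot z xi - t = (p * t * dot xi xi - t) + dot z xi by ring.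
  have -> : p * t * dot xi xi - dot z xi - t = (p * t * dot xi xi - t) - dot z xi by ring.
  move: (p * t * dot xi xi - t) => A; rewrite cosD cosB.
  move: (cos A) (cos _) (sin A) (sin _) (expR _) (\1_`[a, b] t) (1 - t / T) => c d u v q o k.
  by field.
rewrite RintZl; last exact: rintD.
rewrite RintD// !gauss_phase// dzz /kint.
move: (gamp _ _ _) (cos _) (Num.sqrt _) (\1_`[a, b] t) (1 - t / T) => u c q o k.
by field.
Qed.

Lemma rint_mult : rint L (mult T p a b).
Proof.
have := rint_fubinil (m1 := L) (m2 := mu) (mF [tuple 0 | i < n]) (Fle _)
  (rint_gaussRn n p0) (rint_itv a b).
apply: eq_rint => xi; rewrite innerF [X in cos X](_ : _ = 0) ?cos0 ?mulr1//.
by rewrite /dot big1// => i _; rewrite tnth_mktuple mul0r.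
Qed.

Lemma mult_kernel z : \int[L]_xi (mult T p a b xi * cos (dot z xi)) =
  Num.sqrt (pi / p) ^+ n *
  \int[mu]_(t in `[a, b]) kint (n%:R / 2) (dot z z / p) T t.
Proof.
transitivity (\int[L]_xi \int[mu]_t F z (xi, t)).
  by apply: eq_Rintegral => xi _; rewrite innerF.
rewrite (Rint_swap (m1 := L) (m2 := mu) (mF z) (Fle z) (rint_gaussRn n p0) (rint_itv a b)).
under eq_Rintegral do rewrite outerF.
rewrite [in RHS]Rint_indic//.
have mk : measurable_fun setT (kint (n%:R / 2) (dot z z / p) T : R -> R).
  by apply: continuous_measurable_fun => t; exact: continuous_kint.
rewrite -RintZl; first by apply: eq_Rintegral => t _; ring.
have c0 : 0 < Num.sqrt (pi / p) ^+ n :> R.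
  by rewrite exprn_gt0// sqrtr_gt0 divr_gt0 ?pi_gt0.
have := rintZl (Num.sqrt (pi / p) ^+ n)^-1 (rint_fubinir (m1 := L) (m2 := mu) (mF z)
  (Fle z) (rint_gaussRn n p0) (rint_itv a b)).
by apply: eq_rint => t; rewrite outerF; field; rewrite lt0r_neq0.
Qed.

Lemma mult_le xi : `|mult T p a b xi| <= b - a.
Proof.
rewrite normrM ger0_norm ?expR_ge0// -[leRHS]mul1r ler_pM ?expR_ge0//.
- by rewrite -expR0 ler_expR oppr_le0 mulr_ge0 ?(ltW p0)// dot_ge0.
- by apply: fejer_le => //; rewrite a0.
Qed.

End piece.

Lemma mult_split T p a b c xi : -1 < a -> a <= b -> b <= c ->
  mult T p a c xi = mult T p a b xi + mult T p b c xi.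
Proof. by move=> a1 ab bc; rewrite /mult (fejer_split _ _ a1 ab bc) mulrDr. Qed.

(* The Fejer kernel majorises the indicator function of the shell. *)
Lemma mult_shell T p xi : 0 < p -> 1 <= T -> `|p * dot xi xi - 1| <= (2 * T)^-1 ->
  1 <= 4 * expR 2 / T * mult T p 0 T xi.
Proof.
move=> p0 T1 h; have T0 : 0 < T by rewrite (lt_le_trans _ T1).
(* On the shell [p |xi|^2 <= 2], because [(2 T)^-1 <= 1]; this is the origin of the factor
   [expR 2]. *)
have e : expR (- 2) <= expR (- (p * dot xi xi)) :> R.
  rewrite ler_expR lerN2; move: h; rewrite ler_norml => /andP[_ h].
  have : (2 * T)^-1 <= 1 by rewrite invf_le1 ?mulr_gt0//; lra.
  lra.
have f := fejer_ge T0 h.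
apply: (@le_trans _ _ (4 * expR 2 / T * (expR (- 2) * (T / 4)))).
  rewrite expRN le_eqVlt; apply/orP; left; apply/eqP; field.
  by rewrite gt_eqF// gt_eqF ?expR_gt0.
rewrite ler_wpM2l ?divr_ge0 ?mulr_ge0 ?expR_ge0 ?(ltW T0)//.
by rewrite ler_pM ?expR_ge0// divr_ge0// ltW.
Qed.

Lemma mult_ge0 T p xi : 0 < T -> 0 <= mult T p 0 T xi.
Proof. by move=> T0; rewrite mulr_ge0 ?expR_ge0// fejer_ge0. Qed.

End Multiplier.

Section PieceEnergy.
Context {R : realType} (n : nat).
Local Notation L := (@lebesgueRn R n).
Local Notation mu := (@lebesgue_measure R).
Variables (om e : Rn R n -> R) (M E : R).
Hypotheses (mom : measurable_fun setT om) (me : measurable_fun setT e).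
Hypotheses (om0 : forall x, 0 <= om x) (omM : forall x, om x <= M).
Hypotheses (rh : rint L (fun x => om x * e x)) (rE : rint L (fun x => om x * e x ^+ 2)).
Let h x := om x * e x.

Let M0 : 0 <= M.
Proof. exact: le_trans (om0 [tuple 0 | i < n]) (omM _). Qed.

Let h2 x : h x ^+ 2 <= M * (om x * e x ^+ 2).
Proof.
rewrite /h exprMn expr2 -mulrA ler_wpM2r// mulr_ge0// ?sqr_ge0//.
Qed.

Let rh2 : rint L (fun x => h x ^+ 2).
Proof.
apply: (@rint_le _ _ _ L _ (fun x => M * (om x * e x ^+ 2))); last exact: rintZl.
  by apply: measurable_funX; exact: measurable_funM.
by move=> x; rewrite ger0_norm ?sqr_ge0.
Qed.

(** The trivial bound: the multiplier is at most [b - a], and Bessel's inequality for [om e] costs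
    one factor [om <= M]. *)
Lemma piece_bessel T p a b : 0 < p -> 0 <= a -> a <= b -> b <= T ->
  \int[L]_xi (mult T p a b xi * energyT h xi) <=
  (b - a) * (2 * pi) ^+ n * M * \int[L]_x (om x * e x ^+ 2).
Proof.
move=> p0 a0 ab bT.
have rm := rint_mult n p0 a0 bT.
have [r1 _ _] := energyT_form rh rm.
rewrite -lee_fin; apply: le_trans (Rint_le_norm r1) _.
have me' := measurable_energyT rh.
apply: (@le_trans _ _ (\int[L]_xi ((b - a) * energyT h xi)%:E)%E).
  apply: le_ge0_int.
  - exact: measurable_norm (rint_measurable r1).
  - exact: measurable_funM.
  - move=> xi; rewrite normr_ge0 normrM (ger0_norm (energyT_ge0 _ _)) /=.
    by rewrite ler_wpM2r ?energyT_ge0// mult_le.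
rewrite ge0_intZl ?subr_ge0//; last by move=> xi; exact: energyT_ge0.
apply: (@le_trans _ _ ((b - a)%:E * ((2 * pi) ^+ n * \int[L]_x (h x ^+ 2))%:E)%E).
  by rewrite lee_wpmul2l ?lee_fin ?subr_ge0//; exact: bessel.
rewrite -EFinM lee_fin -!mulrA ler_wpM2l ?subr_ge0// ler_wpM2l ?exprn_ge0 ?mulr_ge0 ?pi_ge0//.
rewrite -RintZl//; apply: le_Rint => //; exact: rintZl.
Qed.

(** The Schur bound: the kernel of the piece lies below a Gaussian of width [c sqrt p], and
    [om <= Th v] lets the Morrey bound of [v] control the integral of this Gaussian against [om]. *)
Lemma piece_kernel (v : Rn R n -> R) Th kap D T p a b c K : (0 < n)%N -> kap <= n%:R ->
  measurable_fun setT v -> (forall x, 0 <= v x) -> morrey v kap D ->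
  0 <= Th -> (forall x, om x <= Th * v x) ->
  0 < p -> 0 <= a -> a <= b -> b <= T -> 0 < c -> 0 <= K ->
  (forall X, 0 <= X -> `|\int[mu]_(t in `[a, b]) kint (n%:R / 2) X T t| <=
     K * expR (- (X / (20 * c ^+ 2)))) ->
  \int[L]_xi (mult T p a b xi * energyT h xi) <=
  Num.sqrt (pi / p) ^+ n * K *
  (Th * ((1 + 2 * (40 * n%:R) ^+ n) * (D * (c * Num.sqrt p) `^ kap))) *
  \int[L]_x (om x * e x ^+ 2).
Proof.
move=> n0 kapn mv v0 hv Th0 omv p0 a0 ab bT c0 K0 hK.
have rm := rint_mult n p0 a0 bT.
have [r1 r2 ->] := energyT_form rh rm.
have rho0 : 0 < c * Num.sqrt p by rewrite mulr_gt0// sqrtr_gt0.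
pose G (z : Rn R n * Rn R n) : R :=
  expR (- (dot (vsub z.1 z.2) (vsub z.1 z.2) / (20 * (c * Num.sqrt p) ^+ 2))).
have mG : measurable_fun setT G.
  apply: measurableT_comp => //; apply: measurableT_comp => //.
  apply: measurable_funM => //; apply: measurable_dot; exact: measurable_vsub.
set B := (1 + _) * _.
have D0 : 0 <= D * (c * Num.sqrt p) `^ kap.
  have := hv [tuple 0 | i < n] _ rho0; rewrite -lee_fin; apply: le_trans.
  by apply: integral_ge0 => y _; rewrite lee_fin mulr_ge0.
have B0 : 0 <= B by rewrite mulr_ge0// addr_ge0// mulr_ge0// exprn_ge0// mulr_ge0.
have Gx x : (\int[L]_y (G (x, y) * om y)%:E <= (Th * B)%:E)%E.
  apply: (@le_trans _ _ (\int[L]_y (Th * (G (x, y) * v y))%:E)%E).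
    apply: le_ge0_int.
    - by apply: measurable_funM => //; exact: measurable_section1.
    - by do 2 apply: measurable_funM => //; exact: measurable_section1.
    - by move=> y; rewrite mulr_ge0 ?expR_ge0//= mulrCA ler_wpM2l ?expR_ge0.
  rewrite ge0_intZl//; last 2 first.
  - by apply: measurable_funM => //; exact: measurable_section1.
  - by move=> y; rewrite mulr_ge0 ?expR_ge0.
  by rewrite EFinM lee_wpmul2l ?lee_fin//; exact: morrey_gauss.
have Gs x y : G (x, y) = G (y, x).
  by rewrite /G /= dot_vsubC.
have Gy y : (\int[L]_x (G (x, y) * om x)%:E <= (Th * B)%:E)%E.
  by apply: le_trans (Gx y); under eq_integral do rewrite Gs.
have S := schur_test mG mom me (fun z => expR_ge0 _) om0 (mulr_ge0 Th0 B0) Gx Gy.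
set q := Num.sqrt (pi / p) ^+ n.
have q0 : 0 <= q by rewrite exprn_ge0// sqrtr_ge0.
have qK0 : 0 <= q * K by rewrite mulr_ge0.
rewrite -lee_fin; apply: le_trans (Rint_le_norm r2) _.
have mH : measurable_fun setT (fun z : Rn R n * Rn R n =>
    G z * (om z.1 * `|e z.1|) * (om z.2 * `|e z.2|)).
  have moe : measurable_fun setT (fun x => om x * `|e x|).
    by apply: measurable_funM => //; exact: measurable_norm.
  apply: measurable_funM; last exact: (measurable_snd_comp moe).
  by apply: measurable_funM => //; exact: (measurable_fst_comp moe).
apply: (@le_trans _ _ (\int[(L \x L)%E]_z ((q * K) *
    (G z * (om z.1 * `|e z.1|) * (om z.2 * `|e z.2|)))%:E)%E).
  apply: le_ge0_int.
  - exact: measurable_norm (rint_measurable r2).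
  - exact: measurable_funM.
  - move=> z; rewrite normr_ge0/=.
    rewrite mult_kernel// -/q !normrM (ger0_norm q0) !(ger0_norm (om0 _)).
    have := hK _ (divr_ge0 (dot_ge0 (vsub z.1 z.2)) (ltW p0)).
    have -> : K * expR (- (dot (vsub z.1 z.2) (vsub z.1 z.2) / p / (20 * c ^+ 2))) = K * G z.
      rewrite /G exprMn sqr_sqrtr ?(ltW p0)//; congr (_ * expR (- _)).
      by field; rewrite !gt_eqF.
    set A := `|\int[_]_(_ in _) _| => hA.
    have -> : q * K * (G z * (om z.1 * `|e z.1|) * (om z.2 * `|e z.2|)) =
      om z.1 * `|e z.1| * (om z.2 * `|e z.2|) * (q * (K * G z)) by ring.
    by rewrite ler_wpM2l ?mulr_ge0// ler_wpM2l.
rewrite ge0_intZl//; last by move=> z; rewrite !mulr_ge0 ?expR_ge0.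
apply: le_trans (lee_wpmul2l _ S) _; first by rewrite lee_fin.
by rewrite -RintE// -!EFinM lee_fin !mulrA.
Qed.

End PieceEnergy.

(** * Duality between a weight and a shell *)

Section Osc.
Context {R : realType} (n : nat).
Local Notation L := (@lebesgueRn R n).
Implicit Types (x y xi : Rn R n) (h G : Rn R n -> R) (b : bool).

(** The boolean selects the imaginary or the real part of [exp(i t)], so that one real-valued
    argument serves both. *)
Definition osc b (t : R) : R := if b then sin t else cos t.

Definition oscT b h x : R := \int[L]_xi (h xi * osc b (dot x xi)).

Lemma measurable_osc_comp b d (X : measurableType d) (f : X -> R) :
  measurable_fun setT f -> measurable_fun setT (fun u => osc b (f u)).
Proof. by case: b; [exact: measurable_sin_comp|exact: measurable_cos_comp]. Qed.

Lemma normr_osc_le1 b t : `|osc b t| <= 1.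
Proof. by case: b; [exact: normr_sin_le1|exact: normr_cos_le1]. Qed.

Lemma rint_osc b d (X : measurableType d) (m : {measure set X -> \bar R})
    (h f : X -> R) : rint m h -> measurable_fun setT f ->
  rint m (fun u => h u * osc b (f u)).
Proof.
move=> rh mf; apply: eq_rint (rint_mulb (M := 1) _ _ rh) => [u||u].
- exact: mulrC.
- exact: measurable_osc_comp.
- exact: normr_osc_le1.
Qed.

Lemma rint_oscT b h x : rint L h -> rint L (fun xi => h xi * osc b (dot x xi)).
Proof. by move=> rh; apply: rint_osc => //; exact: measurable_dot. Qed.

Lemma oscT_le b h x : rint L h -> `|oscT b h x| <= \int[L]_xi `|h xi|.
Proof.
move=> rh; apply: norm_Rint_le.
- exact: rint_measurable (rint_oscT b x rh).
- exact: rint_norm.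
- by move=> xi; rewrite normrM ler_piMr// normr_osc_le1.
Qed.

Lemma measurable_oscT b h : rint L h -> measurable_fun setT (oscT b h).
Proof.
move=> rh; have rg := rint_gaussRn n (@ltr01 R).
pose f (z : Rn R n * Rn R n) := expR (- (1 * dot z.1 z.1)) * (h z.2 * osc b (dot z.1 z.2)).
have mf : measurable_fun setT f.
  apply: measurable_funM; first exact: (measurable_fst_comp (rint_measurable rg)).
  apply: measurable_funM; first exact: (measurable_snd_comp (rint_measurable rh)).
  by apply: measurable_osc_comp; apply: measurable_dot;
    [exact: measurable_fst|exact: measurable_snd].
have fle x xi : `|f (x, xi)| <= expR (- (1 * dot x x)) * `|h xi|.
  rewrite normrM ger0_norm ?expR_ge0// ler_wpM2l ?expR_ge0// normrM ler_piMr//.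
  exact: normr_osc_le1.
have := rint_measurable (rint_fubinil (m1 := L) (m2 := L) mf fle rg (rint_norm rh)).
have me : measurable_fun setT (fun x : Rn R n => expR (1 * dot x x)).
  apply: measurableT_comp => //; apply: measurable_funM => //; exact: measurable_dot.
move=> /(measurable_funM me); apply: eq_measurable_fun => x _ /=.
rewrite /f /= RintZl; last exact: rint_oscT.
by rewrite mulrA -expRD subrr expR0 mul1r.
Qed.

Lemma oscT_sqr_le b h xi : oscT b h xi ^+ 2 <= energyT h xi.
Proof.
case: b; rewrite /energyT.
  have -> : oscT true h xi = sinT h xi by apply: eq_Rintegral => x _; rewrite dotC.
  by rewrite lerDr sqr_ge0.
have -> : oscT false h xi = cosT h xi by apply: eq_Rintegral => x _; rewrite dotC.
by rewrite lerDl sqr_ge0.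
Qed.

Lemma oscT_duality b h G : rint L h -> rint L G ->
  \int[L]_x (h x * oscT b G x) = \int[L]_xi (G xi * oscT b h xi).
Proof.
move=> rh rG.
pose f (z : Rn R n * Rn R n) := h z.1 * (G z.2 * osc b (dot z.1 z.2)).
have mf : measurable_fun setT f.
  apply: measurable_funM; first exact: (measurable_fst_comp (rint_measurable rh)).
  apply: measurable_funM; first exact: (measurable_snd_comp (rint_measurable rG)).
  by apply: measurable_osc_comp; apply: measurable_dot;
    [exact: measurable_fst|exact: measurable_snd].
have fle x xi : `|f (x, xi)| <= `|h x| * `|G xi|.
  by rewrite normrM ler_wpM2l// normrM ler_piMr// normr_osc_le1.
transitivity (\int[L]_x \int[L]_xi f (x, xi)).
  apply: eq_Rintegral => x _; rewrite -RintZl //; exact: rint_oscT.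
rewrite (Rint_swap (m1 := L) (m2 := L) mf fle (rint_norm rh) (rint_norm rG)).
apply: eq_Rintegral => xi _; rewrite -RintZl; last exact: rint_oscT.
by apply: eq_Rintegral => x _; rewrite /f /= mulrCA dotC.
Qed.

Lemma rint_energyT h : rint L h -> rint L (fun x => h x ^+ 2) -> rint L (energyT h).
Proof.
move=> rh rh2; apply: ge0_rint; first exact: measurable_energyT.
- by move=> x; exact: energyT_ge0.
- by apply: le_lt_trans (bessel rh rh2) _; rewrite ltry.
Qed.

(* The T T^* argument: test the adjoint estimate on [e = oscT b G] and absorb. *)
Lemma adjoint_bound b (S : set (Rn R n)) (om : Rn R n -> R) G (B : R) :
  measurable S -> 0 <= B -> rint L om -> (forall x, 0 <= om x) ->
  (exists M, forall x, om x <= M) ->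
  rint L G -> rint L (fun xi => G xi ^+ 2) -> (forall xi, ~ S xi -> G xi = 0) ->
  (forall e : Rn R n -> R, measurable_fun setT e -> (exists M, forall x, `|e x| <= M) ->
    \int[L]_xi (\1_S xi * energyT (fun x => om x * e x) xi) <=
    B * \int[L]_x (om x * e x ^+ 2)) ->
  \int[L]_x (om x * oscT b G x ^+ 2) <= B * \int[L]_xi (G xi ^+ 2).
Proof.
move=> mS B0 rom om0 [M omM] rG rG2 GS hB.
pose e := oscT b G; pose h x := om x * e x.
have me : measurable_fun setT e by exact: measurable_oscT.
set N := \int[L]_xi `|G xi|; have eN x : `|e x| <= N by exact: oscT_le.
have rh : rint L h.
  apply: eq_rint (rint_mulb me eN rom) => x; exact: mulrC.
have rE : rint L (fun x => om x * e x ^+ 2).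
  by apply: eq_rint (rint_mulb me eN rh) => x; rewrite /h; ring.
have rh2 : rint L (fun x => h x ^+ 2).
  apply: eq_rint (rint_mulb (M := M) (rint_measurable rom) _ rE) => x.
    by rewrite /h; ring.
  by rewrite ger0_norm.
have {}hB := hB e me (ex_intro _ N eN).
set E := \int[L]_x (om x * e x ^+ 2) in hB *; set P := \int[L]_xi (G xi ^+ 2).
have P0 : 0 <= P by apply: Rintegral_ge0 => x _; exact: sqr_ge0.
have rS := rint_indic_mul mS (rint_energyT rh rh2).
have EE : E = \int[L]_xi (G xi * oscT b h xi).
  by rewrite -oscT_duality//; apply: eq_Rintegral => x _; rewrite /h -/(e x); ring.
(* The Cauchy-Schwarz inequality with a free parameter. The indicator of [S] may be inserted because
   [G] vanishes off [S]. *)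
have key lam : 0 < lam -> E <= lam / 2 * P + (2 * lam)^-1 * (B * E).
  move=> lam0; rewrite {1}EE.
  apply: (@le_trans _ _ (\int[L]_xi (lam / 2 * (G xi ^+ 2) +
     (2 * lam)^-1 * (\1_S xi * energyT h xi)))).
    apply: le_Rint.
    - apply: eq_rint (rint_mulb (measurable_oscT b rh) (fun xi => oscT_le b xi rh) rG) => xi.
      exact: mulrC.
    - by apply: rintD; exact: rintZl.
    - move=> xi; rewrite indicE; have [_|/negP h'] := boolP (xi \in S); last first.
        by rewrite GS ?mul0r ?mulr0 ?addr0 ?expr0n ?mulr0// => H; apply: h'; rewrite inE.
      rewrite mul1r; have := oscT_sqr_le b h xi; set u := oscT _ _ _; set q := energyT _ _.
      move=> uq; apply: (@le_trans _ _ (lam / 2 * G xi ^+ 2 + (2 * lam)^-1 * u ^+ 2)).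
        rewrite -subr_ge0 (_ : _ - _ = (2 * lam)^-1 * (lam * G xi - u) ^+ 2).
          by apply: mulr_ge0; [rewrite invr_ge0 mulr_ge0// ltW|exact: sqr_ge0].
        by field; rewrite gt_eqF.
      by rewrite lerD2l ler_wpM2l// invr_ge0 mulr_ge0// ltW.
  rewrite RintD ?RintZl//; [|exact: rintZl|exact: rintZl].
  by rewrite lerD2l ler_wpM2l ?invr_ge0 ?mulr_ge0 ?(ltW lam0).
have E0 : 0 <= E by apply: Rintegral_ge0 => x _; rewrite mulr_ge0// sqr_ge0.
rewrite leNgt; apply/negP => EB.
(* The best parameter is [B], which may vanish. Taking [B + eps] with [eps * (P + 1) = E - B * P]
   yields [E <= E - eps], a contradiction. *)
pose eps := (E - B * P) / (P + 1).
have P1 : 0 < P + 1 by rewrite ltr_wpDl.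
have eps0 : 0 < eps by rewrite divr_gt0// subr_gt0.
have l0 : 0 < B + eps by rewrite ltr_wpDl.
have := key _ l0.
have h1 : (2 * (B + eps))^-1 * (B * E) <= E / 2.
  rewrite mulrC ler_pdivrMr ?mulr_gt0// (_ : E / 2 * _ = (B + eps) * E); last by field.
  by rewrite ler_wpM2r// lerDl ltW.
have h2 : eps * (P + 1) = E - B * P by rewrite /eps divfK// gt_eqF.
have h3 : eps * P + eps = E - B * P by rewrite -h2; ring.
have h4 : (B + eps) / 2 * P = (B * P + eps * P) / 2 by ring.
rewrite h4; lra.
Qed.

End Osc.

Section Shell.
Context {R : realType} (n : nat).
Local Notation L := (@lebesgueRn R n).
Local Notation mu := (@lebesgue_measure R).
Variables (alpha : R).
Hypotheses (n0 : (0 < n)%N) (alpha0 : 0 <= alpha).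
Let eta := alpha - (n%:R + 1) / 2.

(** The two bounds for the range of [tau] near [2^j]. In the second one,
    [eta = (n - 1)/2 - (n - alpha)]: the decay of the kernel against the growth of the Morrey mass
    of a ball of radius [2^j / r]. *)
Definition shell_bound (r M ThD : R) (j : nat) : R :=
  Num.min (2 ^+ j * M) (r `^ alpha * (2 ^+ j) `^ (- eta) * ThD).

Definition shell (r : R) (J : nat) : set (Rn R n) :=
  [set xi | `|(r ^+ 2)^-1 * dot xi xi - 1| <= (2 * 2 ^+ J)^-1].

Lemma measurable_shell r J : measurable (shell r J).
Proof.
rewrite /shell -[X in measurable X]setTI.
have m : measurable_fun setT (fun xi : Rn R n => `|(r ^+ 2)^-1 * dot xi xi - 1|).
  apply: measurable_norm; apply: measurable_funB => //.
  by apply: measurable_funM => //; exact: measurable_dot.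
rewrite (_ : [set xi | _] = (fun xi : Rn R n => `|(r ^+ 2)^-1 * dot xi xi - 1|) @^-1`
   `]-oo, (2 * 2 ^+ J)^-1]%classic).
  exact: m.
by apply/seteqP; split => xi /=; rewrite in_itv.
Qed.

Lemma shell_energy : exists2 C, 0 <= C &
  forall (v : Rn R n -> R) D (om e : Rn R n -> R) M Th r J,
  measurable_fun setT v -> (forall x, 0 <= v x) -> morrey v (n%:R - alpha) D ->
  measurable_fun setT om -> (forall x, 0 <= om x) -> (forall x, om x <= M) ->
  measurable_fun setT e ->
  rint L (fun x => om x * e x) -> rint L (fun x => om x * e x ^+ 2) ->
  0 <= Th -> (forall x, om x <= Th * v x) -> 0 < r ->
  \int[L]_xi (\1_(shell r J) xi * energyT (fun x => om x * e x) xi) <=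
  C / 2 ^+ J * (shell_bound r M (Th * D) 0 + \sum_(j < J) shell_bound r M (Th * D) j) *
  \int[L]_x (om x * e x ^+ 2).
Proof.
have k0 : 0 <= n%:R / 2 :> R by rewrite divr_ge0.
have [Ck Ck0 hCk] := kernel_bound k0.
pose C6 : R := 1 + 2 * (40 * n%:R) ^+ n.
have C60 : 0 <= C6 by rewrite addr_ge0// mulr_ge0// exprn_ge0// mulr_ge0.
pose C1 : R := (2 * pi) ^+ n + Num.sqrt pi ^+ n * (8 + Ck) * C6.
have pn0 : 0 <= (2 * pi) ^+ n :> R by rewrite exprn_ge0// mulr_ge0// pi_ge0.
have qn0 : 0 <= Num.sqrt pi ^+ n :> R by rewrite exprn_ge0// sqrtr_ge0.
have C10 : 0 <= C1 by rewrite addr_ge0// !mulr_ge0// addr_ge0.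
exists (4 * expR 2 * C1) => [|v D om e M Th r J mv v0 hv mom om0 omM me rh rE Th0 omv r0].
  by rewrite !mulr_ge0 ?expR_ge0.
set h := fun x => om x * e x; set E := \int[L]_x (om x * e x ^+ 2); set T : R := 2 ^+ J.
have E0 : 0 <= E by apply: Rintegral_ge0 => x _; rewrite mulr_ge0// sqr_ge0.
have M0 : 0 <= M by apply: le_trans (om0 [tuple 0 | i < n]) (omM _).
have D0 : 0 <= D.
  have := hv [tuple 0 | i < n] 1 ltr01; rewrite powR1 mulr1 -lee_fin; apply: le_trans.
  by apply: integral_ge0 => y _; rewrite lee_fin mulr_ge0.
pose p := (r ^+ 2)^-1; have p0 : 0 < p by rewrite invr_gt0 exprn_gt0.
have sp : Num.sqrt p = r^-1 by rewrite /p sqrtrV ?sqr_ge0// sqrtr_sqr gtr0_norm.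
have spi : Num.sqrt (pi / p) ^+ n = Num.sqrt pi ^+ n * r ^+ n.
  by rewrite /p invrK sqrtrM ?pi_ge0// sqrtr_sqr gtr0_norm// exprMn.
have two j : 1 <= 2 ^+ j :> R by rewrite exprn_ege1// ler1n.
have two0 j : 0 < 2 ^+ j :> R by rewrite exprn_gt0.
(* Here [a = 2^j]. The factor [r^n] of the kernel and the Morrey radius [a / r] leave [r^alpha], and
   the powers of [a] add up to [- eta]. *)
have conv a (K0 : R) : 0 < a -> Num.sqrt (pi / p) ^+ n * (K0 * a `^ (2^-1 - n%:R / 2)) *
    (Th * (C6 * (D * (a * Num.sqrt p) `^ (n%:R - alpha)))) =
    Num.sqrt pi ^+ n * K0 * C6 * (r `^ alpha * a `^ (- eta) * (Th * D)).
  move=> a0; rewrite spi sp powRM ?invr_ge0 ?(ltW a0) ?(ltW r0)//.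
  have -> : r^-1 `^ (n%:R - alpha) = r `^ alpha / r ^+ n.
    rewrite -powR_inv1 ?(ltW r0)// -powRrM mulN1r opprB powRD ?(gt_eqF r0) ?implybT//.
    by rewrite powRN powR_mulrn ?(ltW r0).
  have -> : a `^ (- eta) = a `^ (2^-1 - n%:R / 2) * a `^ (n%:R - alpha).
    by rewrite -powRD ?(gt_eqF a0) ?implybT//; congr (_ `^ _); rewrite /eta; field.
  by field; rewrite expf_neq0// gt_eqF.
have piece j a b : 0 <= a -> a <= b -> b <= T -> b - a <= 2 ^+ j ->
    (exists2 K0, 0 <= K0 <= 8 + Ck & forall X, 0 <= X ->
      `|\int[mu]_(t in `[a, b]) kint (n%:R / 2) X T t| <=
     K0 * (2 ^+ j) `^ (2^-1 - n%:R / 2) * expR (- (X / (20 * (2 ^+ j) ^+ 2)))) ->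
    \int[L]_xi (mult T p a b xi * energyT h xi) <=
    C1 * shell_bound r M (Th * D) j * E.
  move=> a0 ab bT ba [K0 /andP[K00 K08] hK].
  have b1 : \int[L]_xi (mult T p a b xi * energyT h xi) <= C1 * (2 ^+ j * M) * E.
    apply: (le_trans (piece_bessel mom me om0 omM rh rE p0 a0 ab bT)).
    rewrite ler_wpM2r// mulrA ler_wpM2r// mulrC; apply: ler_pM => //.
      by rewrite subr_ge0.
    by rewrite /C1 lerDl !mulr_ge0// addr_ge0.
  have b2 : \int[L]_xi (mult T p a b xi * energyT h xi) <=
      C1 * (r `^ alpha * (2 ^+ j) `^ (- eta) * (Th * D)) * E.
    have kn : n%:R - alpha <= n%:R by rewrite gerBl.
    have KK0 : 0 <= K0 * (2 ^+ j) `^ (2^-1 - n%:R / 2) by rewrite mulr_ge0// powR_ge0.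
    apply: (le_trans (piece_kernel mom me om0 rh rE n0 kn mv v0 hv Th0 omv p0 a0 ab bT
      (two0 j) KK0 hK)).
    rewrite -/C6 conv// ler_wpM2r// ler_wpM2r//.
      by rewrite !mulr_ge0// powR_ge0.
    rewrite /C1 -[leLHS]add0r lerD// ler_wpM2r// ler_wpM2l//.
  by rewrite /shell_bound minEle; case: ifP => _; [exact: b1|exact: b2].
have rm a b : 0 <= a -> b <= T -> rint L (fun xi => mult T p a b xi * energyT h xi).
  by move=> a0 bT; have [] := energyT_form rh (rint_mult n p0 a0 bT).
(* The range [[0, 1]], bounded by [kernel_bound0], and the range [[1, 2]] both have index 0; hence
   the additional term outside the sum. *)
have sum J' : (J' <= J)%N -> \int[L]_xi (mult T p 0 (2 ^+ J') xi * energyT h xi) <=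
    C1 * (shell_bound r M (Th * D) 0 + \sum_(j < J') shell_bound r M (Th * D) j) * E.
  elim: J' => [|J' ih] hJ.
    rewrite big_ord0 addr0 expr0; apply: piece => //.
    - exact: two.
    - by rewrite subr0 expr0.
    - exists 8; first by rewrite lerDl Ck0 ler0n.
      move=> X X0; rewrite expr0 powR1 mulr1 expr1n mulr1.
      by apply: kernel_bound0 => //; exact: two.
  have jT : 2 ^+ J'.+1 <= T by rewrite /T ler_eXn2l ?ltr1n.
  have jj : 2 ^+ J' <= 2 ^+ J'.+1 :> R by rewrite ler_eXn2l ?ltr1n.
  have E2 : 2 ^+ J'.+1 = 2 * 2 ^+ J' :> R by rewrite exprS.
  have -> : \int[L]_xi (mult T p 0 (2 ^+ J'.+1) xi * energyT h xi) =
     \int[L]_xi (mult T p 0 (2 ^+ J') xi * energyT h xi) +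
     \int[L]_xi (mult T p (2 ^+ J') (2 ^+ J'.+1) xi * energyT h xi).
    rewrite -RintD.
    - by apply: eq_Rintegral => xi _; rewrite -mulrDl -mult_split// ?ltrN10// ltW.
    - by apply: rm => //; exact: le_trans jT.
    - by apply: rm => //; exact: ltW.
  rewrite big_ord_recr /= addrA mulrDr mulrDl lerD//.
    by apply: ih; exact: ltnW.
  apply: piece => //.
  - by rewrite E2 mulrDl mul1r addrK.
  - exists Ck; first by rewrite Ck0 lerDr ler0n.
    move=> X X0; rewrite -mulrA; apply: hCk => //.
    by rewrite jj E2 lexx.
have T1 : 1 <= T by exact: two.
have T0 : 0 < T by exact: two0.
apply: (@le_trans _ _ (\int[L]_xi (4 * expR 2 / T * (mult T p 0 T xi * energyT h xi)))).
  have rZ := rintZl (4 * expR 2 / T) (rm 0 T (lexx _) (lexx _)).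
  have dom xi : \1_(shell r J) xi * energyT h xi <=
      4 * expR 2 / T * (mult T p 0 T xi * energyT h xi).
    rewrite mulrA ler_wpM2r ?energyT_ge0// indicE.
    have [/set_mem xS|_] := boolP (xi \in _); first exact: mult_shell.
    apply: mulr_ge0; last exact: (mult_ge0 p xi T0).
    by rewrite divr_ge0 ?mulr_ge0 ?expR_ge0// ltW.
  apply: le_Rint => //.
  apply: rint_le rZ => [|xi].
    apply: measurable_funM; first by apply: measurable_indic; exact: measurable_shell.
    exact: measurable_energyT.
  by rewrite ger0_norm ?mulr_ge0 ?energyT_ge0.
rewrite RintZl; last exact: rm.
rewrite (_ : 4 * expR 2 * C1 / T * _ * E = 4 * expR 2 / T * (C1 *
  (shell_bound r M (Th * D) 0 + \sum_(j < J) shell_bound r M (Th * D) j) * E)); last first.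
  by field; rewrite gt_eqF// /T two0.
by rewrite ler_wpM2l ?sum// divr_ge0 ?mulr_ge0 ?expR_ge0// ltW.
Qed.

(** The dual of [shell_energy]: [adjoint_bound] asks for the energy estimate with bounded test
    functions only, and these make all the integrability conditions automatic. *)
Lemma shell_estimate : exists2 C, 0 <= C &
  forall b (v : Rn R n -> R) D (om : Rn R n -> R) M Th r J (G : Rn R n -> R),
  measurable_fun setT v -> (forall x, 0 <= v x) -> morrey v (n%:R - alpha) D ->
  rint L om -> (forall x, 0 <= om x) -> (forall x, om x <= M) ->
  0 <= Th -> (forall x, om x <= Th * v x) -> 0 < r ->
  rint L G -> rint L (fun xi => G xi ^+ 2) -> (forall xi, ~ shell r J xi -> G xi = 0) ->
  \int[L]_x (om x * oscT b G x ^+ 2) <=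
  C / 2 ^+ J * (shell_bound r M (Th * D) 0 + \sum_(j < J) shell_bound r M (Th * D) j) *
  \int[L]_xi (G xi ^+ 2).
Proof.
have [C C0 hC] := shell_energy; exists C => // b v D om M Th r J G mv v0 hv rom om0 omM
  Th0 omv r0 rG rG2 GS.
have M0 : 0 <= M by apply: le_trans (om0 [tuple 0 | i < n]) (omM _).
have D0 : 0 <= D.
  have := hv [tuple 0 | i < n] 1 ltr01; rewrite powR1 mulr1 -lee_fin; apply: le_trans.
  by apply: integral_ge0 => y _; rewrite lee_fin mulr_ge0.
have s0 j : 0 <= shell_bound r M (Th * D) j.
  by rewrite le_min !mulr_ge0 ?powR_ge0// exprn_ge0.
apply: (adjoint_bound (S := shell r J) b _ _ rom om0 _ rG rG2 GS).
- exact: measurable_shell.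
- by rewrite mulr_ge0 ?divr_ge0 ?exprn_ge0// addr_ge0// sumr_ge0.
- by exists M.
- move=> e me [N eN]; have mom := rint_measurable rom.
  have rh : rint L (fun x => om x * e x).
    by apply: eq_rint (rint_mulb me eN rom) => x; exact: mulrC.
  apply: (hC v) => //.
  by apply: eq_rint (rint_mulb me eN rh) => x; ring.
Qed.

End Shell.

(** * Summation over the level sets of the weight *)

Section LevelSum.
Context {R : realType}.
Implicit Types (s d : R).

Lemma two_powR_gt1 (d : R) : 0 < d -> 1 < 2 `^ d.
Proof.
move=> d0; have {1}<- : 1 `^ d = 1 by rewrite powR1.
by rewrite gt0_ltr_powR ?nnegrE ?ltr1n.
Qed.

(* [Psi s = 6 / (2 ^ d - 1) * s ^ d / (1 + s ^ d)] is bounded and its increments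
   over the dyadic step from [s] to [2 s] dominate the summand. *)
Lemma dyadic_min_sum (beta : R) : 1 < beta -> exists2 K, 0 <= K &
  forall s N, 0 < s ->
  \sum_(i < N) Num.min (2 ^+ i * s) ((2 ^+ i * s) `^ (1 - beta)) <= K.
Proof.
(* As [d <= 1] and [d <= beta - 1], one has [u <= u^d] for [u <= 1] and [u^(1 - beta) <= u^(-d)] for
   [u > 1]; both branches of the minimum are thus measured by the one quantity [u^d]. *)
move=> b1; pose d := Num.min (beta - 1) 1.
have d0 : 0 < d by rewrite lt_min subr_gt0 b1 ltr01.
have d1 : d <= 1 by rewrite ge_min lexx orbT.
have db : d <= beta - 1 by rewrite ge_min lexx.
pose c : R := 2 `^ d; have c1 : 1 < c by exact: two_powR_gt1.
have c2 : c <= 2 by rewrite /c -[leRHS]powRr1// ler_powR// ler1n.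
pose K := 6 / (c - 1).
have K0 : 0 <= K by rewrite divr_ge0// subr_ge0 ltW.
exists K => // s N s0.
pose Psi (s : R) := K * (s `^ d / (1 + s `^ d)).
have Psi0 (u : R) : 0 <= Psi u <= K.
  have u0 : 0 <= u `^ d by exact: powR_ge0.
  have u1 : 0 < 1 + u `^ d by rewrite ltr_pwDl.
  apply/andP; rewrite /Psi; split.
    by apply: mulr_ge0 => //; rewrite divr_ge0 ?(ltW u1).
  by apply: ler_piMr => //; rewrite ler_pdivrMr// mul1r lerDr.
have step (u : R) : 0 < u -> Num.min u (u `^ (1 - beta)) <= Psi (2 * u) - Psi u.
  move=> u0; rewrite /Psi powRM ?(ltW u0)// -/c.
  set q := u `^ d; have q0 : 0 < q by rewrite powR_gt0.
  have c0 : 0 < c by exact: lt_trans c1.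
  have q10 : 0 < 1 + q by rewrite addr_gt0.
  have cq10 : 0 < 1 + c * q by rewrite addr_gt0// mulr_gt0.
  have E : K * (c * q / (1 + c * q)) - K * (q / (1 + q)) =
      6 * q / ((1 + q) * (1 + c * q)).
    by rewrite /K; field; rewrite !gt_eqF ?subr_gt0.
  have den0 : 0 < (1 + q) * (1 + c * q) by rewrite mulr_gt0.
  have cq : c * q <= 2 * q by rewrite ler_wpM2r// ltW.
  rewrite E ler_pdivlMr//; have [u1|u1] := leP u 1.
    have uq : u <= q by apply: ger1_powR => //; rewrite u0 u1.
    have q1 : q <= 1.
      have <- : 1 `^ d = 1 by rewrite powR1.
      by rewrite ge0_ler_powR ?nnegrE ?(ltW d0) ?(ltW u0).
    apply: (@le_trans _ _ (q * 6)); last by rewrite mulrC.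
    apply: ler_pM => //.
    - by rewrite le_min powR_ge0 ltW.
    - exact: ltW.
    - by rewrite ge_min uq.
    - have : (1 + q) * (1 + c * q) <= 2 * 3.
        apply: ler_pM; [by lra| |by lra|by lra].
        by rewrite addr_ge0// mulr_ge0// ltW.
      lra.
  have uq : u `^ (1 - beta) <= q^-1.
    by rewrite /q -powRN ler_powR// ?(ltW u1)//; lra.
  have q1 : 1 <= q.
    by rewrite /q -[leLHS](powRr0 u) ler_powR// ltW.
  apply: (@le_trans _ _ (q^-1 * (2 * q * (3 * q)))).
    apply: ler_pM => //.
    - by rewrite le_min powR_ge0 ltW.
    - exact: ltW.
    - by rewrite ge_min uq orbT.
    - apply: ler_pM; [by lra| |by lra|by lra].
      by rewrite addr_ge0// mulr_ge0// ltW.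
  by rewrite le_eqVlt; apply/orP; left; apply/eqP; field; rewrite gt_eqF.
suff : \sum_(i < N) Num.min (2 ^+ i * s) ((2 ^+ i * s) `^ (1 - beta)) <=
    Psi (2 ^+ N * s) - Psi s.
  move=> h; apply: le_trans h _.
  have /andP[_ h1] := Psi0 (2 ^+ N * s); have /andP[h2 _] := Psi0 s; lra.
elim: N => [|N ih]; first by rewrite big_ord0 expr0 mul1r subrr.
rewrite big_ord_recr /=; have p0 : 0 < 2 ^+ N * s by rewrite mulr_gt0// exprn_gt0.
have := step _ p0; rewrite exprS -mulrA; lra.
Qed.

(** The two terms are equal at [lam = (B / A)^(1/beta)], where their common value is
    [A lam = A^(1 - 1/beta) B^(1/beta)]. Measuring the levels in units of [lam] reduces the sum to
    the case [A = B = 1]. *)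
Lemma level_sum (beta : R) : 1 < beta -> exists2 K, 0 <= K &
  forall A B s N, 0 < A -> 0 < B -> 0 < s ->
  \sum_(i < N) Num.min (A * (2 ^+ i * s)) (B * (2 ^+ i * s) `^ (1 - beta)) <=
  K * (A `^ (1 - beta^-1) * B `^ (beta^-1)).
Proof.
move=> b1; have [K K0 hK] := dyadic_min_sum b1; exists K => // A B s N A0 B0 s0.
have beta0 : 0 < beta by exact: lt_trans b1.
pose lam := (B / A) `^ beta^-1.
have BA0 : 0 < B / A by rewrite divr_gt0.
have lam0 : 0 < lam by rewrite powR_gt0.
have lamb : lam `^ beta = B / A by rewrite -powRrM mulVf ?gt_eqF// powRr1// ltW.
have E1 : A * lam = A `^ (1 - beta^-1) * B `^ beta^-1.
  rewrite /lam powRM ?invr_ge0 ?ltW// mulrCA -(powR_inv1 (ltW A0)) -powRrM mulN1r.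
  by rewrite -{1}[A]powRr1 ?(ltW A0)// -powRD ?(gt_eqF A0) ?implybT// mulrC.
have E2 : B * lam `^ (1 - beta) = A * lam.
  rewrite powRB ?(gt_eqF lam0) ?implybT// lamb powRr1 ?(ltW lam0)//.
  by field; rewrite !gt_eqF.
rewrite -E1 mulrC (_ : \sum_(i < N) _ = A * lam * \sum_(i < N)
  Num.min (2 ^+ i * (s / lam)) ((2 ^+ i * (s / lam)) `^ (1 - beta))).
  apply: ler_wpM2l; first by rewrite mulr_ge0 ?(ltW A0) ?(ltW lam0).
  by apply: hK; rewrite divr_gt0.
rewrite mulr_sumr; apply: eq_bigr => i _.
rewrite minr_pMr; last by rewrite mulr_ge0 ?(ltW A0) ?(ltW lam0).
have t0 : 0 <= 2 ^+ i * (s / lam).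
  by rewrite mulr_ge0 ?exprn_ge0 ?divr_ge0 ?ltW.
have -> : 2 ^+ i * s = lam * (2 ^+ i * (s / lam)) by field; rewrite gt_eqF.
by rewrite (mulrA A) powRM ?(ltW lam0)// (mulrA B) E2.
Qed.

Lemma geometric_sum_le (q : R) J : 0 <= q -> q < 1 -> \sum_(j < J) q ^+ j <= (1 - q)^-1.
Proof.
move=> q0 q1; have q1' : 0 < 1 - q by rewrite subr_gt0.
rewrite -[leRHS]mul1r ler_pdivlMr//.
suff -> : (\sum_(j < J) q ^+ j) * (1 - q) = 1 - q ^+ J by rewrite gerBl exprn_ge0.
elim: J => [|J ih]; first by rewrite big_ord0 mul0r expr0 subrr.
by rewrite big_ord_recr /= mulrDl ih exprS; ring.
Qed.

End LevelSum.

Section Truncation.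
Context {R : realType} (n : nat).
Local Notation L := (@lebesgueRn R n).
Implicit Types (w : Rn R n -> R).

Definition vzero : Rn R n := [tuple 0 | i < n].

Lemma cube_fin (x : Rn R n) rho : (L (cube x rho) < +oo)%E.
Proof.
rewrite (_ : cube x rho = [set y | forall i,
  `[(tnth x i : R) - rho, tnth x i + rho]%classic (tnth y i)]); last first.
  by apply/seteqP; split => y /= h i; have := h i; rewrite in_itv/= ler_distl.
rewrite (lebesgueRn_prod (A := fun i => `[(tnth x i : R) - rho, tnth x i + rho]%classic))//.
set P := (\prod_(i < n) _)%E; suff /andP[] : (0 <= P < +oo)%E by [].
rewrite /P.
elim/big_ind: _ => [|a b /andP[a0 ao] /andP[b0 bo]|i _]; first by rewrite lee01 ltry.
  by rewrite mule_ge0// lte_mul_pinfty// ge0_fin_numE.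
rewrite measure_ge0 lebesgue_measure_itv/=.
by case: ifP => _; rewrite ?ltry// -EFinB ltry.
Qed.

(** On this set the weight is bounded and integrable, and only the [2 N] dyadic levels between
    [2^-N] and [2^N] occur. *)
Definition truncset w (N : nat) : set (Rn R n) :=
  cube (vzero) N%:R `&` [set x | 2^-1 ^+ N < w x <= 2 ^+ N].

Lemma measurable_level w a b : measurable_fun setT w ->
  measurable [set x | a < w x <= b].
Proof.
move=> mw; rewrite -[X in measurable X]setTI.
rewrite (_ : [set x | _] = w @^-1` `]a, b]%classic); first exact: mw.
by apply/seteqP; split => x /=; rewrite in_itv.
Qed.

Lemma in_truncset w x : 0 < w x ->
  \forall N \near \oo, x \in truncset w N.
Proof.
move=> wx.
pose S := \sum_(i < n) `|tnth x i : R| + w x + (w x)^-1.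
exists (Num.truncn S).+1 => // N /= hN.
have wV : 0 < (w x)^-1 by rewrite invr_gt0.
have s0 : 0 <= \sum_(i < n) `|tnth x i : R| by exact: sumr_ge0.
have SN : S <= N%:R.
  by apply: (le_trans (ltW (truncnS_gt _))); rewrite ler_nat.
have N2 : N%:R < 2 ^+ N :> R by rewrite -natrX ltr_nat ltn_expl.
rewrite inE; split => /=.
  move=> i; rewrite tnth_mktuple subr0.
  apply: (@le_trans _ _ (\sum_(i < n) `|tnth x i : R|)).
    by rewrite (bigD1 i)//= lerDl sumr_ge0.
  apply: le_trans SN; rewrite /S; lra.
apply/andP; split; last by move: SN; rewrite /S; lra.
rewrite exprVn -[ltRHS]invrK ltf_pV2 ?posrE ?exprn_gt0// ?invr_gt0//.
move: SN; rewrite /S; lra.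
Qed.

End Truncation.

Arguments vzero {R n}.

Section WeightedShell.
Context {R : realType} (n : nat).
Local Notation L := (@lebesgueRn R n).
Variables (alpha beta : R).
Hypotheses (n0 : (0 < n)%N) (beta1 : 1 <= beta)
  (alpha1 : beta + (n%:R - 1) / 2 < alpha).

Let alpha0 : 0 <= alpha.
Proof.
apply: le_trans (ltW alpha1); apply: addr_ge0; first exact: le_trans beta1.
by rewrite divr_ge0// subr_ge0 ler1n.
Qed.

Let beta0 : 0 < beta. Proof. exact: lt_le_trans beta1. Qed.

(** The decay per step in [j] that is left after the sum over the levels. The hypothesis on [alpha]
    says that the exponent is negative, that is, [q < 1]. *)
Let q : R := 2 `^ (- ((alpha - (n%:R + 1) / 2 + 1 - beta) / beta)).

Let q0 : 0 < q. Proof. by rewrite powR_gt0. Qed.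

Let q1 : q < 1.
Proof.
have bb := beta0; have aa := alpha1.
rewrite /q powRN; set e := _ / beta.
have e0 : 0 < e by rewrite divr_gt0//; lra.
by rewrite invf_lt1 ?powR_gt0// two_powR_gt1.
Qed.

Let qE j : q ^+ j = (2 ^+ j) `^ (- ((alpha - (n%:R + 1) / 2 + 1 - beta) / beta)).
Proof.
rewrite -(powR_mulrn j (ltW q0)) /q -powRrM mulrC powRrM.
by rewrite (powR_mulrn j (ler0n _ 2)).
Qed.

(** On the level [t < w <= 2 t] one has [w <= 2 t] and, as [1 - beta < 0], also
    [w <= t^(1 - beta) w^beta]. The maximum of a piece and its constant [Th] thus scale in opposite
    directions, and [level_sum] adds up the smaller bounds. *)
Lemma level_decomposition : exists2 K, 0 <= K &
  forall (w : Rn R n -> R) D r N, measurable_fun setT w -> (forall x, 0 <= w x) ->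
  0 < D -> 0 < r -> exists (m : nat) (om : 'I_m -> Rn R n -> R) (M Th : 'I_m -> R),
  [/\ forall i, rint L (om i) /\ forall x, 0 <= om i x <= M i,
      forall i, 0 <= Th i /\ forall x, om i x <= Th i * w x `^ beta,
      forall x, \sum_(i < m) om i x = \1_(truncset w N) x * w x &
      forall j, \sum_(i < m) shell_bound n alpha r (M i) (Th i * D) j <=
        K * (r `^ (alpha / beta) * D `^ (beta^-1)) * q ^+ j].
Proof.
have trunc_rint (w : Rn R n -> R) (A : set (Rn R n)) N (M : R) :
    measurable_fun setT w -> measurable A -> A `<=` cube vzero N ->
    0 <= M -> (forall x, 0 <= w x) ->
    (forall x, A x -> w x <= M) -> rint L (fun x => \1_A x * w x) /\
    forall x, 0 <= \1_A x * w x <= M.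
  move=> mw mA AN M0 w0 wM.
  have b x : 0 <= \1_A x * w x <= M.
    rewrite indicE; have [/set_mem Ax|_] := boolP (x \in A).
      by rewrite mul1r w0 wM.
    by rewrite mul0r lexx M0.
  split=> //; apply: (@rint_bounded _ _ _ L (cube vzero N) M).
  - exact: measurable_cube.
  - exact: cube_fin.
  - by apply: measurable_funM => //; exact: measurable_indic.
  - by move=> x; case/andP: (b x) => h1 h2; rewrite ger0_norm.
  - move=> x Nx; rewrite indicE memNset ?mul0r// => Ax; exact/Nx/AN.
(* For [beta = 1] all the powers [t^(1 - beta)] are 1 and the levels cannot be summed. Then the
   truncated weight is taken as a single piece, since the Schur bound alone decays in [j]. *)
have [bE|bN] := eqVneq beta 1.
  exists 1 => // w D r N mw w0 D0 r0.
  exists 1%N, (fun _ x => \1_(truncset w N) x * w x), (fun=> 2 ^+ N), (fun=> 1).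
  have mT : measurable (truncset w N).
    by apply: measurableI; [exact: measurable_cube|exact: measurable_level].
  split.
  - move=> _; apply: trunc_rint => //; first exact: subIsetl.
    by move=> x [_ /= /andP[]].
  - move=> _; split => // x; rewrite bE powRr1// mul1r ler_piMl// indicE.
  - by move=> x; rewrite big_ord1.
  - move=> j; rewrite big_ord1 !mul1r qE bE invr1 !mulr1 !powRr1 ?(ltW D0)// addrK.
    rewrite /shell_bound; apply: (@le_trans _ _ (r `^ alpha * (2 ^+ j) `^ (- (alpha - (n%:R + 1) / 2)) * D)).
      by rewrite ge_min lexx orbT.
    by rewrite le_eqVlt; apply/orP; left; apply/eqP; ring.
have b1 : 1 < beta by rewrite lt_neqAle eq_sym bN.
have [K K0 hK] := level_sum b1.
exists (K * 2 `^ (1 - beta^-1)); first by rewrite mulr_ge0// powR_ge0.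
move=> w D r N mw w0 D0 r0.
pose t (i : nat) : R := 2 ^+ i * 2^-1 ^+ N.
have t0 i : 0 < t i by rewrite mulr_gt0 ?exprn_gt0.
have tS i : t i.+1 = 2 * t i by rewrite /t exprS mulrA.
pose A i := cube vzero N%:R `&` [set x | t i < w x <= t i.+1].
have mA i : measurable (A i).
  by apply: measurableI; [exact: measurable_cube|exact: measurable_level].
exists (N + N)%N, (fun i x => \1_(A i) x * w x), (fun i => t i.+1),
  (fun i => (t i) `^ (1 - beta)).
split.
- move=> i; apply: trunc_rint => //; first exact: subIsetl.
    exact: ltW.
  by move=> x [_ /= /andP[]].
- move=> i; split; first exact: powR_ge0.
  move=> x; rewrite indicE; have [/set_mem[_ /= /andP[tw _]]|_] := boolP (x \in A i); last first.
    by rewrite mul0r mulr_ge0// powR_ge0.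
  have wx0 : 0 < w x by exact: lt_trans tw.
  rewrite mul1r -[leLHS]powRr1// -{1}(subrK beta 1) powRD ?(gt_eqF wx0) ?implybT//.
  rewrite ler_wpM2r ?powR_ge0//.
  rewrite -(opprB beta) !powRN lef_pV2 ?posrE ?powR_gt0//.
  by rewrite ge0_ler_powR ?subr_ge0 ?nnegrE ?ltW.
- move=> x; rewrite -mulr_suml; congr (_ * _).
  have ind a b : \1_(cube vzero N%:R `&` [set x | a < w x <= b]) x =
      \1_(cube vzero N%:R) x * ((a < w x <= b)%R : bool)%:R :> R.
    rewrite !indicE in_setI; case: (x \in cube _ _); rewrite ?mul0r// mul1r.
    have -> // : (x \in [set u | a < w u <= b]) = (a < w x <= b)%R.
    by apply/idP/idP; rewrite inE.
  have part k : \sum_(i < k) \1_(A i) x =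
      \1_(cube vzero N%:R) x * ((t 0 < w x <= t k)%R : bool)%:R :> R.
    elim: k => [|k ih].
      rewrite big_ord0; case: (boolP (t 0 < w x <= t 0)%R) => [/andP[h1 h2]|_].
        by move: (lt_le_trans h1 h2); rewrite ltxx.
      by rewrite mulr0.
    rewrite big_ord_recr /= ih ind -mulrDr; congr (_ * _).
    have tk : t k <= t k.+1 by rewrite tS mulrDl mul1r lerDl ltW.
    have t0k : t 0 <= t k.
      by rewrite ler_wpM2r ?exprn_ge0// ler_eXn2l ?ltr1n.
    have [wk|wk] := leP (w x) (t k).
      by rewrite (le_trans wk tk) andbT addr0.
    by rewrite (le_lt_trans t0k wk) /= add0r.
  rewrite part -ind.
  rewrite /truncset /t expr0 mul1r exprD -mulrA -exprMn mulfV// expr1n mulr1.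
  by [].
- move=> j.
  (* The factor 2 comes from the maximum [t i.+1 = 2 * t i] of the weight on the level [i]. *)
  have A0 : (0 : R) < 2 ^+ j * 2 by rewrite mulr_gt0// exprn_gt0.
  have B0 : 0 < r `^ alpha * (2 ^+ j) `^ (- (alpha - (n%:R + 1) / 2)) * D.
    by rewrite !mulr_gt0 ?powR_gt0// exprn_gt0.
  have := hK _ _ (2^-1 ^+ N) (N + N)%N A0 B0 _; rewrite exprn_gt0// => /(_ isT).
  rewrite (eq_bigr (fun i : 'I_(N + N) => shell_bound n alpha r (t i.+1) (t i `^ (1 - beta) * D) j));
    last first.
    move=> i _; rewrite /shell_bound -/(t i) tS !mulrA; congr Num.min.
    by rewrite -!mulrA; congr (_ * (_ * _)); rewrite mulrC.
  move=> h; apply: le_trans h _; rewrite -!mulrA ler_wpM2l//.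
  rewrite qE; set X : R := 2 ^+ j; have X0 : 0 < X by rewrite exprn_gt0.
  have -> : X `^ (- ((alpha - (n%:R + 1) / 2 + 1 - beta) / beta)) =
      X `^ (1 - beta^-1) * X `^ (- (alpha - (n%:R + 1) / 2) * beta^-1).
    rewrite -powRD ?(gt_eqF X0) ?implybT//; congr (_ `^ _); field.
    by rewrite gt_eqF.
  clearbody X; rewrite (powRM _ (ltW X0) (ler0n _ 2)).
  rewrite (powRM _ (powR_ge0 _ _) (mulr_ge0 (powR_ge0 _ _) (ltW D0))).
  rewrite (powRM _ (powR_ge0 _ _) (ltW D0)) -!powRrM -/(alpha / beta).
  move: (X `^ _) (X `^ _) (r `^ _) (D `^ _) (2 `^ _) => u1 u2 u3 u4 u5.
  by rewrite le_eqVlt; apply/orP; left; apply/eqP; ring.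
Qed.

(** [shell_estimate] is applied to each level, and the truncation of the weight is removed by
    Fatou's lemma; the constants do not depend on the truncation. *)
Lemma weighted_shell : exists2 C, 0 <= C &
  forall b (w : Rn R n -> R) D r J (G : Rn R n -> R),
  measurable_fun setT w -> (forall x, 0 <= w x) ->
  morrey (fun x => w x `^ beta) (n%:R - alpha) D -> 0 < D -> 0 < r ->
  rint L G -> rint L (fun xi => G xi ^+ 2) -> (forall xi, ~ shell r J xi -> G xi = 0) ->
  (\int[L]_x (w x * oscT b G x ^+ 2)%:E <=
   (C / 2 ^+ J * (r `^ (alpha / beta) * D `^ (beta^-1)) * \int[L]_xi (G xi ^+ 2))%:E)%E.
Proof.
have [K K0 hK] := level_decomposition.
have [C C0 hC] := shell_estimate n0 alpha0.
have K10 : 0 <= K * (1 + (1 - q)^-1).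
  by rewrite mulr_ge0// addr_ge0// invr_ge0 subr_ge0; exact: ltW.
exists (C * (K * (1 + (1 - q)^-1))) => [|b w D r J G mw w0 hw D0 r0 rG rG2 GS].
  exact: mulr_ge0.
have mv : measurable_fun setT (fun x => w x `^ beta).
  exact: (measurableT_comp (measurable_powR beta) mw).
have v0 x : 0 <= w x `^ beta by exact: powR_ge0.
have mo := measurable_oscT b rG.
have mtr N : measurable_fun setT (fun x => \1_(truncset w N) x * w x * oscT b G x ^+ 2).
  apply: measurable_funM; last exact: measurable_funX.
  apply: measurable_funM => //; apply: measurable_indic.
  by apply: measurableI; [exact: measurable_cube|exact: measurable_level].
apply: (@fatou_bound _ _ _ L (fun N x => \1_(truncset w N) x * w x * oscT b G x ^+ 2)).
- exact: mtr.
- by move=> N x; apply: mulr_ge0; [exact: mulr_ge0|exact: sqr_ge0].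
- move=> x; have := w0 x; rewrite le_eqVlt => /predU1P[<-|wx].
    by under eq_fun do rewrite mulr0; exact: cvg_cst.
  apply: cvg_near_cst; apply: filterS (in_truncset wx) => N xN.
  by rewrite indicE xN mul1r.
move=> N; have [m [om [M [Th [h1 h2 h3 h4]]]]] := hK w D r N mw w0 D0 r0.
have ro i : rint L (fun x => om i x * oscT b G x ^+ 2).
  apply: eq_rint (rint_mulb (M := (\int[L]_xi `|G xi|) ^+ 2) (measurable_funX 2 mo) _ (h1 i).1).
    by move=> x; exact: mulrC.
  move=> x; rewrite normrX; have := oscT_le b x rG => h.
  by rewrite ler_pXn2r ?nnegrE//; exact: le_trans h.
have rs : rint L (fun x => \1_(truncset w N) x * w x * oscT b G x ^+ 2).
  by apply: eq_rint (rint_sum (index_enum 'I_m) ro) => x; rewrite -h3 mulr_suml.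
rewrite -RintE// lee_fin.
have -> : \int[L]_x (\1_(truncset w N) x * w x * oscT b G x ^+ 2) =
    \sum_(i < m) \int[L]_x (om i x * oscT b G x ^+ 2).
  by rewrite -Rint_sum//; apply: eq_Rintegral => x _; rewrite -h3 mulr_suml.
have P0 : 0 <= \int[L]_xi (G xi ^+ 2) by apply: Rintegral_ge0 => x _; exact: sqr_ge0.
apply: (@le_trans _ _ (\sum_(i < m) (C / 2 ^+ J * (shell_bound n alpha r (M i) (Th i * D) 0 +
   \sum_(j < J) shell_bound n alpha r (M i) (Th i * D) j) * \int[L]_xi (G xi ^+ 2)))).
  apply: ler_sum => i _; apply: (hC b (fun x => w x `^ beta) D) => //.
  - exact: (h1 i).1.
  - by move=> x; case/andP: ((h1 i).2 x).
  - by move=> x; case/andP: ((h1 i).2 x).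
  - exact: (h2 i).1.
  - exact: (h2 i).2.
(* After the exchange the sum over the levels is inside, where [h4] bounds it by a multiple of
   [q^j]; the outer series is geometric. *)
rewrite -mulr_suml ler_wpM2r// -mulr_sumr big_split/= exchange_big/=.
set B := r `^ _ * _ in h4 *; have B0 : 0 <= B by rewrite mulr_ge0// powR_ge0.
have -> : C * (K * (1 + (1 - q)^-1)) / 2 ^+ J * B =
  C / 2 ^+ J * (K * B * (1 + (1 - q)^-1)) by ring.
rewrite ler_wpM2l ?divr_ge0 ?exprn_ge0// mulrDr mulr1 lerD//.
  by have := h4 0%N; rewrite expr0 mulr1.
apply: (@le_trans _ _ (\sum_(j < J) K * B * q ^+ j)); first by apply: ler_sum => j _.
rewrite -mulr_sumr; apply: ler_wpM2l; first exact: mulr_ge0.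
by apply: geometric_sum_le => //; exact: ltW.
Qed.

End WeightedShell.

(** Adding the dominating function makes the integrand nonnegative, so that Tonelli's theorem gives
    measurability in the parameter; its integral is then subtracted. *)
Lemma measurable_Rint_param d1 d2 (X : measurableType d1) (Y : measurableType d2)
    (R : realType) (m : {sigma_finite_measure set Y -> \bar R})
    (f : X * Y -> R) (b : Y -> R) :
  measurable_fun setT f -> (forall x y, `|f (x, y)| <= b y) -> rint m b ->
  measurable_fun setT (fun x => \int[m]_y f (x, y)).
Proof.
move=> mf fb rb; have mb := rint_measurable rb.
have rf x : rint m (fun y => f (x, y)).
  by apply: (rint_le _ (fb x) rb); exact: measurable_section1.
have mfb : measurable_fun setT (fun z : X * Y => f z + b z.2).
  by apply: measurable_funD => //; exact: measurable_snd_comp.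
have fb0 z : 0 <= f z + b z.2.
  by case: z => x y /=; have := fb x y; rewrite ler_norml => /andP[h _]; lra.
have mE := measurable_tonelli1 m mfb fb0.
have : measurable_fun setT (fun x => fine (\int[m]_y (f (x, y) + b y)%:E)%E - \int[m]_y b y).
  apply: measurable_funB => //; exact: (measurableT_comp _ mE).
apply: eq_measurable_fun => x _.
rewrite -[fine _]/(\int[m]_y (f (x, y) + b y)) RintD//.
by rewrite addrK.
Qed.

(** * Smoothing on an annulus *)

Section BesselLine.
Context {R : realType}.
Local Notation mu := (@lebesgue_measure R).

Lemma rint_lebesgueRn0 : rint (@lebesgueRn R 0) (fun=> 1).
Proof.
apply: ge0_rint => //; by rewrite integral_lebesgueRn0 ltry.
Qed.

Lemma lebesgueRn1 (f : R -> R) : rint mu f ->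
  rint (@lebesgueRn R 1) (fun x => f (tnth x ord0)) /\
  \int[@lebesgueRn R 1]_x f (tnth x ord0) = \int[mu]_t f t.
Proof.
move=> rf; have mf := rint_measurable rf.
have [||r E] := @rint_lebesgueRnS R 0 (fun x => f (tnth x ord0)) (fun t => `|f t|) (fun=> 1)
  _ (rint_norm rf) rint_lebesgueRn0.
  exact: (measurableT_comp mf (measurable_tnth ord0)).
  by move=> x y; rewrite tnth0 mulr1.
split=> //; rewrite E; apply: eq_Rintegral => t _.
by rewrite /Rintegral integral_lebesgueRn0 /= tnth0.
Qed.

(** The case [n = 1] of [bessel], carried from 1-tuples to the line and restricted to one of the two
    squares of [energyT]. *)
Lemma bessel_line c (h : R -> R) : rint mu h -> rint mu (fun u => h u ^+ 2) ->
  (\int[mu]_t ((\int[mu]_u (h u * osc c (u * t))) ^+ 2)%:E <=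
   (2 * pi * \int[mu]_u (h u ^+ 2))%:E)%E.
Proof.
move=> rh rh2; have [r1 _] := lebesgueRn1 rh; have [r2 E2] := lebesgueRn1 rh2.
have := bessel r1 r2; rewrite E2 expr1; apply: le_trans.
rewrite ge0_integral_lebesgueRnS; last 2 first.
- by apply/measurable_EFinP; exact: measurable_energyT.
- by move=> x; rewrite lee_fin energyT_ge0.
have E t : oscT c (fun x : Rn R 1 => h (tnth x ord0)) (cons_point (t, [tuple])) =
    \int[mu]_u (h u * osc c (u * t)).
  have rr : rint mu (fun u => h u * osc c (u * t)).
    by apply: rint_osc => //; exact: measurable_funM.
  rewrite -(lebesgueRn1 rr).2.
  apply: eq_Rintegral => x _; congr (_ * osc _ _).
  by rewrite /dot big_ord1 tnth0 mulrC.
apply: ge0_le_integral => //.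
- by move=> t _; rewrite lee_fin sqr_ge0.
- apply/measurable_EFinP; apply: measurable_funX.
  apply: (measurable_Rint_param (f := fun z : measurableTypeR R * measurableTypeR R =>
    h z.2 * osc c (z.2 * z.1)) _ _ (rint_norm rh)).
    apply: measurable_funM; first exact: (measurable_snd_comp (rint_measurable rh)).
    by apply: measurable_osc_comp; apply: measurable_funM;
      [exact: measurable_snd|exact: measurable_fst].
  by move=> t u; rewrite normrM ler_piMr// normr_osc_le1.
- under eq_fun do rewrite integral_lebesgueRn0.
  apply/measurable_EFinP; apply: (measurableT_comp (measurable_energyT r1)).
  have := @measurable_cons_point R 0.
  by move=> /(measurable_section2 ([tuple] : 0.-tuple (measurableTypeR R))).
- move=> t _; rewrite integral_lebesgueRn0 lee_fin -E; exact: oscT_sqr_le.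
Qed.

End BesselLine.

Section Window.
Context {R : realType}.
Local Notation mu := (@lebesgue_measure R).
Variable del : R.
Hypothesis del0 : 0 < del.

Definition window (N : R) : set R := `[N - del / 2, N + del / 2]%classic.

(** The Fourier transform of the indicator function of an interval of length [del] centred at 0,
    with its limit value at [t = 0]. *)
Definition wfactor (t : R) : R := if t == 0 then del else 2 * sin (del / 2 * t) / t.

Lemma sin_ge_half (u : R) : 0 <= u <= 2^-1 -> u / 2 <= sin u.
Proof.
move=> /andP[u0 u2].
have := @drv_ge0 R (fun t : R => sin t - t / 2) (fun t => cos t - 2^-1) 0 u u0.
rewrite sin0 mul0r subr0 subr_ge0; apply => t tu.
  by apply: (is_derive_eq (drvB (is_derive_sin t) (drvM (drv_id t) (drv_cst t 2^-1)))); rewrite mulr0 mul1r addr0.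
rewrite subr_ge0; case/andP: tu => t0 tu.
have := @drv_lip R cos (fun x => - sin x) 1 0 t t0 (fun x _ => is_derive_cos x) _.
rewrite cos0 subr0 mul1r => h.
have {h} : `|cos t - 1| <= t by apply: h => x _; rewrite normrN normr_sin_le1.
rewrite ler_norml => /andP[]; lra.
Qed.

(** For [|t| <= del^-1] the argument of the sine is at most [1/2], where [sin u >= u / 2]. This
    determines the length of the time interval that a frequency window of width [del] can
    control. *)
Lemma wfactor_ge t : `|t| <= del^-1 -> del ^+ 2 / 4 <= wfactor t ^+ 2.
Proof.
rewrite /wfactor; case: eqVneq => [_ _|t0 ht].
  by rewrite ler_pdivrMr// ler_peMr ?sqr_ge0// ler1n.
have key (u : R) : 0 < u -> u <= del^-1 -> del / 2 <= 2 * sin (del / 2 * u) / u.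
  move=> u0 ud; rewrite ler_pdivlMr//.
  have : del / 2 * u / 2 <= sin (del / 2 * u).
    apply: sin_ge_half; rewrite mulr_ge0 ?divr_ge0 ?(ltW del0) ?(ltW u0)//=.
    rewrite -[leRHS]mul1r mulrAC ler_wpM2r ?invr_ge0//.
    by rewrite mulrC -ler_pdivlMr// mul1r.
  lra.
have E : (2 * sin (del / 2 * t) / t) ^+ 2 = (2 * sin (del / 2 * `|t|) / `|t|) ^+ 2.
  case: (ger0P t) => // _; rewrite mulrN sinN mulrN mulNr invrN mulrN opprK.
  by [].
have nt : 0 < `|t| by rewrite normr_gt0.
have k := key _ nt ht.
rewrite E (_ : del ^+ 2 / 4 = (del / 2) ^+ 2); last by field.
have d0 : 0 <= del / 2 by rewrite divr_ge0// ltW.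
by rewrite ler_pXn2r ?nnegrE// (le_trans d0).
Qed.

Lemma window_osc c N t :
  \int[mu]_u (\1_(window N) u * osc c (u * t)) = wfactor t * osc c (t * N).
Proof.
have le1 : N - del / 2 <= N + del / 2 by have := del0; lra.
transitivity (\int[mu]_(u in window N) osc c (u * t)).
  by rewrite [RHS]Rint_indic//; exact: measurable_itv.
rewrite /window /wfactor; have [->|t0] := eqVneq t 0.
  rewrite mul0r; transitivity (\int[mu]_(u in `[N - del / 2, N + del / 2]) osc c 0).
    by apply: eq_Rintegral => u _; rewrite mulr0.
  pose F (u : R) := u * osc c 0.
  transitivity (F (N + del / 2) - F (N - del / 2)); last by rewrite /F; field.
  apply: (FTC le1) => u _; first exact: cvg_cst.
  by apply: (is_derive_eq (drvM (drv_id u) (drv_cst u (osc c 0)))); rewrite mulr0 addr0 mul1r.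
have dt (u : R) : is_derive u 1 (fun v : R => v * t) t.
  by apply: (is_derive_eq (drvM (drv_id u) (drv_cst u t))); rewrite mulr0 addr0 mul1r.
have co (u : R) : {for u, continuous (fun u : R => osc c (u * t))}.
  case: c; first exact: drv_continuous (drv_sin (dt u)).
  exact: drv_continuous (drv_cos (dt u)).
have e1 : (N + del / 2) * t = t * N + del / 2 * t by ring.
have e2 : (N - del / 2) * t = t * N - del / 2 * t by ring.
case: c co => co.
  pose F (u : R) := - (cos (u * t) / t).
  transitivity (F (N + del / 2) - F (N - del / 2)).
    apply: (FTC le1) => u _; first exact: co.
    apply: (is_derive_eq (drvN (drvM (drv_cos (dt u)) (drv_cst u t^-1)))).
    by rewrite /osc; move: (sin _) => S; field.
  by rewrite /F e1 e2 cosD cosB /osc; field.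
pose F (u : R) := sin (u * t) / t.
transitivity (F (N + del / 2) - F (N - del / 2)).
  apply: (FTC le1) => u _; first exact: co.
  apply: (is_derive_eq (drvM (drv_sin (dt u)) (drv_cst u t^-1))).
  by rewrite /osc; move: (cos _) => S; field.
by rewrite /F e1 e2 sinD sinB /osc; field.
Qed.

End Window.

Section ScaleLemmas.
Context {R : realType}.
Implicit Types (a b k m y : R).

Lemma dyadic_scale m : 1 <= m -> exists J, 2 ^+ J <= m < 2 * 2 ^+ J.
Proof.
move=> m1; have m0 : 0 <= m by exact: le_trans m1.
have t0 : (0 < Num.truncn m)%N by rewrite truncn_gt0.
have /andP[h1 h2] := trunc_log_bounds (isT : (1 < 2)%N) t0.
exists (trunc_log 2 (Num.truncn m)); apply/andP; split.
  by apply: le_trans (_ : (Num.truncn m)%:R <= m); rewrite -?natrX ?ler_nat// truncn_le.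
apply: (lt_le_trans (truncnS_gt m)).
by rewrite -exprS -natrX ler_nat.
Qed.

(** For [0 < k <= 2] the power lies between 1 and [y^2], and [|y^2 - 1| = (y + 1) |y - 1|]. *)
Lemma powR_sub1_le k y : 0 < k <= 2 -> 2^-1 <= y <= 3 / 2 ->
  `|y `^ k - 1| <= 5 / 2 * `|y - 1|.
Proof.
move=> /andP[k0 k2] /andP[y1 y2]; have y0 : 0 < y by lra.
have one : 1 `^ k = 1 :> R by rewrite powR1.
have y22 : y `^ 2 = y * y by rewrite (powR_mulrn 2 (ltW y0)) expr2.
have [h|h] := leP 1 y.
  have p1 : 1 <= y `^ k by rewrite -one ge0_ler_powR ?nnegrE ?(ltW k0) ?(ltW y0).
  have p2 : y `^ k <= y * y by rewrite -y22 ler_powR.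
  rewrite !ger0_norm ?subr_ge0//.
  have : 0 <= (y - 1) * (5 / 2 - (y + 1)) by rewrite mulr_ge0//; lra.
  nra.
have p1 : y `^ k <= 1.
  by rewrite -[leRHS]one ge0_ler_powR ?nnegrE ?(ltW k0) ?(ltW y0)// ltW.
have p2 : y * y <= y `^ k by rewrite -y22 ger_powR// y0 ltW.
rewrite !ler0_norm ?subr_le0// ?(ltW h)//.
have : 0 <= (1 - y) * (5 / 2 - (y + 1)) by rewrite mulr_ge0//; lra.
nra.
Qed.

Lemma powR_ratio_le k a b : 0 < a -> 0 < b -> a <= 2 * b -> b <= 2 * a ->
  a `^ k <= 2 `^ `|k| * b `^ k.
Proof.
move=> a0 b0 ab ba; have [k0|k0] := leP 0 k.
  by rewrite ger0_norm// -powRM ?(ltW b0)// ge0_ler_powR ?nnegrE ?mulr_ge0 ?(ltW a0) ?(ltW b0).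
rewrite ltr0_norm//.
have h : b `^ (- k) <= 2 `^ (- k) * a `^ (- k).
  rewrite -powRM ?(ltW a0)//.
  by rewrite ge0_ler_powR ?nnegrE ?mulr_ge0 ?(ltW a0) ?(ltW b0)// oppr_ge0 ltW.
rewrite -[k in a `^ k]opprK -[k in b `^ k]opprK [a `^ _]powRN [b `^ _]powRN.
by rewrite ler_pdivlMr ?powR_gt0// mulrC ler_pdivrMr ?powR_gt0.
Qed.

Lemma dyadic_scale_div (C del lam X : R) : 0 <= C -> 0 < del -> 0 < lam -> 0 < X ->
  2 * lam / (5 * del) < 2 * X -> C / X <= 5 * C * del / lam.
Proof.
move=> C0 d0 l0 X0; rewrite ltr_pdivrMr ?mulr_gt0// => h.
rewrite ler_pdivrMr// mulrAC ler_pdivlMr//.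
rewrite (_ : 5 * C * del * X = C * (5 * del * X)); last by ring.
by rewrite ler_wpM2l//; lra.
Qed.

End ScaleLemmas.

Section Smoothing.
Context {R : realType} (n : nat).
Local Notation L := (@lebesgueRn R n).
Local Notation mu := (@lebesgue_measure R).
Variables (alpha beta gamma : R).
Hypotheses (n0 : (0 < n)%N) (beta1 : 1 <= beta)
  (alpha1 : beta + (n%:R - 1) / 2 < alpha) (gamma1 : 1 <= gamma).

Definition disp (xi : Rn R n) : R := enorm xi `^ gamma.

Lemma measurable_enorm : measurable_fun setT (@enorm R n).
Proof.
apply: (@measurableT_comp _ _ _ _ _ _ (@Num.sqrt R)).
  by apply: continuous_measurable_fun; exact: sqrt_continuous.
exact: measurable_dot.
Qed.

Lemma measurable_disp : measurable_fun setT disp.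
Proof. exact: (measurableT_comp (measurable_powR gamma) measurable_enorm). Qed.

Lemma enorm_ge0 (x : Rn R n) : 0 <= enorm x.
Proof. exact: sqrtr_ge0. Qed.

Lemma dotE (x : Rn R n) : dot x x = enorm x ^+ 2.
Proof. by rewrite /enorm sqr_sqrtr// dot_ge0. Qed.

(** The real and imaginary parts of [exp(i x.xi)] and of [exp(i t |xi|^gamma)] are combined
    independently; the propagator is a linear combination of such integrals. *)
Definition wave b c (g : Rn R n -> R) (z : Rn R n * measurableTypeR R) : R :=
  \int[L]_xi (g xi * osc b (dot z.1 xi) * osc c (z.2 * disp xi)).

Lemma rint_wave b c g z : rint L g ->
  rint L (fun xi => g xi * osc b (dot z.1 xi) * osc c (z.2 * disp xi)).
Proof.
move=> rg; apply: rint_osc; first by apply: rint_osc => //; exact: measurable_dot.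
by apply: measurable_funM => //; exact: measurable_disp.
Qed.

Lemma measurable_wave b c g : rint L g -> measurable_fun setT (wave b c g).
Proof.
move=> rg; apply: (measurable_Rint_param (f := fun q : (Rn R n * measurableTypeR R) * Rn R n =>
  g q.2 * osc b (dot q.1.1 q.2) * osc c (q.1.2 * disp q.2)) _ _ (rint_norm rg)).
  have m1 : measurable_fun setT (fun q : (Rn R n * measurableTypeR R) * Rn R n => q.1).
    exact: measurable_fst.
  apply: measurable_funM.
    apply: measurable_funM; first exact: (measurable_snd_comp (rint_measurable rg)).
    apply: measurable_osc_comp; apply: measurable_dot; last exact: measurable_snd.
    exact: (measurableT_comp measurable_fst m1).
  apply: measurable_osc_comp; apply: measurable_funM.
    exact: (measurableT_comp measurable_snd m1).
  exact: (measurable_snd_comp measurable_disp).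
move=> z xi /=; rewrite -mulrA normrM ler_piMr// normrM -[leRHS]mul1r.
by rewrite ler_pM// normr_osc_le1.
Qed.

Section window.
Variables (g : Rn R n -> R) (lo hi del : R).
Hypotheses (rg : rint L g) (rg2 : rint L (fun xi => g xi ^+ 2)) (lo0 : 0 < lo)
  (supp : forall xi, g xi != 0 -> lo <= enorm xi <= hi).
Hypothesis del0 : 0 < del.

Let W (lam : measurableTypeR R) xi : R := \1_(window del (disp xi)) lam.

Let WE lam xi : W lam xi = (`|lam - disp xi| <= del / 2)%R%:R.
Proof.
rewrite /W indicE; congr ((_ : bool)%:R); apply/idP/idP.
  by rewrite inE /window /= in_itv/= ler_distl.
by rewrite inE /window /= in_itv/= ler_distl.
Qed.

Let W01 lam xi : 0 <= W lam xi <= 1.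
Proof. by rewrite WE; case: (`|lam - disp xi| <= del / 2)%R; rewrite ?lexx ?ler01. Qed.

Let W_norm lam xi : `|W lam xi| <= 1.
Proof. by case/andP: (W01 lam xi) => h1 h2; rewrite ger0_norm. Qed.

Let Wsq lam xi : W lam xi ^+ 2 = W lam xi.
Proof. by rewrite WE; case: (`|lam - disp xi| <= del / 2)%R; rewrite ?expr1n ?expr0n. Qed.

Let mW : measurable_fun setT (fun q : measurableTypeR R * Rn R n => W q.1 q.2).
Proof.
have m : measurable_fun setT (fun q : measurableTypeR R * Rn R n => q.1 - disp q.2).
  by apply: measurable_funB; [exact: measurable_fst|exact: (measurable_snd_comp measurable_disp)].
have mi : measurable_fun setT (\1_(window del 0) : measurableTypeR R -> R).
  by apply: measurable_indic; exact: measurable_itv.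
apply: eq_measurable_fun (measurableT_comp mi m) => q _ /=.
rewrite WE indicE; congr ((_ : bool)%:R); apply/idP/idP.
  by rewrite inE /window /= in_itv/= sub0r add0r ler_norml.
by rewrite inE /window /= in_itv/= sub0r add0r ler_norml.
Qed.

Let H := hi `^ gamma + del.

Let gamma0 : 0 < gamma. Proof. exact: lt_le_trans gamma1. Qed.

Let disp_bounds xi : g xi != 0 -> lo `^ gamma <= disp xi <= hi `^ gamma.
Proof.
move=> /supp /andP[h1 h2]; have hi0 : 0 <= hi by apply: le_trans h2; exact: enorm_ge0.
by rewrite /disp !ge0_ler_powR ?nnegrE ?(ltW gamma0) ?(ltW lo0) ?enorm_ge0.
Qed.

Let Wg_le lam xi : `|W lam xi * g xi| <= \1_`[- H, H] lam * `|g xi|.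
Proof.
have [g0|g0] := eqVneq (g xi) 0; first by rewrite g0 mulr0 normr0 mulr0.
rewrite normrM ler_wpM2r// WE indicE; case: (boolP (`|lam - disp xi| <= del / 2)%R) => [h|_]; last first.
  by rewrite normr0.
rewrite normr1 mem_set// /= in_itv/=.
have /andP[_ h2] := disp_bounds g0.
have : 0 <= disp xi by exact: powR_ge0.
move: h; rewrite ler_norml => /andP[]; have := del0; rewrite /H; lra.
Qed.

(** The part of the Fourier integral whose time frequency [disp xi] lies within [del / 2] of
    [lam]. *)
Let A b x (lam : measurableTypeR R) : R :=
  \int[L]_xi (W lam xi * g xi * osc b (dot x xi)).

Let mF b x : measurable_fun setT (fun q : measurableTypeR R * Rn R n =>
  W q.1 q.2 * g q.2 * osc b (dot x q.2)).
Proof.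
apply: measurable_funM.
  by apply: measurable_funM => //; exact: (measurable_snd_comp (rint_measurable rg)).
by apply: measurable_osc_comp; apply: measurable_dot => //; exact: measurable_snd.
Qed.

Let F_le b x lam xi : `|W lam xi * g xi * osc b (dot x xi)| <=
  \1_`[- H, H] lam * `|g xi|.
Proof.
by rewrite normrM (le_trans _ (Wg_le lam xi))// ler_piMr// normr_osc_le1.
Qed.

Let rA b x : rint mu (A b x).
Proof.
exact: (rint_fubinil (m1 := mu) (m2 := L) (mF b x) (F_le b x) (rint_itv _ _) (rint_norm rg)).
Qed.

Let A_le b x lam : `|A b x lam| <= \int[L]_xi `|g xi|.
Proof.
apply: norm_Rint_le; [exact: (measurable_section1 _ (mF b x))|exact: rint_norm|].
move=> xi; rewrite -mulrA normrM -[leRHS]mul1r ler_pM//.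
by rewrite normrM ler_piMr// normr_osc_le1.
Qed.

Let rA2 b x : rint mu (fun lam => A b x lam ^+ 2).
Proof.
by apply: eq_rint (rint_mulb (rint_measurable (rA b x)) (A_le b x) (rA b x)).
Qed.

(** Spreading each time frequency over a window multiplies the function of [t] by the transform of
    the window. The space-time function thereby becomes a Fourier transform in [lam] of an
    integrable function, to which Bessel's inequality applies. *)
Let window_identity b c x t :
  \int[mu]_lam (A b x lam * osc c (lam * t)) = wfactor del t * wave b c g (x, t).
Proof.
pose f (q : measurableTypeR R * Rn R n) :=
  W q.1 q.2 * g q.2 * osc b (dot x q.2) * osc c (q.1 * t).
have mf : measurable_fun setT f.
  apply: measurable_funM; first exact: mF.
  by apply: measurable_osc_comp; apply: measurable_funM => //; exact: measurable_fst.
have fle lam xi : `|f (lam, xi)| <= \1_`[- H, H] lam * `|g xi|.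
  by rewrite normrM (le_trans _ (F_le b x lam xi))// ler_piMr// normr_osc_le1.
transitivity (\int[mu]_lam \int[L]_xi f (lam, xi)).
  apply: eq_Rintegral => lam _; rewrite mulrC -RintZl.
    by apply: eq_Rintegral => xi _; rewrite mulrC.
  exact: (rint_sectionl (m2 := L) (mF b x) (F_le b x) (rint_norm rg)).
rewrite (Rint_swap (m1 := mu) (m2 := L) mf fle (rint_itv _ _) (rint_norm rg)).
rewrite /wave -RintZl; last exact: rint_wave.
apply: eq_Rintegral => xi _ /=.
transitivity (\int[mu]_lam (g xi * osc b (dot x xi) * (W lam xi * osc c (lam * t)))).
  by apply: eq_Rintegral => lam _; rewrite /f /=; ring.
rewrite RintZl ?window_osc//; first by ring.
by apply: rint_osc; [exact: rint_itv|exact: measurable_funM].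
Qed.

(** The constant is Bessel's [2 pi] divided by the lower bound [del^2 / 4] of [wfactor ^+ 2]. *)
Lemma wave_window b c x :
  (\int[mu]_t (\1_`[- del^-1, del^-1] t * wave b c g (x, t) ^+ 2)%:E <=
   (8 * pi / del ^+ 2)%:E * \int[mu]_lam (A b x lam ^+ 2)%:E)%E.
Proof.
have B := bessel_line c (rA b x) (rA2 b x).
have mw : measurable_fun setT (fun t : measurableTypeR R => wave b c g (x, t)).
  exact: (measurable_section1 _ (measurable_wave b c rg)).
have mi : measurable_fun setT (fun t : measurableTypeR R =>
    \int[mu]_u (A b x u * osc c (u * t))).
  apply: (measurable_Rint_param (f := fun z : measurableTypeR R * measurableTypeR R =>
    A b x z.2 * osc c (z.2 * z.1)) _ _ (rint_norm (rA b x))).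
    apply: measurable_funM; first exact: (measurable_snd_comp (rint_measurable (rA b x))).
    by apply: measurable_osc_comp; apply: measurable_funM;
      [exact: measurable_snd|exact: measurable_fst].
  by move=> t u; rewrite normrM ler_piMr// normr_osc_le1.
have d2 : 0 < del ^+ 2 by rewrite exprn_gt0.
apply: (@le_trans _ _ (\int[mu]_t (4 / del ^+ 2 *
   (\int[mu]_u (A b x u * osc c (u * t))) ^+ 2)%:E)%E).
  apply: le_ge0_int.
  - apply: measurable_funM; last exact: measurable_funX.
    by apply: measurable_indic; exact: measurable_itv.
  - by apply: measurable_funM => //; exact: measurable_funX.
  - move=> t; apply/andP; split; first by apply: mulr_ge0 => //; exact: sqr_ge0.
    rewrite indicE; have [/set_mem/=|_] := boolP (t \in _); last first.
      by rewrite mul0r mulr_ge0 ?divr_ge0 ?sqr_ge0.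
    rewrite in_itv/= -ler_norml => /(wfactor_ge del0) h; rewrite mul1r window_identity exprMn.
    rewrite mulrA -[leLHS]mul1r ler_wpM2r ?sqr_ge0//.
    by rewrite mulrAC ler_pdivlMr// mul1r mulrC -ler_pdivrMr.
rewrite ge0_intZl ?divr_ge0 ?(ltW d2)//; last 2 first.
- exact: measurable_funX.
- by move=> t; exact: sqr_ge0.
apply: (@le_trans _ _ ((4 / del ^+ 2)%:E * (2 * pi * \int[mu]_u (A b x u ^+ 2))%:E)%E).
  by rewrite lee_wpmul2l// lee_fin divr_ge0// ltW.
rewrite -RintE// -!EFinM lee_fin le_eqVlt; apply/orP; left; apply/eqP.
by move: (pi : R) (\int[mu]_u _) => p I; field; rewrite gt_eqF.
Qed.

(** For [r = lam^(1/gamma)] the factor [r^(alpha/beta)] of the shell estimate, times the relative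
    thickness [del / lam], is [del * lam^kap]. *)
Let kap := alpha / (beta * gamma) - 1.

Definition shell_const (C : R) := forall b (w : Rn R n -> R) D r J (G : Rn R n -> R),
  measurable_fun setT w -> (forall x, 0 <= w x) ->
  morrey (fun x => w x `^ beta) (n%:R - alpha) D -> 0 < D -> 0 < r ->
  rint L G -> rint L (fun xi => G xi ^+ 2) -> (forall xi, ~ shell r J xi -> G xi = 0) ->
  (\int[L]_x (w x * oscT b G x ^+ 2)%:E <=
   (C / 2 ^+ J * (r `^ (alpha / beta) * D `^ (beta^-1)) * \int[L]_xi (G xi ^+ 2))%:E)%E.

Hypothesis del_small : del <= lo `^ gamma / 5.

(** Raised to the power [2 / gamma <= 2], the quotient [disp xi / lam] becomes [|xi|^2 / r^2], and
    its distance from 1 grows by at most [5/2]. Hence the bound [5 del / (4 lam)], which the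
    condition on [J] compares with [(2 * 2^J)^-1]. *)
Lemma window_shell lam xi J : lo `^ gamma / 2 < lam -> g xi != 0 ->
  `|lam - disp xi| <= del / 2 -> 2 ^+ J <= 2 * lam / (5 * del) ->
  shell (lam `^ gamma^-1) J xi.
Proof.
move=> hlam g0 hw hJ; have d0 := del0; have ds := del_small.
have lg0 : 0 < lo `^ gamma by rewrite powR_gt0.
have lam0 : 0 < lam by lra.
have N0 : 0 <= disp xi by exact: powR_ge0.
have JJ : (0 : R) < 2 ^+ J by rewrite exprn_gt0.
pose y := disp xi / lam.
have hy : `|y - 1| <= del / (2 * lam).
  rewrite (_ : y - 1 = (disp xi - lam) / lam); last by rewrite /y; field; rewrite gt_eqF.
  rewrite normrM distrC (ger0_norm (x := lam^-1)) ?invr_ge0 ?(ltW lam0)//.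
  rewrite ler_pdivrMr// (_ : del / (2 * lam) * lam = del / 2)//.
  by field; rewrite gt_eqF.
have dl : del / (2 * lam) <= 2^-1.
  by rewrite ler_pdivrMr ?mulr_gt0//; lra.
have hy2 : 2^-1 <= y <= 3 / 2.
  by move: hy; rewrite ler_norml => /andP[]; lra.
have k2 : 0 < 2 / gamma <= 2.
  by rewrite divr_gt0 ?gamma0//= ler_pdivrMr ?gamma0// ler_peMr.
have := powR_sub1_le k2 hy2.
have -> : y `^ (2 / gamma) = ((lam `^ gamma^-1) ^+ 2)^-1 * dot xi xi.
  rewrite /y powRM ?invr_ge0 ?(ltW lam0)// mulrC; congr (_ * _).
    rewrite -(powR_inv1 (ltW lam0)) -powRrM mulN1r powRN; congr (_^-1).
    by rewrite -(powR_mulrn 2 (powR_ge0 _ _)) -powRrM mulrC.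
  rewrite /disp -powRrM mulrCA divff ?gt_eqF ?gamma0// mulr1.
  by rewrite (powR_mulrn 2 (enorm_ge0 _)) dotE.
rewrite /shell /= => h; apply: (le_trans h).
apply: (@le_trans _ _ (5 / 2 * (del / (2 * lam)))); first by rewrite ler_wpM2l.
rewrite -[leRHS]mul1r ler_pdivlMr ?mulr_gt0//.
apply: (@le_trans _ _ (5 / 2 * (del / (2 * lam)) * (2 * (2 * lam / (5 * del))))).
  by rewrite ler_wpM2l ?mulr_ge0 ?invr_ge0 ?(ltW del0) ?mulr_ge0 ?(ltW lam0)// ler_wpM2l.
by rewrite le_eqVlt; apply/orP; left; apply/eqP; field; rewrite !gt_eqF.
Qed.

Let Q lam xi : R := W lam xi * (disp xi `^ kap * g xi ^+ 2).

Let Q0 lam xi : 0 <= Q lam xi.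
Proof.
case/andP: (W01 lam xi) => h _; apply: mulr_ge0 => //.
by apply: mulr_ge0; [exact: powR_ge0|exact: sqr_ge0].
Qed.

Let mQ : measurable_fun setT (fun q : measurableTypeR R * Rn R n => Q q.1 q.2).
Proof.
apply: measurable_funM => //.
apply: (measurable_snd_comp (f := fun xi => disp xi `^ kap * g xi ^+ 2)).
apply: measurable_funM; last by apply: measurable_funX; exact: rint_measurable rg.
exact: (measurableT_comp (measurable_powR kap) measurable_disp).
Qed.

Lemma window_estimate C b (w : Rn R n -> R) D lam : 0 <= C -> shell_const C ->
  measurable_fun setT w -> (forall x, 0 <= w x) ->
  morrey (fun x => w x `^ beta) (n%:R - alpha) D -> 0 < D ->
  (\int[L]_x (w x * A b x lam ^+ 2)%:E <=
   (5 * C * 2 `^ `|kap| * D `^ (beta^-1) * del)%:E * \int[L]_xi (Q lam xi)%:E)%E.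
Proof.
move=> C0 hC mw w0 hw D0; have d0 := del0; have ds := del_small.
have Dp0 : 0 <= D `^ beta^-1 by exact: powR_ge0.
have K0 : 0 <= 5 * C * 2 `^ `|kap| * D `^ (beta^-1) * del.
  by rewrite !mulr_ge0 ?powR_ge0 ?(ltW del0).
have lg0 : 0 < lo `^ gamma by rewrite powR_gt0.
(* For so small a [lam] the window contains no frequency of the support of [g], because
   [del <= lo^gamma / 5]; both sides can be compared with 0. *)
have [hl|hl] := leP lam (lo `^ gamma / 2).
  have A0 x : A b x lam = 0.
    rewrite /A /Rintegral integral0_eq// => xi _.
    have [->|g0] := eqVneq (g xi) 0; first by rewrite mulr0 mul0r.
    rewrite WE; case: (boolP (`|lam - disp xi| <= del / 2)%R) => [|_]; last by rewrite !mul0r.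
    have /andP[h1 _] := disp_bounds g0.
    rewrite ler_norml => /andP[h2 h3]; exfalso; move: h1 h2 h3 hl ds lg0.
    by move: (lo `^ gamma) (disp xi) => l N; lra.
  rewrite integral0_eq; last by move=> x _; rewrite A0 expr0n mulr0.
  by apply: mule_ge0; [rewrite lee_fin|apply: integral_ge0 => xi _; rewrite lee_fin].
have lam0 : 0 < lam by lra.
have m1 : 1 <= 2 * lam / (5 * del) by rewrite ler_pdivlMr ?mulr_gt0//; lra.
(* [J] is the largest admissible index, so that [2^-J] is at most a multiple of [del / lam]. *)
have [J /andP[J1 J2]] := dyadic_scale m1.
have JJ : (0 : R) < 2 ^+ J by rewrite exprn_gt0.
pose r := lam `^ gamma^-1; have r0 : 0 < r by rewrite powR_gt0.
pose G xi := W lam xi * g xi.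
have mWl : measurable_fun setT (W lam) by exact: (measurable_section1 _ mW).
have rG : rint L G by exact: rint_mulb mWl (W_norm lam) rg.
have rWg : rint L (fun xi => W lam xi * g xi ^+ 2) by exact: rint_mulb mWl (W_norm lam) rg2.
have rG2 : rint L (fun xi => G xi ^+ 2).
  by apply: eq_rint rWg => xi; rewrite /G exprMn Wsq.
have GS xi : ~ shell r J xi -> G xi = 0.
  move=> h; rewrite /G; have [->|g0] := eqVneq (g xi) 0; first by rewrite mulr0.
  rewrite WE; case: (boolP (`|lam - disp xi| <= del / 2)%R) => [h'|_]; last by rewrite mul0r.
  by case: h; exact: window_shell.
apply: le_trans (hC b w D r J G mw w0 hw D0 r0 rG rG2 GS) _.
rewrite EFinM RintE//; set c := C / _ * _.
have c0 : 0 <= c by rewrite mulr_ge0 ?divr_ge0 ?(ltW JJ)// mulr_ge0// powR_ge0.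
rewrite -ge0_intZl//; last 2 first.
- exact: rint_measurable rG2.
- by move=> xi; exact: sqr_ge0.
have mQl : measurable_fun setT (Q lam) by exact: (measurable_section1 _ mQ).
rewrite -ge0_intZl//.
apply: le_ge0_int.
- by apply: measurable_funM => //; exact: rint_measurable rG2.
- exact: measurable_funM.
- move=> xi; apply/andP; split; first by apply: mulr_ge0 => //; exact: sqr_ge0.
  rewrite /G exprMn Wsq /Q.
  have [->|g0] := eqVneq (g xi) 0; first by rewrite expr0n !mulr0.
  rewrite WE; case: (boolP (`|lam - disp xi| <= del / 2)%R) => [h'|_]; last by rewrite !mul0r !mulr0.
  rewrite !mul1r mulrA ler_wpM2r ?sqr_ge0//.
  have /andP[h1 _] := disp_bounds g0.
  have N0 : 0 < disp xi by exact: lt_le_trans h1.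
  have lamN : lam `^ kap <= 2 `^ `|kap| * disp xi `^ kap.
    by apply: powR_ratio_le => //; move: h'; rewrite ler_norml => /andP[]; lra.
  apply: (@le_trans _ _ (5 * C * D `^ beta^-1 * del * lam `^ kap)); last first.
    rewrite [leRHS](_ : _ = 5 * C * D `^ beta^-1 * del * (2 `^ `|kap| * disp xi `^ kap)).
      by rewrite ler_wpM2l// !mulr_ge0// ltW.
    by move: (2 `^ _) (D `^ _) (disp _ `^ _) => u1 u2 u3; ring.
  have -> : lam `^ kap = lam `^ (alpha / (beta * gamma)) / lam.
    by rewrite /kap powRB ?(gt_eqF lam0) ?implybT// powRr1// ltW.
  have rE : r `^ (alpha / beta) = lam `^ (alpha / (beta * gamma)).
    by rewrite /r -powRrM; congr (_ `^ _); rewrite invfM; ring.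
  rewrite /c rE; set u := lam `^ _; set v := D `^ _.
  have u0 : 0 <= u by exact: powR_ge0.
  have CJ : C / 2 ^+ J <= 5 * C * del / lam.
    exact: dyadic_scale_div.
  apply: (@le_trans _ _ (5 * C * del / lam * (u * v))); first by rewrite ler_wpM2r// mulr_ge0.
  by rewrite le_eqVlt; apply/orP; left; apply/eqP; ring.
Qed.

(** The factor [del^-2] of [wave_window] is compensated by one [del] from the thickness of the shell
    in [window_estimate] and another from the length of the window when [lam] is integrated. The
    bound is therefore uniform in [del]. *)
Lemma window_total C b c (w : Rn R n -> R) D : 0 <= C -> shell_const C ->
  measurable_fun setT w -> (forall x, 0 <= w x) ->
  morrey (fun x => w x `^ beta) (n%:R - alpha) D -> 0 < D ->
  (\int[(L \x mu)%E]_z (\1_`[- del^-1, del^-1] z.2 * (w z.1 * wave b c g z ^+ 2))%:E <=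
   (40 * pi * C * 2 `^ `|kap| * D `^ (beta^-1))%:E *
   \int[L]_xi (disp xi `^ kap * g xi ^+ 2)%:E)%E.
Proof.
move=> C0 hC mw w0 hw D0; have d0 := del0.
have d2 : 0 < del ^+ 2 by rewrite exprn_gt0.
have pi0 : 0 <= pi :> R by exact: pi_ge0.
have c80 : 0 <= 8 * pi / del ^+ 2 by apply: divr_ge0; [exact: mulr_ge0|exact: ltW].
have mi : measurable_fun setT (\1_`[- del^-1, del^-1] : measurableTypeR R -> R).
  by apply: measurable_indic; exact: measurable_itv.
have i0 (t : R) : 0 <= \1_`[- del^-1, del^-1] t :> R by [].
have mwave := measurable_wave b c rg.
have mA : measurable_fun setT (fun q : Rn R n * measurableTypeR R => A b q.1 q.2).
  apply: (measurable_Rint_param (f := fun q : (Rn R n * measurableTypeR R) * Rn R n =>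
    W q.1.2 q.2 * g q.2 * osc b (dot q.1.1 q.2)) _ _ (rint_norm rg)).
    have m1 : measurable_fun setT (fun q : (Rn R n * measurableTypeR R) * Rn R n => q.1).
      exact: measurable_fst.
    apply: measurable_funM.
      apply: measurable_funM; last exact: (measurable_snd_comp (rint_measurable rg)).
      have m2 : measurable_fun setT
          (fun q : (Rn R n * measurableTypeR R) * Rn R n => (q.1.2, q.2)).
        apply: measurable_fun_pair; last exact: measurable_snd.
        exact: (measurableT_comp measurable_snd m1).
      exact: (measurableT_comp mW m2).
    apply: measurable_osc_comp; apply: measurable_dot; last exact: measurable_snd.
    exact: (measurableT_comp measurable_fst m1).
  move=> q xi; rewrite -mulrA normrM -[leRHS]mul1r ler_pM//.
  by rewrite normrM ler_piMr// normr_osc_le1.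
rewrite tonelli_prod1; last 2 first.
- apply: measurable_funM; first exact: measurable_snd_comp mi.
  by apply: measurable_funM; [exact: measurable_fst_comp|exact: measurable_funX].
- by move=> z; apply: mulr_ge0 => //; apply: mulr_ge0 => //; exact: sqr_ge0.
pose B (q : Rn R n * measurableTypeR R) := 8 * pi / del ^+ 2 * (w q.1 * A b q.1 q.2 ^+ 2).
have mB : measurable_fun setT B.
  apply: measurable_funM => //; apply: measurable_funM; first exact: measurable_fst_comp.
  exact: measurable_funX.
have B0 q : 0 <= B q by apply: mulr_ge0 => //; apply: mulr_ge0 => //; exact: sqr_ge0.
have mwx x : measurable_fun setT (fun t : measurableTypeR R =>
    \1_`[- del^-1, del^-1] t * wave b c g (x, t) ^+ 2).
  apply: measurable_funM => //; apply: measurable_funX.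
  exact: (measurable_section1 _ mwave).
have mAx x : measurable_fun setT (fun t : measurableTypeR R => A b x t ^+ 2).
  by apply: measurable_funX; exact: (measurable_section1 _ mA).
apply: (@le_trans _ _ (\int[L]_x \int[mu]_lam (B (x, lam))%:E)%E).
  apply: ge0_le_integral; first exact: measurableT.
  - move=> x _; apply: integral_ge0 => t _; rewrite lee_fin.
    by apply: mulr_ge0 => //; apply: mulr_ge0 => //; exact: sqr_ge0.
  - apply: (measurable_tonelli1 mu (f := fun z : Rn R n * measurableTypeR R =>
      \1_`[- del^-1, del^-1] z.2 * (w z.1 * wave b c g z ^+ 2))).
      apply: measurable_funM; first exact: measurable_snd_comp mi.
      by apply: measurable_funM; [exact: measurable_fst_comp|exact: measurable_funX].
    by move=> z; apply: mulr_ge0 => //; apply: mulr_ge0 => //; exact: sqr_ge0.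
  - exact: measurable_tonelli1.
  - move=> x _ /=.
    rewrite (_ : (fun t => _) = (fun t : measurableTypeR R =>
      (w x * (\1_`[- del^-1, del^-1] t * wave b c g (x, t) ^+ 2))%:E)); last first.
      by apply/funext => t; congr EFin; rewrite mulrCA.
    rewrite ge0_intZl//; last by move=> t; apply: mulr_ge0 => //; exact: sqr_ge0.
    apply: le_trans (lee_wpmul2l _ (wave_window b c x)) _; first by rewrite lee_fin.
    rewrite muleA -EFinM -ge0_intZl; last 3 first.
    - exact: mulr_ge0.
    - exact: mAx.
    - by move=> t; exact: sqr_ge0.
    rewrite le_eqVlt; apply/orP; left; apply/eqP.
    by apply: eq_integral => t _; congr EFin; rewrite /B /=; ring.
rewrite (tonelli_swap L mu mB B0).
have mQ' : measurable_fun setT (fun q : measurableTypeR R * Rn R n =>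
   8 * pi / del ^+ 2 * (5 * C * 2 `^ `|kap| * D `^ (beta^-1) * del) * Q q.1 q.2).
  exact: measurable_funM.
have cc0 : 0 <= 8 * pi / del ^+ 2 * (5 * C * 2 `^ `|kap| * D `^ (beta^-1) * del).
  by rewrite mulr_ge0// !mulr_ge0 ?powR_ge0 ?(ltW del0).
apply: (@le_trans _ _ (\int[mu]_lam \int[L]_xi (8 * pi / del ^+ 2 *
  (5 * C * 2 `^ `|kap| * D `^ (beta^-1) * del) * Q lam xi)%:E)%E).
  apply: ge0_le_integral; first exact: measurableT.
  - by move=> lam _; apply: integral_ge0 => x _; rewrite lee_fin.
  - exact: measurable_tonelli2.
  - apply: (measurable_tonelli1 L (f := fun q : measurableTypeR R * Rn R n =>
   8 * pi / del ^+ 2 * (5 * C * 2 `^ `|kap| * D `^ (beta^-1) * del) * Q q.1 q.2)) => //.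
    by move=> q; exact: mulr_ge0.
  - move=> lam _ /=.
    rewrite [leRHS]ge0_intZl//; last exact: (measurable_section1 _ mQ).
    rewrite EFinM -muleA [leLHS]ge0_intZl//.
    + by rewrite lee_wpmul2l ?lee_fin//; exact: window_estimate.
    + by apply: measurable_funM => //; apply: measurable_funX; exact: (measurable_section2 _ mA).
    + by move=> x; apply: mulr_ge0 => //; exact: sqr_ge0.
rewrite (tonelli_swap mu L (f := fun q : measurableTypeR R * Rn R n =>
   8 * pi / del ^+ 2 * (5 * C * 2 `^ `|kap| * D `^ (beta^-1) * del) * Q q.1 q.2)) //=; last first.
  by move=> q; exact: mulr_ge0.
have mg : measurable_fun setT (fun xi => disp xi `^ kap * g xi ^+ 2).
  apply: measurable_funM; last by apply: measurable_funX; exact: rint_measurable rg.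
  exact: (measurableT_comp (measurable_powR kap) measurable_disp).
rewrite -ge0_intZl//; last 2 first.
- by rewrite !mulr_ge0 ?powR_ge0.
- by move=> xi; apply: mulr_ge0; [exact: powR_ge0|exact: sqr_ge0].
rewrite le_eqVlt; apply/orP; left; apply/eqP; apply: eq_integral => xi _.
have rW : rint mu (fun lam : measurableTypeR R => W lam xi) by exact: rint_itv.
rewrite (_ : (fun lam => _) = (fun lam : measurableTypeR R => ((8 * pi / del ^+ 2 *
    (5 * C * 2 `^ `|kap| * D `^ beta^-1 * del) * (disp xi `^ kap * g xi ^+ 2)) * W lam xi)%:E)).
  rewrite -RintE; last exact: rintZl.
  rewrite RintZl// /W Rint_itv1; last by have := del0; lra.
  congr EFin; set u1 := 2 `^ `|kap|; set u2 := D `^ beta^-1; set u3 := disp xi `^ kap.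
  move: (disp xi) u1 u2 u3 (pi : R) => N u1 u2 u3 p.
  by field; rewrite gt_eqF.
by apply/funext => lam; congr EFin; rewrite /Q; ring.
Qed.

End window.

(** As [del] tends to 0 the time intervals [|t| <= del^-1] exhaust the line. The lower end [lo] of
    the annulus gives the scale with respect to which [del] has to be small. *)
Lemma smoothing_annulus : exists2 C, 0 <= C &
  forall b c (w g : Rn R n -> R) D lo hi,
  measurable_fun setT w -> (forall x, 0 <= w x) ->
  morrey (fun x => w x `^ beta) (n%:R - alpha) D -> 0 < D ->
  rint L g -> rint L (fun xi => g xi ^+ 2) -> 0 < lo ->
  (forall xi, g xi != 0 -> lo <= enorm xi <= hi) ->
  (\int[(L \x mu)%E]_z (w z.1 * wave b c g z ^+ 2)%:E <=
   (C * D `^ (beta^-1))%:E *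
   \int[L]_xi (enorm xi `^ (alpha / beta - gamma) * g xi ^+ 2)%:E)%E.
Proof.
have [C C0 hC] := weighted_shell n0 beta1 alpha1.
set kap := alpha / (beta * gamma) - 1.
exists (40 * pi * C * 2 `^ `|kap|) => [|b c w g D lo hi mw w0 hw D0 rg rg2 lo0 supp].
  by rewrite !mulr_ge0 ?pi_ge0 ?powR_ge0.
have g0 : 0 < gamma by exact: lt_le_trans gamma1.
have b0 : 0 < beta by exact: lt_le_trans beta1.
have -> : (\int[L]_xi (enorm xi `^ (alpha / beta - gamma) * g xi ^+ 2)%:E =
    \int[L]_xi (disp xi `^ kap * g xi ^+ 2)%:E)%E.
  apply: eq_integral => xi _; rewrite /disp -powRrM; congr ((_ `^ _ * _)%:E).
  by rewrite /kap; field; rewrite !gt_eqF.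
have lg : 0 < lo `^ gamma / 5 by rewrite divr_gt0 ?powR_gt0.
pose del (k : nat) := lo `^ gamma / 5 / k.+1%:R.
have del0 k : 0 < del k by rewrite divr_gt0.
have dels k : del k <= lo `^ gamma / 5.
  by rewrite /del ler_piMr ?(ltW lg)// invf_le1// ler1n.
have mwave := measurable_wave b c rg.
apply: (@fatou_bound _ _ R (L \x mu)%E (fun (k : nat) (z : Rn R n * measurableTypeR R) =>
  \1_`[- (del k)^-1, (del k)^-1] z.2 *
  (w z.1 * wave b c g z ^+ 2))).
- move=> k; apply: measurable_funM.
    apply: (measurable_snd_comp (f := (\1_`[- (del k)^-1, (del k)^-1] : measurableTypeR R -> R))).
    by apply: measurable_indic; exact: measurable_itv.
  by apply: measurable_funM; [exact: measurable_fst_comp|exact: measurable_funX].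
- by move=> k z; apply: mulr_ge0 => //; apply: mulr_ge0 => //; exact: sqr_ge0.
- move=> z; apply: cvg_near_cst.
  exists (Num.truncn (`|z.2| * (lo `^ gamma / 5))).+1 => // k /= hk.
  rewrite indicE mem_set ?mul1r//= in_itv/= -ler_norml /del invfM invrK.
  rewrite mulrC -ler_pdivrMr ?invr_gt0// invrK.
  apply: (le_trans (ltW (truncnS_gt _))); rewrite ler_nat.
  exact: leq_trans hk _.
- move=> k; exact: (window_total rg rg2 lo0 supp (del0 k) (dels k)).
Qed.

End Smoothing.

Lemma Rint_eq0 d (X : measurableType d) (R : realType) (m : {measure set X -> \bar R})
  (f : X -> R) : (forall x, f x = 0) -> \int[m]_x f x = 0.
Proof. by move=> f0; rewrite /Rintegral integral0_eq// => x _; rewrite f0. Qed.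

Lemma Rint_dct d (X : measurableType d) (R : realType) (m : {measure set X -> \bar R})
    (f_ : nat -> X -> R) (f g : X -> R) :
  (forall k, measurable_fun setT (f_ k)) -> rint m g ->
  (forall k x, `|f_ k x| <= g x) -> (forall x, f_ k x @[k --> \oo] --> f x) ->
  \int[m]_x f_ k x @[k --> \oo] --> \int[m]_x f x.
Proof.
move=> mf rg fg cf.
have mlim : measurable_fun setT f by apply: (measurable_fun_cvg mf) => x _; exact: cf.
have rf : rint m f.
  apply: (rint_le mlim _ rg) => x.
  by apply: (@ler_cvg_to _ _ _ _ _ _ _ _ (cvg_norm (cf x)) (cvg_cst (g x))); exact: nearW.
have rfk k : rint m (f_ k) by exact: rint_le (mf k) (fg k) rg.
have H : (\int[m]_x (f_ k x)%:E)%E @[k --> \oo] --> (\int[m]_x (f x)%:E)%E.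
  have [] // := dominated_convergence (mu := m) (f_ := fun k x => (f_ k x)%:E)
    (f := EFin \o f) (g := EFin \o g) measurableT.
  - by move=> k; exact/measurable_EFinP.
  - exact/measurable_EFinP.
  - by apply: aeW => x _; apply: cvg_EFin; [exact: nearW|exact: cf].
  - by apply: aeW => x k _; rewrite /= lee_fin.
have := fine_cvg (_ : (\int[m]_x (f_ k x)%:E)%E @[k --> \oo] --> (\int[m]_x f x)%:E).
by apply; rewrite RintE.
Qed.

(* A function that is measurable in one variable and continuous in the other is
   the limit of the functions obtained by discretising the latter. *)
Lemma measurable_caratheodory d (Y : measurableType d) (R : realType)
    (f : measurableTypeR R * Y -> R) :
  (forall a, measurable_fun setT (fun y => f (a, y))) ->
  (forall y (a : R), (fun a : R => f (a, y)) x @[x --> a] --> f (a, y)) ->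
  measurable_fun setT f.
Proof.
move=> mf cf.
(* [p k a] rounds [a] down to a multiple of [(k.+1)^-1]; the shift by [k.+1] makes the argument of
   [truncn] nonnegative as soon as [|a| <= k.+1]. *)
pose u (k : nat) (a : R) : R := k.+1%:R * (a + k.+1%:R).
pose p (k : nat) (a : R) : R := (Num.truncn (u k a))%:R / k.+1%:R - k.+1%:R.
have mu k : measurable_fun setT (u k : measurableTypeR R -> R).
  by apply: measurable_funM => //; exact: measurable_funD.
have mt k j : measurable [set a : measurableTypeR R | Num.truncn (u k a) = j].
  have pre (i : interval R) : measurable (u k @^-1` [set` i] : set (measurableTypeR R)).
    by rewrite -[X in measurable X]setTI; exact: mu.
  case: j => [|j].
    rewrite (_ : [set a | _] = u k @^-1` `]-oo, 1[); first exact: pre.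
    apply/seteqP; split => a /=; rewrite in_itv/= ltNge -truncn_gt0 lt0n negbK.
      by move=> ->.
    by move/eqP.
  rewrite (_ : [set a | _] = u k @^-1` `[j.+1%:R, j.+2%:R[); first exact: pre.
  apply/seteqP; split => a /=; rewrite in_itv/=.
    move=> h; have u1 : 1 <= u k a by rewrite -truncn_gt0 h.
    by rewrite -truncn_eq ?h ?eqxx// (le_trans ler01).
  move=> h; apply/eqP; rewrite truncn_eq//.
  by case/andP: h => h _; apply: le_trans h.
apply: (@measurable_fun_cvg _ _ _ _ (fun k z => f (p k z.1, z.2))).
  move=> k _ B mB; rewrite setTI.
  rewrite (_ : _ @^-1` _ = \bigcup_j ([set a | Num.truncn (u k a) = j] `*`
     ((fun y => f (j%:R / k.+1%:R - k.+1%:R, y)) @^-1` B))).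
    apply: bigcupT_measurable => j; apply: measurableX; first exact: mt.
    by rewrite -[X in measurable X]setTI; exact: mf.
  apply/seteqP; split => [[a y] /= h|[a y] [j _ [/= <-]]]; last by [].
  by exists (Num.truncn (u k a)).
move=> [a y] _ /=; apply: (cvg_comp _ _ _ (cf y a)).
apply/cvgrPdist_le => e e0.
exists (Num.truncn (`|a| + e^-1)).+1 => // k /= hk.
have kk : `|a| + e^-1 <= k.+1%:R.
  apply: (le_trans (ltW (truncnS_gt _))); rewrite ler_nat.
  exact: leq_trans hk _.
have k0 : (0 : R) < k.+1%:R by [].
have ei : 0 < e^-1 by rewrite invr_gt0.
have ka : 0 <= a + k.+1%:R.
  have := ler_norm (- a); rewrite normrN; move: kk ei; lra.
have u0 : 0 <= u k a by rewrite mulr_ge0.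
have h1 : (Num.truncn (u k a))%:R <= u k a by rewrite truncn_le.
have h2 := truncnS_gt (u k a).
rewrite /p; set T := (Num.truncn _)%:R in h1 *.
have {}h2 : u k a < T + 1 by move: h2; rewrite -natr1.
have E : a - (T / k.+1%:R - k.+1%:R) = (u k a - T) / k.+1%:R.
  by rewrite /u; field; rewrite gt_eqF.
rewrite E ger0_norm; last by rewrite divr_ge0// subr_ge0.
rewrite ler_pdivrMr//; apply: (@le_trans _ _ 1); first by lra.
rewrite mulrC -ler_pdivrMr// mul1r.
by apply: le_trans kk; rewrite lerDr.
Qed.

(** * Schwartz functions *)

Section SeparatelyContinuous.
Context {R : realType}.

Lemma tnth_set_coord n (x : Rn R n) i j a :
  tnth (set_coord x i a) j = if j == i then a else tnth x j.
Proof. by rewrite tnth_mktuple. Qed.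

Lemma set_coord_id n (x : Rn R n) i : set_coord x i (tnth x i) = x.
Proof.
by apply: eq_from_tnth => j; rewrite tnth_set_coord; case: eqVneq => // ->.
Qed.

Lemma set_coord_twice n (x : Rn R n) i a b :
  set_coord (set_coord x i a) i b = set_coord x i b.
Proof. by apply: eq_from_tnth => j; rewrite !tnth_set_coord; case: eqVneq. Qed.

Lemma set_coord0 n a (x : Rn R n) b :
  set_coord (cons_point (a, x)) ord0 b = cons_point (b, x).
Proof.
apply: eq_from_tnth => j; rewrite tnth_set_coord.
by have [k ->|->] := unliftP ord0 j; rewrite ?eqxx ?tnth0//= !tnthS.
Qed.

Lemma set_coordS n a (x : Rn R n) i b :
  set_coord (cons_point (a, x)) (lift ord0 i) b = cons_point (a, set_coord x i b).
Proof.
apply: eq_from_tnth => j; rewrite tnth_set_coord.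
have [k ->|->] := unliftP ord0 j; last by rewrite !tnth0.
by rewrite !tnthS tnth_set_coord (inj_eq lift_inj).
Qed.

(** The Schwartz condition speaks directly of regularity along coordinate lines only. Separate
    continuity is enough for measurability, by adding one continuous variable at a time. *)
Lemma measurable_sepcont n (u : Rn R n -> R) :
  (forall x i (b : R), (fun a => u (set_coord x i a)) a @[a --> b] --> u (set_coord x i b)) ->
  measurable_fun setT u.
Proof.
elim: n u => [|n ih] u cu.
  move=> _ Y mY; rewrite setTI.
  have [h|h] := pselect (Y (u [tuple])).
    rewrite (_ : _ @^-1` _ = setT); first exact: measurableT.
    by apply/seteqP; split => // x _ /=; rewrite (tuple0 x).
  rewrite (_ : _ @^-1` _ = set0); first exact: measurable0.
  by apply/seteqP; split => // x /=; rewrite (tuple0 x).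
have m : measurable_fun setT (fun p : measurableTypeR R * Rn R n => u (cons_point p)).
  apply: measurable_caratheodory => [a|y a].
    apply: ih => x i b; have := cu (cons_point (a, x)) (lift ord0 i) b.
    rewrite set_coordS; under eq_fun do rewrite set_coordS.
    exact.
  have := cu (cons_point (a, y)) ord0 a; rewrite set_coord0.
  by under eq_fun do rewrite set_coord0.
have mc : measurable_fun setT (fun x : Rn R n.+1 =>
    (tnth x ord0, [tuple of behead x]) : measurableTypeR R * Rn R n).
  apply: measurable_fun_pair; [exact: measurable_tnth|exact: measurable_behead].
apply: eq_measurable_fun (measurableT_comp m mc) => x _ /=; congr u.
by have [[b y] ->] := cons_point_inj x; rewrite tnth0 /=; apply: val_inj.
Qed.

Lemma rint_cauchy_density : rint (@lebesgue_measure R) (fun t => (1 + t ^+ 2)^-1).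
Proof.
have p (t : R) : 0 < 1 + t ^+ 2 by rewrite ltr_pwDl// sqr_ge0.
have q0 (t : R) : 0 <= (1 + t ^+ 2)^-1 by rewrite invr_ge0 ltW.
have dp (t : R) : is_derive t 1 (fun t => 1 + t ^+ 2) (0 + 2%:R * t ^+ 1 * 1).
  exact: drvD (drv_cst t 1) (drvX 2 (drv_id t)).
have c (t : R) : {for t, continuous (fun t : R => (1 + t ^+ 2)^-1)}.
  exact: drv_continuous (drvV (dp t) (lt0r_neq0 (p t))).
have m : measurable_fun setT (fun t : R => (1 + t ^+ 2)^-1).
  by apply: continuous_measurable_fun => t; exact: c.
have mI k : measurable_fun setT (\1_`[(- k%:R : R), k%:R] : R -> R).
  by apply: measurable_indic; exact: measurable_itv.
apply: ge0_rint => //.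
suff : (\int[@lebesgue_measure R]_t ((1 + t ^+ 2)^-1)%:E <= pi%:E)%E.
  by move=> h; apply: le_lt_trans h _; rewrite ltry.
apply: (@fatou_bound _ _ R lebesgue_measure
  (fun k t => \1_`[(- k%:R : R), k%:R] t * (1 + t ^+ 2)^-1)).
- by move=> k; exact: measurable_funM.
- by move=> k t; exact: mulr_ge0.
- move=> t; apply: cvg_near_cst; exists (Num.truncn `|t|).+1 => // k /= hk.
  rewrite indicE mem_set ?mul1r//= in_itv/= -ler_norml.
  by apply: (le_trans (ltW (truncnS_gt _))); rewrite ler_nat.
- move=> k.
  have r : rint lebesgue_measure (fun t => \1_`[(- k%:R : R), k%:R] t * (1 + t ^+ 2)^-1).
    apply: (rint_le _ _ (rint_itv (- k%:R : R) k%:R)) => [|t].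
      exact: measurable_funM.
    rewrite ger0_norm ?mulr_ge0// ler_piMr// invf_le1//.
    by rewrite lerDl sqr_ge0.
  rewrite -RintE// lee_fin -Rint_indic; last exact: measurable_itv.
  have k0 : - k%:R <= k%:R :> R by rewrite (@le_trans _ _ 0)// oppr_le0.
  rewrite (_ : \int[_]_(_ in _) _ = atan k%:R - atan (- k%:R)).
    rewrite atanN opprK; have := atan_ltpi2 (k%:R : R).
    by move: (atan _) => t; lra.
  by apply: (FTC k0) => t _; exact: c.
Qed.

(** A positive integrable majorant for rapidly decreasing functions, of product form so that
    integration proceeds coordinate by coordinate. It serves again as a weight in the extension to
    [L^2]. *)
Definition rho n (x : Rn R n) : R := \prod_(i < n) (1 + (tnth x i : R) ^+ 2)^-1.

Let sq1 (t : R) : 0 < 1 + t ^+ 2. Proof. by rewrite ltr_pwDl// sqr_ge0. Qed.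

Lemma rho_ge0 n (x : Rn R n) : 0 <= rho x.
Proof. by apply: prodr_ge0 => i _; rewrite invr_ge0 ltW. Qed.

Lemma rho_le1 n (x : Rn R n) : rho x <= 1.
Proof.
by apply: prodr_ile1 => i _; rewrite invr_ge0 ltW//= invf_le1// lerDl sqr_ge0.
Qed.

Lemma rho_cons n a (x : Rn R n) : rho (cons_point (a, x)) = (1 + a ^+ 2)^-1 * rho x.
Proof.
rewrite /rho big_ord_recl tnth0; congr (_ * _).
by apply: eq_bigr => i _; rewrite tnthS.
Qed.

Lemma measurable_rho n : measurable_fun setT (@rho n).
Proof.
apply: measurable_prod => i _.
apply: (measurableT_comp (rint_measurable rint_cauchy_density)).
exact: measurable_tnth.
Qed.

Lemma rint_rho n : rint (lebesgueRn n) (@rho n).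
Proof.
elim: n => [|n ih].
  by apply: eq_rint (@rint_lebesgueRn0 R) => x; rewrite /rho big_ord0.
have [|//] := rint_lebesgueRnS (@measurable_rho n.+1) (@rint_cauchy_density) ih.
move=> a x; rewrite ger0_norm ?rho_ge0// rho_cons.
by [].
Qed.

(** Induction on the dimension brings the coordinate [i] to the front, where the one-dimensional
    statement applies on each line. [F''] makes [F'] continuous along these lines. *)
Lemma Rint_partial0 n i (F F' F'' : Rn R n -> R) c : measurable_fun setT F' ->
  (forall x (a : R), is_derive a 1 (fun b : R => F (set_coord x i b)) (F' (set_coord x i a))) ->
  (forall x (a : R), is_derive a 1 (fun b : R => F' (set_coord x i b)) (F'' (set_coord x i a))) ->
  (forall x, `|F x| <= c * rho x) -> (forall x, `|F' x| <= c * rho x) ->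
  \int[lebesgueRn n]_x F' x = 0.
Proof.
elim: n i F F' F'' c => [[]//|n ih] i F F' F'' c mF dF ddF bF bF'.
pose a_ (t : measurableTypeR R) := c * (1 + t ^+ 2)^-1.
have ra : rint lebesgue_measure a_ by exact: rintZl rint_cauchy_density.
have rb := rint_rho n.
have fab a x : `|F' (cons_point (a, x))| <= a_ a * rho x.
  by rewrite /a_ -mulrA -rho_cons.
have [_ ->] := rint_lebesgueRnS mF ra rb fab.
have mFc : measurable_fun setT (fun z : measurableTypeR R * Rn R n => F' (cons_point z)).
  by apply: (measurableT_comp mF); exact: measurable_cons_point.
move: dF ddF; have [j ->|->] := unliftP ord0 i => dF ddF.
  apply: Rint_eq0 => a.
  apply: (ih j (fun x => F (cons_point (a, x))) _ (fun x => F'' (cons_point (a, x))) (a_ a)).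
  - exact: measurable_section1 mFc.
  - by move=> x b; have := dF (cons_point (a, x)) b; rewrite set_coordS;
      under eq_fun do rewrite set_coordS.
  - by move=> x b; have := ddF (cons_point (a, x)) b; rewrite set_coordS;
      under eq_fun do rewrite set_coordS.
  - by move=> x; rewrite /a_ -mulrA -rho_cons.
  - exact: fab.
rewrite (Rint_swap (m1 := lebesgue_measure) (m2 := lebesgueRn n) mFc fab ra rb).
apply: Rint_eq0 => x.
apply: (@Rint_deriv0 R (fun a => F (cons_point (a, x))) _ (fun a => F'' (cons_point (a, x)))
  (2 * (c * rho x))).
- by move=> b; have := dF (cons_point (b, x)) b; rewrite set_coord0;
    under eq_fun do rewrite set_coord0.
- by move=> b; have := ddF (cons_point (b, x)) b; rewrite set_coord0;
    under eq_fun do rewrite set_coord0.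
- exact: (rint_sectionr (m1 := lebesgue_measure) mFc fab ra).
- move=> a; have c0 : 0 <= c * rho x.
    have := le_trans (normr_ge0 _) (bF (cons_point (0, x))).
    by rewrite rho_cons expr0n addr0 invr1 mul1r.
  apply: (le_trans (bF _)); rewrite rho_cons mulrCA.
  have na : 0 <= `|a| by [].
  rewrite ler_pdivlMr; last by lra.
  rewrite mulrAC; apply: ler_wpM2r => //; rewrite mulrC ler_pdivrMr//.
  rewrite -(real_normK (num_real a)); have := sqr_ge0 (`|a| - 1); nra.
Qed.

End SeparatelyContinuous.

Section Schwartz.
Context {R : realType} (n : nat).
Local Notation L := (@lebesgueRn R n).
Implicit Types (u : Rn R n -> R) (x xi : Rn R n) (i : 'I_n).

Lemma schwartz_partial u i : schwartz_real u -> schwartz_real (partial i u).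
Proof. by move=> su I; have := su (rcons I i); rewrite /partials foldr_rcons. Qed.

Lemma schwartz_partials u I : schwartz_real u -> schwartz_real (partials I u).
Proof. by move=> su; elim: I => [//|i I ih]; exact: schwartz_partial. Qed.

Lemma schwartz_drv u i x (a : R) : schwartz_real u ->
  is_derive a 1 (fun b : R => u (set_coord x i b)) (partial i u (set_coord x i a)).
Proof.
move=> su; have [+ _] := su [::] => /(_ i (set_coord x i a)).
rewrite /partial tnth_set_coord eqxx /=.
under eq_fun do rewrite set_coord_twice.
move=> du; apply: DeriveDef => //.
by rewrite derive1E.
Qed.

Lemma schwartz_measurable u : schwartz_real u -> measurable_fun setT u.
Proof.
move=> su; apply: measurable_sepcont => x i b.
exact: drv_continuous (schwartz_drv i x b su).
Qed.

Lemma exprD_le (a b : R) m : 0 <= a -> 0 <= b ->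
  (a + b) ^+ m <= 2 ^+ m * (a ^+ m + b ^+ m).
Proof.
move=> a0 b0; have [ab|/ltW ab] := leP a b.
  apply: (@le_trans _ _ (2 ^+ m * b ^+ m)).
    by rewrite -exprMn lerXn2r ?nnegrE ?addr_ge0 ?mulr_ge0//; lra.
  by rewrite ler_wpM2l ?exprn_ge0// lerDr exprn_ge0.
apply: (@le_trans _ _ (2 ^+ m * a ^+ m)).
  by rewrite -exprMn lerXn2r ?nnegrE ?addr_ge0 ?mulr_ge0//; lra.
by rewrite ler_wpM2l ?exprn_ge0// lerDl exprn_ge0.
Qed.

Lemma rho_lower x : 1 <= (1 + dot x x) ^+ n * rho x.
Proof.
rewrite -[n in _ ^+ n]card_ord -prodr_const /rho -big_split /=.
rewrite -[leLHS](_ : \prod_(i < n) 1 = 1 :> R); last by rewrite big1.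
apply: ler_prod => i _; rewrite ler01 /= ler_pdivlMr ?mul1r.
  rewrite lerD2l /dot (bigD1 i)//= -expr2 lerDl sumr_ge0// => j _.
  exact: sqr_ge0.
by rewrite ltr_pwDl// sqr_ge0.
Qed.

(** The bounds for the powers 0 and [2 n] of the norm control [(1 + |x|^2)^n |u x|], and
    [rho x >= (1 + |x|^2)^(-n)]. *)
Lemma schwartz_bound u : schwartz_real u -> exists2 c, 0 <= c &
  forall x, `|u x| <= c * rho x.
Proof.
move=> su; have [_ hu] := su [::].
have [M0 h0] := hu 0%N; have [M1 h1] := hu (2 * n)%N.
pose c := 2 ^+ n * (`|M0| + `|M1|).
have c0 : 0 <= c by rewrite mulr_ge0 ?exprn_ge0// addr_ge0.
exists c => // x.
have d0 := dot_ge0 x.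
apply: (@le_trans _ _ ((1 + dot x x) ^+ n * `|u x| * rho x)).
  by rewrite mulrAC ler_peMl// rho_lower.
rewrite ler_wpM2r ?rho_ge0//.
apply: (@le_trans _ _ (2 ^+ n * (1 ^+ n + dot x x ^+ n) * `|u x|)).
  by rewrite ler_wpM2r// exprD_le.
rewrite /c -mulrA ler_wpM2l ?exprn_ge0// expr1n mulrDl mul1r.
rewrite lerD//.
  by apply: le_trans (ler_norm _); have := h0 x; rewrite expr0 mul1r.
by apply: le_trans (ler_norm _); have := h1 x; rewrite exprM -dotE.
Qed.

Lemma schwartz_rint u : schwartz_real u -> rint L u.
Proof.
move=> su; have [c c0 hc] := schwartz_bound su.
exact: rint_le (schwartz_measurable su) hc (rintZl c (@rint_rho R n)).
Qed.

Lemma schwartz_rint2 u : schwartz_real u -> rint L (fun x => u x ^+ 2).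
Proof.
move=> su; have [c c0 hc] := schwartz_bound su.
apply: eq_rint (rint_mulb (M := c) (schwartz_measurable su) _ (schwartz_rint su)) => // x.
by apply: (le_trans (hc x)); rewrite ler_piMr// rho_le1.
Qed.

Definition osc_sign b : R := if b then 1 else -1.

Lemma drv_osc b (f : R -> R) (t df : R) : is_derive t 1 f df ->
  is_derive t 1 (fun v => osc b (f v)) (osc_sign b * osc (~~ b) (f t) * df).
Proof.
case: b => hf; rewrite /osc /osc_sign /=.
  by apply: (is_derive_eq (drv_sin hf)); rewrite mul1r.
by apply: (is_derive_eq (drv_cos hf)); rewrite mulN1r.
Qed.

Lemma dot_set_coord x xi i (a : R) :
  is_derive a 1 (fun b : R => dot (set_coord x i b) xi) (tnth xi i).
Proof.
pose K := \sum_(j < n | j != i) tnth x j * tnth xi j : R.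
have E : (fun b : R => dot (set_coord x i b) xi) = (fun b => b * tnth xi i + K).
  apply/funext => b; rewrite /dot (bigD1 i)//= tnth_set_coord eqxx; congr (_ + _).
  by apply: eq_bigr => j /negPf ji; rewrite tnth_set_coord ji.
rewrite E; apply: (is_derive_eq (drvD (drvM (drv_id a) (drv_cst a (tnth xi i : R))) (drv_cst a K))).
by rewrite mulr0 addr0 mul1r addr0.
Qed.

(** Integration by parts for [u] times the other one of sine and cosine. Iterated in [oscT_decay],
    it trades powers of a frequency coordinate for partial derivatives. *)
Lemma oscT_partial b u xi i : schwartz_real u ->
  tnth xi i * oscT b u xi = osc_sign b * oscT (~~ b) (partial i u) xi.
Proof.
move=> su; have su1 := schwartz_partial i su; have su2 := schwartz_partial i su1.
pose z : R := tnth xi i.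
pose F (u : Rn R n -> R) b x := u x * osc b (dot x xi).
pose c := ~~ b.
pose F' x := F (partial i u) c x + osc_sign c * z * F u (~~ c) x.
pose F'' x := F (partial i (partial i u)) c x + 2 * osc_sign c * z * F (partial i u) (~~ c) x
   - z ^+ 2 * F u c x.
have dF (v : Rn R n -> R) d x (a : R) : schwartz_real v ->
    is_derive a 1 (fun b : R => F v d (set_coord x i b))
      (F (partial i v) d (set_coord x i a) + osc_sign d * z * F v (~~ d) (set_coord x i a)).
  move=> sv; apply: (is_derive_eq (drvM (schwartz_drv i x a sv)
    (drv_osc d (dot_set_coord x xi i a)))).
  by rewrite /F -/z; ring.
have Fle (v : Rn R n -> R) d x k : `|v x| <= k * rho x -> `|F v d x| <= k * rho x.
  by move=> h; rewrite /F normrM (le_trans _ h)// ler_piMr// normr_osc_le1.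
have sgn d : `|osc_sign d| = 1 by case: d; rewrite /osc_sign ?normrN1 ?normr1.
have [k0 k00 h0] := schwartz_bound su; have [k1 k10 h1] := schwartz_bound su1.
have rF d v : schwartz_real v -> rint L (F v d).
  move=> sv; apply: rint_osc; first exact: schwartz_rint.
  exact: measurable_dot.
have rF1 := rF c _ su1; have rF0 := rF (~~ c) _ su.
have rF' : rint L F' by apply: rintD => //; exact: rintZl.
have key : \int[L]_x F' x = 0.
  apply: (@Rint_partial0 R n i (F u c) F' F'' (k0 + (k1 + `|z| * k0))).
  - exact: rint_measurable rF'.
  - by move=> x a; exact: dF.
  - move=> x a.
    apply: (is_derive_eq (drvD (dF _ c x a su1) (drvZ (osc_sign c * z) (dF _ (~~ c) x a su)))).
    rewrite /F'' negbK.
    have sg : osc_sign c * osc_sign (~~ c) = -1 by case: (c); rewrite /osc_sign /= ?mulr1 ?mul1r.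
    rewrite (_ : osc_sign c * z * (F (partial i u) (~~ c) (set_coord x i a) +
       osc_sign (~~ c) * z * F u c (set_coord x i a)) =
       osc_sign c * z * F (partial i u) (~~ c) (set_coord x i a) +
       (osc_sign c * osc_sign (~~ c)) * (z ^+ 2 * F u c (set_coord x i a))); last by ring.
    by rewrite sg; ring.
  - move=> x; apply: (le_trans (Fle _ _ _ _ (h0 x))).
    by rewrite ler_wpM2r ?rho_ge0// lerDl addr_ge0// mulr_ge0.
  - move=> x; rewrite /F'; apply: (le_trans (ler_normD _ _)).
    rewrite mulrDl [leRHS]addrC ler_wpDr ?mulr_ge0 ?rho_ge0// mulrDl lerD//.
      exact: Fle.
    rewrite normrM normrM sgn mul1r -mulrA ler_wpM2l//.
    exact: Fle.
move: key; rewrite RintD//; last exact: rintZl.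
rewrite RintZl// /oscT.
have comm v d : \int[L]_x F v d x = \int[L]_y (v y * osc d (dot xi y)).
  by apply: eq_Rintegral => x _; rewrite /F dotC.
rewrite !comm /c negbK -/z => h.
have {}h : \int[L]_y (partial i u y * osc (~~ b) (dot xi y)) =
    - (osc_sign (~~ b) * z * \int[L]_y (u y * osc b (dot xi y))).
  by apply/eqP; rewrite -subr_eq0 opprK; apply/eqP.
by rewrite h; case: (b); rewrite /osc_sign /=; ring.
Qed.

Lemma oscT_decay b u i m : schwartz_real u -> exists M, forall xi,
  `|tnth xi i : R| ^+ m * `|oscT b u xi| <= M.
Proof.
elim: m b u => [|m ih] b u su.
  exists (\int[L]_x `|u x|) => xi; rewrite expr0 mul1r.
  exact: oscT_le (schwartz_rint su).
have [M hM] := ih (~~ b) (partial i u) (schwartz_partial i su).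
exists M => xi; apply: le_trans (hM xi).
rewrite exprSr -mulrA -normrM oscT_partial// normrM.
by case: (b); rewrite /osc_sign ?normrN1 ?normr1 mul1r.
Qed.

End Schwartz.

(** * Integrability of powers of the frequency *)

Section PowerWeight.
Context {R : realType} (n : nat).
Local Notation L := (@lebesgueRn R n).
Implicit Types (x xi : Rn R n).

Lemma cube_vol x rh : 0 <= rh -> L (cube x rh) = ((2 * rh) ^+ n)%:E.
Proof.
move=> r0.
pose I i := `[(tnth x i : R) - rh, (tnth x i : R) + rh]%classic.
rewrite (_ : cube x rh = [set y | forall i : 'I_n, I i (tnth y i : R)]); last first.
  by apply/seteqP; split => y /= h i; have := h i; rewrite /I /= in_itv/= ler_distl.
rewrite (lebesgueRn_prod (A := I)); last by move=> i; exact: measurable_itv.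
rewrite (eq_bigr (fun=> (2 * rh)%:E)); last first.
  move=> i _; rewrite /I lebesgue_measure_itv/= lte_fin.
  by case: ltP => h; rewrite -?EFinB; congr EFin; lra.
by rewrite prodEFin prodr_const card_ord.
Qed.

Lemma cube_enorm_lower (rh : R) xi : 0 <= rh -> ~ cube vzero rh xi -> rh <= enorm xi.
Proof.
move=> r0 h; have := @dot_vsub_ge R n vzero xi rh r0 h.
have -> : dot (vsub vzero xi) (vsub vzero xi) = dot xi xi.
  by rewrite dot_vsubC /vzero vsub0.
by rewrite dotE ler_pXn2r ?nnegrE// enorm_ge0.
Qed.

Lemma enorm_eq0 xi : (forall i, tnth xi i = 0 :> R) -> enorm xi = 0.
Proof.
by move=> h; rewrite /enorm /dot big1 ?sqrtr0// => i _; rewrite h mulr0.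
Qed.

(** Decay is known along one coordinate at a time; this comparison turns it into decay in the
    Euclidean norm. *)
Lemma dot_pow_le m : exists2 K, 0 <= K & forall xi,
  (1 + dot xi xi) ^+ m <= K * (1 + \sum_(i < n) `|tnth xi i : R| ^+ (2 * m)).
Proof.
suff [K K0 h] : exists2 K, 0 <= K & forall (I : seq 'I_n) xi, (size I <= n)%N ->
    (1 + \sum_(i <- I) tnth xi i * tnth xi i) ^+ m <=
    K * (1 + \sum_(i <- I) `|tnth xi i : R| ^+ (2 * m)).
  exists K => // xi; have := h (enum 'I_n) xi; rewrite size_enum_ord => /(_ (leqnn n)).
  by rewrite !big_enum.
pose K k : R := (2 ^+ m) ^+ k; have K1 k : 1 <= K k by rewrite !exprn_ege1// ler1n.
exists (K n) => [|I xi hI]; first by apply: le_trans (K1 n).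
have : (1 + \sum_(i <- I) tnth xi i * tnth xi i) ^+ m <=
    K (size I) * (1 + \sum_(i <- I) `|tnth xi i : R| ^+ (2 * m)).
  elim: I {hI} => [|i I ih]; first by rewrite !big_nil !addr0 expr1n mulr1.
  rewrite !big_cons.
  set A := \sum_(j <- I) _ in ih *; set B := \sum_(j <- I) _ in ih *.
  have A0 : 0 <= A by apply: sumr_ge0 => j _; exact: sqr_ge0.
  have B0 : 0 <= B by apply: sumr_ge0 => j _; rewrite exprn_ge0.
  have -> : 1 + (tnth xi i * tnth xi i + A) = (1 + A) + (tnth xi i : R) ^+ 2 by rewrite expr2; ring.
  apply: (le_trans (exprD_le m _ (sqr_ge0 _))); first by rewrite addr_ge0.
  have -> : ((tnth xi i : R) ^+ 2) ^+ m = `|tnth xi i : R| ^+ (2 * m).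
    by rewrite exprM real_normK// num_real.
  set t := `|_| ^+ _; have t0 : 0 <= t by rewrite exprn_ge0.
  rewrite /K /= exprS -mulrA ler_wpM2l ?exprn_ge0// -/(K (size I)).
  apply: (@le_trans _ _ (K (size I) * (1 + B) + K (size I) * t)).
    by rewrite lerD// ler_peMl.
  by rewrite -mulrDr ler_wpM2l ?(le_trans ler01)//; lra.
move=> h; apply: (le_trans h); apply: ler_wpM2r.
  by rewrite addr_ge0// sumr_ge0// => j _; rewrite exprn_ge0.
by rewrite /K ler_weXn2l// exprn_ege1// ler1n.
Qed.

(** Outside the cube of radius [2^-(K+1)] the power is at most [2^(-(K+1) s)], and the cube of
    radius [2^-K] has volume [2^((1-K) n)]. The product is [C q^K], and [q < 1] because
    [s > - n]. *)
Lemma neg_power_ball s : (0 < n)%N -> - n%:R < s -> s < 0 ->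
  rint L (fun xi => \1_(cube vzero 1) xi * enorm xi `^ s).
Proof.
move=> n0 sn s0.
pose q : R := 2 `^ (- (n%:R + s)).
have q0 : 0 < q by rewrite powR_gt0.
have q1 : q < 1.
  by rewrite /q powRN invf_lt1 ?powR_gt0// two_powR_gt1//; lra.
have q10 : 0 <= (1 - q)^-1 by rewrite invr_ge0 subr_ge0 ltW.
pose C : R := 2 `^ (n%:R - s).
have mc (rh : R) : measurable_fun setT (\1_(cube vzero rh) : Rn R n -> R).
  exact: measurable_indic_cube.
have mp : measurable_fun setT (fun xi : Rn R n => enorm xi `^ s).
  exact: (@measurable_disp R n s).
pose h (k : nat) : R := 2^-1 ^+ k.
have h0 k : 0 < h k by rewrite exprn_gt0.
pose f (K : nat) (xi : Rn R n) := \1_(cube vzero 1) xi * (1 - \1_(cube vzero (h K)) xi) * enorm xi `^ s.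
have f0 K xi : 0 <= f K xi.
  rewrite /f; apply: mulr_ge0; last exact: powR_ge0.
  by apply: mulr_ge0 => //; rewrite subr_ge0 indicE; case: (_ \in _).
have mf K : measurable_fun setT (f K).
  apply: measurable_funM => //; apply: measurable_funM => //.
  exact: measurable_funB.
have key K : (\int[L]_xi (f K xi)%:E <= (C * \sum_(k < K) q ^+ k)%:E)%E.
  elim: K => [|K ih].
    rewrite big_ord0 mulr0 integral0_eq// => xi _.
    by rewrite /f /h expr0 indicE; case: (_ \in _); rewrite ?subrr ?mulr0 ?mul0r ?mul0r.
  apply: (@le_trans _ _ (\int[L]_xi ((f K xi)%:E +
     (h K.+1 `^ s * \1_(cube vzero (h K)) xi)%:E))%E).
    apply: ge0_le_integral => //.
    - by move=> xi _; rewrite lee_fin.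
    - exact/measurable_EFinP.
    - by apply: emeasurable_funD; apply/measurable_EFinP => //; exact: measurable_funM.
    - move=> xi _; rewrite -EFinD lee_fin /f !indicE.
      have [_|_] := boolP (xi \in cube vzero 1); last first.
        by rewrite !mul0r add0r mulr_ge0 ?powR_ge0.
      rewrite !mul1r; have [_|/negP xK] := boolP (xi \in cube vzero (h K.+1)).
        by rewrite subrr mul0r addr_ge0 ?mulr_ge0 ?powR_ge0// subr_ge0; case: (_ \in _).
      rewrite subr0 mul1r; have [_|_] := boolP (xi \in cube vzero (h K)); last first.
        by rewrite subr0 mul1r mulr0 addr0.
      rewrite subrr mul0r add0r mulr1.
      have hx : h K.+1 <= enorm xi.
        by apply: cube_enorm_lower; [exact: ltW|move=> H; apply: xK; rewrite inE].
      have x0 : 0 < enorm xi by exact: lt_le_trans hx.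
      have : h K.+1 `^ (- s) <= enorm xi `^ (- s).
        by rewrite ge0_ler_powR ?nnegrE ?(ltW x0) ?(ltW (h0 _))// oppr_ge0 ltW.
      by rewrite !powRN lef_pV2 ?posrE ?powR_gt0.
  rewrite ge0_integralD//; last 4 first.
  - by move=> xi _; rewrite lee_fin.
  - exact/measurable_EFinP.
  - by move=> xi _; rewrite lee_fin mulr_ge0 ?powR_ge0.
  - by apply/measurable_EFinP; exact: measurable_funM.
  rewrite big_ord_recr /= mulrDr EFinD leeD//.
  rewrite ge0_intZl ?powR_ge0// integral_indic//; last exact: measurable_cube.
  rewrite setIT [X in (_ * X)%E](_ : _ = ((2 * h K) ^+ n)%:E); last exact: (cube_vol vzero (ltW (h0 K))).
  rewrite -EFinM lee_fin le_eqVlt; apply/orP; left; apply/eqP.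
  have two0 : (2 : R) != 0 by [].
  have hE k : h k = 2 `^ (- k%:R) by rewrite /h powRN powR_mulrn// exprVn.
  have e1 : h K.+1 `^ s = 2 `^ (- (K.+1%:R * s)) by rewrite hE -powRrM mulNr.
  have e2 : (2 * h K) ^+ n = 2 `^ ((1 - K%:R) * n%:R).
    rewrite powRrM powR_mulrn ?powR_ge0// powRD ?two0 ?implybT//.
    by rewrite powRr1// hE.
  have e3 : q ^+ K = 2 `^ (- (n%:R + s) * K%:R) by rewrite powRrM powR_mulrn ?powR_ge0.
  rewrite e1 e2 e3 /C -!powRD ?two0 ?implybT//; congr (_ `^ _).
  by rewrite -natr1; ring.
apply: ge0_rint.
- exact: measurable_funM.
- by move=> xi; rewrite mulr_ge0 ?powR_ge0.
apply: (@le_lt_trans _ _ (C * (1 - q)^-1)%:E); last exact: ltry.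
apply: (@fatou_bound _ _ R L f).
- exact: mf.
- exact: f0.
- move=> xi; have [x0|/existsNP[i /eqP xi0]] := pselect (forall i, tnth xi i = 0 :> R).
    (* At the origin the power with [s < 0] has the default value 0, and so does every [f k]. *)
    rewrite enorm_eq0// powR0 ?lt_eqF// mulr0.
    rewrite (_ : (fun k => f k xi) = fun=> 0); first exact: cvg_cst.
    by apply/funext => k; rewrite /f enorm_eq0// powR0 ?lt_eqF// mulr0.
  apply: cvg_near_cst.
  have p : 0 < `|tnth xi i : R| by rewrite normr_gt0.
  exists (Num.truncn `|tnth xi i : R|^-1).+1 => // k /= hk.
  rewrite /f [in \1_(cube vzero (h k)) xi]indicE memNset ?subr0 ?mulr1// => /(_ i).
  rewrite tnth_mktuple subr0; apply/negP; rewrite -ltNge /h exprVn.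
  rewrite -[ltRHS]invrK ltf_pV2 ?posrE ?invr_gt0 ?exprn_gt0//.
  apply: (lt_le_trans (truncnS_gt _)); apply: (@le_trans _ _ k%:R); first by rewrite ler_nat.
  by rewrite -natrX ler_nat ltnW// ltn_expl.
- move=> K; apply: (le_trans (key K)); rewrite lee_fin ler_wpM2l ?powR_ge0//.
  by apply: geometric_sum_le => //; exact: ltW.
Qed.

(** A negative power is integrable near the origin, where [G] is bounded; away from it the decay of
    [G] absorbs any power, with [rho] left over for integrability. *)
Lemma rint_power_weight (G : Rn R n -> R) s : (0 < n)%N -> - n%:R < s ->
  measurable_fun setT G ->
  (forall i m, exists M, forall xi, `|tnth xi i : R| ^+ m * `|G xi| <= M) ->
  rint L (fun xi => enorm xi `^ s * G xi).
Proof.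
move=> n0 sn mG hG.
have mp : measurable_fun setT (fun xi : Rn R n => enorm xi `^ s).
  exact: (@measurable_disp R n s).
have [M GM] : exists M, forall xi, `|G xi| <= M.
  have [M hM] := hG (Ordinal n0) 0%N; exists M => xi.
  by have := hM xi; rewrite expr0 mul1r.
have M0 : 0 <= M by apply: le_trans (GM vzero).
have pos m : exists2 c, 0 <= c & forall xi, (1 + dot xi xi) ^+ m * `|G xi| <= c.
  have [K K0 hK] := dot_pow_le m.
  have /choice[N hN] : forall i : 'I_n, exists N, forall xi, `|tnth xi i : R| ^+ (2 * m) * `|G xi| <= N.
    by move=> i; exact: hG.
  exists (K * (M + \sum_(i < n) `|N i|)) => [|xi].
    by rewrite mulr_ge0// addr_ge0// sumr_ge0.
  apply: (@le_trans _ _ (K * (1 + \sum_(i < n) `|tnth xi i : R| ^+ (2 * m)) * `|G xi|)).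
    by rewrite ler_wpM2r.
  rewrite -mulrA ler_wpM2l// mulrDl mul1r lerD// mulr_suml.
  by apply: ler_sum => i _; apply: (le_trans (hN i xi)); exact: ler_norm.
have bigpow S : rint L (fun xi => (1 + dot xi xi) ^+ S * G xi).
  have [c c0 hc] := pos (S + n)%N.
  apply: (rint_le _ _ (rintZl c (@rint_rho R n))) => [|xi].
    apply: measurable_funM => //; apply: measurable_funX; apply: measurable_funD => //.
    exact: measurable_dot.
  have d0 := dot_ge0 xi.
  rewrite normrM ger0_norm ?exprn_ge0 ?addr_ge0//.
  apply: (@le_trans _ _ ((1 + dot xi xi) ^+ (S + n) * `|G xi| * rho xi)).
    rewrite exprD mulrAC -[leLHS]mulr1 -!mulrA ler_wpM2l ?exprn_ge0 ?addr_ge0//.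
    by rewrite mulr1 [rho _ * _]mulrC mulrCA ler_peMr// rho_lower.
  by rewrite ler_wpM2r ?rho_ge0.
pose S := (Num.truncn `|s|).+1.
have sS : s <= (2 * S)%:R.
  apply: (le_trans (ler_norm s)); apply: (le_trans (ltW (truncnS_gt _))).
  by rewrite ler_nat leq_pmull.
have far xi : 1 <= enorm xi -> enorm xi `^ s <= (1 + dot xi xi) ^+ S.
  move=> x1; apply: (@le_trans _ _ (enorm xi `^ (2 * S)%:R)); first exact: ler_powR.
  rewrite powR_mulrn ?enorm_ge0// exprM -dotE ler_pXn2r ?nnegrE ?addr_ge0 ?dot_ge0//.
  by rewrite lerDr.
have [s0|s0] := leP 0 s.
  apply: (rint_le _ _ (rint_norm (bigpow S))) => [|xi]; first exact: measurable_funM.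
  rewrite !normrM ler_wpM2r// (ger0_norm (powR_ge0 _ _)) (le_trans _ (ler_norm _))//.
  have [x1|x1] := leP 1 (enorm xi); first exact: far.
  apply: (@le_trans _ _ 1).
    have {1}<- : 1 `^ s = 1 :> R by rewrite powR1.
    by rewrite ge0_ler_powR ?nnegrE ?enorm_ge0// ltW.
  by rewrite exprn_ege1// lerDl dot_ge0.
have r1 := rintZl M (neg_power_ball n0 sn s0).
apply: (rint_le _ _ (rintD r1 (rint_norm (bigpow S)))) => [|xi]; first exact: measurable_funM.
rewrite normrM (ger0_norm (powR_ge0 _ _)) indicE.
have [_|/negP xc] := boolP (xi \in cube vzero 1).
  rewrite mul1r mulrC; apply: (@le_trans _ _ (M * enorm xi `^ s)).
    by rewrite ler_wpM2r ?powR_ge0.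
  by rewrite lerDl.
rewrite mul0r mulr0 add0r normrM ler_wpM2r// (le_trans _ (ler_norm _))// far//.
by apply: cube_enorm_lower => // H; apply: xc; rewrite inE.
Qed.

End PowerWeight.

Lemma Rint_ae d (X : measurableType d) (R : realType) (m : {measure set X -> \bar R})
    (P : X -> Prop) (f g : X -> R) : measurable_fun setT f -> measurable_fun setT g ->
  (forall x, P x -> f x = g x) -> {ae m, forall x, P x} ->
  \int[m]_x f x = \int[m]_x g x.
Proof.
move=> mf mg fg hP; rewrite /Rintegral; congr fine.
apply: ae_eq_integral => //; [exact/measurable_EFinP|exact/measurable_EFinP|].
by apply: filterS hP => x Px _; rewrite fg.
Qed.

(** * The estimate for Schwartz functions *)

Section SchwartzSmoothing.
Context {R : realType} (n : nat).
Local Notation L := (@lebesgueRn R n).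
Local Notation mu := (@lebesgue_measure R).
Variables (alpha beta gamma : R).
Hypotheses (n0 : (0 < n)%N) (beta1 : 1 <= beta)
  (alpha1 : beta + (n%:R - 1) / 2 < alpha) (alpha2 : alpha < n%:R) (gamma1 : 1 <= gamma).
Implicit Types (x y xi : Rn R n) (b c : bool).

Local Notation s := (1 - 2^-1 * (alpha / beta + 2 - gamma)).

(** The property of the real and imaginary parts of the Fourier transform on which the argument
    rests; coordinatewise decay is the form in which [oscT_decay] provides it. *)
Definition decaying (P : Rn R n -> R) := measurable_fun setT P /\
  forall i m, exists M, forall xi, `|tnth xi i : R| ^+ m * `|P xi| <= M.

Lemma decaying_oscT b u : schwartz_real u -> decaying (oscT b u).
Proof.
move=> su; split; first exact: measurable_oscT (schwartz_rint su).
by move=> i m; exact: oscT_decay.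
Qed.

Lemma decayingD P Q : decaying P -> decaying Q -> decaying (fun xi => P xi + Q xi).
Proof.
move=> [mP dP] [mQ dQ]; split; first exact: measurable_funD.
move=> i m; have [M hM] := dP i m; have [N hN] := dQ i m.
exists (M + N) => xi; apply: le_trans (lerD (hM xi) (hN xi)).
by rewrite -mulrDr ler_wpM2l ?exprn_ge0// ler_normD.
Qed.

Lemma decayingN P : decaying P -> decaying (fun xi => - P xi).
Proof.
move=> [mP dP]; split; first exact: measurableT_comp.
by move=> i m; have [M hM] := dP i m; exists M => xi; rewrite normrN.
Qed.

(** This is the square integrability of [|xi|^s] near the origin: [2 s = gamma - alpha / beta], and
    [alpha / beta <= alpha < n]. *)
Lemma smoothing_order_gt : - n%:R < s * 2.
Proof.
have b0 : 0 < beta := lt_le_trans ltr01 beta1.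
have : alpha / beta < n%:R.
  have n1 : (1 : R) <= n%:R by rewrite ler1n.
  have a0 : 0 < alpha by have := alpha1; have := beta1; lra.
  by apply: le_lt_trans alpha2; rewrite ler_pdivrMr// ler_peMr// ltW.
by have := gamma1; lra.
Qed.

Lemma rint_smoothing P : decaying P -> rint L (fun xi => enorm xi `^ s * P xi).
Proof.
move=> [mP dP]; apply: rint_power_weight => //.
have := smoothing_order_gt; have : (1 : R) <= n%:R by rewrite ler1n.
by lra.
Qed.

Lemma rint_smoothing2 P : decaying P ->
  rint L (fun xi => (enorm xi `^ s * P xi) ^+ 2).
Proof.
move=> [mP dP].
have [M hM] := dP (Ordinal n0) 0%N.
have : rint L (fun xi => enorm xi `^ (s * 2) * P xi ^+ 2).
  apply: rint_power_weight => //; first exact: smoothing_order_gt.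
    exact: measurable_funX.
  move=> i m; have [N hN] := dP i m; exists (N * M) => xi.
  rewrite normrX expr2 mulrA ler_pM ?mulr_ge0 ?exprn_ge0//.
  by have := hM xi; rewrite expr0 mul1r.
apply: eq_rint => xi.
by rewrite powRrM powR_mulrn ?powR_ge0// exprMn.
Qed.

(** A point is a null set. This disposes of the places where a power of the Euclidean norm takes a
    default value: the origin of frequency space and the diagonal of the Kerman-Sawyer kernel. *)
Lemma vsub_ae y : {ae L, forall x, enorm (vsub x y) != 0}.
Proof.
exists [set x | forall i : 'I_n, [set (tnth y i : R)]%classic (tnth x i : R)]; split.
- rewrite (_ : [set _ | _] = \bigcap_(i in [set: 'I_n])
    ((@tnth n (measurableTypeR R))^~ i @^-1` [set (tnth y i : R)])); last first.
    by apply/seteqP; split=> x /= h; [move=> i _|move=> i]; exact: h.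
  apply: fin_bigcap_measurable => // i _.
  by rewrite -[X in measurable X]setTI; apply: measurable_tnth => //.
- rewrite (lebesgueRn_prod (A := fun i : 'I_n => [set (tnth y i : R)]%classic))//.
  rewrite (bigD1 (Ordinal n0))//= lebesgue_measure_set1; exact: mul0e.
- move=> x /= /negP; rewrite negbK => /eqP x0 i.
  have : dot (vsub x y) (vsub x y) = 0 by rewrite dotE x0 expr0n.
  move=> /eqP; rewrite /dot psumr_eq0; last by move=> j _; exact: sqr_ge0.
  move=> /allP/(_ i (mem_index_enum _)); rewrite mulf_eq0 orbb tnth_mktuple.
  by rewrite subr_eq0 => /eqP.
Qed.

Lemma enorm_ae : {ae L, forall xi, enorm xi != 0}.
Proof. by apply: filterS (vsub_ae vzero) => xi; rewrite /vzero vsub0. Qed.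

(** Frequencies are restricted to annuli exhausting the space without the origin. The order [s]
    satisfies [alpha / beta - gamma + 2 s = 0], so the weights on the right-hand side cancel and the
    bound does not see the annulus. *)
Lemma smoothing_decaying : exists2 C, 0 <= C &
  forall b c (w P : Rn R n -> R) D,
  measurable_fun setT w -> (forall x, 0 <= w x) ->
  morrey (fun x => w x `^ beta) (n%:R - alpha) D -> 0 < D -> decaying P ->
  (\int[(L \x mu)%E]_z
     (w z.1 * wave gamma b c (fun xi => enorm xi `^ s * P xi)%R z ^+ 2)%:E <=
   (C * D `^ (beta^-1))%:E * \int[L]_xi (P xi ^+ 2)%:E)%E.
Proof.
have [C C0 hC] := smoothing_annulus n0 beta1 alpha1 gamma1.
exists C => // b c w P D mw w0 hw D0 dP.
have mP := dP.1.
set g := fun xi : Rn R n => enorm xi `^ s * P xi.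
have rg : rint L g := rint_smoothing dP.
have rg2 : rint L (fun xi => g xi ^+ 2) := rint_smoothing2 dP.
pose S (N : nat) : set (Rn R n) := [set xi | N.+1%:R^-1 <= enorm xi <= N.+1%:R].
have mS N : measurable (S N).
  rewrite (_ : S N = @enorm R n @^-1` `[N.+1%:R^-1, N.+1%:R]%classic); last first.
    by apply/seteqP; split => xi /=; rewrite in_itv/=.
  by rewrite -[X in measurable X]setTI; apply: measurable_enorm.
pose gN (N : nat) (xi : Rn R n) := \1_(S N) xi * g xi.
have rgN N : rint L (gN N) by exact: rint_indic_mul.
have i01 (N : nat) xi : (\1_(S N) xi : R) = 0 \/ (\1_(S N) xi : R) = 1.
  by rewrite indicE; case: (_ \in _); [right|left].
have gNle N xi : `|gN N xi| <= `|g xi|.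
  by rewrite /gN; case: (i01 N xi) => ->; rewrite ?mul0r ?mul1r ?normr0.
have gN2 N xi : gN N xi ^+ 2 = \1_(S N) xi * g xi ^+ 2.
  by rewrite /gN; case: (i01 N xi) => ->; rewrite ?mul0r ?mul1r ?expr0n.
have rgN2 N : rint L (fun xi => gN N xi ^+ 2).
  by apply: eq_rint (rint_indic_mul (mS N) rg2) => xi; rewrite gN2.
have cgN xi : enorm xi != 0 -> gN N xi @[N --> \oo] --> g xi.
  move=> x0; have xp : 0 < enorm xi by rewrite lt_def x0 enorm_ge0.
  apply: cvg_near_cst.
  exists (Num.truncn (enorm xi + (enorm xi)^-1)).+1 => // N /= hN.
  have h : enorm xi + (enorm xi)^-1 <= N.+1%:R.
    apply: (le_trans (ltW (truncnS_gt _))); rewrite ler_nat.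
    by apply: leq_trans hN _; exact: leqnSn.
  have xi0 : 0 < (enorm xi)^-1 by rewrite invr_gt0.
  rewrite /gN indicE mem_set ?mul1r// /S /=; apply/andP; split; last by lra.
  by rewrite -[leRHS]invrK lef_pV2 ?posrE//; lra.
have cwave z : wave gamma b c (gN N) z @[N --> \oo] --> wave gamma b c g z.
  (* The functions [gN] vanish at the origin, where [g] need not, since the power 0 of 0 is 1. [g1]
     is their pointwise limit everywhere and agrees with [g] almost everywhere. *)
  pose g1 (xi : Rn R n) := if enorm xi == 0 then 0 else g xi.
  have mg1 : measurable_fun setT g1.
    apply: measurable_fun_if => //.
    - apply: measurable_fun_eqr => //; exact: measurable_enorm.
    - exact: measurable_funTS (rint_measurable rg).
  have E : wave gamma b c g z = wave gamma b c g1 z.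
    have m1 := rint_measurable (rint_wave gamma b c z rg).
    have m2 : measurable_fun setT (fun xi : Rn R n =>
        g1 xi * osc b (dot z.1 xi) * osc c (z.2 * disp gamma xi)).
      apply: measurable_funM; last first.
        apply: measurable_osc_comp; apply: measurable_funM => //.
        exact: (@measurable_disp R n gamma).
      apply: measurable_funM; last by apply: measurable_osc_comp; exact: measurable_dot.
      exact: mg1.
    apply: (Rint_ae m1 m2 _ enorm_ae) => xi x0.
    by rewrite /g1 (negPf x0).
  rewrite E; apply: (Rint_dct _ (rint_norm rg)).
  - by move=> N; exact: rint_measurable (rint_wave gamma b c z (rgN N)).
  - move=> N xi; apply: le_trans (gNle N xi); move: (gN N xi) => k.
    by rewrite !normrM -mulrA ler_piMr// mulr_ile1// normr_osc_le1.
  - move=> xi; apply: cvgM; last exact: cvg_cst.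
    apply: cvgM; last exact: cvg_cst.
    rewrite /g1; case: eqVneq => x0; last exact: cgN.
    rewrite (_ : (fun _ => _) = fun=> 0); first exact: cvg_cst.
    apply/funext => N; rewrite /gN indicE memNset ?mul0r// /S /= x0 => /andP[+ _].
    by apply/negP; rewrite -ltNge.
apply: (@fatou_bound _ _ R (prodm L mu) (fun N z => w z.1 * wave gamma b c (gN N) z ^+ 2)).
- move=> N; apply: measurable_funM; first exact: measurable_fst_comp.
  by apply: measurable_funX; exact: measurable_wave.
- by move=> N z; rewrite mulr_ge0// sqr_ge0.
- by move=> z; apply: cvgM; [exact: cvg_cst|rewrite expr2; exact: cvgM].
- move=> N.
  apply: (le_trans (hC b c w (gN N) D N.+1%:R^-1 N.+1%:R mw w0 hw D0 (rgN N) (rgN2 N) _ _)) => //.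
    move=> xi; rewrite /gN indicE; have [|] := boolP (xi \in S N); first by rewrite inE.
    by rewrite mul0r eqxx.
  apply: lee_wpmul2l; first by rewrite lee_fin mulr_ge0// powR_ge0.
  apply: le_ge0_int => [||xi].
  - apply: measurable_funM; last exact: rint_measurable (rgN2 N).
    exact: (@measurable_disp R n (alpha / beta - gamma)).
  - exact: measurable_funX.
  - rewrite mulr_ge0 ?powR_ge0 ?sqr_ge0//= gN2 /g indicE.
    have [|_] := boolP (xi \in S N); last by rewrite mul0r mulr0 sqr_ge0.
    rewrite inE => /= /andP[h _].
    have x0 : 0 < enorm xi by apply: lt_le_trans h; rewrite invr_gt0.
    rewrite mul1r exprMn -[(_ `^ s) ^+ 2]powR_mulrn ?powR_ge0// -powRrM mulrA.
    rewrite -powRD ?(gt_eqF x0) ?implybT// (_ : _ + _ = 0) ?powRr0 ?mul1r//.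
    by lra.
Qed.

Definition normsq (z : R[i]) : R := complex.Re z ^+ 2 + complex.Im z ^+ 2.

Lemma normc_sqr z : ComplexField.Normc.normc z ^+ 2 = normsq z.
Proof.
by case: z => a b; rewrite /ComplexField.Normc.normc sqr_sqrtr// addr_ge0 ?sqr_ge0.
Qed.

Lemma fourier_oscT f xi : schwartz f ->
  let u x := complex.Re (f x) in let v x := complex.Im (f x) in
  complex.Re (fourier f xi) = oscT false u xi + oscT true v xi /\
  complex.Im (fourier f xi) = oscT false v xi - oscT true u xi.
Proof.
move=> [su sv] u v.
have ru := schwartz_rint su; have rv := schwartz_rint sv.
split; rewrite /oscT -?RintD -?RintB; try exact: rint_oscT.
  apply: eq_Rintegral => x _; rewrite dotC /u /v /osc; case: (f x) => a b /=.
  by rewrite cosN sinN /=; ring.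
apply: eq_Rintegral => x _; rewrite dotC /u /v /osc; case: (f x) => a b /=.
by rewrite cosN sinN /=; ring.
Qed.

Lemma decaying_fourier f : schwartz f ->
  decaying (fun xi => complex.Re (fourier f xi)) /\
  decaying (fun xi => complex.Im (fourier f xi)).
Proof.
move=> sf; have h xi := fourier_oscT xi sf; case: sf h => su sv h; split.
  under eq_fun do rewrite (h _).1.
  by apply: decayingD; exact: decaying_oscT.
under eq_fun do rewrite (h _).2.
by apply: decayingD; [|apply: decayingN]; exact: decaying_oscT.
Qed.

Lemma propagator_wave f x (t : R) : schwartz f ->
  let p xi := enorm xi `^ s * complex.Re (fourier f xi) in
  let q xi := enorm xi `^ s * complex.Im (fourier f xi) in
  let W b c g := wave gamma b c g (x, t) in
  propagator s gamma f x t = Complex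
    ((2 * pi) ^- n * (W false false p + W true true p - W true false q + W false true q))
    ((2 * pi) ^- n * (W true false p - W false true p + W false false q + W true true q)).
Proof.
move=> sf p q W.
have [dP dQ] := decaying_fourier sf.
have rW b c g : decaying g -> rint L (fun xi => enorm xi `^ s * g xi * osc b (dot x xi) *
    osc c (t * disp gamma xi)).
  by move=> dg; exact: (@rint_wave R n gamma b c _ (x, t) (rint_smoothing dg)).
have rp b c := rW b c _ dP; have rq b c := rW b c _ dQ.
apply/eqP; rewrite /propagator /cintegral eq_complex /=; apply/andP.
rewrite !mul0r subr0 addr0 /W /wave; split; apply/eqP; congr (_ * _).
  have r1 := rintD (rp false false) (rp true true); have r2 := rintB r1 (rq true false).
  rewrite -(RintD (rp false false) (rp true true)) -(RintB r1 (rq true false)).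
  rewrite -(RintD r2 (rq false true)); apply: eq_Rintegral => xi _.
  rewrite cosN sinN /disp /osc /=; move: (\int[L]_y complex.Re _) (\int[L]_y complex.Im _) => A B.
  by ring.
have r1 := rintB (rp true false) (rp false true); have r2 := rintD r1 (rq false false).
rewrite -(RintB (rp true false) (rp false true)) -(RintD r1 (rq false false)).
rewrite -(RintD r2 (rq true true)); apply: eq_Rintegral => xi _.
rewrite cosN sinN /disp /osc /=; move: (\int[L]_y complex.Re _) (\int[L]_y complex.Im _) => A B.
by ring.
Qed.

Lemma measurable_propagator f : schwartz f ->
  cmeasurable (fun z : Rn R n * measurableTypeR R => propagator s gamma f z.1 z.2).
Proof.
move=> sf; have [dP dQ] := decaying_fourier sf.
have m b c g : decaying g -> measurable_fun setT
    (fun z : Rn R n * measurableTypeR R => wave gamma b c (fun xi => enorm xi `^ s * g xi) (z.1, z.2)).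
  move=> dg; have := @measurable_wave R n gamma b c _ (rint_smoothing dg).
  by apply: eq_measurable_fun => -[].
split; under eq_fun do rewrite (propagator_wave _ _ sf) /=; apply: measurable_funM => //.
  apply: measurable_funD; last exact: m.
  by apply: measurable_funB; [apply: measurable_funD|]; exact: m.
apply: measurable_funD; last exact: m.
by apply: measurable_funD; [apply: measurable_funB|]; exact: m.
Qed.

Lemma normsq_propagator f x (t : R) : schwartz f ->
  let p xi := enorm xi `^ s * complex.Re (fourier f xi) in
  let q xi := enorm xi `^ s * complex.Im (fourier f xi) in
  (normsq (propagator s gamma f x t) <= ((2 * pi) ^- n) ^+ 2 * 4 *
  \sum_(d <- [:: (false, false); (false, true); (true, false); (true, true)])
    (wave gamma d.1 d.2 p (x, t) ^+ 2 + wave gamma d.1 d.2 q (x, t) ^+ 2) : Prop).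
Proof.
move=> sf p q; rewrite (propagator_wave x t sf) -/p -/q /normsq !big_cons big_nil.
rewrite [complex.Re _]/= [complex.Im _]/=.
move: (wave _ _ _ _ _) (wave _ _ _ _ _) (wave _ _ _ _ _) (wave _ _ _ _ _) => a1 a2 a3 a4.
move: (wave _ _ _ _ _) (wave _ _ _ _ _) (wave _ _ _ _ _) (wave _ _ _ _ _) => b1 b2 b3 b4.
move: (_ ^- _) => k; rewrite !exprMn -mulrDr -mulrA ler_wpM2l ?sqr_ge0//.
have h (y1 y2 y3 y4 : R) : (y1 + y2 + y3 + y4) ^+ 2 <= 4 * (y1 ^+ 2 + y2 ^+ 2 + y3 ^+ 2 + y4 ^+ 2).
  rewrite -subr_ge0 (_ : _ - _ = (y1 - y2) ^+ 2 + (y1 - y3) ^+ 2 + (y1 - y4) ^+ 2 +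
    (y2 - y3) ^+ 2 + (y2 - y4) ^+ 2 + (y3 - y4) ^+ 2); last by ring.
  by rewrite !addr_ge0 ?sqr_ge0.
apply: (le_trans (lerD (h _ _ _ _) (h _ _ _ _))).
by rewrite !sqrrN -mulrDr ler_wpM2l// le_eqVlt; apply/orP; left; apply/eqP; ring.
Qed.

(** The transforms of the real and imaginary parts are bounded separately by Bessel's inequality;
    the factor 2 absorbs the cross terms. *)
Lemma fourier_L2_le f : schwartz f ->
  (\int[L]_xi (normsq (fourier f xi))%:E <=
   (2 * (2 * pi) ^+ n)%:E * \int[L]_x (normsq (f x))%:E)%E.
Proof.
move=> sf; have h xi := fourier_oscT xi sf; case: sf h => su sv h.
set u := fun x => complex.Re (f x); set v := fun x => complex.Im (f x).
have ru := schwartz_rint su; have rv := schwartz_rint sv.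
have ru2 := schwartz_rint2 su; have rv2 := schwartz_rint2 sv.
have Bu := bessel ru ru2; have Bv := bessel rv rv2.
have mu' := measurable_energyT ru; have mv' := measurable_energyT rv.
apply: (@le_trans _ _ (\int[L]_xi (2 * (energyT u xi + energyT v xi))%:E)%E).
  apply: le_ge0_int => [||xi].
  - rewrite /normsq; under eq_fun do rewrite (h _).1 (h _).2.
    apply: measurable_funD; apply: measurable_funX;
      [apply: measurable_funD|apply: measurable_funB]; exact: measurable_oscT.
  - by apply: measurable_funM => //; exact: measurable_funD.
  - apply/andP; split; first by rewrite addr_ge0 ?sqr_ge0.
    rewrite /normsq (h xi).1 (h xi).2.
    have E (k : Rn R n -> R) : energyT k xi = oscT false k xi ^+ 2 + oscT true k xi ^+ 2.
      by rewrite /energyT; congr (_ ^+ 2 + _ ^+ 2); apply: eq_Rintegral => x _; rewrite dotC.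
    rewrite !E -/u -/v.
    move: (oscT _ _ _) (oscT _ _ _) (oscT _ _ _) (oscT _ _ _) => a1 a2 a3 a4.
    rewrite -subr_ge0 (_ : _ - _ = (a4 - a3) ^+ 2 + (a2 + a1) ^+ 2); last by ring.
    by rewrite addr_ge0 ?sqr_ge0.
rewrite ge0_intZl//; last 2 first.
- exact: measurable_funD.
- by move=> xi; rewrite addr_ge0 ?energyT_ge0.
rewrite EFinM -muleA; apply: lee_wpmul2l => //.
under eq_integral do rewrite EFinD.
rewrite ge0_integralD//; last 4 first.
- by move=> xi _; rewrite lee_fin energyT_ge0.
- exact/measurable_EFinP.
- by move=> xi _; rewrite lee_fin energyT_ge0.
- exact/measurable_EFinP.
apply: (le_trans (leeD Bu Bv)).
rewrite -EFinD -mulrDr -RintD// EFinM RintE//.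
exact: rintD.
Qed.

Lemma smoothing_schwartz : exists2 C, 0 <= C &
  forall (w : Rn R n -> R) D f, measurable_fun setT w -> (forall x, 0 <= w x) ->
  morrey (fun x => w x `^ beta) (n%:R - alpha) D -> 0 < D -> schwartz f ->
  (\int[mu]_t \int[L]_x (normsq (propagator s gamma f x t) * w x)%:E <=
   (C * D `^ (beta^-1))%:E * \int[L]_x (normsq (f x))%:E)%E.
Proof.
have [C C0 hC] := smoothing_decaying.
pose k : R := ((2 * pi) ^- n) ^+ 2 * 4.
have k0 : 0 <= k by rewrite mulr_ge0 ?sqr_ge0.
(* [k] comes from [normsq_propagator], 4 from the choices of the two booleans, [C] from
   [smoothing_decaying] and the last factor from [fourier_L2_le]. *)
exists (k * (4 * (C * (2 * (2 * pi) ^+ n)))).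
  do 4 ?[apply: mulr_ge0 => //]; apply: exprn_ge0; apply: mulr_ge0 => //.
  exact: pi_ge0.
move=> w D f mw w0 hw D0 sf.
have [dP dQ] := decaying_fourier sf.
set p := fun xi => enorm xi `^ s * complex.Re (fourier f xi).
set q := fun xi => enorm xi `^ s * complex.Im (fourier f xi).
have rp : rint L p := rint_smoothing dP; have rq : rint L q := rint_smoothing dQ.
pose ds := [:: (false, false); (false, true); (true, false); (true, true)].
pose F (z : Rn R n * measurableTypeR R) := \sum_(d <- ds)
  (w z.1 * wave gamma d.1 d.2 p z ^+ 2 + w z.1 * wave gamma d.1 d.2 q z ^+ 2).
have mwave b c g : rint L g -> measurable_fun setT (fun z : Rn R n * measurableTypeR R =>
    w z.1 * wave gamma b c g z ^+ 2).
  move=> rg; apply: measurable_funM; first exact: measurable_fst_comp.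
  by apply: measurable_funX; exact: measurable_wave.
have w20 b c g z : 0 <= w z.1 * wave gamma b c g z ^+ 2 by rewrite mulr_ge0// sqr_ge0.
have mF : measurable_fun setT F.
  by apply: measurable_sum => d; apply: measurable_funD; exact: mwave.
have F0 z : 0 <= F z by apply: sumr_ge0 => d _; rewrite addr_ge0.
have [mr mi] := measurable_propagator sf.
pose H (z : Rn R n * measurableTypeR R) := normsq (propagator s gamma f z.1 z.2) * w z.1.
have mH : measurable_fun setT H.
  apply: measurable_funM; last exact: measurable_fst_comp.
  by apply: measurable_funD; exact: measurable_funX.
have H0 z : 0 <= H z by rewrite mulr_ge0// addr_ge0// sqr_ge0.
rewrite -(tonelli_prod2 L mu mH H0).
apply: (@le_trans _ _ (\int[(L \x mu)%E]_z (k * F z)%:E)%E).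
  apply: le_ge0_int => //; first exact: measurable_funM.
  move=> [x t]; rewrite H0 /= /H /F.
  apply: (le_trans (ler_wpM2r (w0 x) (normsq_propagator x t sf))).
  rewrite -/k -mulrA ler_wpM2l// mulr_suml le_eqVlt; apply/orP; left; apply/eqP.
  have com (a b c : R) : (a + b) * c = c * a + c * b by ring.
  by apply: eq_bigr => d _; exact: com.
rewrite (ge0_intZl _ k0 mF F0).
have -> : (k * (4 * (C * (2 * (2 * pi) ^+ n))) * D `^ beta^-1)%:E =
    (k%:E * (4 * (C * D `^ beta^-1 * (2 * (2 * pi) ^+ n)))%:E)%E.
  by rewrite -EFinM; congr EFin; ring.
rewrite -[leRHS]muleA; apply: lee_wpmul2l; first by rewrite lee_fin.
under eq_integral do rewrite -sumEFin.
rewrite ge0_integral_sum//; last 2 first.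
- by move=> d; apply/measurable_EFinP; apply: measurable_funD; exact: mwave.
- by move=> d z _; rewrite lee_fin addr_ge0.
set B := ((C * D `^ beta^-1)%:E * \int[L]_xi (normsq (fourier f xi))%:E)%E.
apply: (@le_trans _ _ (\sum_(d <- ds) B)%E).
  apply: lee_sum => d _.
  under eq_integral do rewrite EFinD.
  rewrite ge0_integralD//; last 4 first.
  - by move=> z _; rewrite lee_fin.
  - by apply/measurable_EFinP; exact: mwave.
  - by move=> z _; rewrite lee_fin.
  - by apply/measurable_EFinP; exact: mwave.
  apply: (le_trans (leeD (hC d.1 d.2 w _ D mw w0 hw D0 dP) (hC d.1 d.2 w _ D mw w0 hw D0 dQ))).
  rewrite -ge0_muleDr; last 2 first.
  - by apply: integral_ge0 => xi _; rewrite lee_fin sqr_ge0.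
  - by apply: integral_ge0 => xi _; rewrite lee_fin sqr_ge0.
  rewrite -ge0_integralD//; last 4 first.
  - by move=> xi _; rewrite lee_fin sqr_ge0.
  - by apply/measurable_EFinP; apply: measurable_funX; exact: dP.1.
  - by move=> xi _; rewrite lee_fin sqr_ge0.
  - by apply/measurable_EFinP; apply: measurable_funX; exact: dQ.1.
have CD : 0 <= C * D `^ beta^-1 by rewrite mulr_ge0 ?powR_ge0.
apply: (@le_trans _ _ (\sum_(d <- ds) ((C * D `^ beta^-1)%:E *
    ((2 * (2 * pi) ^+ n)%:E * \int[L]_x (normsq (f x))%:E)))%E).
  apply: lee_sum => d _; apply: lee_wpmul2l => //; exact: fourier_L2_le.
rewrite muleA -EFinM; set Y := (_ * integral _ _ _)%E.
have Y0 : (0 <= Y)%E.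
  apply: mule_ge0; last by apply: integral_ge0 => x _; rewrite lee_fin addr_ge0 ?sqr_ge0.
  rewrite lee_fin; apply: mulr_ge0 => //; apply: mulr_ge0 => //.
  by apply: exprn_ge0; apply: mulr_ge0 => //; exact: pi_ge0.
rewrite EFinM -muleA -/Y !big_cons big_nil adde0.
have -> : (4%:E = 1%:E + (1%:E + (1%:E + 1%:E)) :> \bar R)%E.
  by rewrite -!EFinD; congr EFin; ring.
by rewrite !ge0_muleDl ?adde_ge0// !mul1e.
Qed.


End SchwartzSmoothing.

Lemma integral_indic_mul d (X : measurableType d) (R : realType)
    (m : {measure set X -> \bar R}) (D : set X) (f : X -> R) :
  (\int[m]_(x in D) (f x)%:E = \int[m]_x (\1_D x * f x)%:E)%E.
Proof.
rewrite integral_mkcond; apply: eq_integral => x _; rewrite patchE indicE.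
by case: (_ \in _); rewrite ?mul1r ?mul0r.
Qed.

(** * Kerman-Sawyer weights *)

Section KermanSawyer.
Context {R : realType} (n : nat).
Local Notation L := (@lebesgueRn R n).
Implicit Types (x y : Rn R n) (v : Rn R n -> R) (k : int) (m : 'I_n -> int).

Lemma edistE x y : Defs.edist x y = enorm (vsub x y).
Proof.
rewrite /Defs.edist /enorm /dot; congr Num.sqrt; apply: eq_bigr => i _.
by rewrite tnth_mktuple expr2.
Qed.

Lemma measurable_dyadic_cube k m : measurable (dyadic_cube k m : set (Rn R n)).
Proof.
rewrite (_ : dyadic_cube k m = \bigcap_(i in [set: 'I_n])
  ((@tnth n (measurableTypeR R))^~ i @^-1` `[(m i)%:~R * 2 ^ k, (m i + 1)%:~R * 2 ^ k[)).
  apply: fin_bigcap_measurable => // i _; rewrite -[X in measurable X]setTI.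
  by apply: measurable_tnth.
apply/seteqP; split => y.
  by move=> h i _ /=; rewrite in_itv/=; exact: h.
by move=> h i; have := h i Logic.I; rewrite /= in_itv.
Qed.

Lemma dyadic_cube_dist k m x y : dyadic_cube k m x -> dyadic_cube k m y ->
  Defs.edist x y <= Num.sqrt n%:R * 2 ^ k.
Proof.
move=> hx hy; have l0 : (0 : R) < 2 ^ k by exact: exprz_gt0.
rewrite -[2 ^ k]ger0_norm ?(ltW l0)// -sqrtr_sqr -sqrtrM ?ler0n// ler_wsqrtr//.
rewrite -[n in n%:R]card_ord -sumr_const mulr_suml; apply: ler_sum => i _.
rewrite mul1r -[leRHS]real_normK ?num_real// -[leLHS]real_normK ?num_real//.
rewrite lerXn2r ?nnegrE//= [leRHS]ger0_norm ?(ltW l0)// ler_norml.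
move: (hx i) (hy i); rewrite intrD mulrDl mul1r => /andP[h1 h2] /andP[h3 h4].
by apply/andP; split; lra.
Qed.

Lemma weight_cube_lty v rh : weight v -> 0 <= rh ->
  (\int[L]_(x in cube vzero rh) (v x)%:E < +oo)%E.
Proof.
move=> [mv v0 vfin] r0; apply: le_lt_trans (vfin (Num.sqrt n%:R * rh)).
have mc : measurable (cball0 (Num.sqrt n%:R * rh) : set (Rn R n)).
  rewrite (_ : cball0 _ = @enorm R n @^-1` `]-oo, Num.sqrt n%:R * rh]%classic); last first.
    by apply/seteqP; split => x /=; rewrite in_itv.
  by rewrite -[X in measurable X]setTI; apply: measurable_enorm.
apply: ge0_subset_integral => //; first exact: measurable_cube.
- by apply: measurable_funTS; exact/measurable_EFinP.
- by move=> x _; rewrite lee_fin.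
move=> x hx; rewrite /cball0 /= /enorm -[rh]ger0_norm// -sqrtr_sqr -sqrtrM ?ler0n//.
rewrite ler_wsqrtr// -[n in n%:R]card_ord -sumr_const mulr_suml; apply: ler_sum => i _.
rewrite mul1r -expr2 -[leLHS]real_normK ?num_real// lerXn2r ?nnegrE//.
by have := hx i; rewrite tnth_mktuple subr0.
Qed.

Lemma weight_dyadic_lty v k m : weight v ->
  (\int[L]_(x in dyadic_cube k m) (v x)%:E < +oo)%E.
Proof.
move=> wv; have [mv v0 _] := wv; have l0 : (0 : R) < 2 ^ k by exact: exprz_gt0.
pose rh : R := (\sum_(i < n) `|(m i)%:~R| + 1) * 2 ^ k.
have S0 (P : pred 'I_n) : 0 <= \sum_(i < n | P i) `|(m i)%:~R : R| by exact: sumr_ge0.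
have r0 : 0 <= rh by rewrite mulr_ge0 ?addr_ge0// ltW.
apply: le_lt_trans (weight_cube_lty wv r0).
apply: ge0_subset_integral => //.
- exact: measurable_dyadic_cube.
- exact: measurable_cube.
- by apply: measurable_funTS; exact/measurable_EFinP.
- by move=> x _; rewrite lee_fin.
move=> x hx i; rewrite tnth_mktuple subr0.
have /andP[h1 h2] := hx i; rewrite intrD in h2.
have h3 : `|(m i)%:~R| * 2 ^ k <= (\sum_(i < n) `|(m i)%:~R|) * 2 ^ k :> R.
  by rewrite ler_wpM2r ?(ltW l0)// (bigD1 i)//= lerDl S0.
have h4 : (m i)%:~R * 2 ^ k <= `|(m i)%:~R| * 2 ^ k :> R by rewrite ler_wpM2r ?(ltW l0)// ler_norm.
have h5 : - ((m i)%:~R * 2 ^ k) <= `|(m i)%:~R| * 2 ^ k :> R.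
  by rewrite -mulNr ler_wpM2r ?(ltW l0)// -normrN ler_norm.
rewrite /rh ler_norml mulrDl mul1r; rewrite mulrDl mul1r in h2.
move: (_ * _) (_ * _) (_ * _) h1 h2 h3 h4 h5 => a b c h1 h2 h3 h4 h5.
by apply/andP; split; lra.
Qed.

Variable alpha : R.
Hypotheses (n0 : (0 < n)%N) (alpha2 : alpha < n%:R).

(* On a cube of side [2 ^ k] the kernel is at least
   [(sqrt n * 2 ^ k) `^ (alpha - n)]. *)
Lemma KS_ratio_ge v k m : weight v ->
  (\int[L]_(x in dyadic_cube k m) (v x)%:E <=
   KS_ratio alpha v (dyadic_cube k m) * ((Num.sqrt n%:R * 2 ^ k) `^ (n%:R - alpha))%:E)%E.
Proof.
move=> [mv v0 vfin]; set Q := dyadic_cube k m; set lam := _ `^ _.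
have mQ : measurable Q by exact: measurable_dyadic_cube.
set V := (\int[L]_(x in Q) (v x)%:E)%E; rewrite /KS_ratio -/V.
have lam0 : 0 < lam.
  by rewrite powR_gt0// mulr_gt0 ?exprz_gt0// sqrtr_gt0 ltr0n.
have mvQ : measurable_fun Q (EFin \o v).
  by apply: measurable_funTS; exact/measurable_EFinP.
have V0 : (0 <= V)%E by apply: integral_ge0 => x _; rewrite lee_fin.
case: eqVneq => [->|Vn0]; first by rewrite mul0e.
have Vfin : V \is a fin_num by rewrite ge0_fin_numE// weight_dyadic_lty.
rewrite -muleA -[leLHS]mul1e -(mulVe Vn0 Vfin) -muleA; apply: lee_wpmul2l.
  by rewrite inve_ge0.
pose F (z : Rn R n * Rn R n) := v z.1 * v z.2 / Defs.edist z.1 z.2 `^ (n%:R - alpha).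
have F0 z : 0 <= F z by rewrite divr_ge0 ?powR_ge0 ?mulr_ge0.
have mF : measurable_fun setT F.
  apply: measurable_funM.
    by apply: measurable_funM; [exact: measurable_fst_comp|exact: measurable_snd_comp].
  rewrite (_ : (fun _ => _) = fun z => enorm (vsub z.1 z.2) `^ (- (n%:R - alpha))); last first.
    by apply/funext => z; rewrite edistE powRN.
  apply: (measurableT_comp (@measurable_disp R n (- (n%:R - alpha)))).
  by apply: measurable_vsub; [exact: measurable_fst|exact: measurable_snd].
have inner y : Q y -> (V * (v y / lam)%:E <= \int[L]_(x in Q) (F (x, y))%:E)%E.
  move=> Qy; rewrite muleC -ge0_integralZl//; last 2 first.
  - by move=> x _; rewrite lee_fin.
  - by rewrite lee_fin divr_ge0// ltW.
  apply: ae_ge0_le_integral => //.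
  - by move=> x _; rewrite -EFinM lee_fin mulr_ge0// divr_ge0// ltW.
  - apply: measurable_funTS; apply/measurable_EFinP; exact: measurable_funM.
  - by move=> x _; rewrite lee_fin.
  - apply: measurable_funTS; apply/measurable_EFinP; exact: measurable_section2 mF.
  (* On the diagonal the kernel has the default value 0 and the lower bound fails; hence the
     comparison almost everywhere. *)
  - apply: filterS (vsub_ae n0 y) => x xy Qx.
    have e0 : 0 < Defs.edist x y by rewrite edistE lt_def xy enorm_ge0.
    rewrite -EFinM lee_fin /F /= mulrC mulrA ler_wpM2l ?mulr_ge0//.
    have h : Defs.edist x y `^ (n%:R - alpha) <= lam.
      apply: ge0_ler_powR; rewrite ?nnegrE ?subr_ge0 ?(ltW alpha2) ?(ltW e0)//.
        by rewrite mulr_ge0 ?sqrtr_ge0// ltW// exprz_gt0.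
      exact: dyadic_cube_dist Qx Qy.
    have p0 : 0 < Defs.edist x y `^ (n%:R - alpha) by exact: powR_gt0.
    by rewrite lef_pV2// ?posrE.
apply: (@le_trans _ _ ((\int[L]_(y in Q) (V * (v y / lam)%:E)) * lam%:E)%E).
  rewrite ge0_integralZl//; last 2 first.
  - by apply: measurable_funTS; apply/measurable_EFinP; exact: measurable_funM.
  - by move=> y _; rewrite lee_fin divr_ge0// ltW.
  under eq_integral do rewrite mulrC EFinM.
  rewrite ge0_integralZl//; last 2 first.
  - by move=> y _; rewrite lee_fin.
  - by rewrite lee_fin invr_ge0 ltW.
  rewrite -/V; move: Vfin => /fineK <-; rewrite -!EFinM lee_fin.
  rewrite -!mulrA [fine V * lam]mulrC mulKf// gt_eqF//.
apply: lee_wpmul2r; first by rewrite lee_fin ltW.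
apply: ge0_le_integral => //.
- by move=> y _; apply: mule_ge0 => //; rewrite lee_fin divr_ge0// ltW.
- apply: measurable_funTS; apply: emeasurable_funM => //.
  by apply/measurable_EFinP; exact: measurable_funM.
apply: measurable_funTS; under eq_fun do rewrite integral_indic_mul.
apply: (measurable_tonelli2 L (f := fun z : Rn R n * Rn R n => \1_Q z.1 * F z)).
  by apply: measurable_funM => //; apply: measurable_fst_comp; exact: measurable_indic.
by move=> z; rewrite mulr_ge0.
Qed.

Lemma dyadic_pow (r : R) : 0 < r -> exists k : int, r <= 2 ^ k <= 2 * r.
Proof.
move=> r0; have [r1|/ltW r1] := leP 1 r.
  have [J /andP[h1 h2]] := dyadic_scale r1; exists J.+1%:Z.
  by rewrite -exprnP exprS ltW//= ler_wpM2l.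
have r1' : 1 <= r^-1 by rewrite invf_ge1.
have [J /andP[h1 h2]] := dyadic_scale r1'; exists (- J%:Z).
have J0 : (0 : R) < 2 ^+ J by rewrite exprn_gt0.
rewrite -exprnN; apply/andP; split.
  by rewrite -[r]invrK lef_pV2 ?posrE ?invr_gt0.
move: h2; rewrite -[2 * 2 ^+ J]invrK ltf_pV2 ?posrE ?invr_gt0 ?mulr_gt0// invfM => h2.
have : 2 * (2^-1 * (2 ^+ J)^-1) <= 2 * r by rewrite ler_wpM2l// ltW.
by rewrite mulrA divff ?mul1r.
Qed.

(** For [rh <= 2^k] an interval of length [2 rh] is covered by three consecutive dyadic intervals of
    length [2^k], so the cube is covered by [3^n] dyadic cubes, indexed by the functions from ['I_n]
    to ['I_3]. As [2^k <= 2 rh], the bounds on these cubes have the right size. *)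
Lemma KS_morrey : exists2 K, 0 < K & forall v D, weight v -> 0 <= D ->
  (KS_norm alpha v <= D%:E)%E -> morrey v (n%:R - alpha) (K * D).
Proof.
set kap := n%:R - alpha; have kap0 : 0 < kap by rewrite subr_gt0.
have sn0 : 0 < Num.sqrt n%:R :> R by rewrite sqrtr_gt0 ltr0n.
exists (#|{ffun 'I_n -> 'I_3}|%:R * (Num.sqrt n%:R * 2) `^ kap).
  rewrite mulr_gt0 ?powR_gt0 ?mulr_gt0// ltr0n; apply/card_gt0P.
  by exists [ffun=> ord0].
move=> v D wv D0 hD x rh r0; have [mv v0 _] := wv.
have [k /andP[k1 k2]] := dyadic_pow r0.
have l0 : (0 : R) < 2 ^ k by exact: exprz_gt0.
pose m (d : {ffun 'I_n -> 'I_3}) i : int := Num.floor ((tnth x i - rh) / 2 ^ k) + (d i)%:Z.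
have Qd d : (\int[L]_(y in dyadic_cube k (m d)) (v y)%:E <=
    (D * (Num.sqrt n%:R * 2 * rh) `^ kap)%:E)%E.
  apply: (le_trans (KS_ratio_ge k (m d) wv)).
  rewrite EFinM; apply: lee_pmul.
  - rewrite /KS_ratio; case: ifP => // _; apply: mule_ge0.
      by rewrite inve_ge0; apply: integral_ge0 => y _; rewrite lee_fin.
    apply: integral_ge0 => y _; apply: integral_ge0 => z _.
    by rewrite lee_fin divr_ge0 ?powR_ge0 ?mulr_ge0.
  - by rewrite lee_fin powR_ge0.
  - apply: le_trans hD; apply: ereal_sup_ubound; exists (k, m d) => //.
  - rewrite lee_fin ge0_ler_powR ?nnegrE ?(ltW kap0)//.
    + by rewrite mulr_ge0 ?(ltW sn0) ?(ltW l0).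
    + by rewrite mulr_ge0 ?mulr_ge0 ?(ltW sn0) ?(ltW r0).
    + by rewrite -mulrA ler_wpM2l ?(ltW sn0).
apply: (@le_trans _ _ (\sum_(d : {ffun 'I_n -> 'I_3})
    \int[L]_(y in dyadic_cube k (m d)) (v y)%:E)%E).
  under eq_bigr do rewrite integral_indic_mul.
  have mQ d : measurable_fun setT (\1_(dyadic_cube k (m d)) : Rn R n -> R).
    by apply: measurable_indic; exact: measurable_dyadic_cube.
  rewrite -ge0_integral_sum//; last 2 first.
  - by move=> d; apply/measurable_EFinP; exact: measurable_funM.
  - by move=> d y _; rewrite lee_fin mulr_ge0.
  under [leRHS]eq_integral do rewrite sumEFin.
  apply: le_ge0_int.
  - by apply: measurable_funM => //; exact: measurable_indic_cube.
  - by apply: measurable_sum => d; exact: measurable_funM.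
  - move=> y; rewrite mulr_ge0//= -mulr_suml ler_wpM2r// indicE.
    have S0 (P : pred {ffun 'I_n -> 'I_3}) :
        0 <= \sum_(d : {ffun 'I_n -> 'I_3} | P d) (\1_(dyadic_cube k (m d)) y : R).
      by apply: sumr_ge0 => d _.
    have [|_] := boolP (y \in cube x rh); last exact: S0.
    rewrite inE => hy.
    pose e i : int := Num.floor (tnth y i / 2 ^ k) - Num.floor ((tnth x i - rh) / 2 ^ k).
    have e02 i : 0 <= e i < 3.
      rewrite /e; set a := (tnth x i - rh) / 2 ^ k; set b := (tnth y i : R) / 2 ^ k.
      have := hy i; rewrite ler_norml => /andP[hy1 hy2].
      have ab : a <= b by rewrite /a /b ler_wpM2r ?invr_ge0 ?(ltW l0)//; lra.
      have ba : b <= a + 2.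
        rewrite -(ler_pM2r l0) mulrDl /a /b !divfK ?gt_eqF//.
        by move: (2 ^ k) k1 hy2 => l k1' hy2'; lra.
      rewrite subr_ge0 le_floor//= ltrBlDl -(ltr_int R) intrD.
      have := floor_le b; have /andP[_ +] := floor_itv a; rewrite intrD => h1 h2.
      by lra.
    pose d : {ffun 'I_n -> 'I_3} := [ffun i => inord `|e i|%N].
    rewrite (bigD1 d)//= indicE mem_set ?lerDl//.
    move=> i; have E : m d i = Num.floor (tnth y i / 2 ^ k).
      rewrite /m ffunE inordK; first by rewrite gez0_abs ?subrKC //; have /andP[] := e02 i.
      by have /andP[h1 h2] := e02 i; rewrite -ltz_nat gez0_abs.
    by rewrite E -ler_pdivlMr// -ltr_pdivrMr// floor_itv.
apply: (le_trans (lee_sum _ (fun d _ => Qd d))).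
rewrite sumEFin lee_fin sumr_const -[leLHS]mulr_natl.
rewrite (powRM (x := Num.sqrt n%:R * 2)) ?(mulr_ge0 (ltW sn0))// ?(ltW r0)//.
by rewrite le_eqVlt; apply/orP; left; apply/eqP; ring.
Qed.

End KermanSawyer.

(** * Density of Schwartz functions in L^2 *)

Section SchwartzLinear.
Context {R : realType} (n : nat).
Implicit Types (u v : Rn R n -> R) (x : Rn R n).

Lemma schwartz_partials_drv u I i x (a : R) : schwartz_real u ->
  is_derive a 1 (fun b : R => partials I u (set_coord x i b))
    (partials (i :: I) u (set_coord x i a)).
Proof. by move=> su; apply: schwartz_drv; exact: schwartz_partials. Qed.

Lemma partials_lin (c : R) u v I : schwartz_real u -> schwartz_real v ->
  partials I (fun x => c * u x + v x) = fun x => c * partials I u x + partials I v x.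
Proof.
move=> su sv; elim: I => [//|i I ih].
apply/funext => x /=; rewrite /partial -/(partials I _) ih -{1}(set_coord_id x i).
rewrite derive1E.
have [_ +] := drvD (drvZ c (schwartz_partials_drv I i x (tnth x i) su))
  (schwartz_partials_drv I i x (tnth x i) sv).
by rewrite set_coord_id.
Qed.

Lemma schwartz_lin (c : R) u v : schwartz_real u -> schwartz_real v ->
  schwartz_real (fun x => c * u x + v x).
Proof.
move=> su sv I; rewrite partials_lin//; split.
  move=> i x; have := drvD (drvZ c (schwartz_partials_drv I i x (tnth x i) su))
    (schwartz_partials_drv I i x (tnth x i) sv).
  by case.
move=> k; have [M hM] := (su I).2 k; have [N hN] := (sv I).2 k.
exists (`|c| * M + N) => x.
apply: (@le_trans _ _ (enorm x ^+ k * (`|c| * `|partials I u x| + `|partials I v x|))).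
  by rewrite ler_wpM2l ?exprn_ge0 ?enorm_ge0// (le_trans (ler_normD _ _))// normrM.
by rewrite mulrDr mulrCA lerD// ler_wpM2l.
Qed.

Lemma schwartz_zero : schwartz_real (fun _ : Rn R n => 0).
Proof.
have E I : partials I (fun _ : Rn R n => 0 : R) = fun=> 0.
  by elim: I => [//|i I ih]; apply/funext => x; rewrite /= /partial ih derive1_cst.
move=> I; rewrite E; split=> [i x|k]; first exact: derivable_cst.
by exists 0 => x; rewrite normr0 mulr0.
Qed.

End SchwartzLinear.

Section GaussPoly.
Context {R : realType}.
Implicit Types (P : {poly R}) (s t : R).

(* As [k] grows, [gpoly k 1] converges to the indicator function of [-1, 1]. *)
Definition gpoly (k : nat) P s : R := P.[s] * expR (- s ^+ (2 * k.+1)).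

(** Differentiation only changes the polynomial, so all iterated derivatives remain in the class. *)
Definition gpoly_deriv (k : nat) P : {poly R} :=
  P^`() - (2 * k.+1)%:R *: ('X^((2 * k.+1).-1) * P).

Lemma drv_gpoly k P s : is_derive s 1 (gpoly k P) (gpoly k (gpoly_deriv k P) s).
Proof.
apply: (is_derive_eq (drvM (is_derive_poly P s)
   (drv_exp (drvN (drvX (2 * k.+1) (drv_id s)))))).
rewrite /gpoly /gpoly_deriv hornerD hornerN hornerZ hornerM hornerXn mulr1.
by ring.
Qed.

Lemma expR_sqr_bound i s : 0 <= s -> s ^+ i * expR (- s) <= i`!%:R.
Proof.
move=> s0; rewrite expRN ler_pdivrMr ?expR_gt0//; case: i => [|i].
  by rewrite fact0 mul1r expr0 (le_trans _ (expR_ge1Dx s))// lerDl.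
rewrite mulrC -ler_pdivrMr ?ltr0n ?fact_gt0//.
by apply: le_trans (expR_ge1Dxn i s0); rewrite lerDr.
Qed.

Lemma even_power_lower k s : s ^+ 2 - 1 <= s ^+ (2 * k.+1).
Proof.
rewrite exprM; have := sqr_ge0 s; move: (s ^+ 2) => y y0.
have [y1|y1] := leP 1 y; first by rewrite exprS (le_trans (_ : _ <= y)) ?ler_peMr ?exprn_ege1//; lra.
by apply: (@le_trans _ _ 0); rewrite ?exprn_ge0//; lra.
Qed.

(** As [s^(2(k+1)) >= s^2 - 1] and [|s| <= 1 + s^2], the monomial of degree [i] is bounded by
    [y^i exp(2 - y)] with [y = 1 + s^2], hence by [exp(2) i!]. *)
Lemma gpoly_bounded k P : exists2 M, 0 <= M & forall s, `|gpoly k P s| <= M.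
Proof.
exists (\sum_(i < size P) `|P`_i| * (expR 2 * i`!%:R)).
  by apply: sumr_ge0 => i _; rewrite mulr_ge0// mulr_ge0// expR_ge0.
move=> s; rewrite /gpoly horner_coef mulr_suml.
apply: (le_trans (ler_norm_sum _ _ _)); apply: ler_sum => i _.
rewrite -mulrA normrM ler_wpM2l// normrM (ger0_norm (expR_ge0 _)).
pose y := 1 + s ^+ 2; have y0 : 0 <= y by rewrite addr_ge0// sqr_ge0.
apply: (@le_trans _ _ (y ^+ i * (expR 2 * expR (- y)))); last first.
  by rewrite mulrCA ler_wpM2l ?expR_ge0// expR_sqr_bound.
apply: ler_pM; rewrite ?expR_ge0//.
  rewrite normrX lerXn2r ?nnegrE// /y.
  by have := sqr_ge0 (`|s| - 2^-1); rewrite -[in X in _ -> X](real_normK (num_real s)); nra.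
rewrite -expRD ler_expR /y; have := even_power_lower k s; lra.
Qed.

End GaussPoly.

Section TensorSchwartz.
Context {R : realType} (n : nat).
Implicit Types (x : Rn R n) (P : 'I_n -> {poly R}) (a b : 'I_n -> R).

Definition tens k a b P x : R := \prod_(i < n) gpoly k (P i) (a i * tnth x i + b i).

Lemma drv_tens k a b P i x (t : R) :
  is_derive t 1 (fun c : R => tens k a b P (set_coord x i c))
  (tens k a b (fun j => if j == i then a i *: gpoly_deriv k (P i) else P j) (set_coord x i t)).
Proof.
pose K := \prod_(j < n | j != i) gpoly k (P j) (a j * tnth x j + b j).
have E (Q : 'I_n -> {poly R}) (c : R) : (forall j, j != i -> Q j = P j) ->
    tens k a b Q (set_coord x i c) = gpoly k (Q i) (a i * c + b i) * K.
  move=> hQ; rewrite /tens (bigD1 i)//= tnth_set_coord eqxx; congr (_ * _).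
  by apply: eq_bigr => j ji; rewrite hQ// tnth_set_coord (negPf ji).
rewrite (_ : (fun _ => _) = fun c => gpoly k (P i) (a i * c + b i) * K); last first.
  by apply/funext => c; rewrite E.
rewrite E; last by move=> j /negPf ->.
rewrite eqxx.
apply: (is_derive_eq (drvM (drv_comp (f := fun c => a i * c + b i) (drv_gpoly k (P i) (a i * t + b i))
  (drvD (drvZ (a i) (drv_id t)) (drv_cst t (b i)))) (drv_cst t K))).
by rewrite mulr0 addr0 /gpoly mulr1 addr0 hornerZ; ring.
Qed.

Lemma partials_tens k a b P I : exists Q, partials I (tens k a b P) = tens k a b Q.
Proof.
elim: I => [|i I [Q ih]]; first by exists P.
exists (fun j => if j == i then a i *: gpoly_deriv k (Q i) else Q j).
apply/funext => x /=; rewrite /partial -/(partials I _) ih derive1E.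
by have [_ ->] := drv_tens k a b Q i x (tnth x i); rewrite set_coord_id.
Qed.

Lemma schwartz_tens k a b P : (forall i, a i != 0) -> schwartz_real (tens k a b P).
Proof.
move=> a0 I; have [Q ->] := partials_tens k a b P I; split.
  by move=> i x; case: (drv_tens k a b Q i x (tnth x i)).
have bnd P' : exists2 M, 0 <= M & forall x, `|tens k a b P' x| <= M.
  have /choice[M hM] : forall i : 'I_n, exists M, 0 <= M /\ forall s, `|gpoly k (P' i) s| <= M.
    by move=> i; have [M M0 hM] := gpoly_bounded k (P' i); exists M.
  exists (\prod_(i < n) M i) => [|x]; first by apply: prodr_ge0 => i _; exact: (hM i).1.
  rewrite /tens normr_prod; apply: ler_prod => i _; rewrite normr_ge0/=.
  exact: (hM i).2.
have coord i m : exists M, forall x, `|tnth x i : R| ^+ m * `|tens k a b Q x| <= M.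
  (* Evaluated at [a i * x_i + b i], the polynomial [w] is [x_i^m]: a power of a coordinate is
     absorbed into the polynomial factor. This is where [a i != 0] enters. *)
  pose w : {poly R} := ((a i)^-1 *: ('X - (b i)%:P)) ^+ m.
  have [M _ hM] := bnd (fun j => if j == i then w * Q i else Q j).
  exists M => x; apply: le_trans (hM x); rewrite -normrX -normrM /tens.
  rewrite [in leRHS](bigD1 i)//= eqxx (bigD1 i)//= mulrA.
  rewrite [X in _ <= `|_ * X|](eq_bigr (fun j => gpoly k (Q j) (a j * tnth x j + b j))); last first.
    by move=> j /negPf ->.
  rewrite le_eqVlt; apply/orP; left; apply/eqP; congr `|_ * _|.
  rewrite /gpoly hornerM mulrA /w; congr (_ * _ * _).
  by rewrite horner_exp !hornerE addrK mulrA mulVf// mul1r.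
move=> m; have [K K0 hK] := @dot_pow_le R n m.
have [M0 M00 hM0] := bnd Q.
have /choice[M hM] : forall i : 'I_n, exists M, forall x, `|tnth x i : R| ^+ (2 * m) * `|tens k a b Q x| <= M.
  by move=> i; exact: coord.
exists (K * (M0 + \sum_(i < n) M i)) => x.
apply: (@le_trans _ _ ((1 + dot x x) ^+ m * `|tens k a b Q x|)).
  rewrite ler_wpM2r// lerXn2r ?nnegrE ?enorm_ge0 ?addr_ge0 ?dot_ge0// dotE.
  by have := sqr_ge0 (enorm x - 2^-1); nra.
apply: (le_trans (ler_wpM2r (normr_ge0 _) (hK x))).
rewrite -mulrA ler_wpM2l// mulrDl mul1r lerD// mulr_suml.
by apply: ler_sum => i _; exact: hM.
Qed.

End TensorSchwartz.

Lemma cvg_bigprod (R : realType) (I : Type) (r : seq I) (f : nat -> I -> R) (l : I -> R) :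
  (forall i, f k i @[k --> \oo] --> l i) ->
  \prod_(i <- r) f k i @[k --> \oo] --> \prod_(i <- r) l i.
Proof.
move=> fl; elim: r => [|i r ih].
  by under eq_fun do rewrite big_nil; rewrite big_nil; exact: cvg_cst.
by under eq_fun do rewrite big_cons; rewrite big_cons; exact: cvgM.
Qed.

Section GaussPolyLimit.
Context {R : realType}.
Implicit Types s : R.

(** The values at [1] and [-1] are the true limits of [gpoly k 1] there; they differ from an
    indicator function only at these two points. *)
Definition plateau s : R := if `|s| < 1 then 1 else if `|s| == 1 then expR (-1) else 0.

Lemma gpoly1 k s : gpoly k 1 s = expR (- s ^+ (2 * k.+1)).
Proof. by rewrite /gpoly hornerC mul1r. Qed.

Lemma gpoly_cvg s : gpoly k 1 s @[k --> \oo] --> plateau s.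
Proof.
under eq_fun do rewrite gpoly1 exprM -[s ^+ 2]real_normK ?num_real//.
rewrite /plateau; have := normr_ge0 s; move: `|s| => y y0.
have pw (q : R) : 0 <= q < 1 -> (q ^+ 2) ^+ k.+1 @[k --> \oo] --> (0 : R).
  move=> /andP[q0 q1]; have q21 : `|q ^+ 2| < 1 by rewrite normrX ger0_norm// exprn_ilt1.
  have := @cvg_geometric R (q ^+ 2) _ q21; apply: cvg_trans.
  rewrite (_ : (fun _ => _) = geometric (q ^+ 2) (q ^+ 2)); first exact: cvg_id.
  by apply/funext => k; rewrite /geometric /= exprS.
have [y1|y1] := ltP y 1.
  rewrite -expR0 -oppr0; apply: continuous_cvg; first exact: continuous_expR.
  by apply: cvgN; apply: pw; rewrite y0.
case: eqVneq => [->|y1'].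
  by under eq_fun do rewrite !expr1n; exact: cvg_cst.
have {}y1 : 1 < y by rewrite lt_def y1'.
have yp : 0 < y by rewrite (lt_trans _ y1).
apply: (@squeeze_cvgr _ _ _ _ (fun=> 0) (fun k => (y^-1 ^+ 2) ^+ k.+1)).
- apply: nearW => k; rewrite expR_ge0/= expRN !exprVn lef_pV2 ?posrE ?expR_gt0 ?exprn_gt0//.
  by apply: le_trans (expR_ge1Dx _); rewrite lerDr.
- exact: cvg_cst.
- by apply: pw; rewrite invr_ge0 y0 invf_lt1.
Qed.

End GaussPolyLimit.

Section Density.
Context {R : realType} (n : nat).
Local Notation L := (@lebesgueRn R n).
Implicit Types (x : Rn R n) (g h u : Rn R n -> R) (A : set (Rn R n)).

Definition schwartz_closure g : Prop := measurable_fun setT g /\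
  forall eps : R, 0 < eps -> exists2 u, schwartz_real u &
    (\int[L]_x ((u x - g x) ^+ 2)%:E <= eps%:E)%E.

Lemma measurable_sqdiff g h : measurable_fun setT g -> measurable_fun setT h ->
  measurable_fun setT (fun x => (g x - h x) ^+ 2).
Proof. by move=> mg mh; apply: measurable_funX; exact: measurable_funB. Qed.

Lemma closure_schwartz u : schwartz_real u -> schwartz_closure u.
Proof.
move=> su; split; first exact: schwartz_measurable.
move=> eps eps0; exists u => //; rewrite integral0_eq ?lee_fin ?ltW// => x _.
by rewrite subrr expr0n.
Qed.

Lemma le_sqdist_comb (c : R) (g h g' h' : Rn R n -> R) (e e' : R) :
  measurable_fun setT g -> measurable_fun setT h ->
  measurable_fun setT g' -> measurable_fun setT h' ->
  (\int[L]_x ((g x - h x) ^+ 2)%:E <= e%:E)%E ->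
  (\int[L]_x ((g' x - h' x) ^+ 2)%:E <= e'%:E)%E ->
  (\int[L]_x (((c * g x + g' x) - (c * h x + h' x)) ^+ 2)%:E <=
   (2 * c ^+ 2 * e + 2 * e')%:E)%E.
Proof.
move=> mg mh mg' mh' he he'.
have m1 := measurable_sqdiff mg mh; have m2 := measurable_sqdiff mg' mh'.
have c0 : 0 <= 2 * c ^+ 2 by rewrite mulr_ge0 ?sqr_ge0.
apply: (@le_trans _ _ (\int[L]_x ((2 * c ^+ 2 * (g x - h x) ^+ 2)%:E + (2 * (g' x - h' x) ^+ 2)%:E))%E).
  apply: ge0_le_integral => //.
  - by move=> x _; rewrite lee_fin sqr_ge0.
  - by apply/measurable_EFinP; apply: measurable_sqdiff;
      apply: measurable_funD => //; exact: measurable_funM.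
  - by apply: emeasurable_funD; apply/measurable_EFinP; exact: measurable_funM.
  - move=> x _; rewrite -EFinD lee_fin.
    move: (g x) (h x) (g' x) (h' x) => p q r s.
    rewrite -subr_ge0 (_ : _ - _ = (c * (p - q) - (r - s)) ^+ 2) ?sqr_ge0//.
    by ring.
rewrite ge0_integralD//; last 4 first.
- by move=> x _; rewrite lee_fin mulr_ge0// sqr_ge0.
- by apply/measurable_EFinP; exact: measurable_funM.
- by move=> x _; rewrite lee_fin mulr_ge0// sqr_ge0.
- by apply/measurable_EFinP; exact: measurable_funM.
rewrite EFinD; apply: leeD.
  rewrite ge0_intZl//; last by move=> x; exact: sqr_ge0.
  by rewrite [leRHS]EFinM; apply: lee_wpmul2l => //; rewrite lee_fin.
rewrite ge0_intZl//; last by move=> x; exact: sqr_ge0.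
by rewrite [leRHS]EFinM; apply: lee_wpmul2l => //; rewrite lee_fin.
Qed.

Lemma closure_lin (c : R) g h : schwartz_closure g -> schwartz_closure h ->
  schwartz_closure (fun x => c * g x + h x).
Proof.
move=> [mg hg] [mh hh]; split.
  by apply: measurable_funD => //; exact: measurable_funM.
move=> eps e0; pose d := 2 * c ^+ 2 + 2.
have d0 : 0 < d by rewrite ltr_wpDl// mulr_ge0// sqr_ge0.
have ed : 0 < eps / d by rewrite divr_gt0.
have [u su hu] := hg _ ed; have [v sv hv] := hh _ ed.
exists (fun x => c * u x + v x); first exact: schwartz_lin.
have := le_sqdist_comb c (schwartz_measurable su) mg (schwartz_measurable sv) mh hu hv.
by rewrite -mulrDl [_ * (eps / d)]mulrC divfK ?gt_eqF.
Qed.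

Lemma closure0 : schwartz_closure (fun=> 0).
Proof. exact/closure_schwartz/schwartz_zero. Qed.

Lemma closure_sum (I : Type) (r : seq I) (c : I -> R) (g : I -> Rn R n -> R) :
  (forall i, schwartz_closure (g i)) -> schwartz_closure (fun x => \sum_(i <- r) c i * g i x).
Proof.
move=> hg; elim: r => [|i r ih].
  by under eq_fun do rewrite big_nil; exact: closure0.
by under eq_fun do rewrite big_cons; exact: closure_lin.
Qed.

Lemma closure_lim g : measurable_fun setT g ->
  (forall eps : R, 0 < eps -> exists2 h, schwartz_closure h &
    (\int[L]_x ((h x - g x) ^+ 2)%:E <= eps%:E)%E) -> schwartz_closure g.
Proof.
move=> mg hg; split=> // eps e0; have e4 : 0 < eps / 4 by rewrite divr_gt0.
have [h [mh hh] hgh] := hg _ e4; have [u su hu] := hh _ e4; exists u => //.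
have := le_sqdist_comb 1 (schwartz_measurable su) mh mh mg hu hgh.
rewrite expr1n (_ : 2 * 1 * (eps / 4) + _ = eps); last by field.
apply: le_trans; apply: le_ge0_int => [||x].
- by apply: measurable_sqdiff => //; exact: schwartz_measurable.
- by apply: measurable_sqdiff; apply: measurable_funD => //; apply: measurable_funM => //;
    exact: schwartz_measurable.
- by rewrite sqr_ge0 (_ : 1 * u x + h x - _ = u x - g x) ?lexx//; ring.
Qed.

Lemma closure_dct (h_ : nat -> Rn R n -> R) g (G : Rn R n -> R) :
  (forall k, schwartz_closure (h_ k)) -> (forall x, h_ k x @[k --> \oo] --> g x) ->
  (forall k x, `|h_ k x| <= G x) -> measurable_fun setT G -> rint L (fun x => G x ^+ 2) ->
  schwartz_closure g.
Proof.
move=> hh hg hG mG rG.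
have mh k : measurable_fun setT (h_ k) := (hh k).1.
have mg : measurable_fun setT g by apply: (measurable_fun_cvg mh) => x _; exact: hg.
have gG x : `|g x| <= G x.
  by apply: (@ler_cvg_to _ _ _ _ _ _ _ _ (cvg_norm (hg x)) (cvg_cst (G x))); exact: nearW.
have b k x : `|(h_ k x - g x) ^+ 2| <= 4 * G x ^+ 2.
  rewrite normrX (_ : 4 * G x ^+ 2 = (2 * G x) ^+ 2); last by ring.
  rewrite lerXn2r ?nnegrE ?mulr_ge0 ?(le_trans (normr_ge0 _) (gG x))//.
  by rewrite (le_trans (ler_normB _ _))//; have := hG k x; have := gG x; lra.
have c0 : \int[L]_x ((h_ k x - g x) ^+ 2) @[k --> \oo] --> \int[L]_x (0 : R).
  apply: (Rint_dct _ (rintZl 4 rG) b) => [k|x]; first exact: measurable_sqdiff.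
  rewrite -[X in _ --> X](_ : (g x - g x) * (g x - g x) = 0); last by rewrite subrr mul0r.
  by under eq_fun do rewrite expr2; apply: cvgM; apply: cvgB => //; exact: cvg_cst.
rewrite Rint_eq0// in c0.
apply: closure_lim => // eps e0.
have /cvgr0_norm_le/(_ _ e0)[k _ hk] := c0.
exists (h_ k) => //; have r : rint L (fun x => (h_ k x - g x) ^+ 2).
  by apply: rint_le (b k) (rintZl 4 rG); exact: measurable_sqdiff.
rewrite -RintE// lee_fin; exact: le_trans (ler_norm _) (hk k (leqnn k)).
Qed.

Lemma closure_ae g h : schwartz_closure g -> measurable_fun setT h ->
  {ae L, forall x, g x = h x} -> schwartz_closure h.
Proof.
move=> [mg hg] mh gh; split=> // eps e0; have [u su hu] := hg eps e0; exists u => //.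
apply: le_trans hu; rewrite le_eqVlt; apply/orP; left; apply/eqP.
have mu' := schwartz_measurable su.
apply: ge0_ae_eq_integral => //.
- by apply/measurable_EFinP; exact: measurable_sqdiff.
- by apply/measurable_EFinP; exact: measurable_sqdiff.
- by move=> x _; rewrite lee_fin sqr_ge0.
- by move=> x _; rewrite lee_fin sqr_ge0.
- by apply: filterS gh => x -> _.
Qed.

Lemma hyperplane_ae i (c : R) : {ae L, forall x, tnth x i != c :> R}.
Proof.
pose A (j : 'I_n) : set R := if j == i then [set c]%classic else setT.
have mA j : measurable (A j : set (measurableTypeR R)) by rewrite /A; case: ifP.
exists [set x | forall j : 'I_n, A j (tnth x j : R)]; split.
- rewrite (_ : [set _ | _] = \bigcap_(j in [set: 'I_n])
    ((@tnth n (measurableTypeR R))^~ j @^-1` A j)); last first.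
    by apply/seteqP; split=> x /= h; [move=> j _|move=> j]; exact: h.
  apply: fin_bigcap_measurable => // j _.
  by rewrite -[X in measurable X]setTI; apply: measurable_tnth.
- rewrite (lebesgueRn_prod mA) (bigD1 i)//= /A eqxx lebesgue_measure_set1; exact: mul0e.
- move=> x /= /negP; rewrite negbK => /eqP xc j; rewrite /A.
  by case: eqVneq => [->|].
Qed.

Definition obox (lo hi : 'I_n -> R) : set (Rn R n) :=
  [set x | forall i, lo i < (tnth x i : R) < hi i].

Lemma measurable_obox lo hi : measurable (obox lo hi).
Proof.
rewrite (_ : obox lo hi = \bigcap_(i in [set: 'I_n])
  ((@tnth n (measurableTypeR R))^~ i @^-1` `]lo i, hi i[)); last first.
  apply/seteqP; split=> x /= h; first by move=> i _ /=; rewrite in_itv/=; exact: h.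
  by move=> i; have := h i Logic.I; rewrite /= in_itv.
apply: fin_bigcap_measurable => // i _.
by rewrite -[X in measurable X]setTI; apply: measurable_tnth.
Qed.

(** Each interval is mapped onto the interval from [-1] to [1] by an affine map, and products of the
    functions [gpoly k 1] converge to the indicator function off the boundary. *)
Lemma closure_obox lo hi : schwartz_closure (\1_(obox lo hi) : Rn R n -> R).
Proof.
have [lh|/existsNP[i /negP lh]] := pselect (forall i, lo i < hi i); last first.
  rewrite (_ : (\1_ _ : Rn R n -> R) = fun=> 0); first exact: closure0.
  apply/funext => x; rewrite indicE memNset// => /(_ i) /andP[h1 h2].
  by move: lh; rewrite (lt_trans h1 h2).
pose a i : R := 2 / (hi i - lo i); pose b i : R := - (hi i + lo i) / (hi i - lo i).
have d0 i : 0 < hi i - lo i by rewrite subr_gt0.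
have a0 i : a i != 0 by rewrite gt_eqF// divr_gt0.
pose s (x : Rn R n) i := a i * tnth x i + b i.
have sE x i : s x i = (2 * (tnth x i : R) - (hi i + lo i)) / (hi i - lo i).
  by rewrite /s /a /b mulrBl mulNr mulrAC.
pose u_ k : Rn R n -> R := tens k a b (fun=> 1).
pose g x := \prod_(i < n) plateau (s x i).
(* [G] dominates all [u_ k] because [s^(2(k+1)) >= s^2 - 1], and being a Schwartz function it is
   square integrable. *)
pose G : Rn R n -> R := tens 0 a b (fun=> (expR 1)%:P).
have sG : schwartz_real G by exact: schwartz_tens.
have cg : schwartz_closure g.
  apply: (@closure_dct u_ g G).
  - by move=> k; apply: closure_schwartz; exact: schwartz_tens.
  - by move=> x; rewrite /u_ /tens /g; apply: cvg_bigprod => i; exact: gpoly_cvg.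
  - move=> k x; rewrite /u_ /G /tens normr_prod; apply: ler_prod => i _.
    rewrite normr_ge0 /= gpoly1 ger0_norm ?expR_ge0// /gpoly hornerC -expRD ler_expR.
    by have := even_power_lower k (a i * tnth x i + b i); rewrite muln1; lra.
  - exact: schwartz_measurable.
  - exact: schwartz_rint2.
apply: (closure_ae cg); first by apply: measurable_indic; exact: measurable_obox.
(* The limit [g] differs from the indicator function only on the hyperplanes carrying the faces,
   which are null sets. *)
have : {ae L, forall x, forall i, (tnth x i != lo i :> R) && (tnth x i != hi i :> R)}.
  apply: filter_forall => i.
  by apply: filterS2 (hyperplane_ae i (lo i)) (hyperplane_ae i (hi i)) => x -> ->.
apply: filterS => x hx.
have key i : plateau (s x i) = ((lo i < (tnth x i : R) < hi i)%R : bool)%:R.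
  have /andP[h1 h2] := hx i; rewrite /plateau.
  have -> : (`|s x i| < 1) = (lo i < (tnth x i : R) < hi i).
    rewrite ltr_norml sE ltr_pdivlMr// ltr_pdivrMr//.
    by apply/idP/idP => /andP[? ?]; apply/andP; split; lra.
  case: ifP => // _; case: eqVneq => // s1; exfalso.
  have : `|s x i * (hi i - lo i)| = hi i - lo i by rewrite normrM s1 mul1r gtr0_norm.
  rewrite sE divfK ?gt_eqF//; move: h1 h2 (d0 i); move: (tnth x i : R) (lo i) (hi i) => t l u h1 h2 lu.
  have [_|_] := ger0P (2 * t - (u + l)) => h.
    by move/eqP: h2; apply; lra.
  by move/eqP: h1; apply; lra.
rewrite /g indicE; have [|/negP] := boolP (x \in obox lo hi).
  by rewrite inE => hin; rewrite big1// => i _; rewrite key hin.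
rewrite inE => /existsNP[i /negP/negPf hin].
by rewrite (bigD1 i)//= key hin mul0r.
Qed.

(** Products of open half-lines are closed under intersection. The value [-oo] leaves a coordinate
    unconstrained, so that conditions on a single coordinate belong to the family. *)
Definition rays : set_system (Rn R n) :=
  [set A | exists b : 'I_n -> \bar R, A = [set x | forall i, (b i < (tnth x i : R)%:E)%E]].

Lemma measurable_raysE : (measurable : set_system (Rn R n)) = <<s rays>>.
Proof.
apply/seteqP; split=> A; last first.
  apply: smallest_sub; first exact: sigma_algebra_measurable.
  move=> _ [b ->]; rewrite (_ : [set _ | _] = \bigcap_(i in [set: 'I_n])
    ((fun x : Rn R n => (tnth x i : R)%:E) @^-1` `]b i, +oo[)); last first.
    apply/seteqP; split=> x /= h; first by move=> i _ /=; rewrite in_itv/= h//= ltry.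
    by move=> i; have := h i Logic.I; rewrite /= in_itv/= => /andP[].
  apply: fin_bigcap_measurable => // i _; rewrite -[X in measurable X]setTI.
  have m : measurable_fun setT (fun x : Rn R n => (tnth x i : R)%:E).
    by apply/measurable_EFinP; exact: measurable_tnth.
  by apply: m => //; exact: emeasurable_itv.
move=> mA.
pose T' := g_sigma_algebraType rays.
have m : measurable_fun setT (id : T' -> Rn R n).
  apply/measurable_fun_tnthP => i /=.
  apply: (measurability _ (RGenOInfty.measurableE R)) => _ [_ [t ->] <-].
  apply: sub_sigma_algebra; exists (fun j => if j == i then t%:E else -oo%E).
  rewrite setTI; apply/seteqP; split=> x /=.
    rewrite in_itv/= andbT => h j; case: eqVneq => [->|_]; first by rewrite lte_fin.
    by rewrite ltNyr.
  by move=> /(_ i); rewrite eqxx lte_fin in_itv/= andbT.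
by have := m measurableT A mA; rewrite setTI.
Qed.

Definition centered_box (N : nat) : set (Rn R n) := obox (fun=> - N%:R) (fun=> N%:R).

Lemma centered_box_lty N : (L (centered_box N) < +oo)%E.
Proof.
apply: (@le_lt_trans _ _ (L (cube vzero N%:R))); last by rewrite cube_vol// ltry.
apply: le_measure; rewrite ?inE; [exact: measurable_obox|exact: measurable_cube|].
move=> x h i; have /andP[h1 h2] := h i.
by rewrite tnth_mktuple subr0 ler_norml !ltW.
Qed.

Lemma centered_box_near x : exists N0, forall N, (N0 <= N)%N -> centered_box N x.
Proof.
pose S : R := \sum_(i < n) `|tnth x i : R|.
exists (Num.truncn S).+1 => N hN i.
have h : S < N%:R by apply: lt_le_trans (truncnS_gt S) _; rewrite ler_nat.
rewrite -ltr_norml; apply: le_lt_trans h.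
by rewrite /S (bigD1 i)//= lerDl sumr_ge0.
Qed.

(** A Dynkin class argument from boxes to measurable sets. Intersecting with a fixed bounded box
    keeps complements and countable unions in [L^2]. *)
Lemma closure_measurable N A : measurable A ->
  schwartz_closure (\1_(A `&` centered_box N) : Rn R n -> R).
Proof.
set B := centered_box N; have mB : measurable B := measurable_obox _ _.
rewrite measurable_raysE.
apply: (dynkin_induction (G := rays)
  (P := fun A => schwartz_closure (\1_(A `&` B) : Rn R n -> R)) measurable_raysE).
- move=> _ _ [b ->] [c ->]; exists (fun i => maxe (b i) (c i)).
  apply/seteqP; split=> x /=.
    by move=> [h1 h2] i; rewrite gt_max h1 h2.
  by move=> h; split=> i; have := h i; rewrite gt_max => /andP[].
- by rewrite setTI; exact: closure_obox.
- move=> _ [b ->].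
  pose lo i : R := match b i with EFin r => Num.max r (- N%:R) | +oo%E => N%:R | -oo%E => - N%:R end.
  rewrite (_ : _ `&` _ = obox lo (fun=> N%:R)); first exact: closure_obox.
  apply/seteqP; split=> x.
    move=> [h1 h2] i; move: (h1 i) (h2 i) => /=; rewrite /lo.
    by case: (b i) => [r||] //=; rewrite lte_fin gt_max => -> /andP[-> ->].
  move=> h; split=> i; move: (h i); rewrite /lo => /andP[]; case: (b i) => [r||] //=.
  + by rewrite gt_max lte_fin => /andP[->].
  + by move=> h1 h2; move: (lt_trans h1 h2); rewrite ltxx.
  + by move=> _ _; rewrite ltNyr.
  + by rewrite gt_max => /andP[_ ->] ->.
  + by move=> h1 h2; move: (lt_trans h1 h2); rewrite ltxx.
  + by move=> -> ->.
- move=> A' mA' hA'.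
  rewrite (_ : \1_(~` A' `&` B) = fun x => -1 * \1_(A' `&` B) x + \1_B x :> R).
    by apply: closure_lin => //; exact: closure_obox.
  apply/funext => x; rewrite !indicE !in_setI in_setC.
  by case: (x \in A'); case: (x \in B); rewrite /= ?mulr1 ?mulr0 ?addNr ?add0r.
- move=> F mF tF hF.
  (* By disjointness these sums only take the values 0 and 1, so they are dominated by the indicator
     function of the box. *)
  pose h k x : R := \sum_(i < k) 1 * \1_(F i `&` B) x.
  have hE k x i : (F i `&` B) x -> h k x = (i < k)%N%:R.
    move=> Fi; have E j : \1_(F j `&` B) x = (j == i)%:R :> R.
      rewrite indicE; congr ((_ : bool)%:R); apply/idP/idP; last by move=> /eqP ->; rewrite inE.
      rewrite inE => Fj; apply/eqP; apply: contrapT => /eqP ji.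
      by move/trivIsetP : tF => /(_ j i Logic.I Logic.I ji)/seteqP[+ _] => /(_ x); apply; split; [exact: Fj.1|exact: Fi.1].
    rewrite /h; under eq_bigr do rewrite E mul1r; have [ik|ki] := ltnP i k.
      rewrite (bigD1 (Ordinal ik))//= eqxx big1 ?addr0// => j ji.
      by rewrite (_ : (j == i :> nat) = false)//; apply: contra_neqF ji => /eqP ji; apply: val_inj.
    by rewrite big1// => j _; rewrite ltn_eqF// (leq_trans (ltn_ord j)).
  have h0 k x : (forall i, ~ (F i `&` B) x) -> h k x = 0.
    by move=> hx; rewrite /h big1// => i _; rewrite indicE memNset ?mulr0//; exact: hx.
  have split1 x : (exists i, (F i `&` B) x) \/ (forall i, ~ (F i `&` B) x).
    by have [|/forallNP] := pselect (exists i, (F i `&` B) x); [left|right].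
  apply: (@closure_dct h _ (\1_B)).
  + move=> k; apply: (closure_sum (index_enum 'I_k) (fun=> 1) (g := fun i : 'I_k => \1_(F i `&` B))).
    by move=> i; exact: hF.
  + move=> x; have [[i Fi]|hx] := split1 x.
      apply: cvg_near_cst; exists i.+1 => // k /= ik; rewrite (hE k x i Fi) ik indicE.
      by rewrite mem_set//; split; [exists i => //; exact: Fi.1|exact: Fi.2].
    apply: cvg_near_cst; apply: nearW => k; rewrite h0// indicE memNset//.
    by move=> [[i _ Fi] Bx]; exact: (hx i).
  + move=> k x; have [[i Fi]|hx] := split1 x.
      rewrite (hE k x i Fi) indicE mem_set; last exact: Fi.2.
      by case: (_ < _)%N; rewrite ?normr1 ?normr0.
    by rewrite h0// normr0.
  + exact: measurable_indic.
  + apply: (rint_bounded (A := B) (M := 1)) => //.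
    * exact: centered_box_lty.
    * by apply: measurable_funX; exact: measurable_indic.
    * by move=> x; rewrite indicE; case: (_ \in _); rewrite ?expr1n ?expr0n ?normr1 ?normr0.
    * by move=> x Bx; rewrite indicE memNset ?expr0n.
Qed.

Lemma truncn_sum (y : R) K : y < K%:R ->
  (Num.truncn y)%:R = \sum_(j < K) (j.+1%:R <= y)%R%:R :> R.
Proof.
move=> yK; rewrite -natr_sum; congr (_%:R).
under eq_bigr do rewrite -truncn_gt_nat.
have : (Num.truncn y <= K)%N.
  by rewrite leqNgt truncn_gt_nat -ltNge (lt_trans yK)// ltr_nat.
move: (Num.truncn y) => t tK.
rewrite -(big_mkord xpredT (fun j => (j < t)%N : nat)) (big_cat_nat (n := t))//=.
rewrite big_nat (eq_bigr (fun=> 1%N)); last by move=> j /andP[_ ->].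
rewrite -big_nat sum_nat_const_nat subn0 muln1 big_nat_cond big1 ?addn0// => j /andP[/andP[tj _] _].
by rewrite ltnNge tj.
Qed.

(** Rounding [k.+1 * g] down to an integer writes the approximation as a finite sum of indicator
    functions of superlevel sets, by [truncn_sum]; it is within [(k.+1)^-1] of [g] on the box. *)
Lemma closure_bounded N K g : measurable_fun setT g -> (forall x, 0 <= g x < K%:R) ->
  schwartz_closure (fun x => \1_(centered_box N) x * g x).
Proof.
move=> mg gK; set B := centered_box N; have mB : measurable B := measurable_obox _ _.
pose A k (j : nat) : set (Rn R n) := [set x | j.+1%:R <= k.+1%:R * g x].
have mA k j : measurable (A k j).
  rewrite (_ : A k j = (fun x => k.+1%:R * g x) @^-1` `[j.+1%:R, +oo[); last first.
    by apply/seteqP; split=> x /=; rewrite in_itv/= andbT.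
  by rewrite -[X in measurable X]setTI; apply: (measurable_funM _ mg).
pose h k x : R := \sum_(j < K * k.+1) k.+1%:R^-1 * \1_(A k j `&` B) x.
have hE k x : h k x = \1_B x * ((Num.truncn (k.+1%:R * g x))%:R / k.+1%:R).
  rewrite (@truncn_sum _ (K * k.+1)); last first.
    by rewrite natrM mulrC ltr_pM2r ?ltr0n//; case/andP: (gK x).
  rewrite mulr_suml mulr_sumr /h; apply: eq_bigr => j _; rewrite mulrA mulrC; congr (_ * _).
  rewrite !indicE in_setI [X in X && _](_ : _ = (j.+1%:R <= k.+1%:R * g x)); last first.
    by apply/idP/idP; rewrite inE.
  by rewrite -mulnb natrM mulrC.
have tr (y : R) : 0 <= y -> (Num.truncn y)%:R <= y < (Num.truncn y)%:R + 1.
  by move=> y0; rewrite natr1; exact: truncn_itv.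
have kp k : (0 : R) < k.+1%:R by rewrite ltr0n.
have tb k x : g x - k.+1%:R^-1 <= (Num.truncn (k.+1%:R * g x))%:R / k.+1%:R <= g x.
  have /andP[g0 _] := gK x; have /andP[h1 h2] := tr _ (mulr_ge0 (ltW (kp k)) g0).
  rewrite ler_pdivrMr// [g x * _]mulrC h1 andbT ler_pdivlMr// mulrBl mulVf ?gt_eqF//.
  by rewrite [g x * _]mulrC; lra.
have i01 x : (\1_B x : R) = 0 \/ (\1_B x : R) = 1.
  by rewrite indicE; case: (_ \in _); [right|left].
apply: (@closure_dct h _ (fun x => K%:R * \1_B x)).
- by move=> k; apply: closure_sum => j; exact: closure_measurable.
- move=> x; under eq_fun do rewrite hE; apply: cvgM; first exact: cvg_cst.
  apply: (@squeeze_cvgr _ _ _ _ (fun k => g x - k.+1%:R^-1) (fun=> g x)).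
  + by apply: nearW => k.
  + rewrite -[X in _ --> X]subr0; apply: cvgB; [exact: cvg_cst|exact: cvg_harmonic].
  + exact: cvg_cst.
- move=> k x; rewrite hE; case: (i01 x) => ->; first by rewrite mul0r normr0 mulr0.
  rewrite mul1r mulr1 ger0_norm; last by rewrite divr_ge0.
  by have /andP[_ h1] := tb k x; have /andP[_ h2] := gK x; rewrite (le_trans h1)// ltW.
- by apply: measurable_funM => //; exact: measurable_indic.
- apply: (rint_bounded (A := B) (M := K%:R ^+ 2)) => //.
  + exact: centered_box_lty.
  + by apply: measurable_funX; apply: measurable_funM => //; exact: measurable_indic.
  + by move=> x; case: (i01 x) => ->; rewrite ?mulr1 ?mulr0 ?expr0n/= ?normr0 ?sqr_ge0// ger0_norm ?sqr_ge0.
  + by move=> x Bx; rewrite indicE memNset ?mulr0 ?expr0n.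
Qed.

Lemma closure_ge0 g : measurable_fun setT g -> (forall x, 0 <= g x) ->
  rint L (fun x => g x ^+ 2) -> schwartz_closure g.
Proof.
move=> mg g0 rg.
pose A K : set (Rn R n) := [set x | g x < K%:R].
have mA K : measurable (A K).
  rewrite (_ : A K = g @^-1` `]-oo, K%:R[); last first.
    by apply/seteqP; split=> x /=; rewrite in_itv.
  by rewrite -[X in measurable X]setTI; apply: mg.
pose h K x : R := \1_(centered_box K) x * (\1_(A K.+1) x * g x).
have i01 (B : set (Rn R n)) x : (\1_B x : R) = 0 \/ (\1_B x : R) = 1.
  by rewrite indicE; case: (_ \in _); [right|left].
apply: (@closure_dct h _ g) => //.
- move=> K; apply: (@closure_bounded _ K.+1); first exact: measurable_funM.
  move=> x; rewrite indicE; have [|_] := boolP (x \in A K.+1).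
    by rewrite inE mul1r g0.
  by rewrite mul0r lexx ltr0n.
- move=> x; apply: cvg_near_cst; have [N0 hN0] := centered_box_near x.
  exists (maxn N0 (Num.truncn (g x)).+1) => // K /=; rewrite geq_max => /andP[k1 k2].
  rewrite /h !indicE !mem_set ?mul1r//; last exact: hN0.
  by apply: (lt_le_trans (truncnS_gt _)); rewrite ler_nat (leq_trans k2).
- move=> K x; rewrite /h; case: (i01 (centered_box K) x) => ->; rewrite ?mul0r ?mul1r ?normr0//.
  by case: (i01 (A K.+1) x) => ->; rewrite ?mul0r ?mul1r ?normr0// ger0_norm.
Qed.

Lemma schwartz_dense g : measurable_fun setT g -> rint L (fun x => g x ^+ 2) ->
  schwartz_closure g.
Proof.
move=> mg rg; pose p x := Num.max (g x) 0; pose q x := Num.max (- g x) 0.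
have -> : g = fun x => -1 * q x + p x.
  by apply/funext => x; rewrite /p /q !maxEle; case: ifP; case: ifP; lra.
have bd (r : Rn R n -> R) : measurable_fun setT r -> (forall x, `|r x| <= `|g x|) -> rint L (fun x => r x ^+ 2).
  move=> mr rg'; apply: rint_le _ _ rg; first exact: measurable_funX.
  by move=> x; rewrite normrX -[leRHS]real_normK ?num_real// lerXn2r ?nnegrE.
have mp : measurable_fun setT p by exact: measurable_maxr.
have mq : measurable_fun setT q by apply: measurable_maxr => //; exact: measurableT_comp.
have le0 (t : R) : `|Num.max t 0| <= `|t|.
  by rewrite ger0_norm ?le_max ?lexx ?orbT// ge_max ler_norm normr_ge0.
apply: closure_lin; apply: closure_ge0 => //.
- by move=> x; rewrite le_max lexx orbT.
- by apply: bd => // x; rewrite -[leRHS]normrN; exact: le0.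
- by move=> x; rewrite le_max lexx orbT.
- by apply: bd => // x; exact: le0.
Qed.

End Density.

(** * Extension to L^2 *)

Section ComplexL2.
Context {R : realType}.
Implicit Types (z : R[i]).

Lemma ReB z1 z2 : complex.Re (z1 - z2) = complex.Re z1 - complex.Re z2.
Proof. by case: z1 z2 => a b [c d]. Qed.

Lemma ImB z1 z2 : complex.Im (z1 - z2) = complex.Im z1 - complex.Im z2.
Proof. by case: z1 z2 => a b [c d]. Qed.

Lemma normsq_ge0 z : 0 <= normsq z.
Proof. by rewrite addr_ge0 ?sqr_ge0. Qed.

Lemma normsqB_le z1 z2 z3 : normsq (z1 - z2) <= 2 * normsq (z1 - z3) + 2 * normsq (z2 - z3).
Proof.
rewrite /normsq !ReB !ImB.
move: (complex.Re z1) (complex.Im z1) (complex.Re z2) (complex.Im z2)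
  (complex.Re z3) (complex.Im z3) => a b c d e f.
rewrite -subr_ge0 (_ : _ - _ = ((a - e) + (c - e)) ^+ 2 + ((b - f) + (d - f)) ^+ 2); last by ring.
by rewrite addr_ge0 ?sqr_ge0.
Qed.

Lemma normsqC z1 z2 : normsq (z1 - z2) = normsq (z2 - z1).
Proof. by rewrite /normsq !ReB !ImB; ring. Qed.

Lemma measurable_normsq d (X : measurableType d) (f : X -> R[i]) :
  cmeasurable f -> measurable_fun setT (fun x => normsq (f x)).
Proof. by move=> [mr mi]; apply: measurable_funD; exact: measurable_funX. Qed.

Lemma cmeasurableB d (X : measurableType d) (f g : X -> R[i]) :
  cmeasurable f -> cmeasurable g -> cmeasurable (fun x => f x - g x).
Proof.
move=> [fr fi] [gr gi]; split.
  by under eq_fun do rewrite ReB; exact: measurable_funB.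
by under eq_fun do rewrite ImB; exact: measurable_funB.
Qed.

Lemma integral_le2 d (X : measurableType d) (m : {measure set X -> \bar R}) (p q r : X -> R) :
  measurable_fun setT p -> measurable_fun setT q -> measurable_fun setT r ->
  (forall x, 0 <= p x) -> (forall x, 0 <= q x) -> (forall x, 0 <= r x) ->
  (forall x, p x <= 2 * q x + 2 * r x) ->
  (\int[m]_x (p x)%:E <= 2%:E * \int[m]_x (q x)%:E + 2%:E * \int[m]_x (r x)%:E)%E.
Proof.
move=> mp mq mr p0 q0 r0 h.
apply: (@le_trans _ _ (\int[m]_x ((2 * q x)%:E + (2 * r x)%:E))%E).
  apply: ge0_le_integral => //.
  - by move=> x _; rewrite lee_fin.
  - exact/measurable_EFinP.
  - by apply: emeasurable_funD; apply/measurable_EFinP; exact: measurable_funM.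
  - by move=> x _; rewrite -EFinD lee_fin.
rewrite ge0_integralD//; last 4 first.
- by move=> x _; rewrite lee_fin mulr_ge0.
- by apply/measurable_EFinP; exact: measurable_funM.
- by move=> x _; rewrite lee_fin mulr_ge0.
- by apply/measurable_EFinP; exact: measurable_funM.
by rewrite !ge0_intZl.
Qed.

Lemma cvge0P (u : nat -> \bar R) : (forall k, 0 <= u k)%E ->
  u k @[k --> \oo] --> 0%E <->
  forall e : R, 0 < e -> exists k0, forall k, (k0 <= k)%N -> (u k <= e%:E)%E.
Proof.
move=> u0; split.
  move=> /fine_cvgP[[k1 _ h1] /cvgr0Pnorm_le h] e e0.
  have [k2 _ h2] := h e e0.
  exists (maxn k1 k2) => k; rewrite geq_max => /andP[/h1 f /h2 le].
  by rewrite -(fineK f) lee_fin (le_trans (ler_norm _)).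
move=> h; apply/fine_cvgP.
have fin e k : (u k <= e%:E)%E -> u k \is a fin_num.
  by move=> le; rewrite ge0_fin_numE// (le_lt_trans le)// ltry.
split.
  have [k1 h1] := h 1 ltr01; exists k1 => // k /= /h1; exact: fin.
apply/cvgr0Pnorm_le => e e0; have [k1 h1] := h e e0; exists k1 => // k /= /h1 le.
by rewrite ger0_norm ?fine_ge0// -lee_fin fineK// (fin e).
Qed.

Variable n : nat.
Local Notation L := (@lebesgueRn R n).
Implicit Types f g : Rn R n -> R[i].

Lemma L2normE f : L2norm f = ((\int[L]_x (normsq (f x))%:E) `^ 2^-1)%E.
Proof.
rewrite /L2norm unlock; congr (_ `^ _)%E; apply: eq_integral => x _.
rewrite abse_EFin poweR_EFin -normc_sqr powR_mulrn ?normr_ge0// real_normK ?num_real//.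
Qed.

Lemma L2norm_ge0 f : (0 <= L2norm f)%E.
Proof. by rewrite L2normE poweR_ge0. Qed.

Lemma L2norm_sqr f : (L2norm f `^ 2 = \int[L]_x (normsq (f x))%:E)%E.
Proof.
rewrite L2normE; set I := integral _ _ _; have I0 : (0 <= I)%E.
  by apply: integral_ge0 => x _; rewrite lee_fin normsq_ge0.
by rewrite -poweRrM ?mulVf ?poweRe1.
Qed.

Lemma L2norm_le f (e : R) : 0 < e -> (\int[L]_x (normsq (f x))%:E <= (e ^+ 2)%:E)%E ->
  (L2norm f <= e%:E)%E.
Proof.
move=> e0 h; rewrite L2normE.
have -> : e%:E = ((e ^+ 2)%:E `^ 2^-1)%E.
  by rewrite poweR_EFin powR12_sqrt ?sqr_ge0// sqrtr_sqr gtr0_norm.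
apply: gt0_ler_poweR => //; rewrite ?in_itv/= ?leey ?andbT ?lee_fin ?sqr_ge0//.
by apply: integral_ge0 => x _; rewrite lee_fin normsq_ge0.
Qed.

Lemma L2fun_lty f : L2fun f -> (\int[L]_x (normsq (f x))%:E < +oo)%E.
Proof. by move=> [_ h]; rewrite -L2norm_sqr poweR_lty. Qed.

Lemma schwartz_approx_small f (f_ : nat -> Rn R n -> R[i]) : schwartz_approx f f_ -> forall e : R, 0 < e ->
  exists k0, forall k, (k0 <= k)%N -> (\int[L]_x (normsq (f_ k x - f x))%:E <= e%:E)%E.
Proof.
move=> [_ /cvge0P h] e e0; have se : 0 < Num.sqrt e by rewrite sqrtr_gt0.
have [k0 hk] := h (fun k => L2norm_ge0 _) _ se; exists k0 => k /hk le.
rewrite -L2norm_sqr; have -> : e%:E = ((Num.sqrt e)%:E `^ 2)%E.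
  by rewrite poweR_EFin powR_mulrn ?sqrtr_ge0// sqr_sqrtr// ltW.
by apply: gt0_ler_poweR => //; rewrite ?in_itv/= ?leey ?andbT ?lee_fin ?sqrtr_ge0 ?L2norm_ge0.
Qed.

Lemma schwartzB f g : schwartz f -> schwartz g -> schwartz (fun x => f x - g x).
Proof.
move=> [fr fi] [gr gi]; split.
  have := schwartz_lin (-1) gr fr; congr schwartz_real; apply/funext => x.
  by rewrite ReB mulN1r addrC.
have := schwartz_lin (-1) gi fi; congr schwartz_real; apply/funext => x.
by rewrite ImB mulN1r addrC.
Qed.

Lemma schwartz_cmeasurable f : schwartz f -> cmeasurable f.
Proof. by move=> [fr fi]; split; exact: schwartz_measurable. Qed.

Lemma exists_schwartz_approx f (e : nat -> R) : L2fun f -> (forall k, 0 < e k) ->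
  exists f_ : nat -> Rn R n -> R[i], (forall k, schwartz (f_ k)) /\
    forall k, (\int[L]_x (normsq (f_ k x - f x))%:E <= (e k)%:E)%E.
Proof.
move=> lf e0; have [[mr mi] _] := lf; have h := L2fun_lty lf.
have rn : rint L (fun x => normsq (f x)).
  by apply: ge0_rint => // [|x]; [exact: measurable_normsq|exact: normsq_ge0].
have [dr ddr] : schwartz_closure (fun x => complex.Re (f x)).
  apply: schwartz_dense => //; apply: rint_le _ _ rn; first exact: measurable_funX.
  by move=> x; rewrite ger0_norm ?sqr_ge0// lerDl sqr_ge0.
have [di ddi] : schwartz_closure (fun x => complex.Im (f x)).
  apply: schwartz_dense => //; apply: rint_le _ _ rn; first exact: measurable_funX.
  by move=> x; rewrite ger0_norm ?sqr_ge0// lerDr sqr_ge0.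
have /choice[f_ hf] : forall k, exists g : Rn R n -> R[i], schwartz g /\
    (\int[L]_x (normsq (g x - f x))%:E <= (e k)%:E)%E.
  move=> k; have e2 : 0 < e k / 2 by rewrite divr_gt0.
  have [u su hu] := ddr _ e2; have [v sv hv] := ddi _ e2.
  exists (fun x => Complex (u x) (v x)); split; first by split.
  rewrite /normsq; under eq_integral do rewrite ReB ImB /= EFinD.
  have mu' := schwartz_measurable su; have mv := schwartz_measurable sv.
  rewrite ge0_integralD//; last 4 first.
  - by move=> x _; rewrite lee_fin sqr_ge0.
  - by apply/measurable_EFinP; exact: measurable_sqdiff.
  - by move=> x _; rewrite lee_fin sqr_ge0.
  - by apply/measurable_EFinP; exact: measurable_sqdiff.
  by rewrite [e k]splitr EFinD; apply: leeD.
by exists f_; split => k; have [] := hf k.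
Qed.

End ComplexL2.

(** Since [|t| <= 2^k t^2 + 2^-k], the weighted summability of the squares makes the increments
    absolutely summable. *)
Lemma cvg_summable_diff (R : realType) (a : nat -> R) :
  (\sum_(0 <= k <oo) (2 ^+ k * (a k.+1 - a k) ^+ 2)%:E < +oo)%E -> cvgn a.
Proof.
move=> h.
have amgm (p t : R) : 0 < p -> `|t| <= p * t ^+ 2 + p^-1.
  move=> p0; rewrite -(ler_pM2l p0) mulrDr divff ?gt_eqF// -[t ^+ 2]real_normK ?num_real//.
  rewrite -subr_ge0 (_ : _ - _ = (p * `|t| - 2^-1) ^+ 2 + 3 / 4); last by field.
  by rewrite addr_ge0 ?sqr_ge0// divr_ge0.
have c1 : cvgn (series (fun k => 2 ^+ k * (a k.+1 - a k) ^+ 2)).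
  by apply: (nnseries_is_cvg _ h) => k; apply: mulr_ge0; [exact: exprn_ge0|exact: sqr_ge0].
have c2 : cvgn (series (fun k : nat => (2^-1 : R) ^+ k)).
  rewrite (_ : (fun k : nat => _) = geometric 1 2^-1); last first.
    by apply/funext => k; rewrite /geometric /= mul1r.
  by apply: is_cvg_geometric_series; rewrite ger0_norm// invf_lt1 ?ltr1n.
have c3 : cvgn (series (fun k => 2 ^+ k * (a k.+1 - a k) ^+ 2 + (2^-1 : R) ^+ k)).
  rewrite (_ : series _ = series (fun k => 2 ^+ k * (a k.+1 - a k) ^+ 2) \+
      series (fun k : nat => (2^-1 : R) ^+ k)); first exact: (is_cvgD c1 c2).
  by apply/funext => k; rewrite /series /= big_split.
have c4 : cvgn (series (telescope a)).
  apply: normed_cvg; apply: series_le_cvg c3 => k.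
  - exact: normr_ge0.
  - apply: addr_ge0; last by rewrite exprn_ge0 ?invr_ge0.
    by apply: mulr_ge0; [exact: exprn_ge0|exact: sqr_ge0].
  - by rewrite exprVn; apply: amgm; exact: exprn_gt0.
rewrite (_ : a = fun k => a 0%N + series (telescope a) k).
  by apply: is_cvgD => //; exact: is_cvg_cst.
by apply/funext => k; exact: eq_sum_telescope.
Qed.

Section Propagator.
Context {R : realType} (n : nat).
Local Notation L := (@lebesgueRn R n).
Local Notation mu := (@lebesgue_measure R).
Variables (alpha beta gamma : R).
Hypotheses (n0 : (0 < n)%N) (beta1 : 1 <= beta)
  (alpha1 : beta + (n%:R - 1) / 2 < alpha) (alpha2 : alpha < n%:R) (gamma1 : 1 <= gamma).
Implicit Types (x xi : Rn R n) (f g : Rn R n -> R[i]).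

Local Notation s := (1 - 2^-1 * (alpha / beta + 2 - gamma)).
Local Notation prop := (propagator s gamma).

Lemma oscTB b (u v : Rn R n -> R) xi : rint L u -> rint L v ->
  oscT b (fun x => u x - v x) xi = oscT b u xi - oscT b v xi.
Proof.
move=> ru rv; rewrite /oscT -RintB; try exact: rint_oscT.
by apply: eq_Rintegral => x _; rewrite mulrBl.
Qed.

Lemma fourierB f g xi : schwartz f -> schwartz g ->
  fourier (fun x => f x - g x) xi = fourier f xi - fourier g xi.
Proof.
move=> sf sg; have sfg := schwartzB sf sg.
have [a1 a2] := fourier_oscT xi sfg; have [b1 b2] := fourier_oscT xi sf.
have [c1 c2] := fourier_oscT xi sg.
case: sf => fr fi; case: sg => gr gi.
have rfr := schwartz_rint fr; have rfi := schwartz_rint fi.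
have rgr := schwartz_rint gr; have rgi := schwartz_rint gi.
apply/eqP; rewrite eq_complex ReB ImB a1 a2 b1 b2 c1 c2.
have -> : (fun x => complex.Re (f x - g x)) = fun x => complex.Re (f x) - complex.Re (g x).
  by apply/funext => x; rewrite ReB.
have -> : (fun x => complex.Im (f x - g x)) = fun x => complex.Im (f x) - complex.Im (g x).
  by apply/funext => x; rewrite ImB.
rewrite !oscTB//; do 8 ![move: (oscT _ _ _) => ?].
by apply/andP; split; apply/eqP; ring.
Qed.

Lemma waveB b c (g h : Rn R n -> R) z : rint L g -> rint L h ->
  wave gamma b c (fun xi => g xi - h xi) z = wave gamma b c g z - wave gamma b c h z.
Proof.
move=> rg rh; rewrite /wave -RintB; try exact: rint_wave.
by apply: eq_Rintegral => xi _; rewrite !mulrBl.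
Qed.

Lemma propagatorB f g x (t : R) : schwartz f -> schwartz g ->
  prop (fun x => f x - g x) x t = prop f x t - prop g x t.
Proof.
move=> sf sg; have sfg := schwartzB sf sg; rewrite !propagator_wave//.
have [dfr dfi] := decaying_fourier sf; have [dgr dgi] := decaying_fourier sg.
have rfr := rint_smoothing n0 beta1 alpha1 alpha2 gamma1 dfr.
have rfi := rint_smoothing n0 beta1 alpha1 alpha2 gamma1 dfi.
have rgr := rint_smoothing n0 beta1 alpha1 alpha2 gamma1 dgr.
have rgi := rint_smoothing n0 beta1 alpha1 alpha2 gamma1 dgi.
have -> : (fun xi => enorm xi `^ s * complex.Re (fourier (fun x => f x - g x) xi)) =
    fun xi => enorm xi `^ s * complex.Re (fourier f xi) - enorm xi `^ s * complex.Re (fourier g xi).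
  by apply/funext => xi; rewrite fourierB// ReB mulrBr.
have -> : (fun xi => enorm xi `^ s * complex.Im (fourier (fun x => f x - g x) xi)) =
    fun xi => enorm xi `^ s * complex.Im (fourier f xi) - enorm xi `^ s * complex.Im (fourier g xi).
  by apply/funext => xi; rewrite fourierB// ImB mulrBr.
rewrite !waveB//; do 16 ![move: (wave _ _ _ _ _) => ?]; move: (_ ^- _) => ?.
by apply/eqP; rewrite eq_complex /=; apply/andP; split; apply/eqP; ring.
Qed.

(** At scales below 1 the bound [rho <= 1] and the volume [(2 rh)^n] suffice, as [n - alpha <= n];
    at larger scales the total mass does, as [n - alpha >= 0]. *)
Lemma morrey_rho : exists2 D, 0 < D &
  morrey (fun x : Rn R n => rho x `^ beta) (n%:R - alpha) D.
Proof.
have r := @rint_rho R n; have I0 : 0 <= \int[L]_x rho x by apply: Rintegral_ge0 => x _; exact: rho_ge0.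
exists (2 ^+ n + \int[L]_x rho x); first by rewrite ltr_wpDr// exprn_gt0.
move=> x rh r0.
have a0 : 0 < alpha.
  have := alpha1; have := beta1; have : (1 : R) <= n%:R by rewrite ler1n.
  by lra.
have rb (y : Rn R n) : 0 <= rho y `^ beta <= rho y.
  rewrite powR_ge0/=; have [->|y0] := eqVneq (rho y) 0.
    by rewrite powR0// gt_eqF// (lt_le_trans ltr01 beta1).
  rewrite -[leRHS]powRr1 ?rho_ge0// ger_powR// rho_le1 lt_def y0 rho_ge0//.
have mr : measurable_fun setT (fun y : Rn R n => rho y `^ beta).
  exact: (measurableT_comp (measurable_powR beta) (@measurable_rho R n)).
have mc := @measurable_indic_cube R n x rh.
have k0 : 0 <= n%:R - alpha by rewrite subr_ge0 ltW.
have [r1|/ltW r1] := leP rh 1.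
  apply: (@le_trans _ _ (\int[L]_y (\1_(cube x rh) y)%:E)%E).
    apply: le_ge0_int => // [|y]; first exact: measurable_funM.
    have /andP[h1 h2] := rb y; by rewrite mulr_ge0//= ler_piMr// (le_trans h2)// rho_le1.
  rewrite integral_indic// ?setIT; last exact: measurable_cube.
  rewrite [X in (X <= _)%E](cube_vol x (ltW r0)) lee_fin exprMn.
  apply: (@le_trans _ _ (2 ^+ n * rh `^ (n%:R - alpha))).
    rewrite ler_wpM2l ?exprn_ge0// -powR_mulrn ?(ltW r0)// ger_powR ?r0// lerBlDr lerDl ltW//.
  by rewrite ler_wpM2r ?powR_ge0// lerDl.
apply: (@le_trans _ _ (\int[L]_y (rho y)%:E)%E).
  apply: le_ge0_int => [||y]; [exact: measurable_funM|exact: measurable_rho|].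
  have /andP[h1 h2] := rb y; by rewrite mulr_ge0//= (le_trans _ h2)// ler_piMl.
rewrite -RintE// lee_fin.
apply: (@le_trans _ _ ((2 ^+ n + \int[L]_x rho x) * 1)); first by rewrite mulr1 lerDr exprn_ge0.
rewrite ler_wpM2l ?addr_ge0 ?exprn_ge0//.
have {1}<- : 1 `^ (n%:R - alpha) = 1 :> R by rewrite powR1.
by rewrite ge0_ler_powR ?nnegrE ?(ltW r0).
Qed.

Local Notation prodL := (prodm L mu).
Local Notation sqint f := (\int[L]_x (normsq (f x))%:E)%E.

(* [rho] is an everywhere positive Morrey weight, so that this single energy
   controls convergence in L^2_loc. *)
Definition rho_energy (G : Rn R n * measurableTypeR R -> R[i]) : \bar R :=
  (\int[prodL]_z (rho z.1 * normsq (G z))%:E)%E.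

Lemma measurable_rho_normsq G : cmeasurable G ->
  measurable_fun setT (fun z : Rn R n * measurableTypeR R => rho z.1 * normsq (G z)).
Proof.
move=> mG; apply: measurable_funM; last exact: measurable_normsq.
exact: measurable_fst_comp (@measurable_rho R n).
Qed.

Lemma rho_normsq_ge0 G (z : Rn R n * measurableTypeR R) : 0 <= rho z.1 * normsq (G z).
Proof. by rewrite mulr_ge0 ?rho_ge0 ?normsq_ge0. Qed.

Lemma rho_energy_le : exists2 C, 0 < C & forall f g, schwartz f -> schwartz g ->
  (rho_energy (fun z => prop f z.1 z.2 - prop g z.1 z.2)%R <=
   C%:E * sqint (fun x => f x - g x)%R)%E.
Proof.
have [D D0 hD] := morrey_rho.
have [C C0 hC] := smoothing_schwartz n0 beta1 alpha1 alpha2 gamma1.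
exists (C * D `^ beta^-1 + 1) => [|f g sf' sg].
  by rewrite ltr_wpDl// mulr_ge0// powR_ge0.
have sf := schwartzB sf' sg.
rewrite (_ : (fun z => _) = fun z : Rn R n * measurableTypeR R =>
    prop (fun x => f x - g x) z.1 z.2); last by apply/funext => z; rewrite propagatorB.
have mp := measurable_propagator n0 beta1 alpha1 alpha2 gamma1 sf.
rewrite /rho_energy (tonelli_prod2 L mu (measurable_rho_normsq mp) (rho_normsq_ge0 _)).
under eq_integral do under eq_integral do rewrite mulrC.
apply: (le_trans (hC _ D _ (@measurable_rho R n) (@rho_ge0 R n) hD D0 sf)).
apply: lee_wpmul2r; first by apply: integral_ge0 => x _; rewrite lee_fin normsq_ge0.
by rewrite lee_fin lerDl.
Qed.

Lemma rho_gt0 x : 0 < rho x.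
Proof. by apply: prodr_gt0 => i _; rewrite invr_gt0 ltr_pwDl// sqr_ge0. Qed.

Lemma sqint_le2 f g h : cmeasurable f -> cmeasurable g -> cmeasurable h ->
  (sqint (fun x => f x - g x) <= 2%:E * sqint (fun x => f x - h x) +
    2%:E * sqint (fun x => g x - h x))%E.
Proof.
move=> mf mg mh; apply: integral_le2; try by move=> x; exact: normsq_ge0.
- by apply: measurable_normsq; exact: cmeasurableB.
- by apply: measurable_normsq; exact: cmeasurableB.
- by apply: measurable_normsq; exact: cmeasurableB.
- by move=> x; exact: normsqB_le.
Qed.

(** For approximants converging at the rate [4^-k] the increments of their propagators are summable
    almost everywhere. Multiplication by the indicator function of [A] makes the sequence converge
    at every point, which gives a measurable limit. *)
Lemma propagator_limit f (f_ : nat -> Rn R n -> R[i]) : cmeasurable f ->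
  (forall k, schwartz (f_ k)) ->
  (forall k, sqint (fun x => f_ k x - f x)%R <= ((2^-1 ^+ 2) ^+ k)%:E)%E ->
  exists (A : set (Rn R n * measurableTypeR R)) (F : Rn R n * measurableTypeR R -> R[i]),
  [/\ measurable A, {ae prodL, forall z, A z}, cmeasurable F &
   forall z,
    \1_A z * complex.Re (prop (f_ k) z.1 z.2) @[k --> \oo] --> complex.Re (F z) /\
    \1_A z * complex.Im (prop (f_ k) z.1 z.2) @[k --> \oo] --> complex.Im (F z)].
Proof.
move=> mf sf hf; have [C C0 hC] := rho_energy_le.
pose P k (z : Rn R n * measurableTypeR R) := prop (f_ k) z.1 z.2.
have mP k : cmeasurable (P k) := measurable_propagator n0 beta1 alpha1 alpha2 gamma1 (sf k).
(* The factor [2^k] is the one required by [cvg_summable_diff]; it uses up half of the rate [4^-k]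
   and leaves a convergent series. *)
pose d k z : R := 2 ^+ k * normsq (P k.+1 z - P k z).
have d0 k z : 0 <= d k z by rewrite mulr_ge0 ?exprn_ge0 ?normsq_ge0.
have md k : measurable_fun setT (d k).
  by apply: measurable_funM => //; apply: measurable_normsq; exact: cmeasurableB.
pose S z := (\sum_(0 <= k <oo) (d k z)%:E)%E.
have S0 z : (0 <= S z)%E by apply: nneseries_ge0 => k _ _; rewrite lee_fin.
have mS : measurable_fun setT S.
  apply: (ge0_emeasurable_sum (P := xpredT)) => [k z _ _|k _]; first by rewrite lee_fin.
  exact/measurable_EFinP.
pose A := [set z | (S z < +oo)%E].
have mA : measurable A by rewrite -[A]setTI; exact: emeasurable_fun_infty_o.
have bound k : (\int[prodL]_z (rho z.1 * d k z)%:E <= (4 * C * 2^-1 ^+ k)%:E)%E.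
  have mPk := cmeasurableB (mP k.+1) (mP k).
  rewrite (eq_integral (fun z => (2 ^+ k * (rho z.1 * normsq (P k.+1 z - P k z)))%:E)); last first.
    by move=> z _; rewrite /d mulrCA.
  rewrite ge0_intZl ?exprn_ge0//; last 2 first.
  - exact: measurable_rho_normsq mPk.
  - by move=> z; exact: (rho_normsq_ge0 (fun z => P k.+1 z - P k z)).
  apply: (@le_trans _ _ ((2 ^+ k)%:E * (C * (4 * (2^-1 ^+ 2) ^+ k))%:E)%E); last first.
    rewrite -EFinM lee_fin le_eqVlt; apply/orP; left; apply/eqP.
    rewrite -exprM mulnC exprM expr2.
    have -> : 2 ^+ k * (C * (4 * (2^-1 ^+ k * 2^-1 ^+ k))) = 4 * C * 2^-1 ^+ k * (2 * 2^-1) ^+ k.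
      by rewrite exprMn; ring.
    by rewrite divff// expr1n mulr1.
  apply: lee_wpmul2l; first by rewrite lee_fin exprn_ge0.
  apply: (le_trans (hC _ _ (sf k.+1) (sf k))); rewrite [leRHS]EFinM; apply: lee_wpmul2l; first by rewrite lee_fin ltW.
  apply: (le_trans (sqint_le2 (schwartz_cmeasurable (sf k.+1)) (schwartz_cmeasurable (sf k)) mf)).
  apply: (@le_trans _ _ (2%:E * ((2^-1 ^+ 2) ^+ k)%:E + 2%:E * ((2^-1 ^+ 2) ^+ k)%:E)%E).
    apply: leeD; (apply: lee_wpmul2l; first by rewrite lee_fin); last exact: hf.
    apply: (le_trans (hf k.+1)); rewrite lee_fin exprS ler_piMl ?exprn_ge0//.
    by rewrite exprn_ile1// invf_le1 ?ler1n.
  by rewrite -!EFinM -EFinD lee_fin; lra.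
have aeA : {ae prodL, forall z, A z}.
  have mr : measurable_fun setT (fun z : Rn R n * measurableTypeR R => rho z.1).
    exact: measurable_fst_comp (@measurable_rho R n).
  have : (prodL).-integrable setT (fun z => (rho z.1)%:E * S z)%E.
    apply/integrableP; split; first by apply: emeasurable_funM => //; exact/measurable_EFinP.
    under eq_integral do rewrite gee0_abs ?mule_ge0 ?lee_fin ?rho_ge0//.
    rewrite (eq_integral (fun z => \sum_(0 <= k <oo) (rho z.1 * d k z)%:E)%E); last first.
      by move=> z _; rewrite /S -nneseriesZl// => k _; rewrite lee_fin.
    rewrite integral_nneseries//; last 2 first.
    - by move=> k; apply/measurable_EFinP; exact: measurable_funM.
    - by move=> k z _; rewrite lee_fin mulr_ge0 ?rho_ge0.
    apply: (@le_lt_trans _ _ (4 * C * (1 - 2^-1)^-1)%:E); last exact: ltry.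
    apply: lime_le; first by apply: is_cvg_nneseries => k _ _; apply: integral_ge0 => z _;
      rewrite lee_fin mulr_ge0 ?rho_ge0.
    apply: nearW => K; rewrite big_mkord.
    apply: (@le_trans _ _ (\sum_(k < K) (4 * C * 2^-1 ^+ k)%:E)%E).
      by apply: lee_sum => k _; exact: bound.
    rewrite sumEFin lee_fin -mulr_sumr ler_wpM2l ?mulr_ge0 ?(ltW C0)//.
    by apply: geometric_sum_le => //; rewrite invf_lt1 ?ltr1n.
  move=> /(integrable_ae measurableT); apply: filterS => z /(_ Logic.I).
  (* As [rho] is positive at every point, finiteness of [rho * S] implies finiteness of [S]. *)
  rewrite /A /=; have := S0 z; case: (S z) => [t|_|//]; first by rewrite ltry.
  by rewrite gt0_muley// lte_fin rho_gt0.
have iA z : (\1_A z : R) = 0 \/ (A z /\ (\1_A z : R) = 1).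
  rewrite indicE; have [h|_] := boolP (z \in A); [right|left] => //.
  by split => //; rewrite inE in h.
have cv z (p : R[i] -> R) : (forall z1 z2, (p z1 - p z2) ^+ 2 <= normsq (z1 - z2)) ->
    cvgn (fun k => \1_A z * p (P k z)).
  move=> hp; case: (iA z) => [->|[Az ->]].
    by under eq_fun do rewrite mul0r; exact: is_cvg_cst.
  under eq_fun do rewrite mul1r; apply: cvg_summable_diff; apply: le_lt_trans Az.
  have p0 k : (0 : R) <= 2 ^+ k by exact: exprn_ge0.
  apply: lee_nneseries => [k _ _|k _]; rewrite lee_fin.
    by apply: mulr_ge0 => //; exact: sqr_ge0.
  by rewrite /d ler_wpM2l.
have cr z : cvgn (fun k => \1_A z * complex.Re (P k z)).
  by apply: cv => z1 z2; rewrite -ReB lerDl sqr_ge0.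
have ci z : cvgn (fun k => \1_A z * complex.Im (P k z)).
  by apply: cv => z1 z2; rewrite -ImB lerDr sqr_ge0.
have mr : measurable_fun setT (fun z => limn (fun k => \1_A z * complex.Re (P k z))).
  apply: (measurable_fun_cvg (h := fun k z => \1_A z * complex.Re (P k z))) => [k|z _]; last exact: cr.
  by apply: measurable_funM; [exact: measurable_indic|exact: (mP k).1].
have mi : measurable_fun setT (fun z => limn (fun k => \1_A z * complex.Im (P k z))).
  apply: (measurable_fun_cvg (h := fun k z => \1_A z * complex.Im (P k z))) => [k|z _]; last exact: ci.
  by apply: measurable_funM; [exact: measurable_indic|exact: (mP k).2].
by exists A, (fun z => Complex (limn (fun k => \1_A z * complex.Re (P k z)))
  (limn (fun k => \1_A z * complex.Im (P k z)))).
Qed.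

Lemma small_power (e : R) : 0 < e -> exists k0, forall k, (k0 <= k)%N ->
  (2^-1 ^+ 2) ^+ k <= e.
Proof.
move=> e0; have := @cvg_geometric R 1 (2^-1 ^+ 2).
rewrite ger0_norm ?exprn_ge0// exprn_ilt1 ?invf_lt1 ?ltr1n// => /(_ isT).
move=> /cvgr0Pnorm_le/(_ e e0)[k0 _ h]; exists k0 => k /h.
by rewrite /geometric /= mul1r ger0_norm ?exprn_ge0.
Qed.

(** [F] is built from one fast sequence, but the estimate holds for every Schwartz function [h].
    This is what makes every approximating sequence converge to the same [F], as [propagator_L2]
    demands. *)
Lemma rho_energy_limit f : L2fun f -> exists (F : Rn R n * measurableTypeR R -> R[i]) C,
  [/\ cmeasurable F, 0 < C & forall h, schwartz h ->
   (rho_energy (fun z => prop h z.1 z.2 - F z)%R <= C%:E * sqint (fun x => h x - f x)%R)%E].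
Proof.
move=> lf; have mf := lf.1; have [C C0 hC] := rho_energy_le.
have q0 k : 0 < (2^-1 ^+ 2 : R) ^+ k by rewrite !exprn_gt0.
have [f_ [sf hf]] := exists_schwartz_approx lf q0.
have [A [F [mA aeA mF cF]]] := propagator_limit mf sf hf.
exists F, (2 * C); split=> // [|h sh]; first by rewrite mulr_gt0.
have mP g := @measurable_propagator R n _ _ _ n0 beta1 alpha1 alpha2 gamma1 g.
have mhF := cmeasurableB (mP h sh) mF.
have mH k := cmeasurableB (mP h sh) (mP (f_ k) (sf k)).
rewrite /rho_energy.
have -> : (\int[prodL]_z (rho z.1 * normsq (prop h z.1 z.2 - F z))%:E =
    \int[prodL]_z (\1_A z * (rho z.1 * normsq (prop h z.1 z.2 - F z)))%:E)%E.
  have m1 := measurable_rho_normsq mhF.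
  apply: ge0_ae_eq_integral => //.
  - exact/measurable_EFinP.
  - by apply/measurable_EFinP; apply: measurable_funM => //; exact: measurable_indic.
  - by move=> z _; rewrite lee_fin (rho_normsq_ge0 (fun z => prop h z.1 z.2 - F z)).
  - by move=> z _; rewrite lee_fin mulr_ge0// (rho_normsq_ge0 (fun z => prop h z.1 z.2 - F z)).
  - by apply: filterS aeA => z Az _; rewrite indicE mem_set// mul1r.
(* Comparing [h] with the approximants of index at least [J] costs at most [e] beyond the desired
   bound; Fatou's lemma along this tail then removes the approximants. *)
apply/lee_addgt0Pr => e e0; have e2 : 0 < e / (2 * C) by rewrite divr_gt0// mulr_gt0.
have [J hJ] := small_power e2.
apply: (@fatou_bound _ _ R prodL (fun j z => \1_A z *
   (rho z.1 * normsq (prop h z.1 z.2 - prop (f_ (j + J)%N) z.1 z.2)))).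
- move=> j; apply: measurable_funM; first exact: measurable_indic.
  exact: measurable_rho_normsq (mH (j + J)%N).
- move=> j z; rewrite mulr_ge0// (rho_normsq_ge0 (fun z => prop h z.1 z.2 - prop (f_ (j + J)%N) z.1 z.2))//.
- move=> z; rewrite indicE; have [zA|_] := boolP (z \in A); last first.
    by rewrite mul0r; under eq_fun do rewrite mul0r; exact: cvg_cst.
  rewrite mul1r; under eq_fun do rewrite mul1r; apply: cvgM; first exact: cvg_cst.
  have [cr ci] := cF z; rewrite indicE zA in cr ci.
  have c1 : complex.Re (prop (f_ (j + J)%N) z.1 z.2) @[j --> \oo] --> complex.Re (F z).
    rewrite (cvg_shiftn J (fun j => complex.Re (prop (f_ j) z.1 z.2))).
    by move: cr; under eq_fun do rewrite mul1r.
  have c2 : complex.Im (prop (f_ (j + J)%N) z.1 z.2) @[j --> \oo] --> complex.Im (F z).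
    rewrite (cvg_shiftn J (fun j => complex.Im (prop (f_ j) z.1 z.2))).
    by move: ci; under eq_fun do rewrite mul1r.
  rewrite /normsq ReB ImB; under eq_fun do rewrite ReB ImB !expr2; rewrite !expr2.
  by apply: cvgD; apply: cvgM; apply: cvgB => //; exact: cvg_cst.
- move=> j; apply: (@le_trans _ _ (rho_energy (fun z => prop h z.1 z.2 - prop (f_ (j + J)%N) z.1 z.2)%R)).
    apply: le_ge0_int => [||z].
    + apply: measurable_funM; first exact: measurable_indic.
      exact: measurable_rho_normsq (mH (j + J)%N).
    + exact: measurable_rho_normsq (mH (j + J)%N).
    + have r0 := rho_normsq_ge0 (fun z => prop h z.1 z.2 - prop (f_ (j + J)%N) z.1 z.2) z.
      by rewrite mulr_ge0//= ler_piMl// indicE; case: (_ \in _).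
  apply: (le_trans (hC h (f_ (j + J)%N) sh (sf _))).
  apply: (@le_trans _ _ (C%:E * (2%:E * sqint (fun x => h x - f x)%R + (e / C)%:E))%E).
    apply: lee_wpmul2l; first by rewrite lee_fin ltW.
    apply: (le_trans (sqint_le2 (schwartz_cmeasurable sh) (schwartz_cmeasurable (sf _)) mf)).
    apply: leeD => //; apply: (@le_trans _ _ (2%:E * (e / (2 * C))%:E)%E).
      apply: lee_wpmul2l; first by rewrite lee_fin.
      by apply: (le_trans (hf _)); rewrite lee_fin hJ// leq_addl.
    rewrite -EFinM lee_fin le_eqVlt; apply/orP; left; apply/eqP.
    by field; rewrite gt_eqF.
  rewrite ge0_muleDr//; last by rewrite lee_fin ltW// divr_gt0.
    by rewrite muleA -!EFinM [C * 2]mulrC [C * _]mulrC divfK ?gt_eqF.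
  by apply: mule_ge0 => //; apply: integral_ge0 => x _; rewrite lee_fin normsq_ge0.
Qed.

Lemma measurable_cball0 (r : R) : measurable (cball0 r : set (Rn R n)).
Proof.
rewrite (_ : cball0 r = @enorm R n @^-1` `]-oo, r]%classic); last first.
  by apply/seteqP; split => x /=; rewrite in_itv.
by rewrite -[X in measurable X]setTI; apply: measurable_enorm.
Qed.

Definition cyl (r : R) : set (Rn R n * measurableTypeR R) :=
  [set z | cball0 r z.1 /\ z.2 \in `[- r, r]].

Lemma measurable_cyl r : measurable (cyl r).
Proof.
rewrite (_ : cyl r = cball0 r `*` `[- r, r]%classic).
  by apply: measurableX; [exact: measurable_cball0|exact: measurable_itv].
by apply/seteqP; split=> z [].
Qed.

Lemma local_integral_prod (G : Rn R n * measurableTypeR R -> R[i]) (r : R) : cmeasurable G ->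
  (\int[mu]_(t in `[(- r)%R, r]) \int[L]_(x in cball0 r) (normsq (G (x, t)))%:E =
   \int[prodL]_z (\1_(cyl r) z * normsq (G z))%:E)%E.
Proof.
move=> mG; have m := measurable_normsq mG.
rewrite (tonelli_prod2 L mu (f := fun z => \1_(cyl r) z * normsq (G z))); last 2 first.
- by apply: measurable_funM => //; apply: measurable_indic; exact: measurable_cyl.
- by move=> z; rewrite mulr_ge0 ?normsq_ge0.
rewrite integral_mkcond; apply: eq_integral => t _; rewrite patchE.
have [tr|tr] := boolP (t \in `[- r, r]%classic).
  rewrite integral_indic_mul; apply: eq_integral => x _; congr (_ * _)%:E.
  rewrite !indicE; congr ((_ : bool)%:R); apply/idP/idP; rewrite !inE => //.
    by move=> h; split=> //; rewrite inE in tr.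
  by case.
rewrite integral0_eq// => x _; rewrite indicE memNset ?mul0r// => -[_ /= h].
by move/negP: tr; apply; rewrite inE.
Qed.

(** On a ball of radius [r] the weight [rho] is at least [(1 + r^2)^(-n)], so the weighted energy of
    the difference controls the local [L^2] norms. *)
Lemma propagator_exists f : L2fun f -> exists F, propagator_L2 s gamma f F.
Proof.
move=> lf; have mf := lf.1; have [F [C [mF C0 hF]]] := rho_energy_limit lf.
have mP g := @measurable_propagator R n _ _ _ n0 beta1 alpha1 alpha2 gamma1 g.
exists (fun x t => F (x, t)); split; [|split].
- rewrite (_ : (fun z => _) = F)//; apply/funext => -[].
  by [].
- have q0 k : 0 < (2^-1 ^+ 2 : R) ^+ k by rewrite !exprn_gt0.
  have [f_ [sf hf]] := exists_schwartz_approx lf q0.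
  exists f_; split=> //; apply/cvge0P => [k|e e0]; first exact: L2norm_ge0.
  have e2 : 0 < e ^+ 2 by rewrite exprn_gt0.
  have [k0 hk] := small_power e2; exists k0 => k /hk le.
  by apply: L2norm_le => //; apply: (le_trans (hf k)); rewrite lee_fin.
- move=> h_ ah r; have sh := ah.1.
  have local k : (\int[mu]_(t in `[(- r)%R, r]) \int[L]_(x in cball0 r)
      (ComplexField.Normc.normc (prop (h_ k) x t - F (x, t)) ^+ 2)%:E <=
      ((1 + r ^+ 2) ^+ n * C)%:E * sqint (fun x => h_ k x - f x)%R)%E.
    under eq_integral do under eq_integral do rewrite normc_sqr.
    have mG := cmeasurableB (mP _ (sh k)) mF.
    rewrite (local_integral_prod r mG) EFinM -muleA.
    have K0 : 0 <= (1 + r ^+ 2) ^+ n by rewrite exprn_ge0// addr_ge0// sqr_ge0.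
    apply: (@le_trans _ _ (((1 + r ^+ 2) ^+ n)%:E * rho_energy (fun z => prop (h_ k) z.1 z.2 - F z)%R)%E).
      rewrite /rho_energy -ge0_intZl//; last 2 first.
      - exact: measurable_rho_normsq mG.
      - by move=> z; exact: (rho_normsq_ge0 (fun z => prop (h_ k) z.1 z.2 - F z)).
      apply: le_ge0_int => [||z].
      + apply: measurable_funM; last exact: measurable_normsq mG.
        by apply: measurable_indic; exact: measurable_cyl.
      + by apply: measurable_funM => //; exact: measurable_rho_normsq mG.
      + have q0 := normsq_ge0 (prop (h_ k) z.1 z.2 - F z).
        rewrite mulr_ge0//= mulrA ler_wpM2r// indicE.
        have [|_] := boolP (z \in cyl r); last by rewrite mulr_ge0 ?rho_ge0.
        rewrite inE => -[zr _]; apply: (le_trans (rho_lower z.1)).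
        rewrite ler_wpM2r ?rho_ge0// lerXn2r ?nnegrE ?addr_ge0 ?dot_ge0 ?sqr_ge0//.
        rewrite lerD2l dotE lerXn2r ?nnegrE ?enorm_ge0//.
        exact: le_trans (enorm_ge0 _) zr.
    by apply: lee_wpmul2l; [rewrite lee_fin|exact: hF].
  apply/cvge0P => [k|e e0].
    apply: integral_ge0 => t _; apply: integral_ge0 => x _; rewrite lee_fin; exact: sqr_ge0.
  set K := (1 + r ^+ 2) ^+ n * C in local.
  have K0 : 0 < K by rewrite mulr_gt0// exprn_gt0// ltr_pwDl// sqr_ge0.
  have eK : 0 < e / K by rewrite divr_gt0.
  have [k0 hk] := schwartz_approx_small ah eK; exists k0 => k /hk le.
  apply: (le_trans (local k)); have -> : (e%:E = K%:E * (e / K)%:E)%E.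
    by rewrite -EFinM mulrC divfK ?gt_eqF.
  by apply: lee_wpmul2l => //; rewrite lee_fin ltW.
Qed.

End Propagator.

Section Extension.
Context {R : realType} (n : nat).
Local Notation L := (@lebesgueRn R n).
Local Notation mu := (@lebesgue_measure R).
Variables (alpha beta gamma : R).
Hypotheses (n0 : (0 < n)%N) (beta1 : 1 <= beta)
  (alpha1 : beta + (n%:R - 1) / 2 < alpha) (alpha2 : alpha < n%:R) (gamma1 : 1 <= gamma).
Implicit Types (x xi : Rn R n) (f g : Rn R n -> R[i]).

Local Notation s := (1 - 2^-1 * (alpha / beta + 2 - gamma)).
Local Notation prop := (propagator s gamma).
Local Notation prodL := (prodm L mu).
Local Notation sqint f := (\int[L]_x (normsq (f x))%:E)%E.

Lemma normsq_le2 (z1 z2 : R[i]) : normsq z1 <= 2 * normsq z2 + 2 * normsq (z2 - z1).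
Proof.
have := normsqB_le z1 0 z2.
by rewrite subr0 [normsq (z1 - z2)]normsqC sub0r /normsq; case: z2 => a b /=; rewrite !sqrrN; lra.
Qed.

Lemma sqint_fin f : L2fun f -> sqint f \is a fin_num.
Proof.
move=> lf; rewrite ge0_fin_numE ?L2fun_lty//.
by apply: integral_ge0 => x _; rewrite lee_fin normsq_ge0.
Qed.

(* Truncating the weight makes the local convergence in [propagator_L2]
   sufficient. *)
Lemma smoothing_L2 : exists2 C, 0 <= C &
  forall (w : Rn R n -> R) D f F, measurable_fun setT w -> (forall x, 0 <= w x) ->
  morrey (fun x => w x `^ beta) (n%:R - alpha) D -> 0 < D -> L2fun f ->
  propagator_L2 s gamma f F ->
  (\int[mu]_t \int[L]_x (normsq (F x t) * w x)%:E <=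
   (C * D `^ (beta^-1))%:E * sqint f)%E.
Proof.
have [C C0 hC] := smoothing_schwartz n0 beta1 alpha1 alpha2 gamma1.
(* The factor 4 stems from two uses of [|a|^2 <= 2 |b|^2 + 2 |b - a|^2], one for [F] and the
   propagated approximant, one for the approximant and [f]. *)
exists (4 * C) => [|w D f F mw w0 hw D0 lf [mF [[f_ ah] hF]]]; first by rewrite mulr_ge0.
have sf := ah.1; have mf := lf.1; have {}hF := hF f_ ah.
pose K := C * D `^ beta^-1; have K0 : 0 <= K by rewrite mulr_ge0 ?powR_ge0.
pose X := fine (sqint f); have XE : X%:E = sqint f by rewrite fineK// sqint_fin.
rewrite -XE -EFinM.
pose G (z : Rn R n * measurableTypeR R) := F z.1 z.2.
pose P k (z : Rn R n * measurableTypeR R) := prop (f_ k) z.1 z.2.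
have mP k : cmeasurable (P k) := measurable_propagator n0 beta1 alpha1 alpha2 gamma1 (sf k).
have mw1 : measurable_fun setT (fun z : Rn R n * measurableTypeR R => w z.1).
  exact: measurable_fst_comp.
have mG := measurable_normsq mF; have mi N : measurable_fun setT (\1_(cyl N) : Rn R n * measurableTypeR R -> R).
  by apply: measurable_indic; exact: measurable_cyl.
pose H (z : Rn R n * measurableTypeR R) := normsq (G z) * w z.1.
have mH : measurable_fun setT H by exact: measurable_funM.
have H0 z : 0 <= H z by rewrite mulr_ge0// normsq_ge0.
rewrite -(tonelli_prod2 L mu mH H0).
pose m (N : nat) (x : Rn R n) : R := Num.min (w x) N%:R.
have m0 N x : 0 <= m N x by rewrite le_min w0 ler0n.
have mm N : measurable_fun setT (fun z : Rn R n * measurableTypeR R => m N z.1).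
  exact: measurable_minr.
have i01 N z : (\1_(@cyl R n N) z : R) = 0 \/ (\1_(@cyl R n N) z : R) = 1.
  by rewrite indicE; case: (_ \in _); [right|left].
apply: (@fatou_bound _ _ R prodL (fun N z => \1_(cyl N%:R) z * (normsq (G z) * m N z.1))).
- by move=> N; apply: measurable_funM => //; apply: measurable_funM.
- by move=> N z; rewrite mulr_ge0// mulr_ge0 ?normsq_ge0.
- move=> z; apply: cvg_near_cst.
  pose T := enorm z.1 + `|z.2 : R| + w z.1.
  exists (Num.truncn T).+1 => // N /= hN.
  have hT : T < N%:R by apply: (lt_le_trans (truncnS_gt T)); rewrite ler_nat.
  have e0 := enorm_ge0 z.1; have t0 := normr_ge0 (z.2 : R); have w00 := w0 z.1.
  rewrite indicE mem_set ?mul1r; last first.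
    split; first by rewrite /cball0 /=; rewrite /T in hT; lra.
    by rewrite in_itv/= -ler_norml; rewrite /T in hT; lra.
  by rewrite /H /m min_l//; rewrite /T in hT; lra.
move=> N; apply/lee_addgt0Pr => e e0.
(* The errors add up to [(4 K + 2 N) (e / M)]; the additional 1 keeps [M] positive. *)
pose M := 4 * K + 2 * N%:R + 1.
have M0 : 0 < M by rewrite ltr_wpDl// addr_ge0// mulr_ge0.
have eM : 0 < e / M by rewrite divr_gt0.
have [k1 hk1] := schwartz_approx_small ah eM.
have u0 k : (0 <= \int[mu]_(t in `[(- N%:R)%R, N%:R]) \int[L]_(x in cball0 N%:R)
    (ComplexField.Normc.normc (prop (f_ k) x t - F x t) ^+ 2)%:E)%E.
  by apply: integral_ge0 => t _; apply: integral_ge0 => x _; rewrite lee_fin; exact: sqr_ge0.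
have [k2 hk2] := (cvge0P u0).1 (hF N%:R) _ eM.
pose k := maxn k1 k2.
have {}hk1 := hk1 k (leq_maxl _ _); have {}hk2 := hk2 k (leq_maxr _ _).
have mPG := cmeasurableB (mP k) mF.
have loc : (\int[prodL]_z (\1_(cyl N%:R) z * normsq (P k z - G z))%:E <= (e / M)%:E)%E.
  rewrite -(local_integral_prod N%:R mPG); apply: le_trans hk2.
  by under eq_integral do under eq_integral do rewrite -normc_sqr.
have sqk : (sqint (f_ k) <= (2 * X + 2 * (e / M))%:E)%E.
  have := integral_le2 L (measurable_normsq (schwartz_cmeasurable (sf k))) (measurable_normsq mf)
    (measurable_normsq (cmeasurableB mf (schwartz_cmeasurable (sf k))))
    (fun x => normsq_ge0 _) (fun x => normsq_ge0 _) (fun x => normsq_ge0 _)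
    (fun x => normsq_le2 (f_ k x) (f x)).
  have -> : (2 * X + 2 * (e / M))%:E = (2%:E * sqint f + 2%:E * (e / M)%:E)%E.
    by rewrite -XE -!EFinM -EFinD.
  move/le_trans; apply; apply: leeD => //.
  apply: lee_wpmul2l; first by rewrite lee_fin.
  by under eq_integral do rewrite normsqC.
have wk : (\int[prodL]_z (normsq (P k z) * w z.1)%:E <= (K * (2 * X + 2 * (e / M)))%:E)%E.
  have mq : measurable_fun setT (fun z : Rn R n * measurableTypeR R => normsq (P k z) * w z.1).
    by apply: measurable_funM => //; exact: measurable_normsq (mP k).
  rewrite (tonelli_prod2 L mu mq); last by move=> z; rewrite mulr_ge0// normsq_ge0.
  apply: (le_trans (hC w D (f_ k) mw w0 hw D0 (sf k))).
  by rewrite [leRHS]EFinM; apply: lee_wpmul2l.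
apply: (@le_trans _ _ (2%:E * (K * (2 * X + 2 * (e / M)))%:E + 2%:E * (N%:R * (e / M))%:E)%E).
  apply: (le_trans (integral_le2 (q := fun z => normsq (P k z) * w z.1)
    (r := fun z => N%:R * (\1_(cyl N%:R) z * normsq (P k z - G z))) prodL _ _ _ _ _ _ _)).
  - by apply: measurable_funM => //; apply: measurable_funM.
  - by apply: measurable_funM => //; exact: measurable_normsq (mP k).
  - by apply: measurable_funM => //; apply: measurable_funM => //; exact: measurable_normsq mPG.
  - by move=> z; rewrite mulr_ge0// mulr_ge0 ?normsq_ge0.
  - by move=> z; rewrite mulr_ge0 ?normsq_ge0.
  - by move=> z; rewrite mulr_ge0// mulr_ge0 ?normsq_ge0.
  - move=> z; have pk0 := normsq_ge0 (P k z); have pg0 := normsq_ge0 (P k z - G z).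
    have w00 := w0 z.1; have mle : m N z.1 <= w z.1 by rewrite ge_min lexx.
    have mleN : m N z.1 <= N%:R by rewrite ge_min lexx orbT.
    case: (i01 N%:R z) => ->; first by rewrite !mul0r mulr0 mulr0 addr0 mulr_ge0// mulr_ge0.
    rewrite !mul1r; apply: (le_trans (ler_wpM2r (m0 N z.1) (normsq_le2 (G z) (P k z)))).
    rewrite mulrDl -!mulrA lerD// ler_wpM2l//; first by rewrite ler_wpM2l.
    by rewrite mulrC ler_wpM2r.
  apply: leeD; apply: lee_wpmul2l; rewrite ?lee_fin//.
  rewrite ge0_intZl//.
  - by rewrite EFinM; apply: lee_wpmul2l; rewrite ?lee_fin.
  - by apply: measurable_funM => //; exact: measurable_normsq mPG.
  - by move=> z; rewrite mulr_ge0 ?normsq_ge0.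
rewrite -!EFinM -!EFinD lee_fin -[4 * C * _]mulrA -/K.
have eE : M * (e / M) = e by rewrite mulrC divfK ?gt_eqF.
rewrite -[X in _ <= _ + X]eE; move: (e / M) eM => y y0; rewrite /M.
rewrite -subr_ge0 (_ : _ - _ = y); last by ring.
exact: ltW.
Qed.

Lemma weighted_normE (w : Rn R n -> R) (F : Rn R n -> R -> R[i]) :
  weighted_L2norm w F =
  ((\int[mu]_t \int[L]_x (normsq (F x t) * w x)%:E) `^ 2^-1)%E.
Proof.
rewrite /weighted_L2norm; congr (_ `^ _)%E.
by apply: eq_integral => t _; apply: eq_integral => x _; rewrite normc_sqr.
Qed.

Lemma KS_norm_ge0 (v : Rn R n -> R) : weight v -> (0 <= KS_norm alpha v)%E.
Proof.
move=> [_ v0 _]; apply: (@le_trans _ _ (KS_ratio alpha v (dyadic_cube 0 (fun=> 0)))); last first.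
  by apply: ereal_sup_ubound; exists (0, fun=> 0).
rewrite /KS_ratio; case: ifP => // _; apply: mule_ge0.
  by rewrite inve_ge0; apply: integral_ge0 => y _; rewrite lee_fin.
apply: integral_ge0 => y _; apply: integral_ge0 => z _.
by rewrite lee_fin divr_ge0 ?powR_ge0 ?mulr_ge0.
Qed.

Lemma smoothing_KS : exists2 C, 0 <= C &
  forall (w : Rn R n -> R) f F, measurable_fun setT w -> (forall x, 0 <= w x) ->
  KS alpha (fun x => w x `^ beta) -> L2fun f -> propagator_L2 s gamma f F ->
  (\int[mu]_t \int[L]_x (normsq (F x t) * w x)%:E <=
   (C * fine (KS_norm alpha (fun x => w x `^ beta)) `^ (beta^-1))%:E * sqint f)%E.
Proof.
have [C C0 hC] := smoothing_L2; have [K K0 hK] := KS_morrey n0 alpha2.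
have bp : 0 < beta^-1 by rewrite invr_gt0 (lt_le_trans ltr01 beta1).
exists (C * K `^ beta^-1) => [|w f F mw w0 [wv vlty] lf hF]; first by rewrite mulr_ge0 ?powR_ge0.
have N0 := KS_norm_ge0 wv; set N := KS_norm _ _ in vlty N0 *.
have Nfin : N \is a fin_num by rewrite ge0_fin_numE.
have Nf0 : 0 <= fine N by exact: fine_ge0.
have bound D : fine N <= D -> 0 < D -> (\int[mu]_t \int[L]_x (normsq (F x t) * w x)%:E <=
    (C * K `^ beta^-1 * D `^ beta^-1)%:E * sqint f)%E.
  move=> ND D0; rewrite -mulrA -powRM ?(ltW K0) ?(ltW D0)//.
  apply: hC => //; last by rewrite mulr_gt0.
  by apply: hK => //; rewrite ?(ltW D0)// -/N -(fineK Nfin) lee_fin.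
(* A vanishing Kerman-Sawyer norm is not an admissible [D], which must be positive. In that case
   every [D > 0] is admissible, and letting it tend to 0 shows that the left-hand side vanishes. *)
have [N1|N1] := ltP 0 (fine N); first exact: bound.
have E0 : fine N = 0 by apply: le_anti; rewrite N1.
have X0 : 0 <= fine (sqint f).
  by apply: fine_ge0; apply: integral_ge0 => x _; rewrite lee_fin normsq_ge0.
rewrite E0 powR0 ?gt_eqF// mulr0 mul0e.
rewrite -[0%E]adde0; apply/lee_addgt0Pr => e e0; rewrite add0e.
(* With [D = (e / A)^beta] the bound becomes [(A - 1) * (e / A)], which is at most [e]. *)
set A := C * K `^ beta^-1 * fine (sqint f) + 1.
have A0 : 0 < A by rewrite ltr_wpDl// !mulr_ge0// powR_ge0.
pose D := (e / A) `^ beta; have D0 : 0 < D by rewrite powR_gt0// divr_gt0.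
apply: (le_trans (bound D _ D0)); first by rewrite E0 ltW.
rewrite -(fineK (sqint_fin lf)) -EFinM lee_fin /D -powRrM divff ?powRr1 ?(ltW (divr_gt0 e0 A0))//; last first.
  by rewrite gt_eqF// (lt_le_trans ltr01 beta1).
rewrite add0r mulrAC mulrA ler_pdivrMr// mulrC ler_wpM2l ?(ltW e0)//.
by rewrite /A lerDl.
Qed.

End Extension.

Theorem theorem1p5 (R : realType) (n : nat) (gamma beta alpha : R)
    (hn : (2 <= n)%N) (hgamma : 1 < gamma)
    (hbeta1 : 1 <= beta) (hbeta2 : beta < (n%:R + 1) / 2)
    (halpha1 : beta + (n%:R - 1) / 2 < alpha) (halpha2 : alpha < n%:R) :
  let s : R := 1 - 2^-1 * (alpha / beta + 2 - gamma) in
  (forall f : Rn R n -> R[i], L2fun f -> exists F, propagator_L2 s gamma f F) /\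
  exists C : R, 0 < C /\
    forall w : Rn R n -> R, weight w -> KS alpha (fun x => w x `^ beta) ->
    forall f : Rn R n -> R[i], L2fun f ->
    forall F : Rn R n -> R -> R[i], propagator_L2 s gamma f F ->
      (weighted_L2norm w F <=
       C%:E * KS_norm alpha (fun x => w x `^ beta)%R `^ ((2 * beta)^-1)
       * L2norm f)%E.
Proof.
move=> s; have n0 : (0 < n)%N by rewrite (leq_trans _ hn).
split; first by move=> f lf; apply: propagator_exists => //; exact: ltW.
have [C C0 hC] := smoothing_KS n0 hbeta1 halpha1 halpha2 (ltW hgamma).
(* The constant of [smoothing_KS] is for the squared norms and may be 0; the additional 1 makes the
   final constant positive. *)
exists (Num.sqrt C + 1); split; first by rewrite ltr_wpDl// sqrtr_ge0.
move=> w ww ksw f lf F hF; have [mw w0 _] := ww.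
have N0 := KS_norm_ge0 alpha ksw.1.
have Nfin : KS_norm alpha (fun x => w x `^ beta) \is a fin_num by rewrite ge0_fin_numE// ksw.2.
have h := hC w f F mw w0 ksw lf hF.
rewrite weighted_normE L2normE -(fineK Nfin).
set N := fine _ in h *; have Nf0 : 0 <= N by exact: fine_ge0.
have Xfin := sqint_fin lf; rewrite -(fineK Xfin) in h *.
set X := fine _ in h *; have X0 : 0 <= X.
  by apply: fine_ge0; apply: integral_ge0 => x _; rewrite lee_fin normsq_ge0.
apply: (@le_trans _ _ (((C * N `^ beta^-1)%:E * X%:E) `^ 2^-1)%E).
  apply: gt0_ler_poweR; rewrite ?in_itv/= ?leey ?andbT ?invr_ge0//.
    apply: integral_ge0 => t _; apply: integral_ge0 => x _.
    by rewrite lee_fin mulr_ge0 ?normsq_ge0.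
  by rewrite -EFinM lee_fin !mulr_ge0 ?powR_ge0.
rewrite -EFinM !poweR_EFin -!EFinM lee_fin powRM ?mulr_ge0 ?powR_ge0// powRM ?powR_ge0//.
rewrite -powRrM -invfM [beta * 2]mulrC ler_wpM2r ?powR_ge0// ler_wpM2r ?powR_ge0//.
by rewrite powR12_sqrt// lerDl.
Qed.
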